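(* Let $\Gamma_1,\Gamma_2$ be two locally perturbed sound-soft surfaces (Dirichlet boundary condition) of polyhedral type, and let $d\in\mathbb S^2_-$ be a single fixed incident direction. If $u^{sc}_{1,\infty}(\hat x;d)=u^{sc}_{2,\infty}(\hat x;d)$ for all $\hat x\in\mathbb S^2_+$, then $\Gamma_1=\Gamma_2$.
   Context: Fix a wave number $k>0$. Write $x=(\tilde x,x_3)\in\mathbb R^3$ with $\tilde x=(x_1,x_2)$, and $\mathbb S^2_\pm=\{x\in\mathbb R^3:|x|=1,\ \pm x_3>0\}$. A locally perturbed surface is $\Gamma=\{(\tilde x,f(\tilde x)):\tilde x\in\mathbb R^2\}$, where $f:\mathbb R^2\to\mathbb R$ is Lipschitz continuous and $f(\tilde x)=0$ for $|\tilde x|>R$ for some $R>\max|f|$; $\Omega=\{x:x_3>f(\tilde x)\}$ is the region above $\Gamma$ and $\nu$ is the unit normal on $\Gamma$ pointing into $\Omega$. $\Gamma$ is of polyhedral type if $f$ is (continuous and) piecewise linear. For $d=(\alpha,\beta,-\gamma)\in\mathbb S^2_-$ the incident plane wave is $u^{in}(x;d)=e^{ikx\cdot d}$ and its reflected wave from the flat plane $\{x_3=0\}$ is $u^{re}(x;d)=-e^{ik(\alpha x_1+\beta x_2+\gamma x_3)}$ in the Dirichlet case and $u^{re}(x;d)=+e^{ik(\alpha x_1+\beta x_2+\gamma x_3)}$ in the Neumann case. The total field is $u=u^{in}+u^{re}+u^{sc}$, where $u$ satisfies $\Delta u+k^2u=0$ in $\Omega$, the boundary condition $u=0$ on $\Gamma$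 (sound-soft/Dirichlet) or $\partial_\nu u=0$ on $\Gamma$ (sound-hard/Neumann), and the scattered field $u^{sc}$ satisfies the Sommerfeld radiation condition $\lim_{r\to\infty}r(\partial_ru^{sc}-iku^{sc})=0$, $r=|x|$, $x\in\Omega$; this problem is uniquely solvable. Then $u^{sc}(x;d)=\frac{e^{ik|x|}}{|x|}\{u^{sc}_\infty(\hat x;d)+O(1/|x|)\}$ as $|x|\to\infty$ in $\Omega$, $\hat x=x/|x|\in\mathbb S^2_+$, and $u^{sc}_\infty(\cdot;d)$ is the far-field pattern. Quantities associated with a surface $\Gamma_j=\{x_3=f_j(\tilde x)\}$ carry the index $j$. *)

(* Defs.v *)
From Stdlib Require Import Reals List.
Open Scope R_scope.

(* Points of R^3 are given by three real coordinates; points of R^2 by two.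
   Complex-valued fields are represented by their real and imaginary parts. *)

Definition norm2 (t1 t2 : R) : R := sqrt (t1 ^ 2 + t2 ^ 2).
Definition norm3 (x1 x2 x3 : R) : R := sqrt (x1 ^ 2 + x2 ^ 2 + x3 ^ 2).
Definition dist3 (x1 x2 x3 y1 y2 y3 : R) : R := norm3 (x1 - y1) (x2 - y2) (x3 - y3).

Definition in_Omega (f : R -> R -> R) (x1 x2 x3 : R) : Prop := x3 > f x1 x2.

Definition lipschitz2 (f : R -> R -> R) : Prop :=
  exists L : R, forall s1 s2 t1 t2 : R,
    Rabs (f s1 s2 - f t1 t2) <= L * norm2 (s1 - t1) (s2 - t2).

Definition locally_perturbed (f : R -> R -> R) : Prop :=
  lipschitz2 f /\
  exists Rad : R, (forall t1 t2, Rabs (f t1 t2) < Rad) /\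
    (forall t1 t2, norm2 t1 t2 > Rad -> f t1 t2 = 0).

(* A (closed, possibly degenerate) triangle in R^2 together with an affine map
   (a t1 + b t2 + c) valid on it. *)
Record affine_piece := mkPiece {
  ax : R; ay : R; bx : R; by_ : R; cx : R; cy : R;
  ca : R; cb : R; cc : R }.

Definition in_triangle (P : affine_piece) (t1 t2 : R) : Prop :=
  exists l1 l2 l3 : R, 0 <= l1 /\ 0 <= l2 /\ 0 <= l3 /\ l1 + l2 + l3 = 1 /\
    t1 = l1 * ax P + l2 * bx P + l3 * cx P /\
    t2 = l1 * ay P + l2 * by_ P + l3 * cy P.

Definition affine_on (f : R -> R -> R) (P : affine_piece) : Prop :=
  forall t1 t2, in_triangle P t1 t2 -> f t1 t2 = ca P * t1 + cb P * t2 + cc P.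

Definition continuous2 (f : R -> R -> R) : Prop :=
  forall s1 s2 eps, eps > 0 -> exists delta, delta > 0 /\
    forall t1 t2, norm2 (t1 - s1) (t2 - s2) < delta -> Rabs (f t1 t2 - f s1 s2) < eps.

Definition polyhedral (f : R -> R -> R) : Prop :=
  continuous2 f /\
  exists (Rb : R) (l : list affine_piece),
    (forall t1 t2, norm2 t1 t2 > Rb -> f t1 t2 = 0) /\
    (forall t1 t2, norm2 t1 t2 <= Rb -> exists P, In P l /\ in_triangle P t1 t2) /\
    (forall P, In P l -> affine_on f P).

Definition pd1 (u g : R -> R -> R -> R) (O : R -> R -> R -> Prop) : Prop :=
  forall x1 x2 x3, O x1 x2 x3 -> derivable_pt_lim (fun t => u t x2 x3) x1 (g x1 x2 x3).
Definition pd2 (u g : R -> R -> R -> R) (O : R -> R -> R -> Prop) : Prop :=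
  forall x1 x2 x3, O x1 x2 x3 -> derivable_pt_lim (fun t => u x1 t x3) x2 (g x1 x2 x3).
Definition pd3 (u g : R -> R -> R -> R) (O : R -> R -> R -> Prop) : Prop :=
  forall x1 x2 x3, O x1 x2 x3 -> derivable_pt_lim (fun t => u x1 x2 t) x3 (g x1 x2 x3).

Definition cont_on (u : R -> R -> R -> R) (O : R -> R -> R -> Prop) : Prop :=
  forall x1 x2 x3, O x1 x2 x3 -> forall eps, eps > 0 -> exists delta, delta > 0 /\
    forall y1 y2 y3, O y1 y2 y3 -> dist3 x1 x2 x3 y1 y2 y3 < delta ->
      Rabs (u y1 y2 y3 - u x1 x2 x3) < eps.

Definition helmholtz (k : R) (u : R -> R -> R -> R) (O : R -> R -> R -> Prop) : Prop :=
  exists g1 g2 g3 h1 h2 h3 : R -> R -> R -> R,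
    cont_on u O /\
    pd1 u g1 O /\ pd2 u g2 O /\ pd3 u g3 O /\
    cont_on g1 O /\ cont_on g2 O /\ cont_on g3 O /\
    pd1 g1 h1 O /\ pd2 g2 h2 O /\ pd3 g3 h3 O /\
    cont_on h1 O /\ cont_on h2 O /\ cont_on h3 O /\
    forall x1 x2 x3, O x1 x2 x3 ->
      h1 x1 x2 x3 + h2 x1 x2 x3 + h3 x1 x2 x3 + k ^ 2 * u x1 x2 x3 = 0.

(* Total field u = u^in + u^re + u^sc, Dirichlet case, d = (al, be, -ga).
   u^in = exp(i k x.d), u^re = - exp(i k (al x1 + be x2 + ga x3)). *)
Definition utot_re (k al be ga : R) (vR : R -> R -> R -> R) (x1 x2 x3 : R) : R :=
  cos (k * (al * x1 + be * x2 - ga * x3)) - cos (k * (al * x1 + be * x2 + ga * x3))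
  + vR x1 x2 x3.
Definition utot_im (k al be ga : R) (vI : R -> R -> R -> R) (x1 x2 x3 : R) : R :=
  sin (k * (al * x1 + be * x2 - ga * x3)) - sin (k * (al * x1 + be * x2 + ga * x3))
  + vI x1 x2 x3.

(* Sommerfeld radiation condition for v = vR + i vI in Omega:
   r (d_r v - i k v) -> 0 as r -> infinity (uniformly in directions). *)
Definition radiating (k : R) (f : R -> R -> R) (vR vI : R -> R -> R -> R) : Prop :=
  exists aR1 aR2 aR3 aI1 aI2 aI3 : R -> R -> R -> R,
    pd1 vR aR1 (in_Omega f) /\ pd2 vR aR2 (in_Omega f) /\ pd3 vR aR3 (in_Omega f) /\
    pd1 vI aI1 (in_Omega f) /\ pd2 vI aI2 (in_Omega f) /\ pd3 vI aI3 (in_Omega f) /\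
    forall eps, eps > 0 -> exists r0, forall x1 x2 x3,
      in_Omega f x1 x2 x3 -> norm3 x1 x2 x3 > r0 ->
      let r := norm3 x1 x2 x3 in
      let drR := (x1 * aR1 x1 x2 x3 + x2 * aR2 x1 x2 x3 + x3 * aR3 x1 x2 x3) / r in
      let drI := (x1 * aI1 x1 x2 x3 + x2 * aI2 x1 x2 x3 + x3 * aI3 x1 x2 x3) / r in
      r * sqrt ((drR + k * vI x1 x2 x3) ^ 2 + (drI - k * vR x1 x2 x3) ^ 2) < eps.

Definition dirichlet_bc (f : R -> R -> R) (uR uI : R -> R -> R -> R) : Prop :=
  forall t1 t2 eps, eps > 0 -> exists delta, delta > 0 /\
    forall x1 x2 x3, in_Omega f x1 x2 x3 -> dist3 t1 t2 (f t1 t2) x1 x2 x3 < delta ->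
      Rabs (uR x1 x2 x3) < eps /\ Rabs (uI x1 x2 x3) < eps.

Definition dirichlet_scattered_field (k al be ga : R) (f : R -> R -> R)
    (vR vI : R -> R -> R -> R) : Prop :=
  helmholtz k (utot_re k al be ga vR) (in_Omega f) /\
  helmholtz k (utot_im k al be ga vI) (in_Omega f) /\
  dirichlet_bc f (utot_re k al be ga vR) (utot_im k al be ga vI) /\
  radiating k f vR vI.

(* F = FR + i FI is the far-field pattern of v = vR + i vI:
   v(x) = e^{ik|x|}/|x| (F(x/|x|) + O(1/|x|)) as |x| -> infinity in Omega. *)
Definition far_field_pattern (k : R) (f : R -> R -> R) (vR vI FR FI : R -> R -> R -> R) : Prop :=
  exists Cst r0 : R, forall x1 x2 x3,
    in_Omega f x1 x2 x3 -> norm3 x1 x2 x3 > r0 ->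
    let r := norm3 x1 x2 x3 in
    let y1 := x1 / r in let y2 := x2 / r in let y3 := x3 / r in
    let eR := (cos (k * r) * FR y1 y2 y3 - sin (k * r) * FI y1 y2 y3) / r in
    let eI := (sin (k * r) * FR y1 y2 y3 + cos (k * r) * FI y1 y2 y3) / r in
    sqrt ((vR x1 x2 x3 - eR) ^ 2 + (vI x1 x2 x3 - eI) ^ 2) <= Cst / r ^ 2.

(* Main.v *)
Require Import Defs.
From Stdlib Require Import Reals Arith PSeries_reg Lra Lia List Classical ClassicalEpsilon FunctionalExtensionality.
From Coquelicot Require Import Coquelicot.
Open Scope R_scope.

(* Equal far fields make [w = u1 - u2] of order [1 / |x| ^ 2] in the exterior half space, where it vanishes on the plane.
   Pairing [w] with odd polynomials times radial solutions (outgoing and incoming) shows that all its moments vanish on every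
   shell, so [w = 0] (Rellich), and [u1 = u2] on the common domain by unique continuation.

   If the surfaces differ, say [f1 > f2] somewhere, then [u2] vanishes on an open piece of the graph of [f1], hence on a piece of
   a plane inside the domain of [u2]: a nodal plane. Take the highest nodal point above a given base point, and reflect the upward
   vertical ray in its nodal plane. If the reflected ray hits the surface, the odd reflection of [u2] carries the face it hits to a
   nodal plane through a higher point of the vertical ray, a contradiction. Otherwise, or if the plane is vertical, there is a
   nodal plane above the maximum of [f2]. A slanted plane contradicts [|u^in + u^re| = 2 |sin (k ga x3)|] at infinity. A horizontal
   one makes [u2^sc] periodic in [x3], hence zero; then [sin (k ga f2) = 0] everywhere and [sin (k ga f1) = 0] where [f1 > f2], so
   by continuity and compact support [f2 = 0] and [f1 <= 0], contrary to [f1 > f2] somewhere. *)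

(** The two surfaces bound different domains and only one incident wave is available, so all
    geometric information has to come from the zero set of a single field. The analytic inputs are
    obtained by elementary means: a barrier gives the interior derivative bound, iterated
    differences at shrinking scales give unique continuation, and lattice sums, for which summation
    by parts is an exact identity, stand for integrals. Rellich's lemma then needs neither an
    expansion in spherical harmonics nor a trace of the normal derivative. The vertical ray is used
    because it is the path that never leaves an epigraph, and reflection preserves length: if the
    reflected ray meets the surface after length [s], the new nodal point lies exactly [s] above the
    old one. Height is therefore a quantity that can only increase, and it is bounded because any
    nodal point at or above the level [Rad] already forces the field to be the flat one. The
    limiting normals at the highest point are controlled by compactness of the unit sphere. *)

Inductive axis := X1 | X2 | X3.
Definition point := axis -> R.

Lemma axis_eq_dec (i j : axis) : {i = j} + {i <> j}.
Proof. decide equality. Defined.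

(** * Coordinates and the sup-norm topology of R^3 *)

Definition sum3 (f : axis -> R) : R := f X1 + f X2 + f X3.
Definition dot (p q : point) : R := sum3 (fun i => p i * q i).
Definition basis (i : axis) : point := fun j => if axis_eq_dec i j then 1 else 0.
Definition line (p e : point) (t : R) : point := fun i => p i + t * e i.
(** The open ball of the sup norm, which is the ball of the uniform structure on the function space
    [axis -> R]; this lets [continuous] and [locally] be used on points directly. [cube] is the
    closed ball. *)
Definition near (p : point) (r : R) (q : point) : Prop := forall i, Rabs (q i - p i) < r.
Definition cube (p : point) (r : R) (q : point) : Prop := forall i, Rabs (q i - p i) <= r.
Definition open_set (O : point -> Prop) : Prop :=
  forall p, O p -> exists r, 0 < r /\ forall q, near p r q -> O q.
Definition closed_set (K : point -> Prop) : Prop :=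
  forall l, (forall eps, 0 < eps -> exists p, K p /\ near l eps p) -> K l.

Lemma continuous_near (u : point -> R) (p : point) :
  continuous u p <->
  forall eps, 0 < eps -> exists d, 0 < d /\ forall q, near p d q -> Rabs (u q - u p) < eps.
Proof.
  split.
  - intros H eps He.
    destruct (proj1 (filterlim_locally u (u p)) H (mkposreal eps He)) as [d Hd].
    exists d; split; [apply cond_pos|]. intros q Hq. exact (Hd q Hq).
  - intros H. apply filterlim_locally. intros eps.
    destruct (H eps (cond_pos eps)) as [d [Hd Hq]].
    exists (mkposreal d Hd). intros q Hb. exact (Hq q Hb).
Qed.

Lemma locally_near (P : point -> Prop) (p : point) :
  locally p P <-> exists d, 0 < d /\ forall q, near p d q -> P q.
Proof.
  split.
  - intros [d Hd]. exists d; split; [apply cond_pos|]. intros q Hq; exact (Hd q Hq).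
  - intros [d [Hd H]]. exists (mkposreal d Hd). intros q Hb; exact (H q Hb).
Qed.

Lemma open_set_locally (O : point -> Prop) p : open_set O -> O p -> locally p O.
Proof. intros H Hp. apply locally_near. exact (H p Hp). Qed.

Lemma near_refl p r : 0 < r -> near p r p.
Proof. intros H i. rewrite Rminus_diag, Rabs_R0. exact H. Qed.

Lemma near_trans p q x r s : near p r q -> near q s x -> near p (r + s) x.
Proof.
  intros H1 H2 i. replace (x i - p i) with ((x i - q i) + (q i - p i)) by ring.
  eapply Rle_lt_trans; [apply Rabs_triang|]. specialize (H1 i); specialize (H2 i). lra.
Qed.

Lemma near_le p r s q : r <= s -> near p r q -> near p s q.
Proof. intros H H1 i. specialize (H1 i). lra. Qed.

Lemma cube_near p r s q : r < s -> cube p r q -> near p s q.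
Proof. intros H H1 i. specialize (H1 i). lra. Qed.

Lemma near_cube p r q : near p r q -> cube p r q.
Proof. intros H1 i. specialize (H1 i). lra. Qed.

Lemma near_open p r : open_set (near p r).
Proof.
  intros q Hq.
  set (m := Rmin (r - Rabs (q X1 - p X1)) (Rmin (r - Rabs (q X2 - p X2)) (r - Rabs (q X3 - p X3)))).
  assert (Hm : 0 < m).
  { unfold m. pose proof (Hq X1); pose proof (Hq X2); pose proof (Hq X3).
    repeat apply Rmin_glb_lt; lra. }
  assert (Hmi : forall i, m <= r - Rabs (q i - p i)).
  { unfold m. intros i.
    pose proof (Rmin_l (r - Rabs (q X1 - p X1)) (Rmin (r - Rabs (q X2 - p X2)) (r - Rabs (q X3 - p X3)))).
    pose proof (Rmin_r (r - Rabs (q X1 - p X1)) (Rmin (r - Rabs (q X2 - p X2)) (r - Rabs (q X3 - p X3)))).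
    pose proof (Rmin_l (r - Rabs (q X2 - p X2)) (r - Rabs (q X3 - p X3))).
    pose proof (Rmin_r (r - Rabs (q X2 - p X2)) (r - Rabs (q X3 - p X3))).
    destruct i; lra. }
  exists m; split; [exact Hm|]. intros x Hx i.
  replace (x i - p i) with ((x i - q i) + (q i - p i)) by ring.
  eapply Rle_lt_trans; [apply Rabs_triang|]. specialize (Hmi i); specialize (Hx i). lra.
Qed.

Lemma open_set_and O1 O2 : open_set O1 -> open_set O2 -> open_set (fun p => O1 p /\ O2 p).
Proof.
  intros H1 H2 p [Hp1 Hp2]. destruct (H1 p Hp1) as [r [Hr Hr']]. destruct (H2 p Hp2) as [s [Hs Hs']].
  exists (Rmin r s). split; [apply Rmin_glb_lt; assumption|].
  intros q Hq. split.
  - apply Hr'. apply near_le with (2 := Hq). apply Rmin_l.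
  - apply Hs'. apply near_le with (2 := Hq). apply Rmin_r.
Qed.

Lemma line_0 p e : line p e 0 = p.
Proof. apply functional_extensionality; intros i; unfold line; ring. Qed.

Lemma line_line p e s t : line (line p e s) e t = line p e (s + t).
Proof. apply functional_extensionality; intros i; unfold line; ring. Qed.

Lemma line_swap p e f s t : line (line p e s) f t = line (line p f t) e s.
Proof. apply functional_extensionality; intros i; unfold line; ring. Qed.

Lemma basis_le i j : Rabs (basis i j) <= 1.
Proof.
  unfold basis; destruct (axis_eq_dec i j); [rewrite Rabs_R1 | rewrite Rabs_R0]; lra.
Qed.

Lemma basis_eq i : basis i i = 1.
Proof. unfold basis; destruct (axis_eq_dec i i); [reflexivity | congruence]. Qed.

Lemma basis_neq i j : i <> j -> basis i j = 0.
Proof. intros H; unfold basis; destruct (axis_eq_dec i j); [congruence | reflexivity]. Qed.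

Lemma point_bound (e : point) : exists E, 0 < E /\ forall i, Rabs (e i) <= E.
Proof.
  exists (1 + Rabs (e X1) + Rabs (e X2) + Rabs (e X3)).
  pose proof (Rabs_pos (e X1)); pose proof (Rabs_pos (e X2)); pose proof (Rabs_pos (e X3)).
  split; [lra|]. intros []; lra.
Qed.

Lemma line_near_line p e q E s t :
  0 < E -> (forall i, Rabs (e i) <= E) -> forall r, near p r q ->
  near (line p e s) (r + Rabs (t - s) * E) (line q e t).
Proof.
  intros HE He r Hr i. unfold line.
  replace (q i + t * e i - (p i + s * e i)) with ((q i - p i) + (t - s) * e i) by ring.
  eapply Rle_lt_trans; [apply Rabs_triang|]. rewrite Rabs_mult.
  specialize (Hr i). specialize (He i).
  pose proof (Rmult_le_compat_l _ _ _ (Rabs_pos (t - s)) He). lra.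
Qed.

Lemma continuous_line (p e : point) (t : R) : continuous (line p e : R -> point) t.
Proof.
  apply filterlim_locally. intros eps.
  destruct (point_bound e) as [E [HE He]].
  assert (Hp : 0 < eps / (2 * E)) by (apply Rdiv_lt_0_compat; [apply cond_pos | lra]).
  exists (mkposreal _ Hp). intros s Hs i.
  change (Rabs (line p e s i - line p e t i) < eps).
  change (Rabs (s - t) < eps / (2 * E)) in Hs.
  assert (H2 : 0 < eps / 2) by (pose proof (cond_pos eps); lra).
  pose proof (line_near_line p e p E t s HE He (eps / 2) (near_refl p _ H2) i) as H.
  assert (Rabs (s - t) * E <= eps / 2).
  { apply Rmult_le_reg_r with (/ E); [apply Rinv_0_lt_compat; lra|].
    replace (Rabs (s - t) * E * / E) with (Rabs (s - t)) by (field; lra).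
    replace (eps / 2 * / E) with (eps / (2 * E)) by (field; lra). lra. }
  lra.
Qed.

Lemma cluster_real (x : nat -> R) (B : R) :
  (forall n, Rabs (x n) <= B) ->
  exists (l : R) (phi : nat -> nat), (forall n, (n <= phi n)%nat) /\
    forall n, Rabs (x (phi n) - l) < / (INR n + 1).
Proof.
  intros HB.
  destruct (Bolzano_Weierstrass x (fun y => - B <= y <= B) (compact_P3 (- B) B)) as [l Hl].
  { intros n. specialize (HB n). apply Rabs_le_between in HB. lra. }
  exists l.
  assert (H : forall n, exists m, (n <= m)%nat /\ Rabs (x m - l) < / (INR n + 1)).
  { intros n.
    assert (Hp : 0 < / (INR n + 1)) by (apply Rinv_0_lt_compat; pose proof (pos_INR n); lra).
    destruct (Hl (disc l (mkposreal _ Hp)) n) as [m [Hm Hd]].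
    - exists (mkposreal _ Hp). intros y Hy; exact Hy.
    - exists m; split; [exact Hm | exact Hd]. }
  destruct (choice _ H) as [phi Hphi]. exists phi. split; intros n; apply Hphi.
Qed.

Lemma cluster_point (x : nat -> point) (B : R) :
  (forall n i, Rabs (x n i) <= B) ->
  exists (l : point) (phi : nat -> nat), (forall n, (n <= phi n)%nat) /\
    forall n, near l (/ (INR n + 1)) (x (phi n)).
Proof.
  intros HB.
  destruct (cluster_real (fun n => x n X1) B (fun n => HB n X1)) as [l1 [f1 [H1 G1]]].
  destruct (cluster_real (fun n => x (f1 n) X2) B (fun n => HB _ X2)) as [l2 [f2 [H2 G2]]].
  destruct (cluster_real (fun n => x (f1 (f2 n)) X3) B (fun n => HB _ X3)) as [l3 [f3 [H3 G3]]].
  exists (fun i => match i with X1 => l1 | X2 => l2 | X3 => l3 end).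
  exists (fun n => f1 (f2 (f3 n))).
  assert (mono : forall n m, (n <= m)%nat -> / (INR m + 1) <= / (INR n + 1)).
  { intros n m Hnm. apply Rinv_le_contravar.
    - pose proof (pos_INR n); lra.
    - apply le_INR in Hnm; lra. }
  split.
  - intros n. specialize (H3 n). specialize (H2 (f3 n)). specialize (H1 (f2 (f3 n))). lia.
  - intros n [].
    + eapply Rlt_le_trans; [apply G1|]. apply mono. specialize (H3 n). specialize (H2 (f3 n)). lia.
    + eapply Rlt_le_trans; [apply G2|]. apply mono. apply H3.
    + apply G3.
Qed.

Lemma inv_INR_lt (eps : R) : 0 < eps -> exists N, forall n, (N <= n)%nat -> / (INR n + 1) < eps.
Proof.
  intros He. destruct (INR_unbounded (/ eps)) as [N HN]. exists N. intros n Hn.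
  apply le_INR in Hn. rewrite <- (Rinv_inv eps).
  apply Rinv_lt_contravar; [|lra].
  pose proof (Rinv_0_lt_compat eps He). pose proof (pos_INR n). nra.
Qed.

(** The form in which compactness is used throughout: negating a uniform statement at every scale
    [/ (INR n + 1)] supplies bounded witnesses, and the contradiction is found at an accumulation
    point [l]. *)
Lemma compact_cluster (P : nat -> point -> Prop) (B : R) :
  (forall n, exists p, P n p /\ forall i, Rabs (p i) <= B) ->
  exists l, forall eps N, 0 < eps -> exists n p, (N <= n)%nat /\ P n p /\ near l eps p.
Proof.
  intros H. destruct (choice _ H) as [x Hx].
  destruct (cluster_point x B (fun n => proj2 (Hx n))) as [l [phi [H1 H2]]].
  exists l. intros eps N He. destruct (inv_INR_lt eps He) as [N0 HN0].
  exists (phi (Nat.max N N0)), (x (phi (Nat.max N N0))). split; [|split].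
  - specialize (H1 (Nat.max N N0)). lia.
  - apply Hx.
  - apply near_le with (2 := H2 _). apply Rlt_le, HN0. lia.
Qed.

Lemma continuous_bounded (K : point -> Prop) (g : point -> R) (B : R) :
  (forall p, K p -> forall i, Rabs (p i) <= B) -> closed_set K ->
  (forall p, K p -> continuous g p) ->
  exists M, 0 < M /\ forall p, K p -> Rabs (g p) <= M.
Proof.
  intros HB Hc Hg. apply NNPP. intros Hn.
  destruct (compact_cluster (fun n p => K p /\ INR n + 1 < Rabs (g p)) B) as [l Hl].
  { intros n. apply NNPP. intros Hm. apply Hn. exists (INR n + 1).
    split; [pose proof (pos_INR n); lra|].
    intros p Hp. apply Rnot_lt_le. intros Hlt. apply Hm. exists p. split; [split|]; auto. }
  assert (Kl : K l).
  { apply Hc. intros eps He. destruct (Hl eps O He) as [n [p [_ [[Kp _] Hp]]]]. exists p; auto. }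
  destruct (proj1 (continuous_near g l) (Hg l Kl) 1 Rlt_0_1) as [d [Hd Hq]].
  destruct (INR_unbounded (Rabs (g l) + 1)) as [N HN].
  destruct (Hl d N Hd) as [n [p [Hn' [[Kp Hgp] Hp]]]].
  specialize (Hq p Hp). apply le_INR in Hn'.
  pose proof (Rabs_triang (g p - g l) (g l)) as Ht.
  replace (g p - g l + g l) with (g p) in Ht by ring. lra.
Qed.

Lemma continuous_min (K : point -> Prop) (g : point -> R) (B : R) :
  (exists p, K p) -> (forall p, K p -> forall i, Rabs (p i) <= B) -> closed_set K ->
  (forall p, K p -> continuous g p) ->
  exists p, K p /\ forall q, K q -> g p <= g q.
Proof.
  intros [p0 Hp0] HB Hc Hg.
  destruct (continuous_bounded K g B HB Hc Hg) as [M [HM HMb]].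
  destruct (completeness (fun y => exists p, K p /\ y = - g p)) as [m [Hm1 Hm2]].
  { exists M. intros y [p [Kp ->]]. specialize (HMb p Kp). apply Rabs_le_between in HMb. lra. }
  { exists (- g p0), p0. auto. }
  destruct (compact_cluster (fun n p => K p /\ g p < - m + / (INR n + 1)) B) as [l Hl].
  { intros n. apply NNPP. intros Hn.
    assert (Hp : 0 < / (INR n + 1)) by (apply Rinv_0_lt_compat; pose proof (pos_INR n); lra).
    assert (m <= m - / (INR n + 1)); [|lra].
    apply Hm2. intros y [p [Kp ->]].
    assert (~ g p < - m + / (INR n + 1)); [|lra].
    intros Hlt. apply Hn. exists p. split; [split|]; auto. }
  assert (Kl : K l).
  { apply Hc. intros eps He. destruct (Hl eps O He) as [n [p [_ [[Kp _] Hp]]]]. exists p; auto. }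
  exists l. split; [exact Kl|]. intros q Kq.
  assert (Hq : - m <= g q).
  { assert (- g q <= m); [|lra]. apply Hm1. exists q; auto. }
  apply Rle_trans with (2 := Hq). apply Rnot_lt_le. intros Hlt.
  set (eta := (g l + m) / 2). assert (He : 0 < eta) by (unfold eta; lra).
  destruct (proj1 (continuous_near g l) (Hg l Kl) eta He) as [d [Hd Hd']].
  destruct (inv_INR_lt eta He) as [N HN].
  destruct (Hl d N Hd) as [n [p [Hn [[Kp Hgp] Hp]]]].
  specialize (Hd' p Hp). specialize (HN n Hn). apply Rabs_lt_between in Hd'. unfold eta in *. lra.
Qed.

Lemma cube_closed p r : closed_set (cube p r).
Proof.
  intros l Hl i. apply Rnot_lt_le. intros H.
  destruct (Hl (Rabs (l i - p i) - r)) as [q [Hq Hn]]; [lra|].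
  specialize (Hq i). specialize (Hn i).
  pose proof (Rabs_triang (l i - q i) (q i - p i)) as Ht.
  replace (l i - q i + (q i - p i)) with (l i - p i) in Ht by ring.
  rewrite Rabs_minus_sym in Hn. lra.
Qed.

Lemma cube_bounded p r : exists B, forall q, cube p r q -> forall i, Rabs (q i) <= B.
Proof.
  destruct (point_bound p) as [E [HE He]]. exists (r + E). intros q Hq i.
  specialize (Hq i). specialize (He i).
  pose proof (Rabs_triang (q i - p i) (p i)) as Ht.
  replace (q i - p i + p i) with (q i) in Ht by ring. lra.
Qed.

(** A radius valid along the whole compact segment. It allows continuation along all parallel
    segments starting near [p] at once. *)
Lemma segment_tube (O : point -> Prop) (p e : point) :
  open_set O -> (forall s, 0 <= s <= 1 -> O (line p e s)) ->
  exists r, 0 < r /\ forall s q, 0 <= s <= 1 -> near (line p e s) r q -> O q.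
Proof.
  intros HO Hs. apply NNPP. intros Hn.
  assert (H : forall n : nat, exists s, 0 <= s <= 1 /\ exists q, near (line p e s) (/ (INR n + 1)) q /\ ~ O q).
  { intros n. apply NNPP. intros Hm. apply Hn. exists (/ (INR n + 1)). split.
    - apply Rinv_0_lt_compat; pose proof (pos_INR n); lra.
    - intros s q H01 Hq. apply NNPP. intros HOq. apply Hm. exists s. split; [exact H01|]. exists q; auto. }
  destruct (choice _ H) as [x Hx].
  destruct (cluster_real x 1) as [l [phi [H1 H2]]].
  { intros n. destruct (Hx n) as [Hx1 _]. apply Rabs_le_between. lra. }
  assert (Hl : 0 <= l <= 1).
  { split; apply Rnot_lt_le; intros Hlt.
    - destruct (inv_INR_lt (- l)) as [N HN]; [lra|]. specialize (HN N (le_n N)).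
      specialize (H2 N). destruct (Hx (phi N)) as [Hx1 _]. apply Rabs_lt_between in H2. lra.
    - destruct (inv_INR_lt (l - 1)) as [N HN]; [lra|]. specialize (HN N (le_n N)).
      specialize (H2 N). destruct (Hx (phi N)) as [Hx1 _]. apply Rabs_lt_between in H2. lra. }
  destruct (HO _ (Hs l Hl)) as [r [Hr Hr']].
  destruct (point_bound e) as [E [HE He]].
  destruct (inv_INR_lt (r / (1 + E))) as [N HN]; [apply Rdiv_lt_0_compat; lra|].
  specialize (HN N (le_n N)).
  destruct (Hx (phi N)) as [_ [q [Hq Hq']]]. apply Hq'. apply Hr'.
  set (a := / (INR N + 1)) in *.
  assert (Ha : 0 < a) by (apply Rinv_0_lt_compat; pose proof (pos_INR N); lra).
  assert (Haq : near (line p e (x (phi N))) a q).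
  { apply near_le with (2 := Hq). unfold a. apply Rinv_le_contravar.
    - pose proof (pos_INR N); lra.
    - specialize (H1 N). apply le_INR in H1. lra. }
  intros i. specialize (Haq i). specialize (H2 N). fold a in H2. specialize (He i).
  unfold line in *.
  replace (q i - (p i + l * e i)) with ((q i - (p i + x (phi N) * e i)) + (x (phi N) - l) * e i) by ring.
  eapply Rle_lt_trans; [apply Rabs_triang|]. rewrite Rabs_mult.
  assert (a * (1 + E) < r).
  { apply Rmult_lt_compat_r with (r := 1 + E) in HN; [|lra].
    replace (r / (1 + E) * (1 + E)) with r in HN by (field; lra). exact HN. }
  pose proof (Rabs_pos (e i)). pose proof (Rabs_pos (x (phi N) - l)). nra.
Qed.

(** * Continuity rules, partial derivatives and C^2 functions *)

Lemma cont_plus (f g : point -> R) p :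
  continuous f p -> continuous g p -> continuous (fun q => f q + g q) p.
Proof. intros Hf Hg. exact (continuous_plus f g p Hf Hg). Qed.

Lemma cont_opp (f : point -> R) p : continuous f p -> continuous (fun q => - f q) p.
Proof. intros Hf. exact (continuous_opp f p Hf). Qed.

Lemma cont_minus (f g : point -> R) p :
  continuous f p -> continuous g p -> continuous (fun q => f q - g q) p.
Proof. intros Hf Hg. exact (continuous_minus f g p Hf Hg). Qed.

Lemma cont_mult (f g : point -> R) p :
  continuous f p -> continuous g p -> continuous (fun q => f q * g q) p.
Proof. intros Hf Hg. exact (continuous_mult (K := R_AbsRing) f g p Hf Hg). Qed.

Lemma cont_const (a : R) (p : point) : continuous (fun _ : point => a) p.
Proof. apply continuous_const. Qed.

Lemma cont_coord (i : axis) (p : point) : continuous (fun x : point => x i) p.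
Proof.
  apply continuous_near. intros eps He. exists eps; split; [exact He|]. intros q Hq. apply Hq.
Qed.

Lemma cont_comp (F : R -> R) (f : point -> R) p :
  continuous f p -> continuous F (f p) -> continuous (fun q => F (f q)) p.
Proof. intros Hf HF. exact (continuous_comp f F p Hf HF). Qed.

Lemma cont_pow (f : point -> R) n p : continuous f p -> continuous (fun q => f q ^ n) p.
Proof.
  intros Hf. induction n; simpl; [apply cont_const | apply cont_mult; assumption].
Qed.

Ltac cont_tac :=
  match goal with
  | |- continuous (fun _ => ?a) _ => apply (cont_const a)
  | |- continuous (fun x => x ?i) _ => apply (cont_coord i)
  | |- continuous (fun x => @?f x + @?g x) _ => apply (cont_plus f g); cont_tac
  | |- continuous (fun x => @?f x - @?g x) _ => apply (cont_minus f g); cont_tac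
  | |- continuous (fun x => @?f x * @?g x) _ => apply (cont_mult f g); cont_tac
  | |- continuous (fun x => - @?f x) _ => apply (cont_opp f); cont_tac
  | |- continuous (fun x => @?f x ^ ?n) _ => apply (cont_pow f n); cont_tac
  | _ => idtac
  end.

Definition deriv (e : point) (u : point -> R) (p : point) : R :=
  Derive (fun t => u (line p e t)) 0.
Definition d1 (i : axis) (u : point -> R) : point -> R := deriv (basis i) u.
Definition d2 (i : axis) (u : point -> R) : point -> R := d1 i (d1 i u).
Definition laplacian (u : point -> R) (p : point) : R := sum3 (fun i => d2 i u p).

Definition is_deriv (e : point) (u : point -> R) (p : point) (l : R) : Prop :=
  is_derive (fun t => u (line p e t)) 0 l.

(** Only pure second derivatives are demanded, as in [helmholtz]. Mixed ones become available once
    [helm_deriv] shows that partial derivatives of solutions are again solutions. *)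
Definition c2_at (u : point -> R) (p : point) : Prop :=
  continuous u p /\ forall i,
    is_deriv (basis i) u p (d1 i u p) /\ continuous (d1 i u) p /\
    is_deriv (basis i) (d1 i u) p (d2 i u p) /\ continuous (d2 i u) p.

Definition c2_on (O : point -> Prop) (u : point -> R) : Prop := forall p, O p -> c2_at u p.

Definition helm_on (k : R) (O : point -> Prop) (u : point -> R) : Prop :=
  c2_on O u /\ forall p, O p -> laplacian u p + k ^ 2 * u p = 0.

Lemma is_deriv_unique e u p l : is_deriv e u p l -> deriv e u p = l.
Proof. intros H. apply is_derive_unique. exact H. Qed.

Lemma line_locally (P : point -> Prop) p e : locally p P -> locally 0 (fun t => P (line p e t)).
Proof.
  intros H. pose proof (continuous_line p e 0) as Hc. rewrite <- (line_0 p e) in H.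
  exact (Hc P H).
Qed.

Lemma is_deriv_ext_loc e u v p l :
  locally p (fun q => u q = v q) -> is_deriv e u p l -> is_deriv e v p l.
Proof.
  intros H Hd. unfold is_deriv in *. refine (is_derive_ext_loc _ _ _ _ _ Hd).
  exact (line_locally _ p e H).
Qed.

Lemma continuous_eq_loc (u v : point -> R) p :
  locally p (fun q => u q = v q) -> continuous u p -> continuous v p.
Proof. intros H Hc. refine (continuous_ext_loc v u p _ Hc); exact H. Qed.

(** The way to verify [c2_on]: exhibit candidates [g], [h] for the derivatives. The returned
    identities for [d1] and [d2] are what later computations of Laplacians rewrite with. *)
Lemma c2_intro (O : point -> Prop) (u : point -> R) (g h : axis -> point -> R) :
  open_set O ->
  (forall p, O p -> continuous u p) ->
  (forall i p, O p -> is_deriv (basis i) u p (g i p)) ->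
  (forall i p, O p -> continuous (g i) p) ->
  (forall i p, O p -> is_deriv (basis i) (g i) p (h i p)) ->
  (forall i p, O p -> continuous (h i) p) ->
  c2_on O u /\ (forall i p, O p -> d1 i u p = g i p) /\ (forall i p, O p -> d2 i u p = h i p).
Proof.
  intros HO Hu Hg Hgc Hh Hhc.
  assert (E1 : forall i p, O p -> d1 i u p = g i p).
  { intros i p Hp. apply is_deriv_unique. apply Hg, Hp. }
  assert (L1 : forall i p, O p -> locally p (fun q => g i q = d1 i u q)).
  { intros i p Hp. generalize (open_set_locally O p HO Hp). apply filter_imp.
    intros q Hq. symmetry. apply E1, Hq. }
  assert (D2 : forall i p, O p -> is_deriv (basis i) (d1 i u) p (h i p)).
  { intros i p Hp. apply is_deriv_ext_loc with (1 := L1 i p Hp). apply Hh, Hp. }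
  assert (E2 : forall i p, O p -> d2 i u p = h i p).
  { intros i p Hp. apply is_deriv_unique. apply D2, Hp. }
  assert (L2 : forall i p, O p -> locally p (fun q => h i q = d2 i u q)).
  { intros i p Hp. generalize (open_set_locally O p HO Hp). apply filter_imp.
    intros q Hq. symmetry. apply E2, Hq. }
  split; [|split; assumption].
  intros p Hp. split; [apply Hu, Hp|]. intros i. split; [|split; [|split]].
  - rewrite E1 by exact Hp. apply Hg, Hp.
  - apply continuous_eq_loc with (1 := L1 i p Hp). apply Hgc, Hp.
  - rewrite E2 by exact Hp. apply D2, Hp.
  - apply continuous_eq_loc with (1 := L2 i p Hp). apply Hhc, Hp.
Qed.

Lemma c2_cont u p : c2_at u p -> continuous u p.
Proof. intros H; exact (proj1 H). Qed.

Lemma c2_d1 u p : c2_at u p -> forall i, is_deriv (basis i) u p (d1 i u p).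
Proof. intros H i; exact (proj1 (proj2 H i)). Qed.

Lemma c2_cont1 u p : c2_at u p -> forall i, continuous (d1 i u) p.
Proof. intros H i; exact (proj1 (proj2 (proj2 H i))). Qed.

Lemma c2_d2 u p : c2_at u p -> forall i, is_deriv (basis i) (d1 i u) p (d2 i u p).
Proof. intros H i; exact (proj1 (proj2 (proj2 (proj2 H i)))). Qed.

Lemma c2_cont2 u p : c2_at u p -> forall i, continuous (d2 i u) p.
Proof. intros H i; exact (proj2 (proj2 (proj2 (proj2 H i)))). Qed.

Lemma c2_on_sub (O O' : point -> Prop) u : (forall p, O' p -> O p) -> c2_on O u -> c2_on O' u.
Proof. intros H Hc p Hp. apply Hc, H, Hp. Qed.

Lemma helm_on_sub k (O O' : point -> Prop) u : (forall p, O' p -> O p) -> helm_on k O u -> helm_on k O' u.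
Proof. intros H [Hc He]. split; [apply (c2_on_sub O); assumption | intros p Hp; apply He, H, Hp]. Qed.

Lemma c2_lin (O : point -> Prop) (u v : point -> R) (a b : R) :
  open_set O -> c2_on O u -> c2_on O v ->
  c2_on O (fun p => a * u p + b * v p) /\
  (forall i p, O p -> d1 i (fun p => a * u p + b * v p) p = a * d1 i u p + b * d1 i v p) /\
  (forall i p, O p -> d2 i (fun p => a * u p + b * v p) p = a * d2 i u p + b * d2 i v p).
Proof.
  intros HO Hu Hv.
  assert (lc : forall (f g : point -> R) p, continuous f p -> continuous g p ->
    continuous (fun q => a * f q + b * g q) p).
  { intros f g p Hf Hg.
    apply cont_plus; apply cont_mult; try assumption; apply cont_const. }
  assert (ld : forall e (f g : point -> R) p l m, is_deriv e f p l -> is_deriv e g p m ->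
    is_deriv e (fun q => a * f q + b * g q) p (a * l + b * m)).
  { intros e f g p l m Hf Hg. unfold is_deriv in *.
    apply (is_derive_plus (fun t => a * f (line p e t)) (fun t => b * g (line p e t)));
      apply is_derive_scal; assumption. }
  apply (c2_intro O _ (fun i p => a * d1 i u p + b * d1 i v p)
    (fun i p => a * d2 i u p + b * d2 i v p) HO).
  - intros p Hp. apply lc; [apply c2_cont, (Hu p Hp) | apply c2_cont, (Hv p Hp)].
  - intros i p Hp. apply ld; [apply c2_d1, (Hu p Hp) | apply c2_d1, (Hv p Hp)].
  - intros i p Hp. apply lc; [apply c2_cont1, (Hu p Hp) | apply c2_cont1, (Hv p Hp)].
  - intros i p Hp. apply ld; [apply c2_d2, (Hu p Hp) | apply c2_d2, (Hv p Hp)].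
  - intros i p Hp. apply lc; [apply c2_cont2, (Hu p Hp) | apply c2_cont2, (Hv p Hp)].
Qed.

Lemma helm_lin k O u v a b :
  open_set O -> helm_on k O u -> helm_on k O v -> helm_on k O (fun p => a * u p + b * v p).
Proof.
  intros HO [Hu Eu] [Hv Ev]. destruct (c2_lin O u v a b HO Hu Hv) as [H1 [_ H2]].
  split; [exact H1|]. intros p Hp. unfold laplacian, sum3 in *.
  rewrite !H2 by exact Hp. specialize (Eu p Hp). specialize (Ev p Hp).
  replace (_ + _) with
    (a * (d2 X1 u p + d2 X2 u p + d2 X3 u p + k ^ 2 * u p)
     + b * (d2 X1 v p + d2 X2 v p + d2 X3 v p + k ^ 2 * v p)) by ring.
  rewrite Eu, Ev. ring.
Qed.

(** * Translations and coordinate reflections *)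

(** Used with every [s i] equal to 1 or -1. Such a map sends axis-parallel lines to axis-parallel
    lines, so it transports pure second derivatives without any knowledge of mixed ones; oblique
    reflections have to wait for [helm_deriv]. *)
Definition flip (c s : point) (x : point) : point := fun i => c i + s i * x i.

Lemma flip_line c s x i t : flip c s (line x (basis i) t) = line (flip c s x) (basis i) (s i * t).
Proof.
  apply functional_extensionality; intros j. unfold flip, line.
  destruct (axis_eq_dec i j) as [<-|H]; [rewrite basis_eq | rewrite basis_neq by exact H]; ring.
Qed.

Lemma flip_continuous c s (Hs : forall i, s i = 1 \/ s i = -1) x (u : point -> R) :
  continuous u (flip c s x) -> continuous (fun y => u (flip c s y)) x.
Proof.
  intros H. apply continuous_near. intros eps He.
  destruct (proj1 (continuous_near _ _) H eps He) as [d [Hd Hq]].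
  exists d; split; [exact Hd|]. intros q Hn. apply Hq. intros i. specialize (Hn i).
  unfold flip. replace (c i + s i * q i - (c i + s i * x i)) with (s i * (q i - x i)) by ring.
  rewrite Rabs_mult. destruct (Hs i) as [-> | ->].
  - rewrite Rabs_R1. lra.
  - rewrite (Rabs_left (-1)) by lra. lra.
Qed.

Lemma flip_open c s (Hs : forall i, s i = 1 \/ s i = -1) O :
  open_set O -> open_set (fun x => O (flip c s x)).
Proof.
  intros HO x Hx. destruct (HO _ Hx) as [r [Hr Hq]]. exists r; split; [exact Hr|].
  intros q Hn. apply Hq. intros i. specialize (Hn i).
  unfold flip. replace (c i + s i * q i - (c i + s i * x i)) with (s i * (q i - x i)) by ring.
  rewrite Rabs_mult. destruct (Hs i) as [-> | ->].
  - rewrite Rabs_R1. lra.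
  - rewrite (Rabs_left (-1)) by lra. lra.
Qed.

Lemma is_deriv_flip c s i u x l :
  is_deriv (basis i) u (flip c s x) l -> is_deriv (basis i) (fun y => u (flip c s y)) x (s i * l).
Proof.
  intros H. unfold is_deriv in *.
  apply is_derive_ext with (fun t => u (line (flip c s x) (basis i) (s i * t))).
  - intros t. rewrite flip_line. reflexivity.
  - apply (is_derive_comp (fun t => u (line (flip c s x) (basis i) t)) (fun t => s i * t)).
    + rewrite Rmult_0_r. exact H.
    + auto_derive; [exact I | ring].
Qed.

Lemma c2_flip c s (Hs : forall i, s i = 1 \/ s i = -1) O u :
  open_set O -> c2_on O u ->
  c2_on (fun x => O (flip c s x)) (fun x => u (flip c s x)) /\
  (forall i p, O (flip c s p) -> d1 i (fun x => u (flip c s x)) p = s i * d1 i u (flip c s p)) /\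
  (forall i p, O (flip c s p) -> d2 i (fun x => u (flip c s x)) p = d2 i u (flip c s p)).
Proof.
  intros HO Hu.
  apply (c2_intro (fun x => O (flip c s x)) (fun x => u (flip c s x))
    (fun i p => s i * d1 i u (flip c s p)) (fun i p => d2 i u (flip c s p))).
  - apply flip_open; assumption.
  - intros p Hp. apply flip_continuous; [exact Hs|]. apply c2_cont, (Hu _ Hp).
  - intros i p Hp. apply is_deriv_flip. apply c2_d1, (Hu _ Hp).
  - intros i p Hp. apply cont_mult; [apply cont_const|].
    apply (flip_continuous c s Hs p (d1 i u)). apply c2_cont1, (Hu _ Hp).
  - intros i p Hp.
    replace (d2 i u (flip c s p)) with (s i * (s i * d2 i u (flip c s p))).
    + apply (is_derive_scal (fun t => d1 i u (flip c s (line p (basis i) t)))).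
      apply (is_deriv_flip c s i (d1 i u)). apply c2_d2, (Hu _ Hp).
    + destruct (Hs i) as [-> | ->]; ring.
  - intros i p Hp. apply (flip_continuous c s Hs p (d2 i u)). apply c2_cont2, (Hu _ Hp).
Qed.

Lemma helm_flip k c s (Hs : forall i, s i = 1 \/ s i = -1) O u :
  open_set O -> helm_on k O u -> helm_on k (fun x => O (flip c s x)) (fun x => u (flip c s x)).
Proof.
  intros HO [Hu Eu]. destruct (c2_flip c s Hs O u HO Hu) as [H1 [_ H2]].
  split; [exact H1|]. intros p Hp. unfold laplacian, sum3. rewrite !H2 by exact Hp. apply (Eu _ Hp).
Qed.

Lemma line_is_flip e h x : line x e h = flip (fun i => h * e i) (fun _ => 1) x.
Proof. apply functional_extensionality; intros i; unfold line, flip; ring. Qed.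

Lemma helm_translate k O u e h :
  open_set O -> helm_on k O u -> helm_on k (fun x => O (line x e h)) (fun x => u (line x e h)).
Proof.
  intros HO Hu.
  assert (E1 : (fun x => O (line x e h)) = (fun x => O (flip (fun i => h * e i) (fun _ => 1) x))).
  { apply functional_extensionality; intros x. rewrite line_is_flip. reflexivity. }
  assert (E2 : (fun x => u (line x e h)) = (fun x => u (flip (fun i => h * e i) (fun _ => 1) x))).
  { apply functional_extensionality; intros x. rewrite line_is_flip. reflexivity. }
  rewrite E1, E2. apply helm_flip; auto.
Qed.

(** * The minimum principle *)

Lemma second_derivative_at_min (g g' : R -> R) (c r : R) :
  0 < r -> (forall t, Rabs t < r -> is_derive g t (g' t)) -> is_derive g' 0 c ->
  (forall t, Rabs t < r -> g 0 <= g t) -> 0 <= c.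
Proof.
  intros Hr Hg Hc Hmin. apply Rnot_lt_le. intros Hneg.
  assert (H00 : Rabs 0 < r) by (rewrite Rabs_R0; exact Hr).
  assert (Z : g' 0 = 0).
  { pose proof (proj1 (is_derive_Reals _ _ _) (Hg 0 H00)) as Hd.
    pose (pr := exist (fun l => derivable_pt_abs g 0 l) (g' 0) Hd : derivable_pt g 0).
    change (derive_pt g 0 pr = 0).
    apply (deriv_minimum g (- r) r 0 pr); [lra | lra |].
    intros x H1 H2. apply Hmin. apply Rabs_lt_between. lra. }
  pose proof (proj1 (is_derive_Reals _ _ _) Hc) as Hc'.
  destruct (Hc' (- c / 2)) as [d Hd]; [lra|].
  set (t := Rmin (r / 2) (d / 2)).
  assert (Ht : 0 < t) by (apply Rmin_glb_lt; [lra | pose proof (cond_pos d); lra]).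
  assert (Htr : t <= r / 2) by apply Rmin_l.
  assert (Htd : t <= d / 2) by apply Rmin_r.
  destruct (MVT_cor2 g g' 0 t Ht) as [x [Ex Hx]].
  { intros x Hx. apply is_derive_Reals, Hg, Rabs_lt_between. lra. }
  assert (Hgt : g 0 <= g t) by (apply Hmin, Rabs_lt_between; lra).
  assert (Hx0 : x <> 0) by lra.
  specialize (Hd x Hx0). rewrite Rplus_0_l, Z, Rminus_0_r in Hd.
  assert (Hq : Rabs (g' x / x - c) < - c / 2).
  { apply Hd, Rabs_lt_between. pose proof (cond_pos d). lra. }
  apply Rabs_lt_between in Hq.
  assert (Hq2 : g' x / x < 0) by lra.
  assert (Hq3 : g' x = g' x / x * x) by (field; lra).
  assert (0 < - (g' x / x) * x) by (apply Rmult_lt_0_compat; lra).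
  assert (0 < - g' x * t) by (apply Rmult_lt_0_compat; lra).
  rewrite Rminus_0_r in Ex. lra.
Qed.

Lemma is_deriv_shift e u p t l :
  is_deriv e u (line p e t) l -> is_derive (fun s => u (line p e s)) t l.
Proof.
  intros H. unfold is_deriv in H.
  apply is_derive_ext with (fun s => u (line (line p e t) e (s - t))).
  - intros s. rewrite line_line. f_equal. f_equal. ring.
  - replace l with (1 * l) by ring.
    apply (is_derive_comp (fun s => u (line (line p e t) e s)) (fun s => s - t)).
    + rewrite Rminus_diag. exact H.
    + auto_derive; [exact I | ring].
Qed.

Lemma line_basis_near p i t r : Rabs t < r -> near p r (line p (basis i) t).
Proof.
  intros H j. unfold line. replace (p j + t * basis i j - p j) with (t * basis i j) by ring.
  rewrite Rabs_mult. pose proof (basis_le i j). pose proof (Rabs_pos (basis i j)).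
  pose proof (Rmult_le_compat_l _ _ _ (Rabs_pos t) (basis_le i j)). lra.
Qed.

(** At a minimum inside [O] all pure second derivatives would be nonnegative, against the strictly
    negative Laplacian. Hence the minimum over the compact [K] is attained where [g] is known to be
    nonnegative. *)
Lemma min_principle (K O : point -> Prop) (g : point -> R) (B : R) :
  (forall p, K p -> forall i, Rabs (p i) <= B) -> closed_set K ->
  (forall p, K p -> continuous g p) ->
  (forall p, O p -> exists r, 0 < r /\ forall q, near p r q -> K q /\ O q) ->
  c2_on O g -> (forall p, O p -> laplacian g p < 0) ->
  (forall p, K p -> O p \/ 0 <= g p) ->
  forall p, K p -> 0 <= g p.
Proof.
  intros HB HK Hg HO Hc HL Hb p Kp.
  destruct (continuous_min K g B) as [q [Kq Hq]]; auto.
  { exists p; exact Kp. }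
  apply Rle_trans with (2 := Hq p Kp).
  destruct (Hb q Kq) as [Oq|]; [|assumption]. exfalso.
  destruct (HO q Oq) as [r [Hr Hr']].
  assert (forall i, 0 <= d2 i g q) as Hd.
  { intros i.
    apply (second_derivative_at_min (fun t => g (line q (basis i) t))
      (fun t => d1 i g (line q (basis i) t)) _ r Hr).
    - intros t Ht. apply is_deriv_shift. apply c2_d1, Hc. apply Hr'. apply line_basis_near, Ht.
    - apply c2_d2, (Hc q Oq).
    - intros t Ht. rewrite line_0. apply Hq. apply Hr'. apply line_basis_near, Ht. }
  specialize (HL q Oq). unfold laplacian, sum3 in HL.
  pose proof (Hd X1); pose proof (Hd X2); pose proof (Hd X3). lra.
Qed.

(** * The interior difference estimate *)

(** The quadratic term dominates on the faces of the cube of radius [d]; the concave term, zero at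
    [x i = p i] and at [x i = p i + d], makes the Laplacian negative. Both grow at most linearly
    when leaving [p] in direction [i], which is what yields a bound on differences. *)
Definition barrier (p : point) (i : axis) (A K d : R) (x : point) : R :=
  A * sum3 (fun j => (x j - p j) ^ 2) + K * ((x i - p i) * (d - (x i - p i))).

Lemma full_open : open_set (fun _ => True).
Proof. intros p _. exists 1. split; [lra | trivial]. Qed.

Lemma barrier_c2 p i A K d :
  c2_on (fun _ => True) (barrier p i A K d) /\
  forall x, laplacian (barrier p i A K d) x = 6 * A - 2 * K.
Proof.
  destruct (c2_intro (fun _ => True) (barrier p i A K d)
    (fun j x => 2 * A * (x j - p j) + K * basis i j * (d - 2 * (x i - p i)))
    (fun j _ => 2 * A - 2 * K * basis i j)) as [H1 [_ H2]].
  - exact full_open.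
  - intros x _. unfold barrier, sum3. cont_tac.
  - intros j x _. unfold is_deriv, barrier, sum3, line.
    destruct i, j; unfold basis; simpl; auto_derive; try exact I; ring.
  - intros j x _. cont_tac.
  - intros j x _. unfold is_deriv, line.
    destruct i, j; unfold basis; simpl; auto_derive; try exact I; ring.
  - intros j x _. apply continuous_const.
  - split; [exact H1|]. intros x. unfold laplacian, sum3. rewrite !H2 by exact I.
    destruct i; unfold basis; simpl; ring.
Qed.

(** Compare the part of [u] that is odd across the plane [x i = p i] with twice the barrier on the
    half cube [p i <= x i]. The odd part vanishes on the plane and is at most [2 * M] on the other
    faces, so the minimum principle bounds it by the barrier, in particular on the axis through
    [p]. *)
Lemma difference_estimate_signed k (O : point -> Prop) u p i d M s :
  open_set O -> helm_on k O u -> 0 < d -> 0 < M ->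
  (forall q, cube p d q -> O q) -> (forall q, cube p d q -> Rabs (u q) <= M) ->
  0 <= s <= d ->
  u (line p (basis i) s) - u (line p (basis i) (- s)) <= 2 * s * (3 * M / d + (k ^ 2 + 1) * M * d / 2).
Proof.
  intros HO Hu Hd HM HcO HuM Hs.
  set (c := fun j => if axis_eq_dec i j then 2 * p j else 0 : R).
  set (sg := fun j => if axis_eq_dec i j then -1 else 1 : R).
  assert (Hsg : forall j, sg j = 1 \/ sg j = -1).
  { intros j; unfold sg; destruct (axis_eq_dec i j); auto. }
  assert (Hfc : forall q r, cube p r q -> cube p r (flip c sg q)).
  { intros q r Hq j. specialize (Hq j). unfold flip, c, sg. destruct (axis_eq_dec i j).
    - replace (2 * p j + -1 * q j - p j) with (- (q j - p j)) by ring. rewrite Rabs_Ropp. exact Hq.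
    - replace (0 + 1 * q j - p j) with (q j - p j) by ring. exact Hq. }
  (* [A] makes the quadratic term at least [M] on the outer faces, and [K] makes the Laplacian of
     the barrier equal to [- N]. Twice [N] exceeds [k ^ 2] times the odd part, which is at most
     [2 * k ^ 2 * M]; the [+ 1] in [N] makes the inequality strict. *)
  set (N := (k ^ 2 + 1) * M).
  set (A := M / d ^ 2). set (K := 3 * M / d ^ 2 + N / 2).
  set (psi := barrier p i A K d).
  set (G := fun x => 2 * psi x + (-1) * (1 * u x + (-1) * u (flip c sg x))).
  destruct (barrier_c2 p i A K d) as [Hp1 Hp2].
  set (O2 := fun x => O x /\ O (flip c sg x)).
  assert (HO2 : open_set O2) by (apply open_set_and; [|apply flip_open]; assumption).
  assert (Hu1 : helm_on k O2 u) by (apply helm_on_sub with (2 := Hu); intros x Hx; apply Hx).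
  assert (Hu2 : helm_on k O2 (fun x => u (flip c sg x))).
  { apply helm_on_sub with (2 := helm_flip k c sg Hsg O u HO Hu). intros x Hx; apply Hx. }
  pose proof (helm_lin k O2 _ _ 1 (-1) HO2 Hu1 Hu2) as [Hw Ew].
  assert (Hpsi : c2_on O2 psi) by (apply c2_on_sub with (2 := Hp1); trivial).
  destruct (c2_lin O2 psi _ 2 (-1) HO2 Hpsi Hw) as [HG1 [_ HG2]].
  fold G in HG1, HG2.
  set (Kc := fun x => cube p d x /\ p i <= x i).
  set (Oc := fun x => near p d x /\ p i < x i).
  assert (HKO2 : forall x, Kc x -> O2 x).
  { intros x [Hx _]. split; apply HcO; [|apply Hfc]; exact Hx. }
  assert (HOcK : forall x, Oc x -> Kc x).
  { intros x [Hx Hx']. split; [apply near_cube, Hx | lra]. }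
  destruct (cube_bounded p d) as [B HB].
  assert (Hmin : forall x, Kc x -> 0 <= G x).
  { apply (min_principle Kc Oc G B).
    - intros x [Hx _]. apply HB, Hx.
    - intros l Hl. split.
      + apply (cube_closed p d). intros eps He. destruct (Hl eps He) as [x [Hx Hx']].
        exists x; split; [apply Hx | exact Hx'].
      + apply Rnot_lt_le. intros Hlt. destruct (Hl (p i - l i)) as [x [Hx Hx']]; [lra|].
        specialize (Hx' i). apply Rabs_lt_between in Hx'. destruct Hx as [_ Hx]. lra.
    - intros x Hx. apply c2_cont, (HG1 x (HKO2 x Hx)).
    - intros x [Hx Hx'].
      destruct (near_open p d x Hx) as [r [Hr Hr']].
      exists (Rmin r (x i - p i)). split; [apply Rmin_glb_lt; lra|].
      intros q Hq.
      assert (Oc q) as Hoq.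
      { split.
        - apply Hr'. apply near_le with (2 := Hq). apply Rmin_l.
        - specialize (Hq i). pose proof (Rmin_r r (x i - p i)). apply Rabs_lt_between in Hq. lra. }
      split; [apply HOcK|]; exact Hoq.
    - apply c2_on_sub with (2 := HG1). intros x Hx. apply HKO2, HOcK, Hx.
    - intros x Hx. pose proof (HKO2 x (HOcK x Hx)) as Hx2.
      assert (HL : laplacian G x =
        2 * laplacian psi x - laplacian (fun y => 1 * u y + -1 * u (flip c sg y)) x).
      { unfold laplacian, sum3. rewrite !HG2 by exact Hx2. ring. }
      rewrite HL. unfold psi. rewrite Hp2. specialize (Ew x Hx2).
      assert (E : 6 * A - 2 * K = - N) by (unfold A, K; field; lra).
      rewrite E.
      pose proof (HuM x (proj1 (HOcK x Hx))) as B1.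
      pose proof (HuM _ (Hfc _ _ (proj1 (HOcK x Hx)))) as B2.
      apply Rabs_le_between in B1. apply Rabs_le_between in B2.
      assert (k ^ 2 * (u x - u (flip c sg x)) <= k ^ 2 * (2 * M)).
      { apply Rmult_le_compat_l; [apply pow2_ge_0 | lra]. }
      unfold N. nra.
    - intros x Hx. destruct (Rlt_dec (p i) (x i)) as [Hlt|Hge].
      + destruct (classic (near p d x)) as [Hn|Hn]; [left; split; assumption|]. right.
        assert (Hj : exists j, Rabs (x j - p j) = d).
        { apply NNPP. intros Hj. apply Hn. intros j. destruct (proj1 Hx j) as [H1|H1]; [exact H1|].
          exfalso. apply Hj. exists j. exact H1. }
        destruct Hj as [j Hj].
        pose proof (HuM x (proj1 Hx)) as B1. pose proof (HuM _ (Hfc _ _ (proj1 Hx))) as B2.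
        apply Rabs_le_between in B1. apply Rabs_le_between in B2.
        assert (M <= psi x); [|unfold G; lra].
        assert (Hsq : (x j - p j) ^ 2 = d ^ 2) by (rewrite <- Hj; rewrite pow2_abs; reflexivity).
        pose proof (proj1 Hx i) as Hxi. apply Rabs_le_between in Hxi.
        assert (0 <= (x i - p i) * (d - (x i - p i))) by (apply Rmult_le_pos; lra).
        assert (HN : 0 <= N) by (unfold N; pose proof (pow2_ge_0 k); nra).
        assert (HA : A * d ^ 2 = M) by (unfold A; field; lra).
        assert (0 < A) by (unfold A; apply Rdiv_lt_0_compat; [lra | apply pow_lt, Hd]).
        assert (0 <= K) by (unfold K; assert (0 <= 3 * M / d ^ 2) by (apply Rdiv_le_0_compat; [lra | apply pow_lt, Hd]); lra).
        assert (d ^ 2 <= sum3 (fun j => (x j - p j) ^ 2)).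
        { unfold sum3. pose proof (pow2_ge_0 (x X1 - p X1)). pose proof (pow2_ge_0 (x X2 - p X2)).
          pose proof (pow2_ge_0 (x X3 - p X3)). destruct j; lra. }
        unfold psi, barrier. nra.
      + right. assert (E : x i = p i) by (destruct Hx; lra).
        assert (Ef : flip c sg x = x).
        { apply functional_extensionality. intros j. unfold flip, c, sg.
          destruct (axis_eq_dec i j) as [<-|]; [rewrite E|]; ring. }
        unfold G. rewrite Ef.
        replace (1 * u x + -1 * u x) with 0 by ring.
        assert (0 <= psi x); [|lra].
        unfold psi, barrier. rewrite E, Rminus_diag.
        assert (0 < A) by (unfold A; apply Rdiv_lt_0_compat; [lra | apply pow_lt, Hd]).
        assert (0 <= sum3 (fun j => (x j - p j) ^ 2)).
        { unfold sum3. pose proof (pow2_ge_0 (x X1 - p X1)). pose proof (pow2_ge_0 (x X2 - p X2)).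
          pose proof (pow2_ge_0 (x X3 - p X3)). lra. }
        nra. }
  set (x := line p (basis i) s).
  assert (Kx : Kc x).
  { split.
    - intros j. unfold x, line. replace (p j + s * basis i j - p j) with (s * basis i j) by ring.
      rewrite Rabs_mult, (Rabs_pos_eq s) by lra. pose proof (basis_le i j).
      pose proof (Rabs_pos (basis i j)). nra.
    - unfold x, line. rewrite basis_eq. lra. }
  specialize (Hmin x Kx).
  assert (Ef : flip c sg x = line p (basis i) (- s)).
  { apply functional_extensionality. intros j. unfold x, flip, c, sg, line.
    destruct (axis_eq_dec i j) as [<-|Hne]; [rewrite basis_eq | rewrite basis_neq by exact Hne]; ring. }
  unfold G in Hmin. rewrite Ef in Hmin.
  assert (Hps : psi x = A * s ^ 2 + K * (s * (d - s))).
  { unfold psi, barrier, x, line, sum3. destruct i; unfold basis; simpl; ring. }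
  rewrite Hps in Hmin. fold N.
  assert (HA : A * s ^ 2 + K * (s * (d - s)) =
    s * (3 * M / d + N * d / 2) - s ^ 2 * (2 * M / d ^ 2 + N / 2)) by (unfold A, K; field; lra).
  assert (0 <= 2 * M / d ^ 2 + N / 2).
  { assert (0 <= 2 * M / d ^ 2) by (apply Rdiv_le_0_compat; [lra | apply pow_lt, Hd]).
    assert (0 <= N) by (unfold N; pose proof (pow2_ge_0 k); nra). lra. }
  pose proof (pow2_ge_0 s). nra.
Qed.

Lemma difference_estimate k (O : point -> Prop) u p i d M s :
  open_set O -> helm_on k O u -> 0 < d <= 1 -> 0 < M ->
  (forall q, cube p d q -> O q) -> (forall q, cube p d q -> Rabs (u q) <= M) ->
  0 <= s <= d ->
  Rabs (u (line p (basis i) s) - u (line p (basis i) (- s))) <= 2 * s * ((4 + k ^ 2) / d * M).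
Proof.
  intros HO Hu Hd HM HcO HuM Hs.
  assert (Hm : helm_on k O (fun q => (-1) * u q + 0 * u q)) by (apply helm_lin; assumption).
  assert (HmM : forall q, cube p d q -> Rabs ((-1) * u q + 0 * u q) <= M).
  { intros q Hq. replace (-1 * u q + 0 * u q) with (- u q) by ring. rewrite Rabs_Ropp. apply HuM, Hq. }
  pose proof (difference_estimate_signed k O u p i d M s HO Hu (proj1 Hd) HM HcO HuM Hs) as H1.
  pose proof (difference_estimate_signed k O _ p i d M s HO Hm (proj1 Hd) HM HcO HmM Hs) as H2.
  assert (HC : 3 * M / d + (k ^ 2 + 1) * M * d / 2 <= (4 + k ^ 2) / d * M).
  { apply Rmult_le_reg_r with d; [lra|].
    replace ((3 * M / d + (k ^ 2 + 1) * M * d / 2) * d) with (3 * M + (k ^ 2 + 1) * M / 2 * d ^ 2) by (field; lra).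
    replace ((4 + k ^ 2) / d * M * d) with ((4 + k ^ 2) * M) by (field; lra).
    assert (0 <= (k ^ 2 + 1) * M) by (pose proof (pow2_ge_0 k); nra).
    assert (d ^ 2 <= 1) by nra. nra. }
  assert (2 * s * (3 * M / d + (k ^ 2 + 1) * M * d / 2) <= 2 * s * ((4 + k ^ 2) / d * M)).
  { apply Rmult_le_compat_l; lra. }
  cbv beta in H2.
  apply Rabs_le_between. lra.
Qed.

(** * Unique continuation along lines *)

(* The coefficients are those of [helm_lin]. *)
Definition fdiff (e : point) (h : R) (u : point -> R) : point -> R :=
  fun x => 1 * u (line x e h) + (-1) * u x.

Fixpoint fdiffs (e : point) (h : R) (m : nat) (u : point -> R) : point -> R :=
  match m with O => u | S m => fdiff e h (fdiffs e h m u) end.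

(** An increment over a step of length [a] is a symmetric difference about the midpoint, so the cube
    of the estimate is centred there. *)
Lemma coordinate_step k p r u M d i a y :
  helm_on k (near p r) u -> (forall q, near p r q -> Rabs (u q) <= M) -> 0 < M ->
  0 < d <= 1 -> Rabs a <= d -> near p (r - d) (line y (basis i) (a / 2)) ->
  Rabs (u (line y (basis i) a) - u y) <= Rabs a * ((4 + k ^ 2) / d * M).
Proof.
  intros Hu HM HM0 Hd Ha Hy.
  set (z := line y (basis i) (a / 2)) in *.
  assert (Hz : forall q, cube z d q -> near p r q).
  { intros q Hq j. specialize (Hq j). specialize (Hy j).
    replace (q j - p j) with ((q j - z j) + (z j - p j)) by ring.
    eapply Rle_lt_trans; [apply Rabs_triang|]. lra. }
  assert (E1 : line z (basis i) (a / 2) = line y (basis i) a).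
  { unfold z. rewrite line_line. f_equal. field. }
  assert (E2 : line z (basis i) (- (a / 2)) = y).
  { unfold z. rewrite line_line. replace (a / 2 + - (a / 2)) with 0 by ring. apply line_0. }
  pose proof (difference_estimate k (near p r) u z i d M (Rabs a / 2) (near_open p r) Hu Hd HM0 Hz
    (fun q Hq => HM q (Hz q Hq))) as H.
  assert (H' : 0 <= Rabs a / 2 <= d) by (pose proof (Rabs_pos a); lra).
  specialize (H H').
  replace (2 * (Rabs a / 2)) with (Rabs a) in H by field.
  destruct (Rle_dec 0 a) as [Hp|Hn].
  - rewrite (Rabs_pos_eq a) in H at 1 2 by exact Hp. rewrite E1, E2 in H. exact H.
  - rewrite (Rabs_left a) in H at 1 2 by lra.
    replace (- a / 2) with (- (a / 2)) in H by field. rewrite Ropp_involutive, E1, E2 in H.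
    rewrite Rabs_minus_sym. exact H.
Qed.

(** A step [h * e] is split into three axis-parallel steps, hence the factor 3. The margin [2 * d]
    pays for the cube of the estimate, of radius [d], and for the displacement [h <= d]. *)
Lemma fdiff_bound k p r u M d e h :
  helm_on k (near p r) u -> (forall q, near p r q -> Rabs (u q) <= M) -> 0 < M ->
  0 < d <= 1 -> 0 < h <= d -> (forall i, Rabs (e i) <= 1) ->
  helm_on k (near p (r - 2 * d)) (fdiff e h u) /\
  forall q, near p (r - 2 * d) q -> Rabs (fdiff e h u q) <= 3 * (4 + k ^ 2) * h / d * M.
Proof.
  intros Hu HM HM0 Hd Hh He.
  assert (Hhe : forall i, Rabs (h * e i) <= h).
  { intros i. rewrite Rabs_mult, (Rabs_pos_eq h) by lra. specialize (He i).
    pose proof (Rmult_le_compat_l h _ _ (Rlt_le _ _ (proj1 Hh)) He). lra. }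
  split.
  - unfold fdiff. apply helm_lin.
    + apply near_open.
    + apply helm_on_sub with (O := fun x => near p r (line x e h)).
      * intros x Hx i. specialize (Hx i). specialize (Hhe i). unfold line.
        replace (x i + h * e i - p i) with ((x i - p i) + h * e i) by ring.
        eapply Rle_lt_trans; [apply Rabs_triang|]. lra.
      * apply helm_translate; [apply near_open | exact Hu].
    + apply helm_on_sub with (2 := Hu). intros x Hx. apply near_le with (2 := Hx). lra.
  - intros x Hx.
    set (y1 := line x (basis X1) (h * e X1)).
    set (y2 := line y1 (basis X2) (h * e X2)).
    assert (E : line x e h = line y2 (basis X3) (h * e X3)).
    { apply functional_extensionality. intros i. unfold y2, y1, line.
      destruct i; unfold basis; simpl; ring. }
    assert (Hstep : forall i y, (forall j, Rabs (y j - x j) <= h) -> y i = x i ->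
      Rabs (u (line y (basis i) (h * e i)) - u y) <= h * ((4 + k ^ 2) / d * M)).
    { intros i y Hy Hyi.
      assert (HC : 0 <= (4 + k ^ 2) / d * M).
      { apply Rmult_le_pos; [|lra]. apply Rdiv_le_0_compat; [|lra]. pose proof (pow2_ge_0 k); lra. }
      apply Rle_trans with (Rabs (h * e i) * ((4 + k ^ 2) / d * M)).
      2: { apply Rmult_le_compat_r; [exact HC | apply Hhe]. }
      apply (coordinate_step k p r u M d i (h * e i) y Hu HM HM0 Hd).
      - specialize (Hhe i). lra.
      - intros j. specialize (Hx j). unfold line.
        assert (Rabs (y j + h * e i / 2 * basis i j - x j) <= h).
        { destruct (axis_eq_dec i j) as [<-|Hne].
          - rewrite basis_eq, Hyi. replace (x i + h * e i / 2 * 1 - x i) with (h * e i / 2) by ring.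
            unfold Rdiv. rewrite Rabs_mult, (Rabs_pos_eq (/ 2)) by lra.
            specialize (Hhe i). pose proof (Rabs_pos (h * e i)). lra.
          - rewrite basis_neq by exact Hne. replace (y j + h * e i / 2 * 0 - x j) with (y j - x j) by ring.
            apply Hy. }
        replace (y j + h * e i / 2 * basis i j - p j)
          with ((y j + h * e i / 2 * basis i j - x j) + (x j - p j)) by ring.
        eapply Rle_lt_trans; [apply Rabs_triang|]. lra. }
    assert (S1 := Hstep X1 x). assert (S2 := Hstep X2 y1). assert (S3 := Hstep X3 y2).
    fold y1 in S1. fold y2 in S2. rewrite <- E in S3.
    assert (H0 : forall j, Rabs (x j - x j) <= h) by (intros j; rewrite Rminus_diag, Rabs_R0; lra).
    assert (H1 : forall j, Rabs (y1 j - x j) <= h).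
    { intros j. unfold y1, line.
      destruct j; unfold basis; simpl;
      [ replace (x X1 + h * e X1 * 1 - x X1) with (h * e X1) by ring; apply Hhe
      | replace (x X2 + h * e X1 * 0 - x X2) with 0 by ring; rewrite Rabs_R0; lra
      | replace (x X3 + h * e X1 * 0 - x X3) with 0 by ring; rewrite Rabs_R0; lra ]. }
    assert (H2 : forall j, Rabs (y2 j - x j) <= h).
    { intros j. unfold y2, y1, line.
      destruct j; unfold basis; simpl;
      [ replace (x X1 + h * e X1 * 1 + h * e X2 * 0 - x X1) with (h * e X1) by ring; apply Hhe
      | replace (x X2 + h * e X1 * 0 + h * e X2 * 1 - x X2) with (h * e X2) by ring; apply Hhe
      | replace (x X3 + h * e X1 * 0 + h * e X2 * 0 - x X3) with 0 by ring; rewrite Rabs_R0; lra ]. }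
    specialize (S1 H0 eq_refl). specialize (S2 H1). specialize (S3 H2).
    assert (E2 : y1 X2 = x X2) by (unfold y1, line, basis; simpl; ring).
    assert (E3 : y2 X3 = x X3) by (unfold y2, y1, line, basis; simpl; ring).
    specialize (S2 E2). specialize (S3 E3).
    unfold fdiff.
    replace (1 * u (line x e h) + -1 * u x) with
      ((u (line x e h) - u y2) + ((u y2 - u y1) + (u y1 - u x))) by ring.
    replace (3 * (4 + k ^ 2) * h / d * M) with
      (h * ((4 + k ^ 2) / d * M) + (h * ((4 + k ^ 2) / d * M) + h * ((4 + k ^ 2) / d * M))) by (field; lra).
    eapply Rle_trans; [apply Rabs_triang|]. apply Rplus_le_compat; [exact S3|].
    eapply Rle_trans; [apply Rabs_triang|]. apply Rplus_le_compat; assumption.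
Qed.

Lemma fdiffs_bound k p r u M d e h m :
  helm_on k (near p r) u -> (forall q, near p r q -> Rabs (u q) <= M) -> 0 < M ->
  0 < d <= 1 -> 0 < h <= d -> (forall i, Rabs (e i) <= 1) ->
  helm_on k (near p (r - 2 * d * INR m)) (fdiffs e h m u) /\
  forall q, near p (r - 2 * d * INR m) q ->
    Rabs (fdiffs e h m u q) <= (3 * (4 + k ^ 2) * h / d) ^ m * M.
Proof.
  intros Hu HM HM0 Hd Hh He.
  assert (HC : 0 < 3 * (4 + k ^ 2) * h / d).
  { apply Rdiv_lt_0_compat; [|lra]. pose proof (pow2_ge_0 k). apply Rmult_lt_0_compat; lra. }
  induction m as [|m [IH1 IH2]].
  - simpl. rewrite Rmult_0_r, Rminus_0_r. split; [exact Hu|]. intros q Hq. rewrite Rmult_1_l. apply HM, Hq.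
  - simpl fdiffs.
    replace (r - 2 * d * INR (S m)) with ((r - 2 * d * INR m) - 2 * d) by (rewrite S_INR; ring).
    replace ((3 * (4 + k ^ 2) * h / d) ^ S m * M) with
      (3 * (4 + k ^ 2) * h / d * ((3 * (4 + k ^ 2) * h / d) ^ m * M)) by (simpl; ring).
    apply fdiff_bound; try assumption.
    apply Rmult_lt_0_compat; [apply pow_lt, HC | exact HM0].
Qed.

(* Newton's forward-difference expansion, as a growth estimate. *)
Lemma newton_growth (a : nat -> nat -> R) (m : nat) (eps : R) :
  0 <= eps ->
  (forall i l, a (S i) l = 1 * a i (S l) + (-1) * a i l) ->
  (forall l, (l < m)%nat -> a O l = 0) ->
  (forall l, (l <= m)%nat -> Rabs (a m l) <= eps) ->
  Rabs (a O (2 * m)%nat) <= eps * 4 ^ m.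
Proof.
  intros He Hrec Hz Hm.
  assert (Z : forall i l, (i + l < m)%nat -> a i l = 0).
  { induction i; intros l Hl; [apply Hz; lia|]. rewrite Hrec, !IHi by lia. ring. }
  assert (G : forall l i, (i <= m)%nat -> (i + l <= 2 * m)%nat -> Rabs (a i l) <= eps * 2 ^ l).
  { induction l; intros i Hi Hl.
    - simpl. rewrite Rmult_1_r. destruct (Nat.eq_dec i m) as [->|Hne].
      + apply Hm. lia.
      + rewrite Z by lia. rewrite Rabs_R0. exact He.
    - destruct (Nat.eq_dec i m) as [->|Hne].
      + apply Rle_trans with eps; [apply Hm; lia|].
        pose proof (pow_R1_Rle 2 (S l)). assert (1 <= 2 ^ S l) by (apply H; lra). nra.
      + replace (a i (S l)) with (a (S i) l + a i l) by (rewrite Hrec; ring).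
        eapply Rle_trans; [apply Rabs_triang|].
        assert (H1 : Rabs (a (S i) l) <= eps * 2 ^ l) by (apply IHl; lia).
        assert (H2 : Rabs (a i l) <= eps * 2 ^ l) by (apply IHl; lia).
        simpl. lra. }
  replace (4 ^ m) with (2 ^ (2 * m)) by (rewrite pow_mult; f_equal; ring).
  apply G; lia.
Qed.

Lemma geometric_vanish (q M x : R) :
  0 <= q < 1 -> (forall m, (0 < m)%nat -> Rabs x <= q ^ m * M) -> x = 0.
Proof.
  intros Hq H. apply NNPP. intros Hx.
  assert (Hx' : 0 < Rabs x) by (apply Rabs_pos_lt, Hx).
  destruct (Rle_lt_dec M 0) as [HM|HM].
  - specialize (H 1%nat (le_n _)). rewrite pow_1 in H. nra.
  - destruct (pow_lt_1_zero q) with (y := Rabs x / M) as [N HN].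
    + rewrite Rabs_pos_eq; lra.
    + apply Rdiv_lt_0_compat; assumption.
    + specialize (HN (S N)). specialize (H (S N)).
      rewrite Rabs_pos_eq in HN by (apply pow_le; lra).
      assert (H1 : q ^ S N < Rabs x / M) by (apply HN; lia).
      apply Rmult_lt_compat_r with (r := M) in H1; [|exact HM].
      replace (Rabs x / M * M) with (Rabs x) in H1 by (field; lra).
      assert (Rabs x <= q ^ S N * M) by (apply H; lia). lra.
Qed.

(* The [m]-th differences with step [l / (2 m)] are [O(q ^ m)] with a small [q], because each of them costs one interior
   estimate at scale [r / (4 m)]; this replaces real analyticity. *)
Lemma continuation_local k p r u M e l :
  helm_on k (near p r) u -> (forall q, near p r q -> Rabs (u q) <= M) -> 0 < M ->
  0 < r <= 1 -> (forall i, Rabs (e i) <= 1) -> 0 < l < r / 2 ->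
  24 * (4 + k ^ 2) * l < r ->
  (forall s, 0 <= s < l / 2 -> u (line p e s) = 0) ->
  u (line p e l) = 0.
Proof.
  intros Hu HM HM0 Hr He Hl Hl2 Hz.
  set (C := 3 * (4 + k ^ 2)). assert (HC : 0 < C) by (unfold C; pose proof (pow2_ge_0 k); lra).
  (* Each difference contributes [C * h / d = 2 * C * l / r] and [newton_growth] a factor 4. The
     hypothesis [24 * (4 + k ^ 2) * l < r] says precisely that the resulting ratio is below 1. *)
  apply geometric_vanish with (q := 8 * C * l / r) (M := M).
  { split.
    - apply Rdiv_le_0_compat; [|lra]. apply Rmult_le_pos; lra.
    - apply Rmult_lt_reg_r with r; [lra|].
      replace (8 * C * l / r * r) with (8 * C * l) by (field; lra). unfold C. lra. }
  intros m Hm. assert (Hm' : 0 < INR m) by (apply lt_0_INR, Hm).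
  assert (Hm1 : 1 <= INR m) by (apply (le_INR 1), Hm).
  (* The [m] differences use up [2 * d * m = r / 2] of the radius, and [h / d = 2 * l / r] does not
     depend on [m]. The first [m] of the [2 * m] steps cover [[0, l / 2)], where [u] is known to
     vanish. *)
  set (h := l / (2 * INR m)). set (d := r / (4 * INR m)).
  assert (Hh : 0 < h) by (apply Rdiv_lt_0_compat; lra).
  assert (Hd : 0 < d) by (apply Rdiv_lt_0_compat; lra).
  assert (Ed : d * (4 * INR m) = r) by (unfold d; field; lra).
  assert (Eh : h * (2 * INR m) = l) by (unfold h; field; lra).
  assert (Hd1 : d <= 1) by nra.
  assert (Hhd : h <= d) by nra.
  destruct (fdiffs_bound k p r u M d e h m Hu HM HM0 (conj Hd Hd1) (conj Hh Hhd) He) as [_ HB].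
  fold C in HB.
  assert (Hpos : 0 <= C * h / d) by (apply Rdiv_le_0_compat; [apply Rmult_le_pos; lra | lra]).
  replace ((8 * C * l / r) ^ m * M) with ((C * h / d) ^ m * M * 4 ^ m).
  2: { replace (8 * C * l / r) with (C * h / d * 4) by (unfold h, d; field; lra).
       rewrite Rpow_mult_distr. ring. }
  replace (line p e l) with (line p e (INR (2 * m) * h)).
  2: { f_equal. rewrite mult_INR. simpl INR. lra. }
  apply (newton_growth (fun i j => fdiffs e h i u (line p e (INR j * h)))).
  - apply Rmult_le_pos; [apply pow_le, Hpos | lra].
  - intros i j. change (fdiffs e h (S i) u) with (fdiff e h (fdiffs e h i u)). unfold fdiff at 1.
    rewrite line_line, S_INR. do 4 f_equal. ring.
  - intros j Hj. apply Hz. apply lt_INR in Hj. pose proof (pos_INR j). split; nra.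
  - intros j Hj. apply HB. intros i. unfold line.
    replace (p i + INR j * h * e i - p i) with (INR j * h * e i) by ring.
    apply le_INR in Hj. pose proof (pos_INR j). specialize (He i).
    rewrite Rabs_mult, Rabs_pos_eq by (apply Rmult_le_pos; lra).
    assert (INR j * h <= l / 2) by nra. pose proof (Rabs_pos (e i)).
    assert (0 <= INR j * h) by (apply Rmult_le_pos; lra). nra.
Qed.

(** Continuity method: let [m] be the supremum of the lengths of initial intervals of zeros.
    Starting [continuation_local] slightly before [m] pushes the zeros past [m], which forces
    [m = S]. *)
Lemma continuation_unit k O u p e S a :
  open_set O -> helm_on k O u -> (forall i, Rabs (e i) <= 1) -> 0 < a ->
  (forall s, 0 <= s <= S -> O (line p e s)) ->
  (forall s, 0 <= s <= S -> s < a -> u (line p e s) = 0) ->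
  forall s, 0 <= s <= S -> u (line p e s) = 0.
Proof.
  intros HO Hu He Ha HS Hz s0 Hs0. apply NNPP. intros Hne.
  set (E := fun t => 0 <= t <= S /\ forall s, 0 <= s < t -> u (line p e s) = 0).
  assert (HE0 : E 0) by (split; [lra | intros s Hs; lra]).
  destruct (completeness E) as [m [Hm1 Hm2]].
  { exists S. intros t Ht. apply Ht. }
  { exists 0. exact HE0. }
  assert (Hm0 : 0 <= m) by (apply Hm1, HE0).
  assert (HmS : m <= S) by (apply Hm2; intros t Ht; apply Ht).
  assert (Hma : Rmin a S <= m).
  { apply Hm1. split; [split; [apply Rmin_glb; lra | apply Rmin_r]|].
    intros s Hs. pose proof (Rmin_l a S); pose proof (Rmin_r a S). apply Hz; lra. }
  assert (Hmz : forall s, 0 <= s < m -> u (line p e s) = 0).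
  { intros s Hs. apply NNPP. intros Hns.
    assert (m <= s); [|lra]. apply Hm2. intros t [Ht1 Ht2]. apply Rnot_lt_le. intros Hlt.
    apply Hns, Ht2. lra. }
  destruct (Req_dec S 0) as [->|HS0].
  { apply Hne. apply Hz; lra. }
  assert (Hmpos : 0 < m) by (pose proof (Rmin_glb_lt a S 0 Ha); lra).
  set (P := line p e m).
  destruct (HO P (HS m (conj Hm0 HmS))) as [r [Hr Hr']].
  destruct (cube_bounded P (r / 2)) as [B HB].
  destruct (continuous_bounded (cube P (r / 2)) u B HB (cube_closed _ _)) as [M [HM HMb]].
  { intros q Hq. apply c2_cont, Hu, Hr'. apply cube_near with (2 := Hq). lra. }
  set (q := Rmin 1 (r / 4)).
  assert (Hq : 0 < q) by (apply Rmin_glb_lt; lra).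
  assert (Hq1 : q <= 1) by apply Rmin_l. assert (Hq2 : q <= r / 4) by apply Rmin_r.
  set (C := 24 * (4 + k ^ 2)). assert (HC : 0 < C) by (unfold C; pose proof (pow2_ge_0 k); lra).
  assert (HC1 : 1 <= C) by (unfold C; pose proof (pow2_ge_0 k); lra).
  (* From the starting point at [m - tau] the target is at distance [l < 2 * tau], so the required
     zeros on [[0, l / 2)] lie before [m]. The bound [q / (8 * C)] makes [C * l < q] and
     [l < q / 2]. *)
  set (tau := Rmin m (q / (8 * C))).
  assert (Htau : 0 < tau) by (apply Rmin_glb_lt; [lra | apply Rdiv_lt_0_compat; lra]).
  assert (Htm : tau <= m) by apply Rmin_l.
  assert (Htq : 8 * C * tau <= q).
  { assert (tau <= q / (8 * C)) by apply Rmin_r.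
    apply Rmult_le_compat_l with (r := 8 * C) in H; [|lra].
    replace (8 * C * (q / (8 * C))) with q in H by (field; lra). exact H. }
  assert (Hext : forall t, 0 <= t < m + tau -> u (line p e t) = 0).
  { intros t Ht. destruct (Rlt_dec t m) as [Hlt|Hge]; [apply Hmz; lra|].
    set (Q := line p e (m - tau)).
    replace (line p e t) with (line Q e (t - (m - tau))).
    2: { unfold Q. rewrite line_line. f_equal. ring. }
    assert (HQ : forall y, near Q q y -> near P (r / 2) y).
    { intros y Hy i. specialize (Hy i). specialize (He i). unfold P, Q, line in *.
      replace (y i - (p i + m * e i)) with ((y i - (p i + (m - tau) * e i)) + - tau * e i) by ring.
      eapply Rle_lt_trans; [apply Rabs_triang|]. rewrite Rabs_mult, Rabs_Ropp, (Rabs_pos_eq tau) by lra.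
      pose proof (Rabs_pos (e i)). nra. }
    apply (continuation_local k Q q u M); try assumption.
    - apply helm_on_sub with (2 := Hu). intros y Hy. apply Hr'. apply near_le with (2 := HQ y Hy). lra.
    - intros y Hy. apply HMb, near_cube, HQ, Hy.
    - lra.
    - split; [lra|]. nra.
    - fold C. nra.
    - intros s Hs. unfold Q. rewrite line_line. apply Hmz. lra. }
  assert (HEm : E (Rmin S (m + tau / 2))).
  { split; [split; [apply Rmin_glb; lra | apply Rmin_l]|].
    intros s Hs. pose proof (Rmin_r S (m + tau / 2)). apply Hext. lra. }
  apply Hm1 in HEm.
  assert (HSm : S = m).
  { apply Rle_antisym; [|exact HmS]. apply Rnot_lt_le. intros Hlt.
    assert (m < Rmin S (m + tau / 2)) by (apply Rmin_glb_lt; lra). lra. }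
  apply Hne, Hext. lra.
Qed.

Lemma continuation_line k O u p e a :
  open_set O -> helm_on k O u -> 0 < a ->
  (forall s, 0 <= s <= 1 -> O (line p e s)) ->
  (forall s, 0 <= s <= 1 -> s < a -> u (line p e s) = 0) ->
  forall s, 0 <= s <= 1 -> u (line p e s) = 0.
Proof.
  intros HO Hu Ha HS Hz s Hs.
  destruct (point_bound e) as [E [HE He]].
  set (e' := fun i => e i / E).
  assert (L : forall t, line p e t = line p e' (E * t)).
  { intros t. apply functional_extensionality. intros i. unfold line, e'. field. lra. }
  rewrite L.
  assert (L2 : forall t, 0 <= t <= E -> 0 <= t / E <= 1 /\ line p e' t = line p e (t / E)).
  { intros t Ht. split.
    - split; [apply Rdiv_le_0_compat; lra|]. apply Rmult_le_reg_r with E; [lra|].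
      replace (t / E * E) with t by (field; lra). lra.
    - rewrite L. f_equal. field. lra. }
  apply (continuation_unit k O u p e' E (E * a)); try assumption.
  - intros i. unfold e'. unfold Rdiv. rewrite Rabs_mult, (Rabs_pos_eq (/ E)).
    + apply Rmult_le_reg_r with E; [lra|]. rewrite Rmult_assoc, Rinv_l, Rmult_1_r, Rmult_1_l by lra. apply He.
    + apply Rlt_le, Rinv_0_lt_compat, HE.
  - apply Rmult_lt_0_compat; assumption.
  - intros t Ht. destruct (L2 t Ht) as [H1 ->]. apply HS, H1.
  - intros t Ht Hta. destruct (L2 t Ht) as [H1 ->]. apply Hz; [exact H1|].
    apply Rmult_lt_reg_r with E; [lra|]. replace (t / E * E) with t by (field; lra). lra.
  - split; [apply Rmult_le_pos; lra|]. nra.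
Qed.

Definition zero_near (u : point -> R) (p : point) : Prop :=
  exists r, 0 < r /\ forall q, near p r q -> u q = 0.

Lemma zero_near_at u p : zero_near u p -> u p = 0.
Proof. intros [r [Hr H]]. apply H, near_refl, Hr. Qed.

(** Each point near the far end is the end of a translate of the segment that starts inside the
    known zero set, and the tube keeps all these translates in [O]. A neighbourhood of zeros is thus
    transported, not merely one zero. *)
Lemma continuation_segment k O u p e :
  open_set O -> helm_on k O u -> (forall s, 0 <= s <= 1 -> O (line p e s)) ->
  zero_near u p -> zero_near u (line p e 1).
Proof.
  intros HO Hu HS [r [Hr Hz]].
  destruct (segment_tube O p e HO HS) as [t [Ht Htube]].
  exists (Rmin (r / 2) t). split; [apply Rmin_glb_lt; lra|].
  intros q Hq.
  set (q0 := line q e (-1)).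
  assert (Hq0 : near p (Rmin (r / 2) t) q0).
  { intros i. specialize (Hq i). unfold q0, line in *.
    replace (q i + -1 * e i - p i) with (q i - (p i + 1 * e i)) by ring. exact Hq. }
  replace q with (line q0 e 1).
  2: { unfold q0. rewrite line_line. replace (-1 + 1) with 0 by ring. apply line_0. }
  destruct (point_bound e) as [E [HE He]].
  apply (continuation_line k O u q0 e (r / (2 * E))); try assumption; try lra.
  - apply Rdiv_lt_0_compat; lra.
  - intros s Hs. apply (Htube s); [exact Hs|]. intros i. specialize (Hq0 i). unfold line.
    replace (q0 i + s * e i - (p i + s * e i)) with (q0 i - p i) by ring.
    pose proof (Rmin_r (r / 2) t). lra.
  - intros s Hs Hsr. apply Hz. intros i. specialize (Hq0 i). specialize (He i). unfold line.
    replace (q0 i + s * e i - p i) with ((q0 i - p i) + s * e i) by ring.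
    eapply Rle_lt_trans; [apply Rabs_triang|]. rewrite Rabs_mult, (Rabs_pos_eq s) by lra.
    pose proof (Rmin_l (r / 2) t).
    assert (s * E < r / 2).
    { apply Rmult_lt_compat_r with (r := E) in Hsr; [|lra].
      replace (r / (2 * E) * E) with (r / 2) in Hsr by (field; lra). exact Hsr. }
    assert (s * Rabs (e i) <= s * E) by (apply Rmult_le_compat_l; lra). lra.
Qed.

(** * Regularity *)

Lemma line_near p r e q t : near p r q -> (forall i, Rabs (e i) <= 1) -> near p (r + Rabs t) (line q e t).
Proof.
  intros Hq He i. unfold line. replace (q i + t * e i - p i) with ((q i - p i) + t * e i) by ring.
  eapply Rle_lt_trans; [apply Rabs_triang|]. rewrite Rabs_mult. specialize (Hq i). specialize (He i).
  pose proof (Rmult_le_compat_l _ _ _ (Rabs_pos t) He). lra.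
Qed.

Lemma uniform_continuous (K : point -> Prop) (g : point -> R) (B : R) :
  (forall p, K p -> forall i, Rabs (p i) <= B) -> closed_set K ->
  (forall p, K p -> continuous g p) ->
  forall eps, 0 < eps -> exists d, 0 < d /\
    forall x y, K x -> near x d y -> Rabs (g y - g x) < eps.
Proof.
  intros HB HK Hg eps He. apply NNPP. intros Hn.
  destruct (compact_cluster (fun n x => K x /\ exists y, near x (/ (INR n + 1)) y /\ eps <= Rabs (g y - g x)) B)
    as [l Hl].
  { intros n. apply NNPP. intros Hm. apply Hn. exists (/ (INR n + 1)). split.
    - apply Rinv_0_lt_compat. pose proof (pos_INR n). lra.
    - intros x y Kx Hy. apply Rnot_le_lt. intros Hle. apply Hm. exists x. split; [|apply HB, Kx].
      split; [exact Kx|]. exists y; split; assumption. }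
  assert (Kl : K l).
  { apply HK. intros d Hd. destruct (Hl d O Hd) as [n [x [_ [[Kx _] Hx]]]]. exists x; auto. }
  destruct (proj1 (continuous_near g l) (Hg l Kl) (eps / 2)) as [d [Hd Hq]]; [lra|].
  destruct (inv_INR_lt (d / 2)) as [N HN]; [lra|].
  destruct (Hl (d / 2) N) as [n [x [Hn' [[Kx [y [Hy Hxy]]] Hx]]]]; [lra|].
  specialize (HN n Hn').
  pose proof (Hq x (near_le l (d / 2) d x ltac:(lra) Hx)) as H1.
  assert (Hly : near l d y) by (apply near_le with (2 := near_trans _ _ _ _ _ Hx Hy); lra).
  pose proof (Hq y Hly) as H2. apply Rabs_lt_between in H1. apply Rabs_lt_between in H2.
  assert (Rabs (g y - g x) < eps); [|lra]. apply Rabs_lt_between. lra.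
Qed.

Lemma mvt_coordinate (u : point -> R) (O : point -> Prop) y i a :
  (forall x, O x -> is_deriv (basis i) u x (d1 i u x)) ->
  (forall c, Rabs c <= Rabs a -> O (line y (basis i) c)) ->
  exists c, Rabs c <= Rabs a /\ u (line y (basis i) a) - u y = a * d1 i u (line y (basis i) c).
Proof.
  intros Hu HO.
  destruct (MVT_gen (fun t => u (line y (basis i) t)) 0 a (fun t => d1 i u (line y (basis i) t))) as [c [Hc Ec]].
  - intros x Hx. apply is_deriv_shift, Hu, HO.
    unfold Rmin, Rmax in Hx. destruct (Rle_dec 0 a); split_Rabs; lra.
  - intros x Hx. apply continuity_pt_filterlim.
    refine (ex_derive_continuous _ _ _). eexists. apply is_deriv_shift, Hu, HO.
    unfold Rmin, Rmax in Hx. destruct (Rle_dec 0 a); split_Rabs; lra.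
  - exists c. split.
    + unfold Rmin, Rmax in Hc. destruct (Rle_dec 0 a); split_Rabs; lra.
    + cbv beta in Ec. rewrite line_0 in Ec. rewrite Ec. ring.
Qed.

Definition uniform_limit (O : point -> Prop) (f : nat -> point -> R) (g : point -> R) : Prop :=
  forall eps, 0 < eps -> exists N, forall n x, (N <= n)%nat -> O x -> Rabs (f n x - g x) <= eps.

Definition uniform_cauchy (O : point -> Prop) (f : nat -> point -> R) : Prop :=
  forall eps, 0 < eps -> exists N, forall n m x, (N <= n)%nat -> (N <= m)%nat -> O x ->
    Rabs (f n x - f m x) <= eps.

Lemma uniform_limit_cauchy O f g : uniform_limit O f g -> uniform_cauchy O f.
Proof.
  intros H eps He. destruct (H (eps / 2)) as [N HN]; [lra|]. exists N. intros n m x Hn Hm Hx.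
  pose proof (HN n x Hn Hx) as H1. pose proof (HN m x Hm Hx) as H2.
  apply Rabs_le_between in H1. apply Rabs_le_between in H2. apply Rabs_le_between. lra.
Qed.

Lemma uniform_cauchy_limit O f : uniform_cauchy O f -> exists g, uniform_limit O f g.
Proof.
  intros H.
  assert (Hl : forall x, exists l, O x -> Un_cv (fun n => f n x) l).
  { intros x. destruct (classic (O x)) as [Hx|Hx]; [|exists 0; contradiction].
    destruct (Stdlib.Reals.Rcomplete.R_complete (fun n => f n x)) as [l Hl]; [|exists l; auto].
    intros eps He. destruct (H (eps / 2)) as [N HN]; [lra|]. exists N. intros n m Hn Hm.
    unfold R_dist. specialize (HN n m x Hn Hm Hx). lra. }
  destruct (choice _ Hl) as [g Hg]. exists g. intros eps He.
  destruct (H (eps / 2)) as [N HN]; [lra|]. exists N. intros n x Hn Hx.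
  destruct (Hg x Hx (eps / 2)) as [N' HN']; [lra|].
  pose proof (HN n (Nat.max N N') x Hn ltac:(lia) Hx) as H1.
  pose proof (HN' (Nat.max N N') ltac:(lia)) as H2. unfold R_dist in H2.
  apply Rabs_le_between in H1. apply Rabs_lt_between in H2. apply Rabs_le_between. lra.
Qed.

Lemma uniform_limit_continuous O f g :
  open_set O -> uniform_limit O f g -> (forall n p, O p -> continuous (f n) p) ->
  forall p, O p -> continuous g p.
Proof.
  intros HO H Hc p Hp. apply continuous_near. intros eps He.
  destruct (H (eps / 4)) as [N HN]; [lra|].
  destruct (proj1 (continuous_near _ _) (Hc N p Hp) (eps / 4)) as [d [Hd Hq]]; [lra|].
  destruct (HO p Hp) as [r [Hr Hr']].
  exists (Rmin d r). split; [apply Rmin_glb_lt; assumption|]. intros q Hn.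
  pose proof (HN N p (le_n _) Hp) as H1.
  pose proof (HN N q (le_n _) (Hr' q (near_le _ _ _ _ (Rmin_r d r) Hn))) as H2.
  pose proof (Hq q (near_le _ _ _ _ (Rmin_l d r) Hn)) as H3.
  apply Rabs_le_between in H1. apply Rabs_le_between in H2. apply Rabs_lt_between in H3.
  apply Rabs_lt_between. lra.
Qed.

Lemma uniform_limit_deriv O i f g f' g' :
  open_set O -> uniform_limit O f g -> uniform_limit O f' g' ->
  (forall n p, O p -> is_deriv (basis i) (f n) p (f' n p)) ->
  forall p, O p -> is_deriv (basis i) g p (g' p).
Proof.
  intros HO Hf Hf' Hd p Hp. destruct (HO p Hp) as [r [Hr Hr']].
  assert (HL : forall t, Boule 0 (mkposreal r Hr) t -> O (line p (basis i) t)).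
  { intros t Ht. apply Hr', line_basis_near. unfold Boule in Ht. rewrite Rminus_0_r in Ht. exact Ht. }
  unfold is_deriv. apply is_derive_Reals. rewrite <- (line_0 p (basis i)) at 1.
  apply (CVU_derivable (fun n t => f n (line p (basis i) t)) (fun n t => f' n (line p (basis i) t))
    (fun t => g (line p (basis i) t)) (fun t => g' (line p (basis i) t)) 0 (mkposreal r Hr)).
  - intros eps He. destruct (Hf' (eps / 2)) as [N HN]; [lra|]. exists N. intros n y Hn Hy.
    rewrite Rabs_minus_sym. specialize (HN n _ Hn (HL y Hy)). lra.
  - intros y Hy eps He. destruct (Hf (eps / 2)) as [N HN]; [lra|]. exists N. intros n Hn.
    unfold R_dist. specialize (HN n _ Hn (HL y Hy)). lra.
  - intros n y Hy. apply is_derive_Reals, is_deriv_shift, Hd, HL, Hy.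
  - unfold Boule. rewrite Rminus_diag, Rabs_R0. exact Hr.
Qed.

Lemma is_deriv_bound i u p l c r :
  0 < r -> is_deriv (basis i) u p l ->
  (forall t, 0 < t < r -> Rabs (u (line p (basis i) t) - u p) <= t * c) -> Rabs l <= c.
Proof.
  intros Hr Hd Hb. apply Rnot_lt_le. intros Hlt.
  apply is_derive_Reals in Hd.
  destruct (Hd (Rabs l - c)) as [d Hdd]; [lra|].
  pose proof (cond_pos d) as Hd0.
  set (t := Rmin (d / 2) (r / 2)).
  assert (Ht : 0 < t) by (apply Rmin_glb_lt; lra).
  assert (Ht1 : t <= d / 2) by apply Rmin_l. assert (Ht2 : t <= r / 2) by apply Rmin_r.
  specialize (Hdd t ltac:(lra)). rewrite Rplus_0_l, line_0 in Hdd.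
  rewrite Rabs_pos_eq in Hdd by lra. specialize (Hdd ltac:(lra)).
  specialize (Hb t ltac:(lra)).
  assert (Hq : Rabs ((u (line p (basis i) t) - u p) / t) <= c).
  { unfold Rdiv. rewrite Rabs_mult, (Rabs_pos_eq (/ t)) by (apply Rlt_le, Rinv_0_lt_compat, Ht).
    apply Rmult_le_reg_r with t; [exact Ht|]. rewrite Rmult_assoc, Rinv_l, Rmult_1_r by lra. lra. }
  pose proof (Rabs_triang_inv l ((u (line p (basis i) t) - u p) / t)) as H1.
  rewrite Rabs_minus_sym in Hdd. lra.
Qed.

Lemma gradient_bound k p r u M d i y :
  helm_on k (near p r) u -> (forall q, near p r q -> Rabs (u q) <= M) -> 0 < M ->
  0 < d <= 1 -> near p (r - 2 * d) y -> Rabs (d1 i u y) <= (4 + k ^ 2) / d * M.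
Proof.
  intros Hu HM HM0 Hd Hy.
  apply (is_deriv_bound i u y _ _ d (proj1 Hd)).
  - apply c2_d1, Hu. apply near_le with (2 := Hy). lra.
  - intros t Ht. rewrite <- (Rabs_pos_eq t) at 2 by lra.
    apply (coordinate_step k p r); try assumption.
    + rewrite Rabs_pos_eq; lra.
    + apply near_le with (2 := line_near p (r - 2 * d) (basis i) y (t / 2) Hy (basis_le i)).
      rewrite Rabs_pos_eq; lra.
Qed.

(** The gradient bound is applied to the solution [fdiff (basis i) t u], whose size is proportional
    to [t] by [fdiff_bound]; dividing by [t] bounds the second derivative and explains the factor
    3. *)
Lemma second_bound k p r u M d i y :
  helm_on k (near p r) u -> (forall q, near p r q -> Rabs (u q) <= M) -> 0 < M ->
  0 < d <= 1 -> near p (r - 4 * d) y -> Rabs (d2 i u y) <= ((4 + k ^ 2) / d) ^ 2 * M * 3.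
Proof.
  intros Hu HM HM0 Hd Hy.
  apply (is_deriv_bound i (d1 i u) y _ _ d (proj1 Hd)).
  - apply c2_d2, Hu. apply near_le with (2 := Hy). lra.
  - intros t Ht.
    destruct (fdiff_bound k p r u M d (basis i) t Hu HM HM0 Hd) as [H1 H2]; [lra | apply basis_le |].
    assert (HC : 0 < (4 + k ^ 2) / d) by (apply Rdiv_lt_0_compat; [pose proof (pow2_ge_0 k) |]; lra).
    assert (HMt : 0 < 3 * (4 + k ^ 2) * t / d * M).
    { apply Rmult_lt_0_compat; [|lra]. apply Rdiv_lt_0_compat; [|lra].
      pose proof (pow2_ge_0 k). apply Rmult_lt_0_compat; lra. }
    pose proof (gradient_bound k p _ _ _ d i y H1 H2 HMt Hd) as H3.
    assert (E : d1 i (fdiff (basis i) t u) y = d1 i u (line y (basis i) t) - d1 i u y).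
    { unfold fdiff.
      set (O := fun x => near p r x /\ near p r (line x (basis i) t)).
      assert (HOy : O y).
      { split; [apply near_le with (2 := Hy); lra|].
        apply near_le with (2 := line_near p _ (basis i) y t Hy (basis_le i)). rewrite Rabs_pos_eq; lra. }
      apply is_deriv_unique. unfold is_deriv.
      replace (d1 i u (line y (basis i) t) - d1 i u y)
        with (1 * d1 i u (line y (basis i) t) + (-1) * d1 i u y) by ring.
      apply (is_derive_plus (fun s => 1 * u (line (line y (basis i) s) (basis i) t))
        (fun s => -1 * u (line y (basis i) s))); apply is_derive_scal.
      - apply is_derive_ext with (fun s => u (line (line y (basis i) t) (basis i) s)).
        + intros s. rewrite line_swap. reflexivity.
        + apply (c2_d1 u). apply Hu, HOy.
      - apply (c2_d1 u). apply Hu, HOy. }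
    rewrite E in H3.
    assert (Hn : near p (r - 2 * d - 2 * d) y) by (apply near_le with (2 := Hy); lra).
    specialize (H3 Hn). eapply Rle_trans; [exact H3|]. apply Req_le. field. lra.
Qed.

(** Differences of members of the sequence are again solutions, so the interior bounds turn uniform
    convergence of [f] into uniform convergence of the first and second derivatives on a smaller
    cube. *)
Lemma helm_uniform_limit k p r f u :
  0 < r <= 1 -> (forall n, helm_on k (near p r) (f n)) -> uniform_limit (near p r) f u ->
  helm_on k (near p (r / 2)) u.
Proof.
  intros Hr Hf Hu.
  (* [4 * d = r / 2] is the loss of radius in [second_bound]. *)
  set (d := r / 8).
  set (C := (4 + k ^ 2) / d).
  assert (Hd : 0 < d <= 1) by (unfold d; lra).
  assert (HC : 0 < C) by (apply Rdiv_lt_0_compat; [pose proof (pow2_ge_0 k) |]; lra).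
  assert (Hsub : forall x, near p (r / 2) x -> near p r x) by (intros x; apply near_le; lra).
  assert (Hdiff : forall n m, helm_on k (near p r) (fun x => 1 * f n x + (-1) * f m x)).
  { intros n m. apply helm_lin; [apply near_open | apply Hf | apply Hf]. }
  assert (Hlin : forall n m i x, near p r x ->
    d1 i (fun x => 1 * f n x + (-1) * f m x) x = d1 i (f n) x - d1 i (f m) x /\
    d2 i (fun x => 1 * f n x + (-1) * f m x) x = d2 i (f n) x - d2 i (f m) x).
  { intros n m i x Hx.
    destruct (c2_lin (near p r) (f n) (f m) 1 (-1) (near_open p r) (proj1 (Hf n)) (proj1 (Hf m))) as [_ [L1 L2]].
    rewrite L1, L2 by exact Hx. split; ring. }
  pose proof (uniform_limit_cauchy _ _ _ Hu) as Hca.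
  assert (Hsup : forall n m eps, (forall x, near p r x -> Rabs (f n x - f m x) <= eps) ->
    forall x, near p r x -> Rabs (1 * f n x + (-1) * f m x) <= eps).
  { intros n m eps H x Hx. replace (1 * f n x + -1 * f m x) with (f n x - f m x) by ring. apply H, Hx. }
  assert (C1 : forall i, uniform_cauchy (near p (r / 2)) (fun n => d1 i (f n))).
  { intros i eps He. destruct (Hca (eps / C)) as [N HN]; [apply Rdiv_lt_0_compat; assumption|].
    exists N. intros n m x Hn Hm Hx.
    rewrite <- (proj1 (Hlin n m i x (Hsub x Hx))).
    replace eps with (C * (eps / C)) by (field; lra).
    apply (gradient_bound k p r); try assumption; try apply Hdiff.
    - apply Hsup. intros y Hy. apply HN; assumption.
    - apply Rdiv_lt_0_compat; assumption.
    - apply near_le with (2 := Hx). unfold d. lra. }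
  assert (C2 : forall i, uniform_cauchy (near p (r / 2)) (fun n => d2 i (f n))).
  { intros i eps He.
    assert (HC3 : 0 < C ^ 2 * 3) by (apply Rmult_lt_0_compat; [apply pow_lt, HC | lra]).
    destruct (Hca (eps / (C ^ 2 * 3))) as [N HN]; [apply Rdiv_lt_0_compat; assumption|].
    exists N. intros n m x Hn Hm Hx.
    rewrite <- (proj2 (Hlin n m i x (Hsub x Hx))).
    replace eps with (C ^ 2 * (eps / (C ^ 2 * 3)) * 3) by (field; lra).
    apply (second_bound k p r); try assumption; try apply Hdiff.
    - apply Hsup. intros y Hy. apply HN; assumption.
    - apply Rdiv_lt_0_compat; assumption.
    - apply near_le with (2 := Hx). unfold d. lra. }
  destruct (choice _ (fun i => uniform_cauchy_limit _ _ (C1 i))) as [g Hg].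
  destruct (choice _ (fun i => uniform_cauchy_limit _ _ (C2 i))) as [h Hh].
  assert (Hu' : uniform_limit (near p (r / 2)) f u).
  { intros eps He. destruct (Hu eps He) as [N HN]. exists N. intros n x Hn Hx. apply HN; auto. }
  pose proof (near_open p (r / 2)) as HO.
  assert (gc : forall i x, near p (r / 2) x -> continuous (g i) x).
  { intros i. apply (uniform_limit_continuous _ _ _ HO (Hg i)).
    intros n x Hx. apply c2_cont1, (proj1 (Hf n)), Hsub, Hx. }
  assert (hc : forall i x, near p (r / 2) x -> continuous (h i) x).
  { intros i. apply (uniform_limit_continuous _ _ _ HO (Hh i)).
    intros n x Hx. apply c2_cont2, (proj1 (Hf n)), Hsub, Hx. }
  destruct (c2_intro (near p (r / 2)) u g h HO) as [H1 [_ H2]]; try assumption.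
  - apply (uniform_limit_continuous _ _ _ HO Hu').
    intros n x Hx. apply c2_cont, (proj1 (Hf n)), Hsub, Hx.
  - intros i. apply (uniform_limit_deriv _ i _ _ _ _ HO Hu' (Hg i)).
    intros n x Hx. apply c2_d1, (proj1 (Hf n)), Hsub, Hx.
  - intros i. apply (uniform_limit_deriv _ i _ _ _ _ HO (Hg i) (Hh i)).
    intros n x Hx. apply c2_d2, (proj1 (Hf n)), Hsub, Hx.
  - split; [exact H1|]. intros x Hx. unfold laplacian, sum3. rewrite !H2 by exact Hx.
    apply NNPP. intros Hne.
    set (T := h X1 x + h X2 x + h X3 x + k ^ 2 * u x) in *.
    assert (HT : 0 < Rabs T) by (apply Rabs_pos_lt, Hne).
    pose proof (pow2_ge_0 k) as Hk.
    set (eps := Rabs T / (2 * (4 + k ^ 2))).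
    assert (He : 0 < eps) by (apply Rdiv_lt_0_compat; lra).
    destruct (Hh X1 eps He) as [N1 HN1]. destruct (Hh X2 eps He) as [N2 HN2].
    destruct (Hh X3 eps He) as [N3 HN3]. destruct (Hu' eps He) as [N4 HN4].
    set (n := (N1 + N2 + N3 + N4)%nat).
    pose proof (HN1 n x ltac:(unfold n; lia) Hx) as K1. pose proof (HN2 n x ltac:(unfold n; lia) Hx) as K2.
    pose proof (HN3 n x ltac:(unfold n; lia) Hx) as K3. pose proof (HN4 n x ltac:(unfold n; lia) Hx) as K4.
    pose proof (proj2 (Hf n) x (Hsub x Hx)) as E. unfold laplacian, sum3 in E.
    apply Rabs_le_between in K1. apply Rabs_le_between in K2.
    apply Rabs_le_between in K3. apply Rabs_le_between in K4.
    assert (K5 : - (k ^ 2 * eps) <= k ^ 2 * (f n x - u x) <= k ^ 2 * eps) by nra.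
    assert (Rabs T <= (3 + k ^ 2) * eps).
    { apply Rabs_le_between. unfold T. lra. }
    assert (Rabs T = 2 * (4 + k ^ 2) * eps) by (unfold eps; field; lra). nra.
Qed.

Lemma helm_on_local k (O : point -> Prop) u :
  (forall p, O p -> exists r, 0 < r /\ helm_on k (near p r) u) -> helm_on k O u.
Proof.
  intros H. split; intros p Hp; destruct (H p Hp) as [r [Hr Hu]]; apply Hu, near_refl, Hr.
Qed.

(** Difference quotients are solutions by translation invariance and converge uniformly to [d1 i u],
    by the mean value theorem and uniform continuity. Their limit is then a solution as well. *)
Lemma helm_deriv k O u i : open_set O -> helm_on k O u -> helm_on k O (d1 i u).
Proof.
  intros HO Hu. apply helm_on_local. intros p Hp.
  destruct (HO p Hp) as [r0 [Hr0 Hr0']].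
  set (r := Rmin 1 (r0 / 2)).
  assert (Hr : 0 < r) by (apply Rmin_glb_lt; lra).
  assert (Hr1 : r <= 1) by apply Rmin_l. assert (Hr2 : r <= r0 / 2) by apply Rmin_r.
  exists (r / 2 / 2). split; [lra|].
  set (s := fun n => r / 4 * / (INR n + 1)).
  assert (Hs : forall n, 0 < s n <= r / 4).
  { intros n. unfold s. assert (0 < / (INR n + 1)) by (apply Rinv_0_lt_compat; pose proof (pos_INR n); lra).
    assert (/ (INR n + 1) <= 1).
    { rewrite <- Rinv_1. apply Rinv_le_contravar; [|pose proof (pos_INR n)]; lra. }
    split; nra. }
  apply (helm_uniform_limit k p (r / 2) (fun n x => / s n * u (line x (basis i) (s n)) + - / s n * u x)).
  - lra.
  - intros n. apply helm_lin.
    + apply near_open.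
    + apply helm_on_sub with (O := fun x => O (line x (basis i) (s n))).
      * intros x Hx. apply Hr0'.
        apply near_le with (2 := line_near p _ (basis i) x (s n) Hx (basis_le i)).
        specialize (Hs n). rewrite Rabs_pos_eq; lra.
      * apply helm_translate; assumption.
    + apply helm_on_sub with (2 := Hu). intros x Hx. apply Hr0'. apply near_le with (2 := Hx). lra.
  - intros eps He.
    destruct (cube_bounded p r) as [B HB].
    destruct (uniform_continuous (cube p r) (d1 i u) B HB (cube_closed p r)) with (eps := eps) as [d [Hd Hdd]].
    + intros q Hq. apply c2_cont1, Hu, Hr0'. apply cube_near with (2 := Hq). lra.
    + exact He.
    + destruct (inv_INR_lt d Hd) as [N HN]. exists N. intros n x Hn Hx. specialize (Hs n).
      destruct (mvt_coordinate u O x i (s n)) as [c [Hc Ec]].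
      * intros y Hy. apply c2_d1, Hu, Hy.
      * intros c Hc. apply Hr0'. apply near_le with (2 := line_near p _ (basis i) x c Hx (basis_le i)).
        rewrite (Rabs_pos_eq (s n)) in Hc; lra.
      * replace (/ s n * u (line x (basis i) (s n)) + - / s n * u x)
          with (/ s n * (u (line x (basis i) (s n)) - u x)) by ring.
        rewrite Ec. rewrite <- Rmult_assoc, Rinv_l, Rmult_1_l by lra.
        apply Rlt_le, Hdd.
        -- apply near_cube. apply near_le with (2 := Hx). lra.
        -- apply line_basis_near. rewrite (Rabs_pos_eq (s n)) in Hc by lra.
           specialize (HN n Hn). unfold s in *.
           assert (0 < / (INR n + 1)) by (apply Rinv_0_lt_compat; pose proof (pos_INR n); lra). nra.
Qed.

(** * The chain rule and invariance under reflections *)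

Lemma is_deriv_direction (O : point -> Prop) u p e :
  open_set O -> O p ->
  (forall i x, O x -> is_deriv (basis i) u x (d1 i u x)) ->
  (forall i, continuous (d1 i u) p) ->
  is_deriv e u p (sum3 (fun i => e i * d1 i u p)).
Proof.
  intros HO Hp Hd Hc. destruct (point_bound e) as [E [HE He]].
  unfold is_deriv. apply is_derive_Reals. intros eps Heps.
  set (eta := eps / (4 * E)). assert (Heta : 0 < eta) by (apply Rdiv_lt_0_compat; lra).
  destruct (HO p Hp) as [r [Hr Hr']].
  assert (Hmod : exists d, 0 < d /\ forall i q, near p d q -> Rabs (d1 i u q - d1 i u p) < eta).
  { destruct (proj1 (continuous_near _ _) (Hc X1) eta Heta) as [a1 [A1 B1]].
    destruct (proj1 (continuous_near _ _) (Hc X2) eta Heta) as [a2 [A2 B2]].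
    destruct (proj1 (continuous_near _ _) (Hc X3) eta Heta) as [a3 [A3 B3]].
    exists (Rmin a1 (Rmin a2 a3)). split; [repeat apply Rmin_glb_lt; assumption|].
    pose proof (Rmin_l a1 (Rmin a2 a3)). pose proof (Rmin_r a1 (Rmin a2 a3)).
    pose proof (Rmin_l a2 a3). pose proof (Rmin_r a2 a3).
    intros [] q Hq; [apply B1 | apply B2 | apply B3]; apply near_le with (2 := Hq); lra. }
  destruct Hmod as [d [Hd0 Hmod]].
  set (m := Rmin r d). assert (Hm : 0 < m) by (apply Rmin_glb_lt; assumption).
  assert (Hdel : 0 < m / (4 * E)) by (apply Rdiv_lt_0_compat; lra).
  exists (mkposreal _ Hdel). intros h Hh Hhd. simpl in Hhd. rewrite Rplus_0_l, line_0.
  assert (HhE : Rabs h * E < m / 4).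
  { apply Rmult_lt_compat_r with (r := E) in Hhd; [|lra].
    replace (m / (4 * E) * E) with (m / 4) in Hhd by (field; lra). exact Hhd. }
  assert (Hhe : forall i, Rabs (h * e i) < m / 4).
  { intros i. rewrite Rabs_mult. specialize (He i). pose proof (Rabs_pos h). nra. }
  set (y1 := line p (basis X1) (h * e X1)).
  set (y2 := line y1 (basis X2) (h * e X2)).
  assert (E3 : line p e h = line y2 (basis X3) (h * e X3)).
  { apply functional_extensionality. intros i. unfold y2, y1, line.
    destruct i; unfold basis; simpl; ring. }
  assert (N0 : near p (m / 4) p) by (apply near_refl; lra).
  assert (N1 : near p (m / 4 + m / 4) y1).
  { apply near_le with (2 := line_near p _ _ p (h * e X1) N0 (basis_le X1)). specialize (Hhe X1). lra. }
  assert (N2 : near p (m / 4 + m / 4 + m / 4) y2).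
  { apply near_le with (2 := line_near p _ _ y1 (h * e X2) N1 (basis_le X2)). specialize (Hhe X2). lra. }
  assert (Hstep : forall i y, near p (3 * m / 4) y -> exists z, near p m z /\
    u (line y (basis i) (h * e i)) - u y = h * e i * d1 i u z).
  { intros i y Hy.
    assert (Hin : forall c, Rabs c <= Rabs (h * e i) -> near p m (line y (basis i) c)).
    { intros c Hc'. apply near_le with (2 := line_near p _ _ y c Hy (basis_le i)).
      specialize (Hhe i). lra. }
    destruct (mvt_coordinate u O y i (h * e i)) as [c [Hc1 Hc2]].
    - intros x Hx. apply Hd, Hx.
    - intros c Hc'. apply Hr'. apply near_le with (2 := Hin c Hc'). apply Rmin_l.
    - exists (line y (basis i) c). split; [apply Hin, Hc1 | exact Hc2]. }
  destruct (Hstep X1 p) as [z1 [Z1 S1]]; [apply near_le with (2 := N0); lra|].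
  destruct (Hstep X2 y1) as [z2 [Z2 S2]]; [apply near_le with (2 := N1); lra|].
  destruct (Hstep X3 y2) as [z3 [Z3 S3]]; [apply near_le with (2 := N2); lra|].
  fold y1 in S1. fold y2 in S2. rewrite <- E3 in S3.
  replace (u (line p e h) - u p) with
    (h * (e X1 * d1 X1 u z1 + e X2 * d1 X2 u z2 + e X3 * d1 X3 u z3)) by lra.
  unfold sum3.
  replace (h * (e X1 * d1 X1 u z1 + e X2 * d1 X2 u z2 + e X3 * d1 X3 u z3) / h -
    (e X1 * d1 X1 u p + e X2 * d1 X2 u p + e X3 * d1 X3 u p)) with
    (e X1 * (d1 X1 u z1 - d1 X1 u p) + (e X2 * (d1 X2 u z2 - d1 X2 u p) + e X3 * (d1 X3 u z3 - d1 X3 u p)))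
    by (field; exact Hh).
  assert (HB : forall i z, near p m z -> Rabs (e i * (d1 i u z - d1 i u p)) <= eps / 4).
  { intros i z Hz. rewrite Rabs_mult.
    pose proof (Hmod i z (near_le _ _ _ _ (Rmin_r r d) Hz)) as H1. specialize (He i).
    replace (eps / 4) with (E * eta) by (unfold eta; field; lra).
    apply Rmult_le_compat; try apply Rabs_pos; lra. }
  pose proof (HB X1 z1 Z1). pose proof (HB X2 z2 Z2). pose proof (HB X3 z3 Z3).
  eapply Rle_lt_trans; [apply Rabs_triang|].
  pose proof (Rabs_triang (e X2 * (d1 X2 u z2 - d1 X2 u p)) (e X3 * (d1 X3 u z3 - d1 X3 u p))). lra.
Qed.

(** For a unit vector [m]: the reflection in the plane through the origin orthogonal to [m],
    followed by the translation by [c]. *)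
Definition mirror (c m x : point) : point := fun i => c i + x i - 2 * dot x m * m i.

Lemma unit_coord_le m i : dot m m = 1 -> Rabs (m i) <= 1.
Proof.
  intros H. unfold dot, sum3 in H. apply Rabs_le_between.
  pose proof (pow2_ge_0 (m X1)). pose proof (pow2_ge_0 (m X2)). pose proof (pow2_ge_0 (m X3)).
  destruct i; nra.
Qed.

(** The constant is [1 + 2 * 3]: in the sup norm each of the three coordinates of the increment
    contributes up to [d] to its dot product with [m]. *)
Lemma mirror_near c m x y d : dot m m = 1 -> near x d y -> near (mirror c m x) (7 * d) (mirror c m y).
Proof.
  intros Hm Hy i. unfold mirror.
  replace (c i + y i - 2 * dot y m * m i - (c i + x i - 2 * dot x m * m i))
    with ((y i - x i) + - (2 * ((y X1 - x X1) * m X1 + (y X2 - x X2) * m X2 + (y X3 - x X3) * m X3) * m i))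
    by (unfold dot, sum3; ring).
  eapply Rle_lt_trans; [apply Rabs_triang|]. rewrite Rabs_Ropp.
  assert (Hc : forall j, Rabs ((y j - x j) * m j) < d).
  { intros j. rewrite Rabs_mult. pose proof (unit_coord_le m j Hm). specialize (Hy j).
    pose proof (Rmult_le_compat_l _ _ _ (Rabs_pos (y j - x j)) H). lra. }
  rewrite !Rabs_mult, (Rabs_pos_eq 2) by lra.
  pose proof (Rabs_triang ((y X1 - x X1) * m X1 + (y X2 - x X2) * m X2) ((y X3 - x X3) * m X3)) as T1.
  pose proof (Rabs_triang ((y X1 - x X1) * m X1) ((y X2 - x X2) * m X2)) as T2.
  pose proof (Hc X1). pose proof (Hc X2). pose proof (Hc X3). specialize (Hy i).
  pose proof (unit_coord_le m i Hm) as Hmi.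
  set (T := Rabs ((y X1 - x X1) * m X1 + (y X2 - x X2) * m X2 + (y X3 - x X3) * m X3)) in *.
  assert (0 <= T) by apply Rabs_pos.
  assert (2 * T * Rabs (m i) <= 2 * T * 1) by (apply Rmult_le_compat_l; lra). lra.
Qed.

Lemma mirror_open c m O : dot m m = 1 -> open_set O -> open_set (fun x => O (mirror c m x)).
Proof.
  intros Hm HO x Hx. destruct (HO _ Hx) as [r [Hr Hr']]. exists (r / 7). split; [lra|].
  intros y Hy. apply Hr'. apply near_le with (2 := mirror_near c m x y _ Hm Hy). lra.
Qed.

Lemma mirror_continuous c m x (u : point -> R) : dot m m = 1 ->
  continuous u (mirror c m x) -> continuous (fun y => u (mirror c m y)) x.
Proof.
  intros Hm H. apply continuous_near. intros eps He.
  destruct (proj1 (continuous_near _ _) H eps He) as [d [Hd Hq]].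
  exists (d / 7); split; [lra|]. intros q Hn. apply Hq.
  apply near_le with (2 := mirror_near c m x q _ Hm Hn). lra.
Qed.

Definition mirror_row (m : point) (j : axis) : point := fun i => basis j i - 2 * m j * m i.

Lemma mirror_line c m x j t : mirror c m (line x (basis j) t) = line (mirror c m x) (mirror_row m j) t.
Proof.
  apply functional_extensionality. intros i. unfold mirror, line, mirror_row, dot, sum3.
  destruct j; unfold basis; simpl; ring.
Qed.

Lemma is_deriv_mirror c m O v x j :
  open_set O -> O (mirror c m x) ->
  (forall i y, O y -> is_deriv (basis i) v y (d1 i v y)) ->
  (forall i, continuous (d1 i v) (mirror c m x)) ->
  is_deriv (basis j) (fun y => v (mirror c m y)) x
    (sum3 (fun i => mirror_row m j i * d1 i v (mirror c m x))).
Proof.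
  intros HO Hx Hd Hc. unfold is_deriv.
  apply is_derive_ext with (fun t => v (line (mirror c m x) (mirror_row m j) t)).
  - intros t. rewrite mirror_line. reflexivity.
  - exact (is_deriv_direction O v _ (mirror_row m j) HO Hx Hd Hc).
Qed.

Lemma mirror_row_orthogonal m i l : dot m m = 1 ->
  sum3 (fun j => mirror_row m j i * mirror_row m j l) = basis i l.
Proof.
  intros Hm. unfold dot, sum3 in *.
  transitivity (basis i l + 4 * m i * m l * (m X1 * m X1 + m X2 * m X2 + m X3 * m X3 - 1)).
  - unfold mirror_row. destruct i, l; unfold basis; simpl; ring.
  - rewrite Hm. ring.
Qed.

(** Rotational invariance of the Laplacian: the rows of the reflection are orthonormal, so the mixed
    derivatives cancel in the sum. These derivatives exist because each [d1 i u] is itself a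
    solution. *)
Lemma helm_mirror k c m O u : dot m m = 1 -> open_set O -> helm_on k O u ->
  helm_on k (fun x => O (mirror c m x)) (fun x => u (mirror c m x)).
Proof.
  intros Hm HO Hu.
  assert (Hdu : forall i, helm_on k O (d1 i u)) by (intros i; apply helm_deriv; assumption).
  set (H := fun i l x => d1 l (d1 i u) (mirror c m x)).
  destruct (c2_intro (fun x => O (mirror c m x)) (fun x => u (mirror c m x))
    (fun j x => sum3 (fun i => mirror_row m j i * d1 i u (mirror c m x)))
    (fun j x => sum3 (fun i => mirror_row m j i * sum3 (fun l => mirror_row m j l * H i l x))))
    as [H1 [_ H2]].
  - apply mirror_open; assumption.
  - intros x Hx. apply mirror_continuous; [exact Hm|]. apply c2_cont, Hu, Hx.
  - intros j x Hx. apply is_deriv_mirror with (O := O); try assumption.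
    + intros i y Hy. apply c2_d1, Hu, Hy.
    + intros i. apply c2_cont1, Hu, Hx.
  - intros j x Hx. unfold sum3.
    assert (T : forall i, continuous (fun y => mirror_row m j i * d1 i u (mirror c m y)) x).
    { intros i. apply cont_mult; [apply cont_const|].
      apply (mirror_continuous c m x (d1 i u) Hm), c2_cont1, Hu, Hx. }
    apply cont_plus; [apply cont_plus|]; apply T.
  - intros j x Hx.
    assert (D : forall i, is_deriv (basis j) (fun y => mirror_row m j i * d1 i u (mirror c m y)) x
      (mirror_row m j i * sum3 (fun l => mirror_row m j l * H i l x))).
    { intros i. apply (is_derive_scal (fun t => d1 i u (mirror c m (line x (basis j) t)))).
      apply (is_deriv_mirror c m O (d1 i u) x j HO Hx).
      - intros l y Hy. apply c2_d1, (Hdu i), Hy.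
      - intros l. apply c2_cont1, (Hdu i), Hx. }
    unfold sum3 at 1 2. unfold is_deriv in *.
    apply (is_derive_plus (fun t => mirror_row m j X1 * d1 X1 u (mirror c m (line x (basis j) t)) +
       mirror_row m j X2 * d1 X2 u (mirror c m (line x (basis j) t)))
       (fun t => mirror_row m j X3 * d1 X3 u (mirror c m (line x (basis j) t)))); [|apply D].
    apply (is_derive_plus (fun t => mirror_row m j X1 * d1 X1 u (mirror c m (line x (basis j) t)))
       (fun t => mirror_row m j X2 * d1 X2 u (mirror c m (line x (basis j) t)))); apply D.
  - intros j x Hx. unfold sum3, H.
    assert (T : forall i l, continuous (fun y => mirror_row m j l * d1 l (d1 i u) (mirror c m y)) x).
    { intros i l. apply cont_mult; [apply cont_const|].
      apply (mirror_continuous c m x (d1 l (d1 i u)) Hm), c2_cont1, (Hdu i), Hx. }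
    apply cont_plus; [apply cont_plus|]; (apply cont_mult; [apply cont_const|]);
      (apply cont_plus; [apply cont_plus|]; apply T).
  - split; [exact H1|]. intros x Hx. unfold laplacian.
    unfold sum3 at 1. rewrite !H2 by exact Hx.
    rewrite <- (proj2 Hu (mirror c m x) Hx).
    f_equal.
    assert (T : sum3 (fun i => sum3 (fun l => sum3 (fun j => mirror_row m j i * mirror_row m j l) * H i l x))
      = laplacian u (mirror c m x)).
    { rewrite (functional_extensionality (fun i => sum3 (fun l => sum3 (fun j => mirror_row m j i * mirror_row m j l) * H i l x))
        (fun i => H i i x)).
      - reflexivity.
      - intros i. unfold sum3 at 1. rewrite !(mirror_row_orthogonal m i) by exact Hm.
        destruct i; unfold basis; simpl; ring. }
    rewrite <- T. unfold sum3. ring.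
Qed.

(** * Solutions that are even and vanish on a plane *)

Definition above (c : R) (F : point -> R) (x : point) : R := if Rle_dec c (x X3) then F x else 0.

Lemma above_cases c F x :
  continuous F x -> (x X3 = c -> F x = 0) ->
  (c < x X3 /\ locally x (fun y => F y = above c F y)) \/
  (x X3 < c /\ locally x (fun y => 0 = above c F y)) \/ (x X3 = c /\ F x = 0).
Proof.
  intros _ H. destruct (Rtotal_order c (x X3)) as [Hlt|[E|Hgt]].
  - left. split; [exact Hlt|]. apply locally_near. exists (x X3 - c). split; [lra|].
    intros y Hy. specialize (Hy X3). apply Rabs_lt_between in Hy. unfold above.
    destruct (Rle_dec c (y X3)); [reflexivity | lra].
  - right. right. split; [lra | apply H; lra].
  - right. left. split; [lra|]. apply locally_near. exists (c - x X3). split; [lra|].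
    intros y Hy. specialize (Hy X3). apply Rabs_lt_between in Hy. unfold above.
    destruct (Rle_dec c (y X3)); [lra | reflexivity].
Qed.

Lemma above_continuous c F x :
  continuous F x -> (x X3 = c -> F x = 0) -> continuous (above c F) x.
Proof.
  intros HF H0. destruct (above_cases c F x HF H0) as [[_ H]|[[_ H]|[E Z]]].
  - exact (continuous_eq_loc _ _ _ H HF).
  - exact (continuous_eq_loc _ _ _ H (cont_const 0 x)).
  - apply continuous_near. intros eps He.
    destruct (proj1 (continuous_near _ _) HF eps He) as [d [Hd Hq]]. exists d; split; [exact Hd|].
    intros q Hn. specialize (Hq q Hn). rewrite Z, Rminus_0_r in Hq.
    assert (Za : above c F x = 0) by (unfold above; destruct (Rle_dec c (x X3)); auto).
    rewrite Za, Rminus_0_r. unfold above. destruct (Rle_dec c (q X3)); [exact Hq|].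
    rewrite Rabs_R0. exact He.
Qed.

Lemma above_deriv c i F G x :
  continuous F x -> (x X3 = c -> F x = 0) -> (x X3 = c -> G x = 0) ->
  is_deriv (basis i) F x (G x) -> is_deriv (basis i) (above c F) x (above c G x).
Proof.
  intros HF H0 G0 Hd. destruct (above_cases c F x HF H0) as [[L H]|[[L H]|[E Z]]].
  - unfold above at 2. destruct (Rle_dec c (x X3)); [|lra]. exact (is_deriv_ext_loc _ _ _ _ _ H Hd).
  - unfold above at 2. destruct (Rle_dec c (x X3)); [lra|].
    apply (is_deriv_ext_loc _ _ _ _ _ H). unfold is_deriv. apply is_derive_Reals, derivable_pt_lim_const.
  - rewrite (G0 E) in Hd.
    assert (Za : forall K, K x = 0 -> above c K x = 0) by (intros K HK; unfold above; destruct (Rle_dec c (x X3)); auto).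
    rewrite (Za G (G0 E)). unfold is_deriv in *. apply is_derive_Reals. apply is_derive_Reals in Hd.
    intros eps He. destruct (Hd eps He) as [d Hd']. exists d. intros h Hh Hhd.
    specialize (Hd' h Hh Hhd). rewrite Rplus_0_l, line_0 in *. rewrite Z in Hd'. rewrite (Za F Z).
    unfold above. destruct (Rle_dec c (line x (basis i) h X3)); [exact Hd'|].
    unfold Rminus, Rdiv. rewrite Ropp_0, Rplus_0_l, Rmult_0_l, Rplus_0_l, Rabs_R0. exact He.
Qed.

Definition shift3 (c : R) : point := fun i => match i with X3 => 2 * c | _ => 0 end.
Definition sign3 : point := fun i => match i with X3 => -1 | _ => 1 end.
Definition reflect3 (c : R) (x : point) : point := flip (shift3 c) sign3 x.

Lemma sign3_cases i : sign3 i = 1 \/ sign3 i = -1.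
Proof. destruct i; auto. Qed.

Lemma is_deriv_zero_line O i u p l :
  open_set O -> O p -> (forall t, O (line p (basis i) t) -> u (line p (basis i) t) = 0) ->
  is_deriv (basis i) u p l -> l = 0.
Proof.
  intros HO Hp Hz Hd. rewrite <- (is_derive_unique _ _ _ Hd).
  apply is_derive_unique.
  apply is_derive_ext_loc with (fun _ => 0).
  - generalize (line_locally O p (basis i) (open_set_locally O p HO Hp)). apply filter_imp.
    intros t Ht. symmetry. apply Hz, Ht.
  - apply is_derive_Reals, derivable_pt_lim_const.
Qed.

(* All derivatives up to the second order vanish on the plane, so that [u] cut off below the plane is still a solution;
   it is then zero by unique continuation. *)
Lemma even_vanish k p r u :
  0 < r -> helm_on k (near p r) u ->
  (forall x, near p r x -> x X3 = p X3 -> u x = 0) ->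
  (forall x, near p r x -> u (reflect3 (p X3) x) = u x) ->
  zero_near u p.
Proof.
  intros Hr Hu Hz Hev. set (c := p X3) in *. pose proof (near_open p r) as HO.
  assert (Hrefl : forall x, near p r x -> near p r (reflect3 c x)).
  { intros x Hx i. specialize (Hx i). unfold reflect3, flip, shift3, sign3, c. destruct i.
    - replace (0 + 1 * x X1 - p X1) with (x X1 - p X1) by ring. exact Hx.
    - replace (0 + 1 * x X2 - p X2) with (x X2 - p X2) by ring. exact Hx.
    - replace (2 * p X3 + -1 * x X3 - p X3) with (- (x X3 - p X3)) by ring. rewrite Rabs_Ropp. exact Hx. }
  assert (Hfix : forall x, x X3 = c -> reflect3 c x = x).
  { intros x Hx. apply functional_extensionality. intros i. unfold reflect3, flip, shift3, sign3. destruct i; try rewrite Hx; ring. }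
  assert (Htan : forall i x t, i <> X3 -> line x (basis i) t X3 = x X3).
  { intros i x t Hi. unfold line. rewrite basis_neq by exact Hi. ring. }
  (* The normal derivative is odd under the reflection, since [u] is even, and so vanishes on the
     plane; the tangential ones vanish because [u] is zero along the plane. *)
  assert (D1 : forall i x, near p r x -> x X3 = c -> d1 i u x = 0).
  { intros i x Hx Ex. destruct (axis_eq_dec i X3) as [->|Hi].
    - destruct (c2_flip (shift3 c) sign3 sign3_cases (near p r) u HO (proj1 Hu)) as [_ [F1 _]].
      assert (Hx' : near p r (reflect3 c x)) by (apply Hrefl, Hx).
      specialize (F1 X3 x Hx'). unfold sign3 at 2 in F1.
      fold (reflect3 c x) in F1. rewrite (Hfix x Ex) in F1.
      assert (E : d1 X3 (fun y => u (reflect3 c y)) x = d1 X3 u x).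
      { apply is_deriv_unique.
        refine (is_deriv_ext_loc _ u _ _ _ _ (c2_d1 _ _ (proj1 Hu x Hx) X3)).
        generalize (open_set_locally _ _ HO Hx). apply filter_imp. intros y Hy. symmetry. apply Hev, Hy. }
      unfold reflect3 in E. rewrite E in F1. lra.
    - apply (is_deriv_zero_line (near p r) i u x); try assumption.
      + intros t Ht. apply Hz; [exact Ht|]. rewrite Htan; assumption.
      + apply c2_d1, Hu, Hx. }
  assert (D2t : forall i x, i <> X3 -> near p r x -> x X3 = c -> d2 i u x = 0).
  { intros i x Hi Hx Ex. apply (is_deriv_zero_line (near p r) i (d1 i u) x); try assumption.
    - intros t Ht. apply D1; [exact Ht|]. rewrite Htan; assumption.
    - apply c2_d2, Hu, Hx. }
  (* The equation itself supplies the remaining normal second derivative. *)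
  assert (D2 : forall i x, near p r x -> x X3 = c -> d2 i u x = 0).
  { intros i x Hx Ex. destruct (axis_eq_dec i X3) as [->|Hi]; [|apply D2t; assumption].
    pose proof (proj2 Hu x Hx) as E. unfold laplacian, sum3 in E.
    rewrite (D2t X1), (D2t X2), (Hz x Hx Ex) in E; try assumption; try discriminate. lra. }
  destruct (c2_intro (near p r) (above c u) (fun i => above c (d1 i u)) (fun i => above c (d2 i u)) HO)
    as [H1 [_ H2]].
  - intros x Hx. apply above_continuous; [apply c2_cont, Hu, Hx | intros E; apply Hz; assumption].
  - intros i x Hx. apply above_deriv.
    + apply c2_cont, Hu, Hx.
    + intros E; apply Hz; assumption.
    + intros E; apply D1; assumption.
    + apply c2_d1, Hu, Hx.
  - intros i x Hx. apply above_continuous; [apply c2_cont1, Hu, Hx | intros E; apply D1; assumption].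
  - intros i x Hx. apply above_deriv.
    + apply c2_cont1, Hu, Hx.
    + intros E; apply D1; assumption.
    + intros E; apply D2; assumption.
    + apply c2_d2, Hu, Hx.
  - intros i x Hx. apply above_continuous; [apply c2_cont2, Hu, Hx | intros E; apply D2; assumption].
  - assert (Hw : helm_on k (near p r) (above c u)).
    { split; [exact H1|]. intros x Hx. pose proof (proj2 Hu x Hx) as E.
      unfold laplacian, sum3 in *. rewrite !H2 by exact Hx. unfold above.
      destruct (Rle_dec c (x X3)); [exact E | ring]. }
    set (q := line p (basis X3) (- (r / 2))).
    assert (Hq : near p r q) by (apply line_basis_near; rewrite Rabs_Ropp, Rabs_pos_eq; lra).
    assert (Zq : zero_near (above c u) q).
    { exists (r / 2). split; [lra|]. intros y Hy. specialize (Hy X3). apply Rabs_lt_between in Hy.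
      unfold q, line in Hy. rewrite basis_eq in Hy. unfold above. fold c in Hy.
      destruct (Rle_dec c (y X3)); [lra | reflexivity]. }
    assert (Zp : zero_near (above c u) p).
    { replace p with (line q (fun i => r / 2 * basis X3 i) 1).
      2: { apply functional_extensionality. intros i. unfold q, line. ring. }
      apply (continuation_segment k (near p r)); try assumption.
      intros s Hs. replace (line q (fun i => r / 2 * basis X3 i) s) with (line p (basis X3) (- (r / 2) * (1 - s))).
      - apply line_basis_near. rewrite Rabs_mult, Rabs_Ropp, !Rabs_pos_eq by lra. nra.
      - apply functional_extensionality. intros i. unfold q, line. ring. }
    destruct Zp as [d [Hd Hzd]].
    exists (Rmin d r). split; [apply Rmin_glb_lt; assumption|]. intros x Hx.
    assert (Hxr : near p r x) by (apply near_le with (2 := Hx), Rmin_r).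
    assert (Hup : forall y, near p (Rmin d r) y -> c <= y X3 -> u y = 0).
    { intros y Hy Hc. rewrite <- (Hzd y (near_le _ _ _ _ (Rmin_l d r) Hy)). unfold above.
      destruct (Rle_dec c (y X3)); [reflexivity | contradiction]. }
    destruct (Rle_dec c (x X3)) as [Hc|Hc]; [apply Hup; assumption|].
    rewrite <- (Hev x Hxr). apply Hup.
    + intros i. specialize (Hx i). unfold reflect3, flip, shift3, sign3, c. destruct i.
      * replace (0 + 1 * x X1 - p X1) with (x X1 - p X1) by ring. exact Hx.
      * replace (0 + 1 * x X2 - p X2) with (x X2 - p X2) by ring. exact Hx.
      * replace (2 * p X3 + -1 * x X3 - p X3) with (- (x X3 - p X3)) by ring. rewrite Rabs_Ropp. exact Hx.
    + unfold reflect3, flip, shift3, sign3. lra.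
Qed.

(** * Odd reflection in a nodal plane *)

Definition psub (x y : point) : point := fun i => x i - y i.

Definition plane_reflection (p n x : point) : point :=
  fun i => x i - 2 * dot (psub x p) n * n i.

Lemma dot_unit_opp n : dot n n = 1 -> dot (fun i => - n i) (fun i => - n i) = 1.
Proof. intros H. rewrite <- H. unfold dot, sum3. ring. Qed.

(** The sum of [u] and its mirror image is even and vanishes on the plane, so [even_vanish] applies
    after moving the plane to [x3 = 0]. The map that moves it is the reflection along
    [basis X3 - n]; the condition [n X3 <= 0] keeps this vector, of squared length [2 * (1 - n X3)],
    away from zero. *)
Lemma odd_reflection_aux k O u p n r :
  open_set O -> helm_on k O u -> O p -> dot n n = 1 -> n X3 <= 0 -> 0 < r ->
  (forall x, near p r x -> dot (psub x p) n = 0 -> u x = 0) ->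
  zero_near (fun x => u x + u (plane_reflection p n x)) p.
Proof.
  intros HO Hu Hp Hn Hn3 Hr Hz.
  set (a := 1 - n X3). assert (Ha : 1 <= a) by (unfold a; lra).
  set (w := fun i => basis X3 i - n i).
  set (m := fun i => w i / sqrt (2 * a)).
  assert (Hs : sqrt (2 * a) * sqrt (2 * a) = 2 * a) by (apply sqrt_sqrt; lra).
  assert (Hs0 : 0 < sqrt (2 * a)) by (apply sqrt_lt_R0; lra).
  assert (Hww : dot w w = 2 * a).
  { unfold w, a. transitivity (1 - 2 * n X3 + dot n n).
    - unfold dot, sum3, basis; simpl; ring.
    - rewrite Hn. ring. }
  assert (Hm : dot m m = 1).
  { unfold m. transitivity (dot w w / (sqrt (2 * a) * sqrt (2 * a))).
    - unfold dot, sum3. field. lra.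
    - rewrite Hs, Hww. field. lra. }
  (* the Householder reflection exchanging the third axis and n *)
  set (A := fun y => mirror p m y).
  assert (EA : forall y i, A y i = p i + y i - dot y w / a * w i).
  { intros y i. unfold A, mirror, m.
    replace (2 * dot y (fun i0 => w i0 / sqrt (2 * a)) * (w i / sqrt (2 * a)))
      with (2 * dot y w * w i / (sqrt (2 * a) * sqrt (2 * a))).
    - rewrite Hs. field. lra.
    - unfold dot, sum3. field. lra. }
  assert (Hwn : dot w n = - a).
  { unfold w, a. transitivity (n X3 - dot n n).
    - unfold dot, sum3, basis; simpl; ring.
    - rewrite Hn. ring. }
  assert (EAn : forall y, dot (psub (A y) p) n = y X3).
  { intros y. transitivity (dot y n - dot y w / a * dot w n).
    - unfold dot at 1, sum3, psub. rewrite !EA. unfold dot, sum3. field. lra.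
    - rewrite Hwn. replace (dot y n - dot y w / a * - a) with (dot y n + dot y w) by (field; lra).
      unfold w, dot, sum3, basis; simpl; ring. }
  set (O' := fun y => O (A y)).
  assert (HO' : open_set O') by (apply mirror_open; assumption).
  assert (HuA : helm_on k O' (fun y => u (A y))) by (apply helm_mirror; assumption).
  set (z := fun _ : axis => 0).
  assert (EAz : A z = p).
  { apply functional_extensionality. intros i. rewrite EA. unfold z, dot, sum3. field. lra. }
  assert (HO'z : O' z) by (unfold O'; rewrite EAz; exact Hp).
  destruct (HO' z HO'z) as [r0 [Hr0 Hr0']].
  set (s := Rmin r0 (r / 7)). assert (Hs' : 0 < s) by (apply Rmin_glb_lt; lra).
  assert (Hs1 : s <= r0) by apply Rmin_l. assert (Hs2 : s <= r / 7) by apply Rmin_r.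
  assert (Hrefl : forall x, near z s x -> near z s (reflect3 0 x)).
  { intros x Hx i. specialize (Hx i). unfold reflect3, flip, shift3, sign3, z in *. destruct i.
    - replace (0 + 1 * x X1 - 0) with (x X1 - 0) by ring. exact Hx.
    - replace (0 + 1 * x X2 - 0) with (x X2 - 0) by ring. exact Hx.
    - replace (2 * 0 + -1 * x X3 - 0) with (- (x X3 - 0)) by ring. rewrite Rabs_Ropp. exact Hx. }
  assert (Hus : helm_on k (near z s) (fun y => u (A y))).
  { apply helm_on_sub with (2 := HuA). intros y Hy. apply Hr0', near_le with (2 := Hy), Hs1. }
  assert (HW : zero_near (fun y => 1 * u (A y) + 1 * u (A (reflect3 0 y))) z).
  { apply (even_vanish k z s); [exact Hs' | | |].
    - apply helm_lin; [apply near_open | exact Hus |].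
      apply helm_on_sub with (2 := helm_flip k (shift3 0) sign3 sign3_cases _ _ (near_open z s) Hus).
      intros y Hy. apply Hrefl, Hy.
    - intros y Hy Ey. change (z X3) with 0 in Ey.
      assert (Ef : reflect3 0 y = y).
      { apply functional_extensionality. intros i. unfold reflect3, flip, shift3, sign3. destruct i; try rewrite Ey; ring. }
      rewrite Ef. rewrite (Hz (A y)); [ring | |].
      + rewrite <- EAz. apply near_le with (2 := mirror_near p m z y s Hm Hy). lra.
      + rewrite EAn. exact Ey.
    - intros y Hy. change (z X3) with 0.
      assert (Ef : reflect3 0 (reflect3 0 y) = y).
      { apply functional_extensionality. intros i. unfold reflect3, flip, shift3, sign3. destruct i; ring. }
      rewrite Ef. ring. }
  destruct HW as [d [Hd Hdz]].
  exists (d / 7). split; [lra|]. intros x Hx.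
  set (y := fun i => (x i - p i) - dot (psub x p) w / a * w i).
  assert (Ey : y = mirror z m (psub x p)).
  { apply functional_extensionality. intros i. unfold y, mirror, z, m.
    replace (2 * dot (psub x p) (fun i0 => w i0 / sqrt (2 * a)) * (w i / sqrt (2 * a)))
      with (2 * dot (psub x p) w * w i / (sqrt (2 * a) * sqrt (2 * a))).
    - rewrite Hs. unfold psub at 2. field. lra.
    - unfold dot, sum3. field. lra. }
  assert (Hyn : near z d y).
  { rewrite Ey.
    assert (Ez : mirror z m z = z).
    { apply functional_extensionality. intros i. unfold mirror, z, dot, sum3. ring. }
    assert (Hxz : near z (d / 7) (psub x p)).
    { intros i. specialize (Hx i). unfold z, psub. rewrite Rminus_0_r. exact Hx. }
    pose proof (mirror_near z m z _ _ Hm Hxz) as H7. rewrite Ez in H7.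
    apply near_le with (2 := H7). lra. }
  assert (Eyw : dot y w = - dot (psub x p) w).
  { transitivity (dot (psub x p) w - dot (psub x p) w / a * dot w w).
    - unfold y, dot, sum3, psub. ring.
    - rewrite Hww. field. lra. }
  assert (EAy : A y = x).
  { apply functional_extensionality. intros i. rewrite EA, Eyw. unfold y. field. lra. }
  assert (EAf : A (reflect3 0 y) = plane_reflection p n x).
  { apply functional_extensionality. intros i. unfold plane_reflection.
    pose proof (EAn y) as Q1. rewrite EAy in Q1. rewrite Q1.
    pose proof (EA y i) as Q2. rewrite EAy in Q2. rewrite Q2, EA.
    assert (Hw3 : w X3 = a) by (unfold w, basis, a; simpl; ring).
    replace (dot (reflect3 0 y) w) with (dot y w - 2 * y X3 * a).
    2: { rewrite <- Hw3. unfold dot, sum3, reflect3, flip, shift3, sign3. ring. }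
    replace (reflect3 0 y i) with (y i - 2 * y X3 * basis X3 i).
    2: { unfold reflect3, flip, shift3, sign3, basis. destruct i; simpl; ring. }
    replace (n i) with (basis X3 i - w i) by (unfold w; ring). field. lra. }
  specialize (Hdz y Hyn). cbv beta in Hdz. rewrite EAy, EAf in Hdz. lra.
Qed.

Lemma plane_reflection_opp p n x : plane_reflection p (fun i => - n i) x = plane_reflection p n x.
Proof. apply functional_extensionality. intros i. unfold plane_reflection, dot, sum3. ring. Qed.

Lemma odd_reflection k O u p n r :
  open_set O -> helm_on k O u -> O p -> dot n n = 1 -> 0 < r ->
  (forall x, near p r x -> dot (psub x p) n = 0 -> u x = 0) ->
  zero_near (fun x => u x + u (plane_reflection p n x)) p.
Proof.
  intros HO Hu Hp Hn Hr Hz. destruct (Rle_dec (n X3) 0) as [H3|H3].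
  - apply (odd_reflection_aux k O u p n r); assumption.
  - destruct (odd_reflection_aux k O u p (fun i => - n i) r) as [d [Hd H]]; try assumption.
    + apply dot_unit_opp, Hn.
    + lra.
    + intros x Hx Hx0. apply Hz; [exact Hx|].
      transitivity (- dot (psub x p) (fun i => - n i)); [unfold dot, sum3; ring | rewrite Hx0; ring].
    + exists d. split; [exact Hd|]. intros q Hq. rewrite <- (plane_reflection_opp p n q). apply H, Hq.
Qed.

(** * Lattice sums *)

Fixpoint sumn (n : nat) (f : nat -> R) : R :=
  match n with O => 0 | S n => sumn n f + f n end.

Lemma sumn_ext n f g : (forall j, f j = g j) -> sumn n f = sumn n g.
Proof. intros H. induction n; simpl; [reflexivity | rewrite IHn, H; reflexivity]. Qed.

Lemma sumn_lin n a b f g : sumn n (fun j => a * f j + b * g j) = a * sumn n f + b * sumn n g.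
Proof. induction n; simpl; [ring | rewrite IHn; ring]. Qed.

Lemma sumn_scal n a f : sumn n (fun j => a * f j) = a * sumn n f.
Proof. induction n; simpl; [ring | rewrite IHn; ring]. Qed.

Lemma sumn_le n f g : (forall j, f j <= g j) -> sumn n f <= sumn n g.
Proof. intros H. induction n; simpl; [lra | specialize (H n); lra]. Qed.

Lemma sumn_succ n f : sumn n (fun j => f (S j)) = sumn n f + f n - f O.
Proof. induction n; simpl; [ring | rewrite IHn; ring]. Qed.

Lemma sumn_telescope n f : sumn n (fun j => f (S j) - f j) = f n - f O.
Proof. induction n; simpl; [ring | rewrite IHn; ring]. Qed.

Definition mk (a b c : R) : point := fun i => match i with X1 => a | X2 => b | X3 => c end.

Definition node (h : R) (K j : nat) : R := (INR j - INR K) * h.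

(** The Riemann sum of mesh [h] over the cube [[- K h, K h]^3], with [2 K + 1] nodes per axis,
    symmetric about the origin. *)
Definition lsum (h : R) (K : nat) (F : point -> R) : R :=
  h ^ 3 * sumn (2 * K + 1) (fun a => sumn (2 * K + 1) (fun b => sumn (2 * K + 1) (fun c =>
    F (mk (node h K a) (node h K b) (node h K c))))).

Lemma mk_eta (x : point) : mk (x X1) (x X2) (x X3) = x.
Proof. apply functional_extensionality. intros []; reflexivity. Qed.

Lemma lsum_ext h K F G : (forall x, F x = G x) -> lsum h K F = lsum h K G.
Proof.
  intros H. unfold lsum. f_equal. apply sumn_ext; intros a. apply sumn_ext; intros b.
  apply sumn_ext; intros c. apply H.
Qed.

Lemma lsum_lin h K a b F G :
  lsum h K (fun x => a * F x + b * G x) = a * lsum h K F + b * lsum h K G.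
Proof.
  unfold lsum.
  rewrite (sumn_ext _ _ (fun i => a * sumn (2 * K + 1) (fun j => sumn (2 * K + 1) (fun c =>
    F (mk (node h K i) (node h K j) (node h K c)))) + b * sumn (2 * K + 1) (fun j => sumn (2 * K + 1) (fun c =>
    G (mk (node h K i) (node h K j) (node h K c)))))).
  - rewrite sumn_lin. ring.
  - intros i. rewrite <- sumn_lin. apply sumn_ext. intros j. apply sumn_lin.
Qed.

Lemma lsum_le h K F G : 0 <= h -> (forall x, F x <= G x) -> lsum h K F <= lsum h K G.
Proof.
  intros Hh H. unfold lsum. apply Rmult_le_compat_l; [apply pow_le, Hh|].
  apply sumn_le; intros a. apply sumn_le; intros b. apply sumn_le; intros c. apply H.
Qed.

Lemma lsum_abs_le h K F G : 0 <= h -> (forall x, Rabs (F x) <= G x) -> Rabs (lsum h K F) <= lsum h K G.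
Proof.
  intros Hh H. apply Rabs_le_between. split.
  - replace (- lsum h K G) with (lsum h K (fun x => (-1) * G x + 0 * G x)) by (rewrite lsum_lin; ring).
    apply lsum_le; [exact Hh|]. intros x. specialize (H x). apply Rabs_le_between in H. lra.
  - apply lsum_le; [exact Hh|]. intros x. specialize (H x). apply Rabs_le_between in H. lra.
Qed.

Lemma node_succ h K j : node h K (S j) = node h K j + h.
Proof. unfold node. rewrite S_INR. ring. Qed.

Lemma node_last h K : node h K (2 * K + 1) = INR K * h + h.
Proof. unfold node. rewrite plus_INR, mult_INR. simpl. ring. Qed.

Lemma node_first h K : node h K 0 = - (INR K * h).
Proof. unfold node. simpl. ring. Qed.

(** A shift by one mesh drops the layer with index 0 and adds the one with index [2 * K + 1], just
    outside the cube. [F] vanishes on both. *)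
Lemma lsum_shift i h K F L :
  0 < h -> L <= INR K * h -> (forall x j, L <= Rabs (x j) -> F x = 0) ->
  lsum h K (fun x => F (line x (basis i) h)) = lsum h K F.
Proof.
  intros Hh HK HF. unfold lsum. f_equal.
  assert (Hlast : L <= Rabs (node h K (2 * K + 1))).
  { rewrite node_last. pose proof (Rle_abs (INR K * h + h)). lra. }
  assert (Hfirst : L <= Rabs (node h K 0)).
  { rewrite node_first. rewrite Rabs_Ropp. pose proof (Rle_abs (INR K * h)). lra. }
  set (n := (2 * K + 1)%nat) in *.
  assert (Z : forall m, sumn m (fun _ => 0) = 0) by (induction m; simpl; lra).
  destruct i.
  - set (g := fun a => sumn n (fun b => sumn n (fun c => F (mk (node h K a) (node h K b) (node h K c))))).
    transitivity (sumn n (fun a => g (S a))).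
    + apply sumn_ext. intros a. unfold g. apply sumn_ext. intros b. apply sumn_ext. intros c.
      f_equal. apply functional_extensionality. intros []; unfold line, mk, basis; simpl; rewrite ?node_succ; ring.
    + rewrite sumn_succ.
      assert (g n = 0).
      { unfold g. rewrite <- (Z n). apply sumn_ext. intros b. rewrite <- (Z n). apply sumn_ext. intros c.
        apply (HF _ X1). exact Hlast. }
      assert (g O = 0).
      { unfold g. rewrite <- (Z n). apply sumn_ext. intros b. rewrite <- (Z n). apply sumn_ext. intros c.
        apply (HF _ X1). exact Hfirst. }
      fold g. lra.
  - apply sumn_ext. intros a.
    set (g := fun b => sumn n (fun c => F (mk (node h K a) (node h K b) (node h K c)))).
    transitivity (sumn n (fun b => g (S b))).
    + apply sumn_ext. intros b. unfold g. apply sumn_ext. intros c.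
      f_equal. apply functional_extensionality. intros []; unfold line, mk, basis; simpl; rewrite ?node_succ; ring.
    + rewrite sumn_succ.
      assert (g n = 0).
      { unfold g. rewrite <- (Z n). apply sumn_ext. intros c. apply (HF _ X2). exact Hlast. }
      assert (g O = 0).
      { unfold g. rewrite <- (Z n). apply sumn_ext. intros c. apply (HF _ X2). exact Hfirst. }
      fold g. lra.
  - apply sumn_ext. intros a. apply sumn_ext. intros b.
    set (g := fun c => F (mk (node h K a) (node h K b) (node h K c))).
    transitivity (sumn n (fun c => g (S c))).
    + apply sumn_ext. intros c. unfold g.
      f_equal. apply functional_extensionality. intros []; unfold line, mk, basis; simpl; rewrite ?node_succ; ring.
    + rewrite sumn_succ.
      assert (g n = 0) by (apply (HF _ X3); exact Hlast).
      assert (g O = 0) by (apply (HF _ X3); exact Hfirst).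
      fold g. lra.
Qed.

(** * Counting lattice points in boxes *)

Definition ind (a b x : R) : R := if Rle_dec a x then if Rle_dec x b then 1 else 0 else 0.

Definition boxind (lo hi x : point) : R :=
  ind (lo X1) (hi X1) (x X1) * ind (lo X2) (hi X2) (x X2) * ind (lo X3) (hi X3) (x X3).

Lemma ind_cases a b x : (a <= x <= b /\ ind a b x = 1) \/ ((x < a \/ b < x) /\ ind a b x = 0).
Proof.
  unfold ind. destruct (Rle_dec a x); [destruct (Rle_dec x b)|];
    [left | right | right]; split; try reflexivity; lra.
Qed.

Lemma boxind_cases lo hi x :
  ((forall i, lo i <= x i <= hi i) /\ boxind lo hi x = 1) \/
  ((exists i, x i < lo i \/ hi i < x i) /\ boxind lo hi x = 0).
Proof.
  unfold boxind.
  destruct (ind_cases (lo X1) (hi X1) (x X1)) as [[A1 ->]|[A1 ->]].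
  - destruct (ind_cases (lo X2) (hi X2) (x X2)) as [[A2 ->]|[A2 ->]].
    + destruct (ind_cases (lo X3) (hi X3) (x X3)) as [[A3 ->]|[A3 ->]].
      * left. split; [|ring]. intros []; assumption.
      * right. split; [exists X3; exact A3 | ring].
    + right. split; [exists X2; exact A2 | ring].
  - right. split; [exists X1; exact A1 | ring].
Qed.

Lemma boxind_nonneg lo hi x : 0 <= boxind lo hi x.
Proof. destruct (boxind_cases lo hi x) as [[_ ->]|[_ ->]]; lra. Qed.

Definition clamp (a b x : R) : R := Rmax a (Rmin x b).

Lemma clamp_spec a b x : a <= b ->
  (x <= a /\ clamp a b x = a) \/ (a <= x <= b /\ clamp a b x = x) \/ (b <= x /\ clamp a b x = b).
Proof.
  intros Hab. unfold clamp, Rmin. destruct (Rle_dec x b); unfold Rmax.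
  - destruct (Rle_dec a x); [right; left | left]; split; try reflexivity; lra.
  - destruct (Rle_dec a b); [right; right | left]; split; try reflexivity; lra.
Qed.

(** Each node in [[a, b]] accounts for a full increment [h] of the clamp to [[a, b + h]], and the
    increments telescope. The lower bound uses the clamp to [[a + h, b]], which moves only on steps
    that start in [[a, b]]. *)
Lemma ind_sum_upper a b h K : a <= b -> 0 < h ->
  h * sumn (2 * K + 1) (fun j => ind a b (node h K j)) <= b - a + h.
Proof.
  intros Hab Hh. rewrite <- sumn_scal.
  assert (Hab' : a <= b + h) by lra.
  apply Rle_trans with (sumn (2 * K + 1)
    (fun j => clamp a (b + h) (node h K (S j)) - clamp a (b + h) (node h K j))).
  - apply sumn_le. intros j. rewrite node_succ.
    destruct (ind_cases a b (node h K j)) as [[H ->]|[H ->]];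
    destruct (clamp_spec a (b + h) (node h K j) Hab') as [[H1 ->]|[[H1 ->]|[H1 ->]]];
    destruct (clamp_spec a (b + h) (node h K j + h) Hab') as [[H2 ->]|[[H2 ->]|[H2 ->]]]; lra.
  - rewrite (sumn_telescope _ (fun j => clamp a (b + h) (node h K j))).
    destruct (clamp_spec a (b + h) (node h K (2 * K + 1)) Hab') as [[H1 ->]|[[H1 ->]|[H1 ->]]];
    destruct (clamp_spec a (b + h) (node h K 0) Hab') as [[H2 ->]|[[H2 ->]|[H2 ->]]]; lra.
Qed.

Lemma ind_sum_lower a b h K : a + h <= b -> 0 < h -> Rabs a <= INR K * h -> Rabs b <= INR K * h ->
  b - a - h <= h * sumn (2 * K + 1) (fun j => ind a b (node h K j)).
Proof.
  intros Hab Hh Ha Hb. rewrite <- sumn_scal.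
  apply Rabs_le_between in Ha. apply Rabs_le_between in Hb.
  apply Rle_trans with (sumn (2 * K + 1)
    (fun j => clamp (a + h) b (node h K (S j)) - clamp (a + h) b (node h K j))).
  - rewrite (sumn_telescope _ (fun j => clamp (a + h) b (node h K j))).
    rewrite node_last, node_first.
    destruct (clamp_spec (a + h) b (INR K * h + h) Hab) as [[H1 ->]|[[H1 ->]|[H1 ->]]];
    destruct (clamp_spec (a + h) b (- (INR K * h)) Hab) as [[H2 ->]|[[H2 ->]|[H2 ->]]]; lra.
  - apply sumn_le. intros j. rewrite node_succ.
    destruct (ind_cases a b (node h K j)) as [[H ->]|[H ->]];
    destruct (clamp_spec (a + h) b (node h K j) Hab) as [[H1 ->]|[[H1 ->]|[H1 ->]]];
    destruct (clamp_spec (a + h) b (node h K j + h) Hab) as [[H2 ->]|[[H2 ->]|[H2 ->]]]; lra.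
Qed.

Lemma lsum_boxind h K lo hi c :
  lsum h K (fun x => c * boxind lo hi x) =
  c * ((h * sumn (2 * K + 1) (fun j => ind (lo X1) (hi X1) (node h K j))) *
       ((h * sumn (2 * K + 1) (fun j => ind (lo X2) (hi X2) (node h K j))) *
        (h * sumn (2 * K + 1) (fun j => ind (lo X3) (hi X3) (node h K j))))).
Proof.
  unfold lsum, boxind, mk. set (n := (2 * K + 1)%nat).
  set (S1 := sumn n (fun j => ind (lo X1) (hi X1) (node h K j))).
  set (S2 := sumn n (fun j => ind (lo X2) (hi X2) (node h K j))).
  set (S3 := sumn n (fun j => ind (lo X3) (hi X3) (node h K j))).
  rewrite (sumn_ext n _ (fun a => (c * S2 * S3) * ind (lo X1) (hi X1) (node h K a))).
  - rewrite sumn_scal. fold S1. ring.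
  - intros a. rewrite (sumn_ext n _ (fun b => (c * S3 * ind (lo X1) (hi X1) (node h K a)) * ind (lo X2) (hi X2) (node h K b))).
    + rewrite sumn_scal. fold S2. ring.
    + intros b. rewrite (sumn_ext n _ (fun d => (c * ind (lo X1) (hi X1) (node h K a) * ind (lo X2) (hi X2) (node h K b))
        * ind (lo X3) (hi X3) (node h K d))).
      * rewrite sumn_scal. fold S3. ring.
      * intros d. ring.
Qed.

(** A bound on an iterated upper limit of the lattice sums. Keeping [eta] explicit lets a vanishing
    main term and a small error term be added, as in [Small_plus]. *)
Definition Small (eta : R) (F : point -> R) : Prop :=
  exists h0, 0 < h0 /\ forall h, 0 < h < h0 -> exists K0, forall K, (K0 <= K)%nat -> Rabs (lsum h K F) <= eta.

(* Stands for a vanishing integral of [F]: the limit [K -> oo] is taken before [h -> 0]. *)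
Definition Null (F : point -> R) : Prop := forall eta, 0 < eta -> Small eta F.

Lemma Small_ext eta F G : (forall x, F x = G x) -> Small eta F -> Small eta G.
Proof.
  intros H [h0 [Hh0 HF]]. exists h0. split; [exact Hh0|]. intros h Hh.
  destruct (HF h Hh) as [K0 HK]. exists K0. intros K HK0. rewrite <- (lsum_ext h K F G H). apply HK, HK0.
Qed.

Lemma Small_le a b F : a <= b -> Small a F -> Small b F.
Proof.
  intros H [h0 [Hh0 HF]]. exists h0. split; [exact Hh0|]. intros h Hh.
  destruct (HF h Hh) as [K0 HK]. exists K0. intros K HK0. specialize (HK K HK0). lra.
Qed.

Lemma Small_lin a b s t F G :
  Small a F -> Small b G -> Small (Rabs s * a + Rabs t * b) (fun x => s * F x + t * G x).
Proof.
  intros [h1 [Hh1 HF]] [h2 [Hh2 HG]]. exists (Rmin h1 h2). split; [apply Rmin_glb_lt; assumption|].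
  intros h Hh. pose proof (Rmin_l h1 h2). pose proof (Rmin_r h1 h2).
  destruct (HF h ltac:(lra)) as [K1 HK1]. destruct (HG h ltac:(lra)) as [K2 HK2].
  exists (Nat.max K1 K2). intros K HK. rewrite lsum_lin.
  eapply Rle_trans; [apply Rabs_triang|]. rewrite !Rabs_mult.
  apply Rplus_le_compat; apply Rmult_le_compat_l; try apply Rabs_pos; [apply HK1 | apply HK2]; lia.
Qed.

Lemma Small_plus a b F G : Small a F -> Small b G -> Small (a + b) (fun x => F x + G x).
Proof.
  intros HF HG. pose proof (Small_lin a b 1 1 F G HF HG) as H. rewrite Rabs_R1, !Rmult_1_l in H.
  apply Small_ext with (2 := H). intros x; ring.
Qed.

Lemma Null_ext F G : (forall x, F x = G x) -> Null F -> Null G.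
Proof. intros H HF eta He. apply Small_ext with (1 := H), HF, He. Qed.

Lemma Null_lin s t F G : Null F -> Null G -> Null (fun x => s * F x + t * G x).
Proof.
  intros HF HG eta He.
  pose proof (Rabs_pos s) as Hs. pose proof (Rabs_pos t) as Ht.
  set (e := eta / (1 + Rabs s + Rabs t)).
  assert (Hep : 0 < e) by (apply Rdiv_lt_0_compat; lra).
  assert (Ee : e * (1 + Rabs s + Rabs t) = eta) by (unfold e; field; lra).
  apply Small_le with (2 := Small_lin e e s t F G (HF e Hep) (HG e Hep)). nra.
Qed.

Lemma Null_scal s F : Null F -> Null (fun x => s * F x).
Proof.
  intros HF. apply Null_ext with (2 := Null_lin s 0 F F HF HF). intros x; ring.
Qed.

Lemma Null_zero : Null (fun _ => 0).
Proof.
  intros eta He. exists 1. split; [lra|]. intros h Hh. exists O. intros K _.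
  replace (lsum h K (fun _ => 0)) with 0; [rewrite Rabs_R0; lra|].
  rewrite (lsum_ext h K (fun _ => 0) (fun _ => 0 * 0 + 0 * 0)) by (intros; ring).
  rewrite (lsum_lin h K 0 0 (fun _ => 0) (fun _ => 0)). ring.
Qed.

Lemma lsum_box_upper h K lo hi c F :
  0 < h -> (forall i, lo i <= hi i) -> 0 <= c -> (forall x, Rabs (F x) <= c * boxind lo hi x) ->
  Rabs (lsum h K F) <= c * ((hi X1 - lo X1 + h) * ((hi X2 - lo X2 + h) * (hi X3 - lo X3 + h))).
Proof.
  intros Hh Hlh Hc HF. apply Rle_trans with (1 := lsum_abs_le h K F _ (Rlt_le _ _ Hh) HF).
  rewrite lsum_boxind. apply Rmult_le_compat_l; [exact Hc|].
  assert (P : forall a b, 0 <= h * sumn (2 * K + 1) (fun j => ind a b (node h K j))).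
  { intros a b. apply Rmult_le_pos; [lra|].
    apply Rle_trans with (sumn (2 * K + 1) (fun _ => 0)).
    - induction (2 * K + 1)%nat; simpl; lra.
    - apply sumn_le. intros j. destruct (ind_cases a b (node h K j)) as [[_ ->]|[_ ->]]; lra. }
  apply Rmult_le_compat; [apply P | apply Rmult_le_pos; apply P | apply ind_sum_upper; auto |].
  apply Rmult_le_compat; [apply P | apply P | apply ind_sum_upper; auto | apply ind_sum_upper; auto].
Qed.

(** The factor 8 appears because a mesh shorter than every side at most doubles each of the three
    factors [hi i - lo i + h]. *)
Lemma Small_box lo hi c F :
  (forall i, lo i < hi i) -> 0 <= c -> (forall x, Rabs (F x) <= c * boxind lo hi x) ->
  Small (8 * c * ((hi X1 - lo X1) * ((hi X2 - lo X2) * (hi X3 - lo X3)))) F.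
Proof.
  intros Hlh Hc HF.
  exists (Rmin (hi X1 - lo X1) (Rmin (hi X2 - lo X2) (hi X3 - lo X3))).
  pose proof (Hlh X1); pose proof (Hlh X2); pose proof (Hlh X3).
  split; [repeat apply Rmin_glb_lt; lra|].
  intros h Hh. exists O. intros K _.
  pose proof (Rmin_l (hi X1 - lo X1) (Rmin (hi X2 - lo X2) (hi X3 - lo X3))).
  pose proof (Rmin_r (hi X1 - lo X1) (Rmin (hi X2 - lo X2) (hi X3 - lo X3))).
  pose proof (Rmin_l (hi X2 - lo X2) (hi X3 - lo X3)). pose proof (Rmin_r (hi X2 - lo X2) (hi X3 - lo X3)).
  eapply Rle_trans; [apply (lsum_box_upper h K lo hi c F); auto; [lra | intros i; specialize (Hlh i); lra]|].
  replace (8 * c * ((hi X1 - lo X1) * ((hi X2 - lo X2) * (hi X3 - lo X3)))) with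
    (c * ((2 * (hi X1 - lo X1)) * ((2 * (hi X2 - lo X2)) * (2 * (hi X3 - lo X3))))) by ring.
  apply Rmult_le_compat_l; [exact Hc|].
  apply Rmult_le_compat; try lra; [apply Rmult_le_pos; lra|].
  apply Rmult_le_compat; lra.
Qed.

(** * Summation by parts and Green's identity in the limit *)

Definition dlap (h : R) (u : point -> R) (x : point) : R :=
  / h ^ 2 * sum3 (fun i => u (line x (basis i) h) + u (line x (basis i) (- h)) - 2 * u x).

Lemma line_back x e h : line (line x e h) e (- h) = x.
Proof. rewrite line_line. replace (h + - h) with 0 by ring. apply line_0. Qed.

Lemma summation_by_parts h K W phi L :
  0 < h -> L + h <= INR K * h -> (forall x j, L <= Rabs (x j) -> phi x = 0) ->
  lsum h K (fun x => W x * dlap h phi x) = lsum h K (fun x => phi x * dlap h W x).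
Proof.
  intros Hh HK Hphi.
  assert (S1 : forall i, lsum h K (fun x => W x * phi (line x (basis i) h)) =
    lsum h K (fun x => phi x * W (line x (basis i) (- h)))).
  { intros i. refine (eq_trans _ (lsum_shift i h K (fun x => phi x * W (line x (basis i) (- h))) L _ _ _)).
    - apply lsum_ext. intros x. cbv beta. rewrite line_back. ring.
    - exact Hh.
    - lra.
    - intros x j Hx. rewrite (Hphi x j Hx). ring. }
  assert (S2 : forall i, lsum h K (fun x => W x * phi (line x (basis i) (- h))) =
    lsum h K (fun x => phi x * W (line x (basis i) h))).
  { intros i. symmetry. refine (eq_trans _ (lsum_shift i h K (fun x => W x * phi (line x (basis i) (- h))) (L + h) _ _ _)).
    - apply lsum_ext. intros x. cbv beta. rewrite line_back. ring.
    - exact Hh.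
    - lra.
    - intros x j Hx. rewrite (Hphi (line x (basis i) (- h)) j); [ring|].
      pose proof (line_basis_near (line x (basis i) (- h)) i h (2 * h)) as Hn.
      unfold line.
      pose proof (Rabs_triang (x j + - h * basis i j) (h * basis i j)) as Ht.
      replace (x j + - h * basis i j + h * basis i j) with (x j) in Ht by ring.
      rewrite (Rabs_mult h), (Rabs_pos_eq h) in Ht by lra.
      pose proof (Rmult_le_compat_l h _ _ (Rlt_le _ _ Hh) (basis_le i j)). lra. }
  assert (E : forall A B : point -> R, lsum h K (fun x => A x * dlap h B x) =
    / h ^ 2 * ((lsum h K (fun x => A x * B (line x (basis X1) h)) + lsum h K (fun x => A x * B (line x (basis X1) (- h)))) +
               (lsum h K (fun x => A x * B (line x (basis X2) h)) + lsum h K (fun x => A x * B (line x (basis X2) (- h)))) +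
               (lsum h K (fun x => A x * B (line x (basis X3) h)) + lsum h K (fun x => A x * B (line x (basis X3) (- h))))
               - 6 * lsum h K (fun x => A x * B x))).
  { intros A B.
    assert (P : forall F G : point -> R, lsum h K F + lsum h K G = lsum h K (fun x => 1 * F x + 1 * G x)).
    { intros F G. rewrite lsum_lin. ring. }
    rewrite !P.
    replace (6 * lsum h K (fun x => A x * B x)) with (lsum h K (fun x => 6 * (A x * B x) + 0 * 0)).
    2: { rewrite (lsum_lin h K 6 0 (fun x => A x * B x) (fun _ => 0)). ring. }
    match goal with |- _ = / h ^ 2 * (lsum h K ?F - lsum h K ?G) =>
      transitivity (lsum h K (fun x => / h ^ 2 * F x + - / h ^ 2 * G x)); [| rewrite lsum_lin; ring] end.
    apply lsum_ext. intros x. unfold dlap, sum3. ring. }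
  rewrite (E W phi), (E phi W), !S1, !S2.
  rewrite (lsum_ext h K (fun x => W x * phi x) (fun x => phi x * W x)) by (intros; ring). ring.
Qed.

Lemma compact_tube (K O : point -> Prop) (B : R) :
  (forall p, K p -> forall i, Rabs (p i) <= B) -> closed_set K -> open_set O ->
  (forall p, K p -> O p) -> exists r, 0 < r /\ forall p q, K p -> near p r q -> O q.
Proof.
  intros HB HK HO HKO. apply NNPP. intros Hn.
  destruct (compact_cluster (fun n p => K p /\ exists q, near p (/ (INR n + 1)) q /\ ~ O q) B) as [l Hl].
  { intros n. apply NNPP. intros Hm. apply Hn. exists (/ (INR n + 1)). split.
    - apply Rinv_0_lt_compat. pose proof (pos_INR n). lra.
    - intros p q Kp Hq. apply NNPP. intros HOq. apply Hm. exists p.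
      split; [split; [exact Kp|] | apply HB, Kp]. exists q; auto. }
  assert (Kl : K l).
  { apply HK. intros eps He. destruct (Hl eps 0%nat He) as [n [p [_ [[Kp _] Hp]]]]. exists p; auto. }
  destruct (HO l (HKO l Kl)) as [r [Hr Hr']].
  destruct (inv_INR_lt (r / 2)) as [N HN]; [lra|].
  destruct (Hl (r / 2) N) as [n [p [Hn' [[Kp [q [Hq HOq]]] Hp]]]]; [lra|].
  apply HOq, Hr'. specialize (HN n Hn').
  apply near_le with (2 := near_trans _ _ _ _ _ Hp Hq). lra.
Qed.

(** The mean value theorem for [g t + g (- t) - A * t ^ 2], followed by the one for [g'] between
    [- c] and [c]. Only closeness of the second derivative to [A] along the segment enters. *)
Lemma second_difference u x i h A eps :
  0 < h ->
  (forall t, Rabs t <= h -> is_deriv (basis i) u (line x (basis i) t) (d1 i u (line x (basis i) t)) /\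
    is_deriv (basis i) (d1 i u) (line x (basis i) t) (d2 i u (line x (basis i) t)) /\
    Rabs (d2 i u (line x (basis i) t) - A) <= eps) ->
  Rabs (/ h ^ 2 * (u (line x (basis i) h) + u (line x (basis i) (- h)) - 2 * u x) - A) <= 2 * eps.
Proof.
  intros Hh H.
  set (g := fun t => u (line x (basis i) t)). set (g' := fun t => d1 i u (line x (basis i) t)).
  assert (Dg : forall t, Rabs t <= h -> is_derive g t (g' t)).
  { intros t Ht. apply is_deriv_shift. exact (proj1 (H t Ht)). }
  assert (Dg' : forall t, Rabs t <= h -> is_derive g' t (d2 i u (line x (basis i) t))).
  { intros t Ht. apply is_deriv_shift. exact (proj1 (proj2 (H t Ht))). }
  set (Q := fun t => g t + g (- t) - A * t ^ 2).
  set (Q' := fun t => g' t - g' (- t) - 2 * A * t).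
  assert (DQ : forall t, Rabs t <= h -> is_derive Q t (Q' t)).
  { intros t Ht. unfold Q, Q'.
    assert (D2 : is_derive (fun t => g (- t)) t (- g' (- t))).
    { replace (- g' (- t)) with (-1 * g' (- t)) by ring.
      apply (is_derive_comp g (fun t => - t)).
      - apply Dg. rewrite Rabs_Ropp. exact Ht.
      - auto_derive; [exact I | ring]. }
    assert (D3 : is_derive (fun t => A * t ^ 2) t (2 * A * t)) by (auto_derive; [exact I | ring]).
    replace (g' t - g' (- t) - 2 * A * t) with (g' t + - g' (- t) - 2 * A * t) by ring.
    apply (is_derive_minus (fun t => g t + g (- t)) (fun t => A * t ^ 2)); [|exact D3].
    apply (is_derive_plus g (fun t => g (- t))); [apply Dg, Ht | exact D2]. }
  destruct (MVT_cor2 Q Q' 0 h Hh) as [c [Ec Hc]].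
  { intros c Hc. apply is_derive_Reals, DQ. rewrite Rabs_pos_eq; lra. }
  destruct (MVT_cor2 g' (fun t => d2 i u (line x (basis i) t)) (- c) c) as [z [Ez Hz]]; [lra | |].
  { intros t Ht. apply is_derive_Reals, Dg'. apply Rabs_le_between. lra. }
  assert (Hz' : Rabs z <= h) by (apply Rabs_le_between; lra).
  pose proof (proj2 (proj2 (H z Hz'))) as HA.
  set (D := d2 i u (line x (basis i) z)) in *.
  assert (E : u (line x (basis i) h) + u (line x (basis i) (- h)) - 2 * u x - A * h ^ 2 = 2 * h * c * (D - A)).
  { transitivity (Q h - Q 0).
    - unfold Q, g. rewrite Ropp_0, line_0. ring.
    - rewrite Ec. unfold Q'. replace (g' c - g' (- c)) with (D * (c - - c)) by (symmetry; exact Ez). ring. }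
  replace (/ h ^ 2 * (u (line x (basis i) h) + u (line x (basis i) (- h)) - 2 * u x) - A) with
    (/ h ^ 2 * (2 * h * c * (D - A))) by (rewrite <- E; field; lra).
  replace (/ h ^ 2 * (2 * h * c * (D - A))) with (2 * (c / h) * (D - A)) by (field; lra).
  assert (Hch : 0 <= c / h <= 1).
  { split; [apply Rdiv_le_0_compat; lra|]. apply Rmult_le_reg_r with h; [exact Hh|].
    replace (c / h * h) with c by (field; lra). lra. }
  rewrite !Rabs_mult, (Rabs_pos_eq 2), (Rabs_pos_eq (c / h)) by lra.
  pose proof (Rabs_pos (D - A)). nra.
Qed.

Lemma dlap_approx (K O : point -> Prop) (B : R) u :
  (forall p, K p -> forall i, Rabs (p i) <= B) -> closed_set K -> open_set O ->
  (forall p, K p -> O p) -> c2_on O u ->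
  forall eps, 0 < eps -> exists h0, 0 < h0 /\ forall h x, 0 < h < h0 -> K x ->
    Rabs (dlap h u x - laplacian u x) <= eps.
Proof.
  intros HB HK HO HKO Hu eps He.
  destruct (compact_tube K O B HB HK HO HKO) as [r [Hr Hr']].
  assert (Hm : forall i, exists d, 0 < d /\ forall x y, K x -> near x d y -> Rabs (d2 i u y - d2 i u x) < eps / 6).
  { intros i. apply (uniform_continuous K (d2 i u) B HB HK); [|lra].
    intros p Kp. apply c2_cont2, Hu, HKO, Kp. }
  destruct (choice _ Hm) as [d Hd].
  exists (Rmin r (Rmin (d X1) (Rmin (d X2) (d X3)))). split.
  { repeat apply Rmin_glb_lt; try assumption; apply Hd. }
  intros h x Hh Kx.
  assert (Hhr : h < r) by (pose proof (Rmin_l r (Rmin (d X1) (Rmin (d X2) (d X3)))); lra).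
  assert (Hhd : forall i, h < d i).
  { pose proof (Rmin_r r (Rmin (d X1) (Rmin (d X2) (d X3)))).
    pose proof (Rmin_l (d X1) (Rmin (d X2) (d X3))). pose proof (Rmin_r (d X1) (Rmin (d X2) (d X3))).
    pose proof (Rmin_l (d X2) (d X3)). pose proof (Rmin_r (d X2) (d X3)). intros []; lra. }
  assert (S : forall i, Rabs (/ h ^ 2 * (u (line x (basis i) h) + u (line x (basis i) (- h)) - 2 * u x)
    - d2 i u x) <= 2 * (eps / 6)).
  { intros i. apply second_difference; [lra|]. intros t Ht.
    assert (HOt : O (line x (basis i) t)) by (apply (Hr' x); [exact Kx | apply line_basis_near; lra]).
    split; [apply c2_d1, Hu, HOt | split; [apply c2_d2, Hu, HOt|]].
    apply Rlt_le, Hd; [exact Kx | apply line_basis_near; specialize (Hhd i); lra]. }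
  unfold dlap, laplacian, sum3. rewrite !Rmult_plus_distr_l.
  pose proof (S X1) as S1. pose proof (S X2) as S2. pose proof (S X3) as S3.
  apply Rabs_le_between in S1. apply Rabs_le_between in S2. apply Rabs_le_between in S3.
  apply Rabs_le_between. lra.
Qed.

Definition extend (D : point -> Prop) (w : point -> R) (x : point) : R :=
  if excluded_middle_informative (D x) then w x else 0.

Lemma extend_in D w x : D x -> extend D w x = w x.
Proof. intros H. unfold extend. destruct (excluded_middle_informative (D x)); [reflexivity | contradiction]. Qed.

Lemma extend_out D w x : ~ D x -> extend D w x = 0.
Proof. intros H. unfold extend. destruct (excluded_middle_informative (D x)); [contradiction | reflexivity]. Qed.

Lemma c2_ext (O : point -> Prop) u v :
  open_set O -> (forall x, O x -> u x = v x) -> c2_on O u ->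
  c2_on O v /\ (forall i p, O p -> d1 i v p = d1 i u p) /\ (forall i p, O p -> d2 i v p = d2 i u p).
Proof.
  intros HO H Hu.
  assert (L : forall p, O p -> locally p (fun q => u q = v q)).
  { intros p Hp. generalize (open_set_locally O p HO Hp). apply filter_imp. exact H. }
  apply (c2_intro O v (fun i => d1 i u) (fun i => d2 i u) HO).
  - intros p Hp. exact (continuous_eq_loc _ _ _ (L p Hp) (c2_cont _ _ (Hu p Hp))).
  - intros i p Hp. apply is_deriv_ext_loc with (1 := L p Hp). apply c2_d1, Hu, Hp.
  - intros i p Hp. apply c2_cont1, Hu, Hp.
  - intros i p Hp. apply c2_d2, Hu, Hp.
  - intros i p Hp. apply c2_cont2, Hu, Hp.
Qed.

Lemma helm_ext k O u v : open_set O -> (forall x, O x -> u x = v x) -> helm_on k O u -> helm_on k O v.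
Proof.
  intros HO H [Hu Eu]. destruct (c2_ext O u v HO H Hu) as [H1 [_ H2]]. split; [exact H1|].
  intros p Hp. unfold laplacian, sum3. rewrite !H2, <- H by exact Hp. exact (Eu p Hp).
Qed.

Lemma laplacian_zero_near u p : zero_near u p -> laplacian u p = 0.
Proof.
  intros [r [Hr Hz]].
  destruct (c2_intro (near p r) u (fun _ _ => 0) (fun _ _ => 0) (near_open p r)) as [_ [_ H]].
  - intros q Hq. apply continuous_eq_loc with (u := fun _ => 0); [|apply cont_const].
    generalize (open_set_locally _ _ (near_open p r) Hq). apply filter_imp. intros y Hy. symmetry. apply Hz, Hy.
  - intros i q Hq. apply is_deriv_ext_loc with (u := fun _ => 0).
    + generalize (open_set_locally _ _ (near_open p r) Hq). apply filter_imp. intros y Hy. symmetry. apply Hz, Hy.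
    + unfold is_deriv. apply is_derive_Reals, derivable_pt_lim_const.
  - intros. apply cont_const.
  - intros. unfold is_deriv. apply is_derive_Reals, derivable_pt_lim_const.
  - intros. apply cont_const.
  - unfold laplacian, sum3. rewrite !H by (apply near_refl, Hr). ring.
Qed.

(** Replace the Laplacian of [phi] by its discrete version, move that onto [w] by exact summation by
    parts, and return to the true Laplacian of [w] on [K], where the equation holds. Both
    replacements cost little, uniformly on a bounded box. *)
Lemma green_limit k (D K : point -> Prop) (w phi : point -> R) (Bw L : R) :
  open_set D -> helm_on k D w -> 0 < Bw -> (forall x, D x -> Rabs (w x) <= Bw) ->
  0 < L -> (forall p, K p -> forall i, Rabs (p i) <= L) -> closed_set K -> (forall p, K p -> D p) ->
  c2_on (fun _ => True) phi -> (forall x, ~ K x -> phi x = 0) ->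
  Null (fun x => extend D w x * (laplacian phi x + k ^ 2 * phi x)).
Proof.
  intros HD Hw HBw Hb HL HKL HK HKD Hphi Hout eta Heta.
  set (W := extend D w).
  assert (HW : helm_on k D W).
  { apply helm_ext with (u := w); try assumption. intros x Hx. symmetry. apply extend_in, Hx. }
  assert (HWb : forall x, Rabs (W x) <= Bw).
  { intros x. unfold W, extend. destruct (excluded_middle_informative (D x)) as [Hx|Hx]; [apply Hb, Hx|].
    rewrite Rabs_R0. lra. }
  destruct (continuous_bounded K phi L HKL HK) as [M [HM HMb]].
  { intros p _. apply c2_cont, Hphi. exact I. }
  assert (HMb' : forall x, Rabs (phi x) <= M).
  { intros x. destruct (classic (K x)) as [Kx|Kx]; [apply HMb, Kx|]. rewrite (Hout x Kx), Rabs_R0. lra. }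
  (* The margin 2 ensures that [phi] vanishes within distance 1 of any point outside the box, so
     that for [h < 1] both its Laplacian and its discrete Laplacian are zero there. *)
  set (z := fun _ : axis => 0). set (L2 := L + 2).
  set (V := (2 * L2 + 1) * ((2 * L2 + 1) * (2 * L2 + 1))).
  assert (HV : 0 < V) by (unfold V, L2; repeat apply Rmult_lt_0_compat; lra).
  set (e := eta / (V * (Bw + M))).
  assert (He : 0 < e) by (apply Rdiv_lt_0_compat; [lra | apply Rmult_lt_0_compat; lra]).
  assert (Ee : e * (V * (Bw + M)) = eta) by (unfold e; field; lra).
  destruct (cube_bounded z L2) as [B HB].
  destruct (dlap_approx (cube z L2) (fun _ => True) B phi HB (cube_closed z L2) full_open (fun _ _ => I) Hphi e He)
    as [h1 [Hh1 H1]].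
  destruct (dlap_approx K D L W HKL HK HD HKD (proj1 HW) e He) as [h2 [Hh2 H2]].
  exists (Rmin 1 (Rmin h1 h2)). split; [repeat apply Rmin_glb_lt; lra|].
  intros h Hh.
  pose proof (Rmin_l 1 (Rmin h1 h2)). pose proof (Rmin_r 1 (Rmin h1 h2)).
  pose proof (Rmin_l h1 h2). pose proof (Rmin_r h1 h2).
  destruct (INR_unbounded ((L + 1 + h) / h)) as [K0 HK0].
  exists K0. intros N HN. apply le_INR in HN.
  assert (HNh : L + 1 + h <= INR N * h).
  { assert (Hq : (L + 1 + h) / h <= INR N) by lra.
    apply Rmult_le_compat_r with (r := h) in Hq; [|lra].
    replace ((L + 1 + h) / h * h) with (L + 1 + h) in Hq by (field; lra). exact Hq. }
  assert (Hphi0 : forall x j, L + 1 <= Rabs (x j) -> phi x = 0).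
  { intros x j Hx. apply Hout. intros Kx. specialize (HKL x Kx j). lra. }
  assert (E : lsum h N (fun x => W x * (laplacian phi x + k ^ 2 * phi x)) =
    lsum h N (fun x => W x * (laplacian phi x - dlap h phi x)) +
    lsum h N (fun x => phi x * (dlap h W x + k ^ 2 * W x))).
  { transitivity (lsum h N (fun x => 1 * (W x * (laplacian phi x - dlap h phi x)) + 1 * (W x * (dlap h phi x + k ^ 2 * phi x)))).
    - apply lsum_ext. intros x. ring.
    - rewrite lsum_lin, !Rmult_1_l. f_equal.
      transitivity (lsum h N (fun x => 1 * (W x * dlap h phi x) + k ^ 2 * (phi x * W x))).
      + apply lsum_ext. intros x. ring.
      + rewrite lsum_lin, (summation_by_parts h N W phi (L + 1)); [| lra | lra | exact Hphi0].
        rewrite <- lsum_lin. apply lsum_ext. intros x. ring. }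
  fold W. rewrite E.
  set (lo := fun _ : axis => - L2). set (hi := fun _ : axis => L2).
  assert (Hlh : forall i, lo i <= hi i) by (intros i; unfold lo, hi, L2; lra).
  assert (HVh : (hi X1 - lo X1 + h) * ((hi X2 - lo X2 + h) * (hi X3 - lo X3 + h)) <= V).
  { unfold hi, lo, V, L2.
    assert (0 <= (L + 2 - - (L + 2) + h) * (L + 2 - - (L + 2) + h)) by (apply Rmult_le_pos; lra).
    apply Rmult_le_compat; try lra. apply Rmult_le_compat; lra. }
  assert (B1 : Rabs (lsum h N (fun x => W x * (laplacian phi x - dlap h phi x))) <= (Bw * e) * V).
  { eapply Rle_trans; [apply (lsum_box_upper h N lo hi (Bw * e)); [lra | exact Hlh | apply Rmult_le_pos; lra |]|].
    - intros x. rewrite Rabs_mult. destruct (boxind_cases lo hi x) as [[Hx ->]|[[i Hx] ->]].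
      + rewrite Rmult_1_r. apply Rmult_le_compat; try apply Rabs_pos; [apply HWb|].
        rewrite Rabs_minus_sym. apply H1; [lra|]. intros j. unfold z. rewrite Rminus_0_r.
        apply Rabs_le_between. apply Hx.
      + rewrite Rmult_0_r.
        assert (Hxi : L2 < Rabs (x i)).
        { unfold lo, hi in Hx. destruct Hx as [Hx|Hx]; split_Rabs; unfold L2 in *; lra. }
        assert (Z : forall y, near x 1 y -> phi y = 0).
        { intros y Hy. apply (Hphi0 y i). specialize (Hy i).
          pose proof (Rabs_triang_inv (x i) (x i - y i)) as T.
          replace (x i - (x i - y i)) with (y i) in T by ring.
          rewrite (Rabs_minus_sym (x i) (y i)) in T. unfold L2 in Hxi. lra. }
        rewrite (laplacian_zero_near phi x).
        * assert (Z0 : phi x = 0) by (apply Z, near_refl; lra).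
          assert (Zp : forall j, phi (line x (basis j) h) = 0).
          { intros j. apply Z, line_basis_near. rewrite Rabs_pos_eq; lra. }
          assert (Zm : forall j, phi (line x (basis j) (- h)) = 0).
          { intros j. apply Z, line_basis_near. rewrite Rabs_Ropp, Rabs_pos_eq; lra. }
          unfold dlap, sum3. rewrite Z0, !Zp, !Zm.
          match goal with |- ?a * Rabs ?b <= _ => replace b with 0 by ring end. rewrite Rabs_R0. lra.
        * exists 1. split; [lra | exact Z].
    - apply Rmult_le_compat_l; [apply Rmult_le_pos; lra | exact HVh]. }
  assert (B2 : Rabs (lsum h N (fun x => phi x * (dlap h W x + k ^ 2 * W x))) <= (M * e) * V).
  { eapply Rle_trans; [apply (lsum_box_upper h N lo hi (M * e)); [lra | exact Hlh | apply Rmult_le_pos; lra |]|].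
    - intros x. destruct (classic (K x)) as [Kx|Kx].
      + assert (Hbx : boxind lo hi x = 1).
        { destruct (boxind_cases lo hi x) as [[_ Hx]|[[i Hx] _]]; [exact Hx|].
          specialize (HKL x Kx i). apply Rabs_le_between in HKL. unfold lo, hi, L2 in Hx. lra. }
        rewrite Hbx, Rmult_1_r, Rabs_mult. apply Rmult_le_compat; try apply Rabs_pos; [apply HMb'|].
        pose proof (proj2 HW x (HKD x Kx)) as Ew.
        replace (dlap h W x + k ^ 2 * W x) with (dlap h W x - laplacian W x) by lra.
        apply H2; [lra | exact Kx].
      + rewrite (Hout x Kx), Rmult_0_l, Rabs_R0.
        apply Rmult_le_pos; [apply Rmult_le_pos; lra | apply boxind_nonneg].
    - apply Rmult_le_compat_l; [apply Rmult_le_pos; lra | exact HVh]. }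
  eapply Rle_trans; [apply Rabs_triang|]. nra.
Qed.

(** * Test functions *)

Lemma is_derive_mult_R (f g : R -> R) x l m :
  is_derive f x l -> is_derive g x m -> is_derive (fun t => f t * g t) x (l * g x + f x * m).
Proof.
  intros Hf Hg. apply is_derive_Reals. apply is_derive_Reals in Hf. apply is_derive_Reals in Hg.
  exact (derivable_pt_lim_mult f g x l m Hf Hg).
Qed.

Lemma is_derive_cont (f : R -> R) x l : is_derive f x l -> continuous f x.
Proof. intros H. refine (ex_derive_continuous _ _ _). exists l. exact H. Qed.

Lemma c2_mult (O : point -> Prop) u v :
  open_set O -> c2_on O u -> c2_on O v ->
  c2_on O (fun x => u x * v x) /\
  (forall i p, O p -> d1 i (fun x => u x * v x) p = d1 i u p * v p + u p * d1 i v p) /\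
  (forall i p, O p -> d2 i (fun x => u x * v x) p =
     d2 i u p * v p + 2 * (d1 i u p * d1 i v p) + u p * d2 i v p).
Proof.
  intros HO Hu Hv.
  assert (Hd : forall (a b : point -> R) e p l m, is_deriv e a p l -> is_deriv e b p m ->
    is_deriv e (fun x => a x * b x) p (l * b p + a p * m)).
  { intros a b e p l m Ha Hb. unfold is_deriv in *.
    pose proof (is_derive_mult_R _ _ _ _ _ Ha Hb) as H. cbv beta in H. rewrite !line_0 in H. exact H. }
  apply (c2_intro O _ (fun i p => d1 i u p * v p + u p * d1 i v p)
    (fun i p => d2 i u p * v p + 2 * (d1 i u p * d1 i v p) + u p * d2 i v p) HO).
  - intros p Hp. apply cont_mult; [apply c2_cont, Hu, Hp | apply c2_cont, Hv, Hp].
  - intros i p Hp. apply Hd; [apply c2_d1, Hu, Hp | apply c2_d1, Hv, Hp].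
  - intros i p Hp. apply cont_plus; apply cont_mult.
    + apply c2_cont1, Hu, Hp.
    + apply c2_cont, Hv, Hp.
    + apply c2_cont, Hu, Hp.
    + apply c2_cont1, Hv, Hp.
  - intros i p Hp.
    replace (d2 i u p * v p + 2 * (d1 i u p * d1 i v p) + u p * d2 i v p) with
      ((d2 i u p * v p + d1 i u p * d1 i v p) + (d1 i u p * d1 i v p + u p * d2 i v p)) by ring.
    apply (is_derive_plus (fun t => d1 i u (line p (basis i) t) * v (line p (basis i) t))
      (fun t => u (line p (basis i) t) * d1 i v (line p (basis i) t))).
    + apply (Hd (d1 i u) v); [apply c2_d2, Hu, Hp | apply c2_d1, Hv, Hp].
    + apply (Hd u (d1 i v)); [apply c2_d1, Hu, Hp | apply c2_d2, Hv, Hp].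
  - intros i p Hp. apply cont_plus; [apply cont_plus|].
    + apply cont_mult; [apply c2_cont2, Hu, Hp | apply c2_cont, Hv, Hp].
    + apply cont_mult; [apply cont_const|].
      apply cont_mult; [apply c2_cont1, Hu, Hp | apply c2_cont1, Hv, Hp].
    + apply cont_mult; [apply c2_cont, Hu, Hp | apply c2_cont2, Hv, Hp].
Qed.

Definition C2fun (F F1 F2 : R -> R) : Prop :=
  (forall t, is_derive F t (F1 t)) /\ (forall t, is_derive F1 t (F2 t)) /\ forall t, continuous F2 t.

Lemma dot_continuous e p : continuous (fun x => dot x e) p.
Proof. unfold dot, sum3. cont_tac. Qed.

Lemma dot_self_continuous p : continuous (fun x => dot x x) p.
Proof. unfold dot, sum3. cont_tac. Qed.

Lemma c2_linear e F F1 F2 : C2fun F F1 F2 ->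
  c2_on (fun _ => True) (fun x => F (dot x e)) /\
  (forall i p, d1 i (fun x => F (dot x e)) p = e i * F1 (dot p e)) /\
  (forall i p, d2 i (fun x => F (dot x e)) p = e i ^ 2 * F2 (dot p e)).
Proof.
  intros [H1 [H2 H3]].
  assert (Hd : forall G i p l, is_derive G (dot p e) l -> is_deriv (basis i) (fun x => G (dot x e)) p (e i * l)).
  { intros G i p l HG. unfold is_deriv.
    apply (is_derive_comp G (fun t => dot (line p (basis i) t) e)).
    - rewrite line_0. exact HG.
    - unfold dot, sum3, line. destruct i; unfold basis; simpl; auto_derive; try exact I; ring. }
  destruct (c2_intro (fun _ => True) (fun x => F (dot x e)) (fun i p => e i * F1 (dot p e))
    (fun i p => e i ^ 2 * F2 (dot p e)) full_open) as [A [B C]].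
  - intros p _. apply (cont_comp F (fun x => dot x e)); [apply dot_continuous | exact (is_derive_cont _ _ _ (H1 _))].
  - intros i p _. apply Hd, H1.
  - intros i p _. apply cont_mult; [apply cont_const|].
    apply (cont_comp F1 (fun x => dot x e)); [apply dot_continuous | exact (is_derive_cont _ _ _ (H2 _))].
  - intros i p _. replace (e i ^ 2 * F2 (dot p e)) with (e i * (e i * F2 (dot p e))) by ring.
    unfold is_deriv. apply (is_derive_scal (fun t => F1 (dot (line p (basis i) t) e))). apply (Hd F1 i p), H2.
  - intros i p _. apply cont_mult; [apply cont_const|].
    apply (cont_comp F2 (fun x => dot x e)); [apply dot_continuous | apply H3].
  - split; [exact A | split; intros; [apply B | apply C]; exact I].
Qed.

Lemma c2_radial F F1 F2 : C2fun F F1 F2 ->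
  c2_on (fun _ => True) (fun x => F (dot x x)) /\
  (forall i p, d1 i (fun x => F (dot x x)) p = 2 * p i * F1 (dot p p)) /\
  (forall i p, d2 i (fun x => F (dot x x)) p = 4 * p i ^ 2 * F2 (dot p p) + 2 * F1 (dot p p)).
Proof.
  intros [H1 [H2 H3]].
  assert (Hd : forall G i p l, is_derive G (dot p p) l -> is_deriv (basis i) (fun x => G (dot x x)) p (2 * p i * l)).
  { intros G i p l HG. unfold is_deriv.
    apply (is_derive_comp G (fun t => dot (line p (basis i) t) (line p (basis i) t))).
    - rewrite line_0. exact HG.
    - unfold dot, sum3, line. destruct i; unfold basis; simpl; auto_derive; try exact I; ring. }
  destruct (c2_intro (fun _ => True) (fun x => F (dot x x)) (fun i p => 2 * p i * F1 (dot p p))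
    (fun i p => 4 * p i ^ 2 * F2 (dot p p) + 2 * F1 (dot p p)) full_open) as [A [B C]].
  - intros p _. apply (cont_comp F (fun x => dot x x)); [apply dot_self_continuous | exact (is_derive_cont _ _ _ (H1 _))].
  - intros i p _. apply Hd, H1.
  - intros i p _. apply (cont_mult (fun x => 2 * x i) (fun x => F1 (dot x x))); [cont_tac|].
    apply (cont_comp F1 (fun x => dot x x)); [apply dot_self_continuous | exact (is_derive_cont _ _ _ (H2 _))].
  - intros i p _.
    replace (4 * p i ^ 2 * F2 (dot p p) + 2 * F1 (dot p p)) with
      (2 * F1 (dot (line p (basis i) 0) (line p (basis i) 0)) + 2 * line p (basis i) 0 i * (2 * p i * F2 (dot p p)))
      by (rewrite line_0; ring).
    unfold is_deriv.
    apply (is_derive_mult_R (fun t => 2 * line p (basis i) t i)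
      (fun t => F1 (dot (line p (basis i) t) (line p (basis i) t)))).
    + unfold line. rewrite basis_eq. auto_derive; [exact I | ring].
    + apply (Hd F1 i p), H2.
  - intros i p _. apply (cont_plus (fun x => 4 * x i ^ 2 * F2 (dot x x)) (fun x => 2 * F1 (dot x x))).
    + apply (cont_mult (fun x => 4 * x i ^ 2) (fun x => F2 (dot x x))); [cont_tac|].
      apply (cont_comp F2 (fun x => dot x x)); [apply dot_self_continuous | apply H3].
    + apply (cont_mult (fun _ => 2) (fun x => F1 (dot x x))); [cont_tac|].
      apply (cont_comp F1 (fun x => dot x x)); [apply dot_self_continuous | exact (is_derive_cont _ _ _ (H2 _))].
  - split; [exact A | split; intros; [apply B | apply C]; exact I].
Qed.

Lemma C2fun_pow n : C2fun (fun t => t ^ n) (fun t => INR n * t ^ (n - 1)) (fun t => INR n * (INR (n - 1) * t ^ (n - 2))).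
Proof.
  assert (H : forall m t, is_derive (fun t => t ^ m) t (INR m * t ^ (m - 1))).
  { intros m t. apply is_derive_Reals.
    replace (m - 1)%nat with (pred m) by lia. apply derivable_pt_lim_pow. }
  split; [|split].
  - intros t. apply H.
  - intros t. apply is_derive_scal. replace (n - 2)%nat with (n - 1 - 1)%nat by lia. apply H.
  - intros t. refine (is_derive_cont _ t (INR n * (INR (n - 1) * (INR (n - 2) * t ^ (n - 2 - 1)))) _).
    apply is_derive_scal, is_derive_scal, H.
Qed.

(** A power of a linear form is not harmonic, whence the term of degree [n - 2]. For [n < 2] the
    truncated subtraction is harmless because the coefficient is zero. *)
Lemma power_radial_laplacian e n F F1 F2 :
  dot e e = 1 -> C2fun F F1 F2 ->
  c2_on (fun _ => True) (fun x => dot x e ^ n * F (dot x x)) /\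
  forall x, laplacian (fun x => dot x e ^ n * F (dot x x)) x =
    INR n * INR (n - 1) * (dot x e ^ (n - 2) * F (dot x x)) +
    dot x e ^ n * (4 * dot x x * F2 (dot x x) + (6 + 4 * INR n) * F1 (dot x x)).
Proof.
  intros He HF.
  destruct (c2_linear e _ _ _ (C2fun_pow n)) as [A1 [A2 A3]].
  destruct (c2_radial F F1 F2 HF) as [B1 [B2 B3]].
  destruct (c2_mult _ _ _ full_open A1 B1) as [C1 [_ C3]].
  split; [exact C1|]. intros x. unfold laplacian, sum3. rewrite !C3 by exact I.
  rewrite !A2, !A3, !B2, !B3.
  assert (Hn : INR n * dot x e ^ (n - 1) * dot x e = INR n * dot x e ^ n).
  { destruct n; [simpl; ring|]. replace (S n - 1)%nat with n by lia. simpl. ring. }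
  set (l := dot x e) in *. set (F0' := F (dot x x)). set (F1' := F1 (dot x x)). set (F2' := F2 (dot x x)).
  set (ln := l ^ n) in *. set (ln1 := l ^ (n - 1)) in *. set (ln2 := l ^ (n - 2)). set (N := INR n) in *.
  set (N1 := INR (n - 1)).
  transitivity ((dot e e) * (N * (N1 * ln2)) * F0' + 4 * F1' * (N * ln1 * dot x e)
    + ln * (4 * dot x x * F2' + 6 * F1')).
  - unfold dot, sum3. ring.
  - rewrite He. fold l. rewrite Hn. ring.
Qed.

(** * A [C^2] step from [0] to [1] on [[0, 3]] *)

Definition pos (t : R) : R := Rmax 0 t.

Lemma pos_cases t : (t <= 0 /\ pos t = 0) \/ (0 <= t /\ pos t = t).
Proof. unfold pos, Rmax. destruct (Rle_dec 0 t); [right | left]; split; try reflexivity; lra. Qed.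

Lemma pos_lipschitz s t : Rabs (pos s - pos t) <= Rabs (s - t).
Proof.
  destruct (pos_cases s) as [[Hs ->]|[Hs ->]]; destruct (pos_cases t) as [[Ht ->]|[Ht ->]];
    split_Rabs; lra.
Qed.

Lemma pos_continuous t : continuous pos t.
Proof.
  apply filterlim_locally. intros eps. exists eps. intros s Hs.
  change (Rabs (pos s - pos t) < eps). change (Rabs (s - t) < eps) in Hs.
  pose proof (pos_lipschitz s t). lra.
Qed.

Lemma pos_pow_derive n t : is_derive (fun t => pos t ^ S (S n)) t (INR (S (S n)) * pos t ^ S n).
Proof.
  destruct (Rtotal_order t 0) as [Hlt|[->|Hgt]].
  - apply is_derive_ext_loc with (fun _ => 0).
    + exists (mkposreal (- t) ltac:(lra)). intros s Hs. change (Rabs (s - t) < - t) in Hs.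
      apply Rabs_lt_between in Hs. destruct (pos_cases s) as [[_ ->]|[H _]]; [simpl; ring | lra].
    + destruct (pos_cases t) as [[_ ->]|[H _]]; [|lra].
      replace (INR (S (S n)) * 0 ^ S n) with 0 by (simpl; ring).
      apply is_derive_Reals, derivable_pt_lim_const.
  - replace (pos 0) with 0 by (destruct (pos_cases 0) as [[_ ->]|[_ ->]]; reflexivity).
    replace (INR (S (S n)) * 0 ^ S n) with 0 by (simpl; ring).
    apply is_derive_Reals. intros eps He.
    assert (Hm : 0 < Rmin 1 eps) by (apply Rmin_glb_lt; lra).
    exists (mkposreal _ Hm). intros h Hh Hhd. simpl in Hhd.
    pose proof (Rmin_l 1 eps). pose proof (Rmin_r 1 eps).
    replace (pos 0) with 0 by (destruct (pos_cases 0) as [[_ ->]|[_ ->]]; reflexivity).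
    rewrite Rplus_0_l.
    destruct (pos_cases h) as [[Hh' ->]|[Hh' ->]].
    + replace ((0 ^ S (S n) - 0 ^ S (S n)) / h - 0) with 0 by (field; exact Hh). rewrite Rabs_R0. exact He.
    + replace ((h ^ S (S n) - 0 ^ S (S n)) / h - 0) with (h ^ n * h) by (simpl; field; exact Hh).
      rewrite Rabs_pos_eq in Hhd by exact Hh'.
      assert (0 <= h ^ n <= 1).
      { split; [apply pow_le, Hh'|]. rewrite <- (pow1 n). apply pow_incr. lra. }
      rewrite Rabs_pos_eq by (apply Rmult_le_pos; lra). nra.
  - apply is_derive_ext_loc with (fun t => t ^ S (S n)).
    + exists (mkposreal t ltac:(lra)). intros s Hs. change (Rabs (s - t) < t) in Hs.
      apply Rabs_lt_between in Hs. destruct (pos_cases s) as [[H _]|[_ ->]]; [lra | reflexivity].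
    + destruct (pos_cases t) as [[H _]|[_ ->]]; [lra|].
      apply is_derive_Reals. apply (derivable_pt_lim_pow t (S (S n))).
Qed.

(** [step1] is the quadratic B-spline with knots 0, 1, 2, 3, written in truncated powers; [step] is
    its integral and [step2] its derivative. *)
Definition step (t : R) : R := / 6 * (pos t ^ 3 - 3 * pos (t - 1) ^ 3 + 3 * pos (t - 2) ^ 3 - pos (t - 3) ^ 3).
Definition step1 (t : R) : R := / 2 * (pos t ^ 2 - 3 * pos (t - 1) ^ 2 + 3 * pos (t - 2) ^ 2 - pos (t - 3) ^ 2).
Definition step2 (t : R) : R := pos t - 3 * pos (t - 1) + 3 * pos (t - 2) - pos (t - 3).

Lemma shift_derive (f : R -> R) a t l : is_derive f (t - a) l -> is_derive (fun t => f (t - a)) t l.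
Proof.
  intros H. replace l with (1 * l) by ring.
  apply (is_derive_comp f (fun t => t - a)); [exact H | auto_derive; [exact I | ring]].
Qed.

Lemma four_derive (f0 f1 f2 f3 : R -> R) c t l0 l1 l2 l3 :
  is_derive f0 t l0 -> is_derive f1 t l1 -> is_derive f2 t l2 -> is_derive f3 t l3 ->
  is_derive (fun t => c * (f0 t - 3 * f1 t + 3 * f2 t - f3 t)) t (c * (l0 - 3 * l1 + 3 * l2 - l3)).
Proof.
  intros H0 H1 H2 H3. apply is_derive_scal.
  apply (is_derive_minus (fun t => f0 t - 3 * f1 t + 3 * f2 t) f3); [|exact H3].
  apply (is_derive_plus (fun t => f0 t - 3 * f1 t) (fun t => 3 * f2 t)); [|apply is_derive_scal, H2].
  apply (is_derive_minus f0 (fun t => 3 * f1 t)); [exact H0 | apply is_derive_scal, H1].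
Qed.

Lemma C2fun_step : C2fun step step1 step2.
Proof.
  pose proof (pos_pow_derive 1) as D3. pose proof (pos_pow_derive 0) as D2.
  split; [|split].
  - intros t. unfold step.
    replace (step1 t) with (/ 6 * (INR 3 * pos t ^ 2 - 3 * (INR 3 * pos (t - 1) ^ 2) + 3 * (INR 3 * pos (t - 2) ^ 2)
      - INR 3 * pos (t - 3) ^ 2)) by (unfold step1; simpl; field).
    apply (four_derive (fun t => pos t ^ 3) (fun t => pos (t - 1) ^ 3) (fun t => pos (t - 2) ^ 3) (fun t => pos (t - 3) ^ 3)).
    + apply D3.
    + apply (shift_derive (fun t => pos t ^ 3)), D3.
    + apply (shift_derive (fun t => pos t ^ 3)), D3.
    + apply (shift_derive (fun t => pos t ^ 3)), D3.
  - intros t. unfold step1.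
    replace (step2 t) with (/ 2 * (INR 2 * pos t ^ 1 - 3 * (INR 2 * pos (t - 1) ^ 1) + 3 * (INR 2 * pos (t - 2) ^ 1)
      - INR 2 * pos (t - 3) ^ 1)) by (unfold step2; simpl; field).
    apply (four_derive (fun t => pos t ^ 2) (fun t => pos (t - 1) ^ 2) (fun t => pos (t - 2) ^ 2) (fun t => pos (t - 3) ^ 2)).
    + apply D2.
    + apply (shift_derive (fun t => pos t ^ 2)), D2.
    + apply (shift_derive (fun t => pos t ^ 2)), D2.
    + apply (shift_derive (fun t => pos t ^ 2)), D2.
  - intros t.
    assert (Hc : forall a, continuous (fun t => pos (t - a)) t).
    { intros a. apply (continuous_comp (fun t => t - a) pos); [|apply pos_continuous].
      apply (continuous_minus (V := R_NormedModule) (fun t => t) (fun _ => a)); [apply continuous_id | apply continuous_const]. }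
    unfold step2.
    apply (continuous_minus (V := R_NormedModule) (fun t => pos t - 3 * pos (t - 1) + 3 * pos (t - 2)) (fun t => pos (t - 3)));
      [|apply Hc].
    apply (continuous_plus (V := R_NormedModule) (fun t => pos t - 3 * pos (t - 1)) (fun t => 3 * pos (t - 2))).
    + apply (continuous_minus (V := R_NormedModule) pos (fun t => 3 * pos (t - 1))); [apply pos_continuous|].
      apply (continuous_mult (K := R_AbsRing) (fun _ => 3) (fun t => pos (t - 1))); [apply continuous_const | apply Hc].
    + apply (continuous_mult (K := R_AbsRing) (fun _ => 3) (fun t => pos (t - 2))); [apply continuous_const | apply Hc].
Qed.

Lemma pos_neg t : t <= 0 -> pos t = 0.
Proof. intros Ht. destruct (pos_cases t) as [[_ ->]|[H ->]]; lra. Qed.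

Lemma pos_pos t : 0 <= t -> pos t = t.
Proof. intros Ht. destruct (pos_cases t) as [[H ->]|[_ ->]]; lra. Qed.

Lemma step_low t : t <= 0 -> step t = 0 /\ step1 t = 0 /\ step2 t = 0.
Proof.
  intros Ht. unfold step, step1, step2. rewrite !pos_neg by lra. repeat split; ring.
Qed.

Lemma step_high t : 3 <= t -> step t = 1 /\ step1 t = 0 /\ step2 t = 0.
Proof.
  intros Ht. unfold step, step1, step2. rewrite !pos_pos by lra. repeat split; field.
Qed.

Lemma step_bound t : Rabs (step t) <= 40 /\ Rabs (step1 t) <= 40 /\ Rabs (step2 t) <= 40.
Proof.
  destruct (Rle_dec t 3) as [Ht|Ht].
  - assert (B : forall a, 0 <= a -> 0 <= pos (t - a) <= 3).
    { intros a Ha. destruct (pos_cases (t - a)) as [[? ->]|[? ->]]; lra. }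
    pose proof (B 0 ltac:(lra)) as B0. rewrite Rminus_0_r in B0.
    pose proof (B 1 ltac:(lra)) as B1. pose proof (B 2 ltac:(lra)) as B2. pose proof (B 3 ltac:(lra)) as B3.
    assert (P2 : forall y, 0 <= y <= 3 -> 0 <= y ^ 2 <= 9).
    { intros y Hy. split; [apply pow2_ge_0|]. replace 9 with (3 ^ 2) by ring. apply pow_incr, Hy. }
    assert (P3 : forall y, 0 <= y <= 3 -> 0 <= y ^ 3 <= 27).
    { intros y Hy. split; [apply pow_le, Hy|]. replace 27 with (3 ^ 3) by ring. apply pow_incr, Hy. }
    pose proof (P2 _ B0). pose proof (P2 _ B1). pose proof (P2 _ B2). pose proof (P2 _ B3).
    pose proof (P3 _ B0). pose proof (P3 _ B1). pose proof (P3 _ B2). pose proof (P3 _ B3).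
    unfold step, step1, step2. repeat split; apply Rabs_le_between; lra.
  - destruct (step_high t) as [-> [-> ->]]; [lra|]. rewrite Rabs_R1, Rabs_R0. repeat split; lra.
Qed.

Lemma C2fun_affine F F1 F2 a b : C2fun F F1 F2 ->
  C2fun (fun t => F (a * t + b)) (fun t => a * F1 (a * t + b)) (fun t => a ^ 2 * F2 (a * t + b)).
Proof.
  intros [H1 [H2 H3]].
  assert (Hd : forall (G : R -> R) t l, is_derive G (a * t + b) l -> is_derive (fun t => G (a * t + b)) t (a * l)).
  { intros G t l HG. apply (is_derive_comp G (fun t => a * t + b)); [exact HG | auto_derive; [exact I | ring]]. }
  split; [|split].
  - intros t. apply Hd, H1.
  - intros t. replace (a ^ 2 * F2 (a * t + b)) with (a * (a * F2 (a * t + b))) by ring.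
    apply is_derive_scal, Hd, H2.
  - intros t. apply (continuous_mult (K := R_AbsRing) (fun _ => a ^ 2) (fun t => F2 (a * t + b))); [apply continuous_const|].
    apply (continuous_comp (fun t => a * t + b) F2); [|apply H3].
    refine (is_derive_cont _ t a _). auto_derive; [exact I | ring].
Qed.

Lemma C2fun_mult F F1 F2 G G1 G2 : C2fun F F1 F2 -> C2fun G G1 G2 ->
  C2fun (fun t => F t * G t) (fun t => F1 t * G t + F t * G1 t)
    (fun t => F2 t * G t + 2 * (F1 t * G1 t) + F t * G2 t).
Proof.
  intros [A1 [A2 A3]] [B1 [B2 B3]].
  split; [|split]; intros t.
  - apply is_derive_mult_R; [apply A1 | apply B1].
  - replace (F2 t * G t + 2 * (F1 t * G1 t) + F t * G2 t) with
      ((F2 t * G t + F1 t * G1 t) + (F1 t * G1 t + F t * G2 t)) by ring.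
    apply (is_derive_plus (fun t => F1 t * G t) (fun t => F t * G1 t));
      apply is_derive_mult_R; [apply A2 | apply B1 | apply A1 | apply B2].
  - assert (Fc := is_derive_cont _ _ _ (A1 t)). assert (F1c := is_derive_cont _ _ _ (A2 t)).
    assert (Gc := is_derive_cont _ _ _ (B1 t)). assert (G1c := is_derive_cont _ _ _ (B2 t)).
    apply (continuous_plus (V := R_NormedModule) (fun t => F2 t * G t + 2 * (F1 t * G1 t)) (fun t => F t * G2 t)).
    + apply (continuous_plus (V := R_NormedModule) (fun t => F2 t * G t) (fun t => 2 * (F1 t * G1 t))).
      * apply (continuous_mult (K := R_AbsRing) F2 G); [apply A3 | exact Gc].
      * apply (continuous_mult (K := R_AbsRing) (fun _ => 2) (fun t => F1 t * G1 t)); [apply continuous_const|].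
        apply (continuous_mult (K := R_AbsRing) F1 G1); assumption.
    + apply (continuous_mult (K := R_AbsRing) F G2); [exact Fc | apply B3].
Qed.

(** * The weak formulation on the exterior half space *)

(** [T0] is the square of the excluded radius, which avoids square roots. *)
Definition half_exterior (T0 : R) (x : point) : Prop := 0 < x X3 /\ T0 < dot x x.

Definition zero_trace (T0 : R) (w : point -> R) : Prop :=
  forall p, p X3 = 0 -> T0 < dot p p -> forall eps, 0 < eps ->
    exists d, 0 < d /\ forall x, half_exterior T0 x -> near p d x -> Rabs (w x) < eps.

Definition flip_dir (e : point) : point := fun i => sign3 i * e i.

(** Odd in [x3], since flipping [x] amounts to flipping [e]. It vanishes on the plane, where [w] has
    zero boundary values, so no boundary term should survive. *)
Definition odd_power (e : point) (n : nat) (x : point) : R := dot x e ^ n - dot x (flip_dir e) ^ n.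

Lemma continuous_open_lt (f : point -> R) c : (forall p, continuous f p) -> open_set (fun p => c < f p).
Proof.
  intros Hf p Hp. destruct (proj1 (continuous_near f p) (Hf p) (f p - c)) as [d [Hd Hq]]; [lra|].
  exists d. split; [exact Hd|]. intros q Hn. specialize (Hq q Hn). apply Rabs_lt_between in Hq. lra.
Qed.

Lemma continuous_closed_le (f : point -> R) c : (forall p, continuous f p) -> closed_set (fun p => c <= f p).
Proof.
  intros Hf l Hl. apply Rnot_lt_le. intros Hlt.
  destruct (proj1 (continuous_near f l) (Hf l) (c - f l)) as [d [Hd Hq]]; [lra|].
  destruct (Hl d Hd) as [p [Hp Hn]]. specialize (Hq p Hn). apply Rabs_lt_between in Hq. lra.
Qed.

Lemma closed_and K1 K2 : closed_set K1 -> closed_set K2 -> closed_set (fun p => K1 p /\ K2 p).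
Proof.
  intros H1 H2 l Hl. split; [apply H1 | apply H2]; intros eps He;
    destruct (Hl eps He) as [p [[Hp1 Hp2] Hn]]; exists p; auto.
Qed.

Lemma half_exterior_open T0 : open_set (half_exterior T0).
Proof.
  apply open_set_and.
  - apply (continuous_open_lt (fun x => x X3)). intros p. apply cont_coord.
  - apply (continuous_open_lt (fun x => dot x x)). apply dot_self_continuous.
Qed.

Lemma dot_self_coord x i : Rabs (x i) <= 1 + dot x x.
Proof.
  unfold dot, sum3. pose proof (pow2_ge_0 (x X1)). pose proof (pow2_ge_0 (x X2)). pose proof (pow2_ge_0 (x X3)).
  apply Rabs_le_between. destruct i; split; nra.
Qed.

(** Compactness makes the boundary values uniform in a thin layer over the shell; [T0 < T1] keeps
    limit points on the part of the plane where the trace is prescribed. *)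
Lemma zero_trace_layer T0 w T1 T2 mu :
  zero_trace T0 w -> T0 < T1 -> 0 < mu ->
  exists d, 0 < d /\ forall x, half_exterior T0 x -> T1 <= dot x x <= T2 -> x X3 < d -> Rabs (w x) <= mu.
Proof.
  intros Hw HT Hmu. apply NNPP. intros Hn.
  destruct (compact_cluster (fun n x => half_exterior T0 x /\ T1 <= dot x x /\ x X3 < / (INR n + 1) /\ mu < Rabs (w x))
    (1 + T2)) as [l Hl].
  { intros n. apply NNPP. intros Hm. apply Hn. exists (/ (INR n + 1)). split.
    - apply Rinv_0_lt_compat. pose proof (pos_INR n). lra.
    - intros x Hx HxT Hx3. apply Rnot_lt_le. intros Hlt. apply Hm. exists x.
      split; [tauto|]. intros i. pose proof (dot_self_coord x i). lra. }
  assert (HlT : T1 <= dot l l).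
  { apply (continuous_closed_le (fun x => dot x x) T1 dot_self_continuous l). intros eps He.
    destruct (Hl eps O He) as [n [x [_ [[_ [Hx _]] Hnx]]]]. exists x; auto. }
  assert (Hl3 : l X3 = 0).
  { apply Rle_antisym; apply Rnot_lt_le; intros Hlt.
    - destruct (inv_INR_lt (l X3 / 2)) as [N HN]; [lra|].
      destruct (Hl (l X3 / 2) N) as [n [x [Hn' [[_ [_ [Hx _]]] Hnx]]]]; [lra|].
      specialize (HN n Hn'). specialize (Hnx X3). apply Rabs_lt_between in Hnx. lra.
    - destruct (Hl (- l X3) O) as [n [x [_ [[[Hx _] _] Hnx]]]]; [lra|].
      specialize (Hnx X3). apply Rabs_lt_between in Hnx. lra. }
  destruct (Hw l Hl3 ltac:(lra) mu Hmu) as [d [Hd Hd']].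
  destruct (Hl d O Hd) as [n [x [_ [[Hx [_ [_ Hwx]]] Hnx]]]].
  specialize (Hd' x Hx Hnx). lra.
Qed.

Lemma flip_dir_unit e : dot e e = 1 -> dot (flip_dir e) (flip_dir e) = 1.
Proof. intros H. rewrite <- H. unfold dot, sum3, flip_dir, sign3. ring. Qed.

Lemma odd_power_plane e n x : x X3 = 0 -> odd_power e n x = 0.
Proof.
  intros H. unfold odd_power. replace (dot x (flip_dir e)) with (dot x e); [ring|].
  unfold dot, sum3, flip_dir, sign3. rewrite H. ring.
Qed.

Lemma odd_power_laplacian e n F F1 F2 :
  dot e e = 1 -> C2fun F F1 F2 ->
  c2_on (fun _ => True) (fun x => odd_power e n x * F (dot x x)) /\
  forall x, laplacian (fun x => odd_power e n x * F (dot x x)) x =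
    INR n * INR (n - 1) * (odd_power e (n - 2) x * F (dot x x)) +
    odd_power e n x * (4 * dot x x * F2 (dot x x) + (6 + 4 * INR n) * F1 (dot x x)).
Proof.
  intros He HF.
  destruct (power_radial_laplacian e n F F1 F2 He HF) as [A1 A2].
  destruct (power_radial_laplacian (flip_dir e) n F F1 F2 (flip_dir_unit e He) HF) as [B1 B2].
  destruct (c2_lin _ _ _ 1 (-1) full_open A1 B1) as [C1 [_ C2]].
  destruct (c2_ext (fun _ => True) _ (fun x => odd_power e n x * F (dot x x)) full_open
    (fun x _ => ltac:(unfold odd_power; ring) :
      1 * (dot x e ^ n * F (dot x x)) + -1 * (dot x (flip_dir e) ^ n * F (dot x x)) = odd_power e n x * F (dot x x)) C1)
    as [D1 [_ D2]].
  split; [exact D1|]. intros x. specialize (A2 x). specialize (B2 x).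
  unfold laplacian, sum3 in *. rewrite !D2, !C2 by exact I.
  transitivity (1 * (d2 X1 (fun x => dot x e ^ n * F (dot x x)) x + d2 X2 (fun x => dot x e ^ n * F (dot x x)) x
    + d2 X3 (fun x => dot x e ^ n * F (dot x x)) x) + -1 * (d2 X1 (fun x => dot x (flip_dir e) ^ n * F (dot x x)) x
    + d2 X2 (fun x => dot x (flip_dir e) ^ n * F (dot x x)) x + d2 X3 (fun x => dot x (flip_dir e) ^ n * F (dot x x)) x)); [ring|].
  rewrite A2, B2. unfold odd_power. ring.
Qed.

(** The test function does not vanish near the plane, so it is first cut off in a layer of thickness
    comparable to [d]. There [P = O(d)], the cutoff has derivatives of order [1 / d] and
    [1 / d ^ 2], and the volume is [O(d)]; the error is thus a constant times the supremum [mu] of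
    [w] in the layer. Only the boundary values of [w] enter, not its gradient. *)
Lemma weak_identity k T0 w Bw e n F F1 F2 T1 T2 :
  0 <= T0 -> helm_on k (half_exterior T0) w -> zero_trace T0 w -> 0 < Bw ->
  (forall x, half_exterior T0 x -> Rabs (w x) <= Bw) ->
  dot e e = 1 -> C2fun F F1 F2 -> T0 < T1 -> T1 < T2 -> (forall t, t <= T1 \/ T2 <= t -> F t = 0) ->
  Null (fun x => extend (half_exterior T0) w x *
    (laplacian (fun x => odd_power e n x * F (dot x x)) x + k ^ 2 * (odd_power e n x * F (dot x x)))).
Proof.
  intros HT0 Hw Htr HBw Hb He HF HT1 HT2 Hsupp.
  set (D := half_exterior T0). set (P := fun x => odd_power e n x * F (dot x x)).
  destruct (odd_power_laplacian e n F F1 F2 He HF) as [HP _]. fold P in HP |- *.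
  set (G := fun x => laplacian P x + k ^ 2 * P x).
  change (Null (fun x => extend D w x * G x)).
  set (L := 2 + T2). assert (HL : 0 < L) by (unfold L; lra).
  assert (Pz : forall x, dot x x <= T1 \/ T2 <= dot x x -> P x = 0).
  { intros x Hx. unfold P. rewrite Hsupp by exact Hx. ring. }
  assert (Pnear : forall x, dot x x < T1 \/ T2 < dot x x -> zero_near P x).
  { intros x [Hx|Hx].
    - destruct (continuous_open_lt (fun y => - dot y y) (- T1)) with (p := x) as [r [Hr Hr']].
      + intros p. apply cont_opp, dot_self_continuous.
      + lra.
      + exists r. split; [exact Hr|]. intros y Hy. apply Pz. specialize (Hr' y Hy). lra.
    - destruct (continuous_open_lt (fun y => dot y y) T2 dot_self_continuous x Hx) as [r [Hr Hr']].
      exists r. split; [exact Hr|]. intros y Hy. apply Pz. specialize (Hr' y Hy). lra. }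
  set (z := fun _ : axis => 0).
  destruct (cube_bounded z L) as [B HB].
  destruct (continuous_bounded (cube z L) G B HB (cube_closed z L)) as [CG [HCG HG]].
  { intros p _. unfold G, laplacian, sum3. apply cont_plus.
    - apply cont_plus; [apply cont_plus|]; exact (c2_cont2 P p (HP p I) _).
    - apply cont_mult; [apply cont_const | apply c2_cont, HP; exact I]. }
  destruct (continuous_bounded (cube z L) (d1 X3 P) B HB (cube_closed z L)) as [Cd [HCd HdP]].
  { intros p _. apply c2_cont1, HP. exact I. }
  intros eta Heta.
  (* With 40 bounding [step] and its derivatives, [41 = 1 + 40] bounds the factor [1 - step], and
     [240 = 2 * 40 + 4 * 40] collects the mixed term and the term with the second derivative. The
     constant 512 in [mu] brings the final error to [eta / 4]. *)
  set (CC := 41 * CG + 240 * Cd). assert (HCC : 0 < CC) by (unfold CC; lra).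
  set (mu := eta / (512 * CC * L ^ 2)).
  assert (HL2 : 0 < L ^ 2) by (apply pow_lt, HL).
  assert (Hmu : 0 < mu) by (apply Rdiv_lt_0_compat; [lra | repeat apply Rmult_lt_0_compat; lra]).
  destruct (zero_trace_layer T0 w T1 T2 mu Htr HT1 Hmu) as [d0 [Hd0 Hlayer]].
  set (d := Rmin 1 (d0 / 4)).
  assert (Hd : 0 < d) by (apply Rmin_glb_lt; lra).
  assert (Hd1 : d <= 1) by apply Rmin_l. assert (Hd2 : d <= d0 / 4) by apply Rmin_r.
  (* Zero for heights up to [d], one from [4 * d] on; this is why [d] is at most [d0 / 4]. *)
  set (th := fun t => step (/ d * t + -1)).
  pose proof (C2fun_affine _ _ _ (/ d) (-1) C2fun_step) as Hth. fold th in Hth.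
  destruct (c2_linear (basis X3) _ _ _ Hth) as [T1' [T2' T3']].
  assert (Edot : forall x, dot x (basis X3) = x X3) by (intros x; unfold dot, sum3, basis; simpl; ring).
  set (Th := fun x => th (dot x (basis X3))) in *.
  destruct (c2_mult _ _ _ full_open HP T1') as [Q1 [_ Q3]].
  set (phi := fun x => P x * Th x) in *.
  assert (Hnull : Null (fun x => extend D w x * (laplacian phi x + k ^ 2 * phi x))).
  { apply (green_limit k D (fun x => (T1 <= dot x x /\ - T2 <= - dot x x) /\ d <= x X3) w phi Bw L); try assumption.
    - apply half_exterior_open.
    - intros p [[_ Hp] _] i. pose proof (dot_self_coord p i). unfold L. lra.
    - apply closed_and; [apply closed_and|].
      + apply (continuous_closed_le (fun x => dot x x)), dot_self_continuous.
      + apply (continuous_closed_le (fun x => - dot x x)). intros p. apply cont_opp, dot_self_continuous.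
      + apply (continuous_closed_le (fun x => x X3)). intros p. apply cont_coord.
    - intros p [[Hp _] Hp3]. split; lra.
    - intros x Hx. unfold phi. destruct (Rlt_dec (x X3) d) as [H3|H3].
      + unfold Th, th. rewrite Edot.
        destruct (step_low (/ d * x X3 + -1)) as [-> _]; [|ring].
        assert (/ d * x X3 <= / d * d) by (apply Rmult_le_compat_l; [apply Rlt_le, Rinv_0_lt_compat, Hd | lra]).
        rewrite Rinv_l in H by lra. lra.
      + rewrite (Pz x); [ring|]. apply NNPP. intros Hn. apply Hx. lra. }
  set (Ex := fun x => extend D w x * (G x - (laplacian phi x + k ^ 2 * phi x))).
  apply Small_ext with (F := fun x => extend D w x * (laplacian phi x + k ^ 2 * phi x) + Ex x).
  { intros x. unfold Ex. ring. }
  replace eta with (eta / 2 + eta / 2) by field.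
  apply Small_plus; [apply Hnull; lra|].
  set (lo := fun i => match i with X3 => 0 | _ => - L end).
  set (hi := fun i => match i with X3 => 4 * d | _ => L end).
  assert (Hlh : forall i, lo i < hi i) by (intros []; unfold lo, hi; lra).
  assert (Hc : 0 <= mu * (CC / d)) by (apply Rmult_le_pos; [lra | apply Rdiv_le_0_compat; lra]).
  apply Small_le with (a := 8 * (mu * (CC / d)) * ((hi X1 - lo X1) * ((hi X2 - lo X2) * (hi X3 - lo X3)))).
  { unfold hi, lo.
    replace (8 * (mu * (CC / d)) * ((L - - L) * ((L - - L) * (4 * d - 0)))) with (128 * mu * CC * L ^ 2) by (field; lra).
    replace (128 * mu * CC * L ^ 2) with (eta / 4) by (unfold mu; field; split; lra). lra. }
  apply (Small_box lo hi (mu * (CC / d)) Ex Hlh Hc).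
  intros x. unfold Ex.
  destruct (classic (D x)) as [Dx|Dx].
  2: { unfold D. rewrite extend_out by exact Dx. rewrite Rmult_0_l, Rabs_R0.
       apply Rmult_le_pos; [exact Hc | apply boxind_nonneg]. }
  destruct (classic (T1 <= dot x x <= T2)) as [HxT|HxT].
  2: { assert (ZP : zero_near P x) by (apply Pnear; lra).
       assert (Zphi : zero_near phi x).
       { destruct ZP as [r [Hr Hr']]. exists r. split; [exact Hr|]. intros y Hy. unfold phi. rewrite Hr' by exact Hy. ring. }
       unfold G. rewrite (laplacian_zero_near P x ZP), (laplacian_zero_near phi x Zphi),
         (zero_near_at P x ZP), (zero_near_at phi x Zphi).
       replace (extend D w x * (0 + k ^ 2 * 0 - (0 + k ^ 2 * 0))) with 0 by ring. rewrite Rabs_R0.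
       apply Rmult_le_pos; [exact Hc | apply boxind_nonneg]. }
  assert (Elap : laplacian phi x + k ^ 2 * phi x =
    Th x * G x + 2 * (d1 X3 P x * (/ d * step1 (/ d * x X3 + -1))) + P x * ((/ d) ^ 2 * step2 (/ d * x X3 + -1))).
  { unfold laplacian, sum3. rewrite !Q3 by exact I. rewrite !T2', !T3'. rewrite !Edot.
    unfold G, laplacian, sum3, phi. rewrite (basis_eq X3), (basis_neq X3 X1), (basis_neq X3 X2) by discriminate.  ring. }
  rewrite Elap. unfold Th, th. rewrite Edot. set (s := / d * x X3 + -1).
  destruct (Rle_dec (4 * d) (x X3)) as [H3|H3].
  { destruct (step_high s) as [-> [-> ->]].
    { unfold s. assert (/ d * (4 * d) <= / d * x X3) by (apply Rmult_le_compat_l; [apply Rlt_le, Rinv_0_lt_compat, Hd | lra]).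
      replace (/ d * (4 * d)) with 4 in H by (field; lra). lra. }
    match goal with |- Rabs ?a <= _ => replace a with 0 by ring end. rewrite Rabs_R0.
    apply Rmult_le_pos; [exact Hc | apply boxind_nonneg]. }
  destruct Dx as [Hx3 HxT0].
  assert (Hxc : forall i, Rabs (x i) <= 1 + T2) by (intros i; pose proof (dot_self_coord x i); lra).
  assert (Hbox : boxind lo hi x = 1).
  { destruct (boxind_cases lo hi x) as [[_ Hx]|[[i Hx] _]]; [exact Hx|]. exfalso.
    specialize (Hxc i). apply Rabs_le_between in Hxc. unfold lo, hi, L in Hx. destruct i; lra. }
  rewrite Hbox, Rmult_1_r, Rabs_mult.
  assert (Hcx : cube z L x).
  { intros i. unfold z, L. rewrite Rminus_0_r. specialize (Hxc i). lra. }
  assert (Hwx : Rabs (extend D w x) <= mu).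
  { unfold D. rewrite extend_in by (split; assumption). apply Hlayer; [split; assumption | exact HxT | lra]. }
  apply Rmult_le_compat; try apply Rabs_pos; [exact Hwx|].
  (* [P] vanishes on the plane, so the mean value theorem gains the factor [d] that compensates the
     second derivative of the cutoff. *)
  assert (HPx : Rabs (P x) <= 4 * d * Cd).
  { destruct (mvt_coordinate P (fun _ => True) x X3 (- x X3)) as [c [Hc1 Hc2]].
    - intros y _. apply c2_d1, HP. exact I.
    - intros c _. exact I.
    - assert (Hz0 : P (line x (basis X3) (- x X3)) = 0).
      { unfold P. rewrite odd_power_plane; [ring|]. unfold line. rewrite basis_eq. ring. }
      rewrite Hz0 in Hc2. rewrite Rabs_Ropp, (Rabs_pos_eq (x X3)) in Hc1 by lra.
      replace (P x) with (x X3 * d1 X3 P (line x (basis X3) c)) by lra.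
      rewrite Rabs_mult, (Rabs_pos_eq (x X3)) by lra.
      apply Rmult_le_compat; try apply Rabs_pos; [lra | lra |].
      apply HdP. intros i. unfold z, L. rewrite Rminus_0_r.
      pose proof (line_basis_near x X3 c) as Hnr. unfold line in *.
      pose proof (Hxc i) as Hxi. pose proof (Rabs_triang (x i) (c * basis X3 i)) as Ht.
      rewrite Rabs_mult in Ht. pose proof (basis_le X3 i). pose proof (Rabs_pos (basis X3 i)).
      destruct i.
      + rewrite (basis_neq X3 X1) in * by discriminate. rewrite Rmult_0_r, Rplus_0_r. lra.
      + rewrite (basis_neq X3 X2) in * by discriminate. rewrite Rmult_0_r, Rplus_0_r. lra.
      + rewrite basis_eq, Rmult_1_r in *. apply Rabs_le_between in Hc1. apply Rabs_le_between in Hxi.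
        apply Rabs_le_between. pose proof (Hxc X3) as H4. rewrite (Rabs_pos_eq (x X3)) in H4 by lra.
        assert (x X3 < 4) by lra. pose proof (pow2_ge_0 (x X1)). pose proof (pow2_ge_0 (x X2)).
        assert (x X3 ^ 2 <= T2) by (unfold dot, sum3 in HxT; nra). split; nra. }
  destruct (step_bound s) as [S0 [S1 S2]].
  assert (HGx : Rabs (G x) <= CG) by (apply HG, Hcx).
  assert (Hdx : Rabs (d1 X3 P x) <= Cd) by (apply HdP, Hcx).
  assert (Hid : 1 <= / d) by (rewrite <- Rinv_1; apply Rinv_le_contravar; lra).
  replace (G x - (step s * G x + 2 * (d1 X3 P x * (/ d * step1 s)) + P x * ((/ d) ^ 2 * step2 s)))
    with (((1 - step s) * G x) + (- (2 * (d1 X3 P x * step1 s) * / d) + - ((P x * / d) * step2 s * / d))) by ring.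
  apply Rle_trans with (41 * CG + (2 * (Cd * 40) * / d + (4 * Cd * 40) * / d)).
  - eapply Rle_trans; [apply Rabs_triang|]. apply Rplus_le_compat.
    + rewrite Rabs_mult. apply Rmult_le_compat; try apply Rabs_pos; [|exact HGx].
      apply Rabs_le_between in S0. apply Rabs_le_between. lra.
    + eapply Rle_trans; [apply Rabs_triang|]. rewrite !Rabs_Ropp, !Rabs_mult.
      rewrite (Rabs_pos_eq 2), (Rabs_pos_eq (/ d)) by lra.
      apply Rplus_le_compat; apply Rmult_le_compat_r; try lra.
      * apply Rmult_le_compat_l; [lra|]. apply Rmult_le_compat; try apply Rabs_pos; assumption.
      * apply Rmult_le_compat; try apply Rabs_pos; [apply Rmult_le_pos; [apply Rabs_pos | lra] | | exact S2].
        apply Rmult_le_reg_r with d; [exact Hd|]. rewrite Rmult_assoc, Rinv_l by lra. lra.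
  - unfold CC, Rdiv. nra.
Qed.

(** * The radial equation *)

(* In the variable [t = |x| ^ 2], a solution [Y x * a (|x| ^ 2)] with a homogeneous harmonic [Y] of degree [n] satisfies
   [4 t a'' + (6 + 4 n) a' + k ^ 2 a = 0]; [bessel] pairs [a] with [a']. *)
Fixpoint bessel (k : R) (a0 a1 : R -> R) (n : nat) : (R -> R) * (R -> R) :=
  match n with
  | O => (a0, a1)
  | S n => let p := bessel k a0 a1 n in
      (snd p, fun t => - ((6 + 4 * INR n) * snd p t + k ^ 2 * fst p t) / (4 * t))
  end.

Definition bessel_eq (k : R) (n : nat) (a a1 : R -> R) : Prop :=
  forall t, 0 < t -> is_derive a t (a1 t) /\
    is_derive a1 t (- ((6 + 4 * INR n) * a1 t + k ^ 2 * a t) / (4 * t)).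

(** With [r = sqrt t]: a homogeneous factor of degree [n] times [a] is [O(1 / r)], the decay of a
    spherical wave. The derivative in [t] gains only one power of [1 / r] because the waves
    oscillate in [r]. *)
Definition bessel_decay (n : nat) (t0 : R) (a a1 : R -> R) : Prop :=
  exists C, 0 < C /\ forall t, t0 <= t ->
    Rabs (a t) <= C * (/ sqrt t) ^ (n + 1) /\ Rabs (a1 t) <= C * (/ sqrt t) ^ (n + 2).

(* Differentiating the equation of order [n] gives the equation of order [n + 1]. *)
Lemma bessel_eq_all k a0 a1 n : bessel_eq k 0 a0 a1 ->
  bessel_eq k n (fst (bessel k a0 a1 n)) (snd (bessel k a0 a1 n)).
Proof.
  intros H. induction n as [|n IH]; [exact H|]. cbn [bessel]; cbv zeta; cbn [fst snd].
  set (a := fst (bessel k a0 a1 n)) in *. set (b := snd (bessel k a0 a1 n)) in *. cbv beta iota delta [fst snd].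
  intros t Ht. destruct (IH t Ht) as [D1 D2]. split; [exact D2|].
  set (F := - ((6 + 4 * INR n) * b t + k ^ 2 * a t) / (4 * t)) in *.
  assert (D3 : is_derive (fun s => - ((6 + 4 * INR n) * b s + k ^ 2 * a s)) t (- ((6 + 4 * INR n) * F + k ^ 2 * b t))).
  { apply (is_derive_opp (fun s => (6 + 4 * INR n) * b s + k ^ 2 * a s)).
    apply (is_derive_plus (fun s => (6 + 4 * INR n) * b s) (fun s => k ^ 2 * a s));
      apply is_derive_scal; assumption. }
  assert (D4 : is_derive (fun s => / (4 * s)) t (- 4 / (4 * t) ^ 2)).
  { auto_derive; [lra | field; lra]. }
  pose proof (is_derive_mult_R _ _ _ _ _ D3 D4) as D5. cbv beta in D5.
  replace (- ((6 + 4 * INR (S n)) * F + k ^ 2 * b t) / (4 * t)) with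
    (- ((6 + 4 * INR n) * F + k ^ 2 * b t) * / (4 * t) +
     - ((6 + 4 * INR n) * b t + k ^ 2 * a t) * (- 4 / (4 * t) ^ 2)).
  - exact D5.
  - rewrite S_INR.
    replace (- ((6 + 4 * INR n) * b t + k ^ 2 * a t) * (- 4 / (4 * t) ^ 2)) with (- 4 / (4 * t) * F)
      by (unfold F; field; lra).
    field. lra.
Qed.

(** The next pair consists of [a'] and [a''], and the equation expresses [a''] with the factor
    [1 / (4 * t)], which supplies the two powers of [1 / sqrt t] required. *)
Lemma bessel_decay_all k a0 a1 t0 n : 0 < t0 -> bessel_decay 0 t0 a0 a1 ->
  bessel_decay n t0 (fst (bessel k a0 a1 n)) (snd (bessel k a0 a1 n)).
Proof.
  intros Ht0 H. induction n as [|n IH]; [exact H|]. cbn [bessel]; cbv zeta; cbn [fst snd].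
  set (a := fst (bessel k a0 a1 n)) in *. set (b := snd (bessel k a0 a1 n)) in *. cbv beta iota delta [fst snd].
  destruct IH as [C [HC IH]].
  assert (Hs0 : 0 < sqrt t0) by (apply sqrt_lt_R0, Ht0).
  pose proof (pos_INR n) as Hn. pose proof (pow2_ge_0 k) as Hk.
  assert (Hi0 : 0 < / sqrt t0) by (apply Rinv_0_lt_compat, Hs0).
  exists (C + C * ((6 + 4 * INR n) * / sqrt t0 + k ^ 2)).
  assert (Hc2 : 0 <= C * ((6 + 4 * INR n) * / sqrt t0 + k ^ 2)).
  { apply Rmult_le_pos; [lra|]. apply Rplus_le_le_0_compat; [|exact Hk]. apply Rmult_le_pos; lra. }
  split; [lra|]. intros t Ht. destruct (IH t Ht) as [Ba Bb].
  assert (Htp : 0 < t) by lra.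
  assert (Hs : 0 < sqrt t) by (apply sqrt_lt_R0, Htp).
  assert (Hi : 0 < / sqrt t) by (apply Rinv_0_lt_compat, Hs).
  assert (Hii : / sqrt t <= / sqrt t0) by (apply Rinv_le_contravar; [exact Hs0 | apply sqrt_le_1; lra]).
  assert (Ett : / t = / sqrt t * / sqrt t) by (rewrite <- Rinv_mult, sqrt_sqrt by lra; reflexivity).
  set (q := / sqrt t) in *.
  assert (Hq : forall m, 0 < q ^ m) by (intros m; apply pow_lt, Hi).
  split.
  - replace (S n + 1)%nat with (n + 2)%nat by lia. specialize (Hq (n + 2)%nat). nra.
  - replace (S n + 2)%nat with (n + 1 + 2)%nat by lia.
    replace (- ((6 + 4 * INR n) * b t + k ^ 2 * a t) / (4 * t)) with
      (/ 4 * (q * q) * (- ((6 + 4 * INR n) * b t + k ^ 2 * a t))) by (rewrite <- Ett; field; lra).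
    rewrite Rabs_mult, Rabs_Ropp, (Rabs_pos_eq (/ 4 * (q * q))) by nra.
    assert (B1 : Rabs ((6 + 4 * INR n) * b t + k ^ 2 * a t) <= C * ((6 + 4 * INR n) * / sqrt t0 + k ^ 2) * q ^ (n + 1)).
    { eapply Rle_trans; [apply Rabs_triang|]. rewrite !Rabs_mult, (Rabs_pos_eq (6 + 4 * INR n)), (Rabs_pos_eq (k ^ 2)) by lra.
      replace (n + 2)%nat with (S (n + 1)) in Bb by lia. simpl in Bb.
      specialize (Hq (n + 1)%nat).
      assert (Rabs (b t) <= C * / sqrt t0 * q ^ (n + 1)).
      { eapply Rle_trans; [exact Bb|]. rewrite <- Rmult_assoc. apply Rmult_le_compat_r; [lra|]. apply Rmult_le_compat_l; lra. }
      assert ((6 + 4 * INR n) * Rabs (b t) <= (6 + 4 * INR n) * (C * / sqrt t0 * q ^ (n + 1))) by (apply Rmult_le_compat_l; lra).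
      assert (k ^ 2 * Rabs (a t) <= k ^ 2 * (C * q ^ (n + 1))) by (apply Rmult_le_compat_l; lra).
      lra. }
    replace (q ^ (n + 1 + 2)) with (q * q * q ^ (n + 1)) by (rewrite (pow_add q (n + 1) 2); ring).
    assert (0 < q * q) by (apply Rmult_lt_0_compat; lra).
    set (R0 := C * ((6 + 4 * INR n) * / sqrt t0 + k ^ 2)) in *. specialize (Hq (n + 1)%nat).
    apply Rle_trans with (/ 4 * (q * q) * (R0 * q ^ (n + 1))).
    + apply Rmult_le_compat_l; [lra | exact B1].
    + assert (0 <= q * q * q ^ (n + 1)) by (apply Rmult_le_pos; lra). nra.
Qed.

Definition wronskian (a a1 b b1 : R -> R) (t : R) : R := a t * b1 t - a1 t * b t.

(** Passing from one order to the next multiplies the Wronskian by [k ^ 2 / (4 * t)]. *)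
Lemma wronskian_all k a0 a1 b0 b1 n t : k <> 0 -> 0 < t -> wronskian a0 a1 b0 b1 t <> 0 ->
  wronskian (fst (bessel k a0 a1 n)) (snd (bessel k a0 a1 n)) (fst (bessel k b0 b1 n)) (snd (bessel k b0 b1 n)) t <> 0.
Proof.
  intros Hk Ht H. induction n as [|n IH]; [exact H|]. cbn [bessel]; cbv zeta; cbn [fst snd]. unfold wronskian in *.
  cbv beta iota delta [fst snd] in *. fold (fst (A := R -> R) (B := R -> R)) in *.
  set (pa := bessel k a0 a1 n) in *. set (pb := bessel k b0 b1 n) in *. destruct pa as [a a'], pb as [b b'].
  replace (a' t * (- ((6 + 4 * INR n) * b' t + k ^ 2 * b t) / (4 * t)) -
    - ((6 + 4 * INR n) * a' t + k ^ 2 * a t) / (4 * t) * b' t) with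
    (k ^ 2 / (4 * t) * (a t * b' t - a' t * b t)) by (field; lra).
  apply Rmult_integral_contrapositive_currified; [|exact IH].
  apply Rmult_integral_contrapositive_currified; [apply pow_nonzero, Hk | apply Rinv_neq_0_compat; lra].
Qed.

(** With [r = sqrt t], the spherical waves [sin (k r) / r] and, in [cosc], [cos (k r) / r]; [sinc1]
    and [cosc1] are their derivatives with respect to [t]. *)
Definition sinc (k t : R) : R := sin (k * sqrt t) / sqrt t.
Definition sinc1 (k t : R) : R := k * cos (k * sqrt t) / (2 * t) - sin (k * sqrt t) / (2 * t * sqrt t).
Definition cosc (k t : R) : R := cos (k * sqrt t) / sqrt t.
Definition cosc1 (k t : R) : R := - (k * sin (k * sqrt t) / (2 * t)) - cos (k * sqrt t) / (2 * t * sqrt t).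

Lemma sinc_bessel k : bessel_eq k 0 (sinc k) (sinc1 k).
Proof.
  intros t Ht. assert (Hs : 0 < sqrt t) by (apply sqrt_lt_R0, Ht).
  assert (E : t = sqrt t * sqrt t) by (rewrite sqrt_sqrt; lra).
  split; unfold sinc, sinc1; auto_derive; try (repeat split; lra || nra).
  - set (r := sqrt t) in *. rewrite E. field. lra.
  - simpl INR. set (r := sqrt t) in *. rewrite E. field. lra.
Qed.

Lemma cosc_bessel k : bessel_eq k 0 (cosc k) (cosc1 k).
Proof.
  intros t Ht. assert (Hs : 0 < sqrt t) by (apply sqrt_lt_R0, Ht).
  assert (E : t = sqrt t * sqrt t) by (rewrite sqrt_sqrt; lra).
  split; unfold cosc, cosc1; auto_derive; try (repeat split; lra || nra).
  - set (r := sqrt t) in *. rewrite E. field. lra.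
  - simpl INR. set (r := sqrt t) in *. rewrite E. field. lra.
Qed.

Lemma trig_decay (k t0 : R) (a a1 : R -> R) : 0 < t0 ->
  (forall t, 0 < t -> exists p q, Rabs p <= 1 /\ Rabs q <= 1 /\
    a t = p / sqrt t /\ a1 t = k * q / (2 * t) - p / (2 * t * sqrt t)) ->
  bessel_decay 0 t0 a a1.
Proof.
  intros Ht0 H. assert (Hs0 : 0 < sqrt t0) by (apply sqrt_lt_R0, Ht0).
  exists (1 + Rabs k + / sqrt t0). pose proof (Rabs_pos k) as Hk.
  assert (Hi0 : 0 < / sqrt t0) by (apply Rinv_0_lt_compat, Hs0).
  split; [lra|]. intros t Ht. assert (Htp : 0 < t) by lra.
  destruct (H t Htp) as [p [q [Hp [Hq [-> ->]]]]].
  assert (Hs : 0 < sqrt t) by (apply sqrt_lt_R0, Htp).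
  assert (Hi : 0 < / sqrt t) by (apply Rinv_0_lt_compat, Hs).
  assert (Hii : / sqrt t <= / sqrt t0) by (apply Rinv_le_contravar; [exact Hs0 | apply sqrt_le_1; lra]).
  assert (E : t = sqrt t * sqrt t) by (rewrite sqrt_sqrt; lra).
  set (r := sqrt t) in *. simpl Nat.add. split.
  - unfold Rdiv. rewrite Rabs_mult, (Rabs_pos_eq (/ r)) by lra. rewrite pow_1.
    apply Rmult_le_compat_r; lra.
  - replace (k * q / (2 * t) - p / (2 * t * r)) with (/ 2 * (k * q - p * / r) * (/ r) ^ 2).
    2: { rewrite E. field. lra. }
    rewrite Rabs_mult, (Rabs_pos_eq ((/ r) ^ 2)) by (apply pow2_ge_0).
    apply Rmult_le_compat_r; [apply pow2_ge_0|].
    rewrite Rabs_mult, (Rabs_pos_eq (/ 2)) by lra.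
    assert (Rabs (k * q - p * / r) <= Rabs k + / sqrt t0); [|lra].
    unfold Rminus. eapply Rle_trans; [apply Rabs_triang|]. rewrite Rabs_Ropp, !Rabs_mult, (Rabs_pos_eq (/ r)) by lra.
    pose proof (Rmult_le_compat_l _ _ _ Hk Hq). pose proof (Rabs_pos p). nra.
Qed.

Lemma Rabs_sin_le x : Rabs (sin x) <= 1.
Proof. apply Rabs_le_between. pose proof (SIN_bound x). lra. Qed.

Lemma Rabs_cos_le x : Rabs (cos x) <= 1.
Proof. apply Rabs_le_between. pose proof (COS_bound x). lra. Qed.

Lemma sinc_decay k t0 : 0 < t0 -> bessel_decay 0 t0 (sinc k) (sinc1 k).
Proof.
  intros Ht0. apply (trig_decay k); [exact Ht0|]. intros t Ht.
  exists (sin (k * sqrt t)), (cos (k * sqrt t)). repeat split; [apply Rabs_sin_le | apply Rabs_cos_le].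
Qed.

Lemma cosc_decay k t0 : 0 < t0 -> bessel_decay 0 t0 (cosc k) (cosc1 k).
Proof.
  intros Ht0. apply (trig_decay k); [exact Ht0|]. intros t Ht.
  assert (Hs : 0 < sqrt t) by (apply sqrt_lt_R0, Ht).
  exists (cos (k * sqrt t)), (- sin (k * sqrt t)).
  split; [apply Rabs_cos_le | split; [rewrite Rabs_Ropp; apply Rabs_sin_le | split; [reflexivity|]]].
  unfold cosc1. field. lra.
Qed.

Lemma sinc_cosc_wronskian k t : k <> 0 -> 0 < t -> wronskian (sinc k) (sinc1 k) (cosc k) (cosc1 k) t <> 0.
Proof.
  intros Hk Ht. assert (Hs : 0 < sqrt t) by (apply sqrt_lt_R0, Ht).
  unfold wronskian, sinc, sinc1, cosc, cosc1.
  set (S := sin (k * sqrt t)). set (C := cos (k * sqrt t)).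
  assert (E : S * S + C * C = 1) by (pose proof (sin2_cos2 (k * sqrt t)) as H; unfold Rsqr in H; exact H).
  replace (S / sqrt t * (- (k * S / (2 * t)) - C / (2 * t * sqrt t)) - (k * C / (2 * t) - S / (2 * t * sqrt t)) * (C / sqrt t))
    with (- (k * (S * S + C * C) / (2 * t * sqrt t))) by (field; lra).
  rewrite E, Rmult_1_r. apply Ropp_neq_0_compat.
  apply Rmult_integral_contrapositive_currified; [exact Hk|].
  apply Rinv_neq_0_compat, Rgt_not_eq. repeat apply Rmult_lt_0_compat; lra.
Qed.

Lemma zero_derivative_constant (A c : R -> R) s t :
  (forall x, is_derive A x (c x)) -> (forall x, Rmin s t <= x <= Rmax s t -> c x = 0) -> A s = A t.
Proof.
  intros HA Hc. destruct (MVT_gen A s t c) as [x [Hx Ex]].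
  - intros x _. apply HA.
  - intros x _. apply continuity_pt_filterlim. exact (is_derive_cont _ _ _ (HA x)).
  - rewrite (Hc x Hx) in Ex. lra.
Qed.

Lemma antiderivative (c : R -> R) (T1 T2 : R) :
  T1 < T2 -> (forall t, continuous c t) -> (forall t, t <= T1 \/ T2 <= t -> c t = 0) ->
  exists A, (forall t, is_derive A t (c t)) /\ (forall t, t <= T1 -> A t = 0) /\
    exists M, 0 < M /\ forall t, T2 <= t -> Rabs (A t) <= M.
Proof.
  intros HT Hc Hz. set (A := fun t => RInt c T1 t).
  assert (HA : forall t, is_derive A t (c t)).
  { intros t. apply is_derive_RInt with T1; [|apply Hc].
    exists (mkposreal 1 Rlt_0_1). intros s _. apply RInt_correct.
    apply (ex_RInt_continuous (V := R_CompleteNormedModule)). intros x _. apply Hc. }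
  exists A. split; [exact HA|]. split.
  - intros t Ht. rewrite (zero_derivative_constant A c t T1 HA).
    + exact (RInt_point (V := R_CompleteNormedModule) T1 c).
    + intros x. rewrite Rmin_left, Rmax_right by lra. intros Hx. apply Hz. lra.
  - exists (1 + Rabs (A T2)). pose proof (Rabs_pos (A T2)). split; [lra|].
    intros t Ht. rewrite <- (zero_derivative_constant A c T2 t HA); [lra|].
    intros x. rewrite Rmin_left, Rmax_right by lra. intros Hx. apply Hz. lra.
Qed.

Lemma continuous_zero_left (f : R -> R) T1 t : (forall s, s <= T1 -> f s = 0) -> t < T1 -> continuous f t.
Proof.
  intros Hz Ht. apply (continuous_ext_loc f (fun _ => 0)); [|apply continuous_const].
  exists (mkposreal (T1 - t) ltac:(lra)). intros s Hs. change (Rabs (s - t) < T1 - t) in Hs.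
  apply Rabs_lt_between in Hs. symmetry. apply Hz. lra.
Qed.

Lemma derive_zero_left (f : R -> R) T1 t : (forall s, s <= T1 -> f s = 0) -> t < T1 -> is_derive f t 0.
Proof.
  intros Hz Ht. apply is_derive_ext_loc with (fun _ => 0).
  - exists (mkposreal (T1 - t) ltac:(lra)). intros s Hs. change (Rabs (s - t) < T1 - t) in Hs.
    apply Rabs_lt_between in Hs. symmetry. apply Hz. lra.
  - apply is_derive_Reals, derivable_pt_lim_const.
Qed.

(* Variation of parameters. *)
Lemma radial_solution k n T1 T2 (chi : R -> R) :
  k <> 0 -> 0 < T1 -> T1 < T2 -> (forall t, continuous chi t) ->
  (forall t, t <= T1 \/ T2 <= t -> chi t = 0) ->
  exists psi psi1 psi2, C2fun psi psi1 psi2 /\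
    (forall t, t <= T1 -> psi t = 0) /\
    (forall t, 4 * t * psi2 t + (6 + 4 * INR n) * psi1 t + k ^ 2 * psi t = chi t) /\
    bessel_decay n T2 psi psi1.
Proof.
  intros Hk HT1 HT2 Hchi Hz.
  pose proof (bessel_eq_all k _ _ n (sinc_bessel k)) as Ea.
  pose proof (bessel_eq_all k _ _ n (cosc_bessel k)) as Eb.
  assert (HT2p : 0 < T2) by lra.
  pose proof (bessel_decay_all k _ _ T2 n HT2p (sinc_decay k T2 HT2p)) as Da.
  pose proof (bessel_decay_all k _ _ T2 n HT2p (cosc_decay k T2 HT2p)) as Db.
  pose proof (fun t Ht => wronskian_all k _ _ _ _ n t Hk Ht (sinc_cosc_wronskian k t Hk Ht)) as HW.
  set (a := fst (bessel k (sinc k) (sinc1 k) n)) in *. set (a1 := snd (bessel k (sinc k) (sinc1 k) n)) in *.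
  set (b := fst (bessel k (cosc k) (cosc1 k) n)) in *. set (b1 := snd (bessel k (cosc k) (cosc1 k) n)) in *.
  set (a2 := fun t => - ((6 + 4 * INR n) * a1 t + k ^ 2 * a t) / (4 * t)).
  set (b2 := fun t => - ((6 + 4 * INR n) * b1 t + k ^ 2 * b t) / (4 * t)).
  assert (ca : forall t, 0 < t -> continuous a t) by (intros t Ht; exact (is_derive_cont _ _ _ (proj1 (Ea t Ht)))).
  assert (ca1 : forall t, 0 < t -> continuous a1 t) by (intros t Ht; exact (is_derive_cont _ _ _ (proj2 (Ea t Ht)))).
  assert (cb : forall t, 0 < t -> continuous b t) by (intros t Ht; exact (is_derive_cont _ _ _ (proj1 (Eb t Ht)))).
  assert (cb1 : forall t, 0 < t -> continuous b1 t) by (intros t Ht; exact (is_derive_cont _ _ _ (proj2 (Eb t Ht)))).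
  assert (cm : forall (f g : R -> R) t, continuous f t -> continuous g t -> continuous (fun t => f t * g t) t).
  { intros f g t Hf Hg. exact (continuous_mult (K := R_AbsRing) f g t Hf Hg). }
  assert (cp : forall (f g : R -> R) t, continuous f t -> continuous g t -> continuous (fun t => f t + g t) t).
  { intros f g t Hf Hg. exact (continuous_plus (V := R_NormedModule) f g t Hf Hg). }
  assert (cs : forall (f g : R -> R) t, continuous f t -> continuous g t -> continuous (fun t => f t - g t) t).
  { intros f g t Hf Hg. exact (continuous_minus (V := R_NormedModule) f g t Hf Hg). }
  assert (cc : forall x t : R, continuous (fun _ : R => x) t) by (intros; apply continuous_const).
  assert (c4 : forall t, 0 < t -> continuous (fun t => / (4 * t)) t).
  { intros t Ht. refine (is_derive_cont _ t (- 4 / (4 * t) ^ 2) _). auto_derive; [lra | field; lra]. }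
  set (W := wronskian a a1 b b1) in *.
  assert (cW : forall t, 0 < t -> continuous (fun t => / W t) t).
  { intros t Ht. apply continuous_Rinv_comp; [|apply HW, Ht].
    unfold W, wronskian. apply cs; apply cm; auto. }
  set (cA := fun t => chi t * (a t * (/ (4 * t) * / W t))).
  set (cB := fun t => chi t * (b t * (/ (4 * t) * / W t))).
  (* The homogeneous solutions are singular at [t = 0], but [chi] vanishes up to [T1 > 0], so the
     products extend by zero to all [t]. *)
  assert (ccA : forall t, continuous cA t).
  { intros t. destruct (Rlt_dec 0 t) as [Ht|Ht].
    - unfold cA. apply cm; [apply Hchi|]. apply cm; [auto|]. apply cm; auto.
    - apply continuous_zero_left with T1; [|lra]. intros s Hs. unfold cA. rewrite Hz by auto. ring. }
  assert (ccB : forall t, continuous cB t).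
  { intros t. destruct (Rlt_dec 0 t) as [Ht|Ht].
    - unfold cB. apply cm; [apply Hchi|]. apply cm; [auto|]. apply cm; auto.
    - apply continuous_zero_left with T1; [|lra]. intros s Hs. unfold cB. rewrite Hz by auto. ring. }
  destruct (antiderivative cA T1 T2 HT2 ccA) as [A [A1 [A2 [MA [HMA A3]]]]].
  { intros t Ht. unfold cA. rewrite Hz by exact Ht. ring. }
  destruct (antiderivative cB T1 T2 HT2 ccB) as [B [B1 [B2 [MB [HMB B3]]]]].
  { intros t Ht. unfold cB. rewrite Hz by exact Ht. ring. }
  (* The densities satisfy [b * cA = a * cB], which makes [psi1] the derivative of [psi]. Beyond
     [T2] the coefficients [A] and [B] are bounded, so [psi] inherits the decay of the homogeneous
     solutions. *)
  set (psi := fun t => b t * A t - a t * B t).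
  set (psi1 := fun t => b1 t * A t - a1 t * B t).
  set (psi2 := fun t => (b2 t * A t - a2 t * B t) + (b1 t * cA t - a1 t * cB t)).
  assert (Z0 : forall t, t <= T1 -> psi t = 0) by (intros t Ht; unfold psi; rewrite A2, B2 by exact Ht; ring).
  assert (Z1 : forall t, t <= T1 -> psi1 t = 0) by (intros t Ht; unfold psi1; rewrite A2, B2 by exact Ht; ring).
  assert (Z2 : forall t, t <= T1 -> psi2 t = 0).
  { intros t Ht. unfold psi2, cA, cB. rewrite A2, B2, Hz by auto. ring. }
  exists psi, psi1, psi2. split; [split; [|split]|split; [exact Z0|split]].
  - intros t. destruct (Rlt_dec 0 t) as [Ht|Ht].
    + replace (psi1 t) with ((b1 t * A t + b t * cA t) - (a1 t * B t + a t * cB t)).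
      2: { unfold psi1, cA, cB. ring. }
      apply (is_derive_minus (fun t => b t * A t) (fun t => a t * B t)); apply is_derive_mult_R; auto.
      * apply (Eb t Ht).
      * apply (Ea t Ht).
    + rewrite Z1 by lra. apply derive_zero_left with T1; [exact Z0 | lra].
  - intros t. destruct (Rlt_dec 0 t) as [Ht|Ht].
    + replace (psi2 t) with ((b2 t * A t + b1 t * cA t) - (a2 t * B t + a1 t * cB t)) by (unfold psi2; ring).
      apply (is_derive_minus (fun t => b1 t * A t) (fun t => a1 t * B t)); apply is_derive_mult_R; auto.
      * apply (Eb t Ht).
      * apply (Ea t Ht).
    + rewrite Z2 by lra. apply derive_zero_left with T1; [exact Z1 | lra].
  - intros t. destruct (Rlt_dec 0 t) as [Ht|Ht].
    + assert (cA' := is_derive_cont _ _ _ (A1 t)). assert (cB' := is_derive_cont _ _ _ (B1 t)).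
      assert (c2 : forall f f1 : R -> R, continuous f t -> continuous f1 t ->
        continuous (fun t => - ((6 + 4 * INR n) * f1 t + k ^ 2 * f t) / (4 * t)) t).
      { intros f f1 Hf Hf1. unfold Rdiv. apply cm; [|auto].
        apply (continuous_opp (V := R_NormedModule) (fun t => (6 + 4 * INR n) * f1 t + k ^ 2 * f t)).
        apply cp; apply cm; auto. }
      unfold psi2. apply cp; apply cs; apply cm; auto; [unfold b2 | unfold a2]; apply c2; auto.
    + apply continuous_zero_left with T1; [exact Z2 | lra].
  - intros t. destruct (Rlt_dec 0 t) as [Ht|Ht].
    + unfold psi, psi1, psi2, a2, b2, cA, cB.
      pose proof (HW t Ht) as HWt. fold W in HWt.
      assert (EW : W t = a t * b1 t - a1 t * b t) by reflexivity.
      transitivity (chi t * ((a t * b1 t - a1 t * b t) / W t)); [field; split; [exact HWt | lra]|].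
      rewrite <- EW. field. exact HWt.
    + rewrite Z0, Z1, Z2, Hz by lra. ring.
  - destruct Da as [Ca [HCa Da]]. destruct Db as [Cb [HCb Db]].
    exists (Cb * MA + Ca * MB). split; [apply Rplus_lt_0_compat; apply Rmult_lt_0_compat; assumption|].
    intros t Ht. destruct (Da t Ht) as [Da1 Da2]. destruct (Db t Ht) as [Db1 Db2].
    specialize (A3 t Ht). specialize (B3 t Ht).
    unfold psi, psi1. split.
    + unfold Rminus. eapply Rle_trans; [apply Rabs_triang|]. rewrite Rabs_Ropp, !Rabs_mult.
      pose proof (Rmult_le_compat _ _ _ _ (Rabs_pos _) (Rabs_pos _) Db1 A3).
      pose proof (Rmult_le_compat _ _ _ _ (Rabs_pos _) (Rabs_pos _) Da1 B3). lra.
    + unfold Rminus. eapply Rle_trans; [apply Rabs_triang|]. rewrite Rabs_Ropp, !Rabs_mult.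
      pose proof (Rmult_le_compat _ _ _ _ (Rabs_pos _) (Rabs_pos _) Db2 A3).
      pose proof (Rmult_le_compat _ _ _ _ (Rabs_pos _) (Rabs_pos _) Da2 B3). lra.
Qed.

Lemma cauchy_schwarz_unit x e : dot e e = 1 -> dot x e ^ 2 <= dot x x.
Proof.
  intros He. set (c := dot x e).
  assert (E : dot x x - c ^ 2 = dot (fun i => x i - c * e i) (fun i => x i - c * e i)).
  { transitivity (dot x x - 2 * c * dot x e + c ^ 2 * dot e e); [rewrite He; unfold c; ring | unfold dot, sum3; ring]. }
  assert (H : 0 <= dot x x - c ^ 2); [|lra].
  rewrite E. unfold dot, sum3.
  pose proof (pow2_ge_0 (x X1 - c * e X1)). pose proof (pow2_ge_0 (x X2 - c * e X2)).
  pose proof (pow2_ge_0 (x X3 - c * e X3)). nra.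
Qed.

Lemma dot_unit_bound x e r : dot e e = 1 -> 0 <= r -> dot x x <= r ^ 2 -> Rabs (dot x e) <= r.
Proof.
  intros He Hr Hx. pose proof (cauchy_schwarz_unit x e He). apply Rabs_le_between. split; nra.
Qed.

Lemma odd_power_bound e n x r : dot e e = 1 -> 0 <= r -> dot x x <= r ^ 2 -> Rabs (odd_power e n x) <= 2 * r ^ n.
Proof.
  intros He Hr Hx. unfold odd_power, Rminus. eapply Rle_trans; [apply Rabs_triang|].
  rewrite Rabs_Ropp, <- !RPow_abs.
  assert (Rabs (dot x e) ^ n <= r ^ n) by (apply pow_incr; split; [apply Rabs_pos | apply dot_unit_bound; assumption]).
  assert (Rabs (dot x (flip_dir e)) ^ n <= r ^ n).
  { apply pow_incr; split; [apply Rabs_pos | apply dot_unit_bound; try assumption; apply flip_dir_unit, He]. }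
  lra.
Qed.

Definition decaying (T0 : R) (w : point -> R) (C : R) : Prop :=
  forall x, half_exterior T0 x -> Rabs (w x) <= C / dot x x.

(** In the shell [t] is comparable to [N ^ 2], while the first and second derivatives of the cutoff
    in [t] are of order [N ^ -2] and [N ^ -4]. The constant is [40], from [step_bound], times
    [32 + 16 + (6 + 4 n)], one summand for each of the three terms. *)
Lemma cutoff_error_bound n N t psi psi1 s1 s2 C :
  1 <= N -> N ^ 2 <= t <= (2 * N) ^ 2 -> 0 < C ->
  Rabs psi <= C * (/ sqrt t) ^ (n + 1) -> Rabs psi1 <= C * (/ sqrt t) ^ (n + 2) ->
  Rabs s1 <= 40 -> Rabs s2 <= 40 ->
  Rabs (4 * t * (2 * (psi1 * (- / N ^ 2 * s1)) + psi * ((- / N ^ 2) ^ 2 * s2)) + (6 + 4 * INR n) * (psi * (- / N ^ 2 * s1)))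
    <= 40 * C * (54 + 4 * INR n) * (/ N) ^ (n + 2).
Proof.
  intros HN Ht HC Hp Hp1 Hs1 Hs2.
  set (q := / N). assert (Hq : 0 < q <= 1).
  { unfold q. split; [apply Rinv_0_lt_compat; lra|]. rewrite <- Rinv_1. apply Rinv_le_contravar; lra. }
  assert (HqN : q * N = 1) by (unfold q; apply Rinv_l; lra).
  assert (Hst : N <= sqrt t) by (rewrite <- (sqrt_pow2 N) by lra; apply sqrt_le_1; nra).
  assert (Hiq : 0 <= / sqrt t <= q).
  { split; [apply Rlt_le, Rinv_0_lt_compat; lra | apply Rinv_le_contravar; lra]. }
  assert (B0 : Rabs psi <= C * q ^ (n + 1)).
  { eapply Rle_trans; [exact Hp|]. apply Rmult_le_compat_l; [lra | apply pow_incr, Hiq]. }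
  assert (B1 : Rabs psi1 <= C * q ^ (n + 2)).
  { eapply Rle_trans; [exact Hp1|]. apply Rmult_le_compat_l; [lra | apply pow_incr, Hiq]. }
  replace (/ N ^ 2) with (q ^ 2) by (unfold q; field; lra).
  set (Q := q ^ n). assert (HQ : 0 < Q) by (apply pow_lt; lra).
  replace (q ^ (n + 1)) with (Q * q) in B0 by (rewrite pow_add; simpl; unfold Q; ring).
  replace (q ^ (n + 2)) with (Q * (q * q)) in * by (rewrite pow_add; simpl; unfold Q; ring).
  assert (Hcq : 0 <= C * (Q * q)) by (apply Rmult_le_pos; [lra | apply Rmult_le_pos; lra]).
  assert (Hcqq : 0 <= C * (Q * (q * q))).
  { apply Rmult_le_pos; [lra|]. apply Rmult_le_pos; [lra | apply Rmult_le_pos; lra]. }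
  assert (Ht4 : 0 <= t * q ^ 2 <= 4).
  { assert (E : (2 * N) ^ 2 * q ^ 2 = 4) by (replace ((2 * N) ^ 2 * q ^ 2) with (4 * ((q * N) * (q * N))) by ring; rewrite HqN; ring).
    assert (0 <= q ^ 2) by apply pow2_ge_0. split; [apply Rmult_le_pos; nra|].
    rewrite <- E. apply Rmult_le_compat_r; lra. }
  pose proof (Rmult_le_compat _ _ _ _ (Rabs_pos psi1) (Rabs_pos s1) B1 Hs1) as P1.
  pose proof (Rmult_le_compat _ _ _ _ (Rabs_pos psi) (Rabs_pos s2) B0 Hs2) as P2.
  pose proof (Rmult_le_compat _ _ _ _ (Rabs_pos psi) (Rabs_pos s1) B0 Hs1) as P3.
  rewrite <- Rabs_mult in P1, P2, P3.
  replace (4 * t * (2 * (psi1 * (- q ^ 2 * s1)) + psi * ((- q ^ 2) ^ 2 * s2)) + (6 + 4 * INR n) * (psi * (- q ^ 2 * s1)))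
    with (- (8 * (t * q ^ 2) * (psi1 * s1)) + (4 * (t * q ^ 2) * q ^ 2 * (psi * s2) + - ((6 + 4 * INR n) * q ^ 2 * (psi * s1)))) by ring.
  pose proof (pos_INR n) as Hn. assert (Hq2 : 0 <= q ^ 2 <= 1) by nra.
  assert (Hq3 : q ^ 2 * (C * (Q * q)) <= C * (Q * (q * q))).
  { replace (q ^ 2 * (C * (Q * q))) with (q * (C * (Q * (q * q)))) by ring. nra. }
  eapply Rle_trans; [apply Rabs_triang|].
  assert (E1 : Rabs (- (8 * (t * q ^ 2) * (psi1 * s1))) <= 32 * (C * (Q * (q * q)) * 40)).
  { rewrite Rabs_Ropp, Rabs_mult, (Rabs_pos_eq (8 * (t * q ^ 2))) by lra.
    apply Rmult_le_compat; try lra. apply Rabs_pos. }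
  assert (E2 : Rabs (4 * (t * q ^ 2) * q ^ 2 * (psi * s2)) <= 16 * (C * (Q * (q * q)) * 40)).
  { rewrite Rabs_mult, Rabs_pos_eq by (apply Rmult_le_pos; lra).
    apply Rle_trans with (16 * q ^ 2 * (C * (Q * q) * 40)).
    - apply Rmult_le_compat; try lra; [apply Rmult_le_pos; lra | apply Rabs_pos |].
      apply Rmult_le_compat_r; lra.
    - lra. }
  assert (E3 : Rabs (- ((6 + 4 * INR n) * q ^ 2 * (psi * s1))) <= (6 + 4 * INR n) * (C * (Q * (q * q)) * 40)).
  { rewrite Rabs_Ropp, Rabs_mult, Rabs_pos_eq by (apply Rmult_le_pos; lra).
    apply Rle_trans with ((6 + 4 * INR n) * (q ^ 2 * (C * (Q * q) * 40))).
    - rewrite <- Rmult_assoc. apply Rmult_le_compat_l; [apply Rmult_le_pos; lra | exact P3].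
    - apply Rmult_le_compat_l; lra. }
  pose proof (Rabs_triang (4 * (t * q ^ 2) * q ^ 2 * (psi * s2)) (- ((6 + 4 * INR n) * q ^ 2 * (psi * s1)))).
  replace (40 * C * (54 + 4 * INR n) * (Q * (q * q))) with
    (32 * (C * (Q * (q * q)) * 40) + (16 * (C * (Q * (q * q)) * 40) + (6 + 4 * INR n) * (C * (Q * (q * q)) * 40))) by ring.
  lra.
Qed.

(* The test function is [(x . e) ^ n - (x . e') ^ n], with [e'] the mirror image of [e], times a radial solution [psi] with
   right-hand side [chi], cut off at radius [N]: since [psi = O(r ^ - (n + 1))] and [w = O(r ^ - 2)], the cutoff costs [O(1 / N)].
   The lower-order moment produced by the Laplacian vanishes by induction on [n]. *)
Lemma radial_moment k T0 w Cw e :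
  k <> 0 -> 0 < T0 -> helm_on k (half_exterior T0) w -> zero_trace T0 w -> 0 < Cw -> decaying T0 w Cw ->
  dot e e = 1 ->
  forall n (chi : R -> R) T1 T2, T0 < T1 -> T1 < T2 -> (forall t, continuous chi t) ->
    (forall t, t <= T1 \/ T2 <= t -> chi t = 0) ->
    Null (fun x => extend (half_exterior T0) w x * (odd_power e n x * chi (dot x x))).
Proof.
  intros Hk HT0 Hw Htr HCw Hdec He n.
  induction n as [n IH] using lt_wf_ind. intros chi T1 T2 HT1 HT2 Hchi Hz.
  set (D := half_exterior T0) in *.
  destruct (radial_solution k n T1 T2 chi Hk ltac:(lra) HT2 Hchi Hz)
    as [psi [psi1 [psi2 [HC2 [Hpz [Hode [C [HC Hpd]]]]]]]].
  pose proof (pos_INR n) as Hn0.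
  intros eta Heta.
  (* In the shell the field is at most [Cw / N ^ 2], the polynomial at most [2 * (2 N) ^ n] and the
     cutoff error [O(N ^ - (n + 2))], together [K / N ^ 4]. The box has volume [(4 N) ^ 3] and
     [Small_box] adds a factor 8, so the total is [512 * K / N]. *)
  set (K := Cw * (2 * 2 ^ n * (40 * C * (54 + 4 * INR n)))).
  assert (HK : 0 < K).
  { unfold K. pose proof (pow_lt 2 n ltac:(lra)). repeat (apply Rmult_lt_0_compat; try lra). }
  set (N := 1 + T2 + 1024 * K / eta).
  assert (HKe : 0 < 1024 * K / eta) by (apply Rdiv_lt_0_compat; lra).
  assert (HN1 : 1 <= N) by (unfold N; lra).
  assert (HNT : T2 < N ^ 2) by (unfold N; nra).
  assert (HN2 : 0 < N ^ 2) by (apply pow_lt; lra).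
  assert (HNK : 512 * K * / N <= eta / 2).
  { apply Rmult_le_reg_r with N; [lra|]. rewrite Rmult_assoc, Rinv_l by lra.
    assert (eta / 2 * (1024 * K / eta) = 512 * K) by (field; lra). unfold N. nra. }
  (* One for [t <= N ^ 2], since the argument is then at least 3, and zero for [t >= (2 N) ^ 2]. As
     [N ^ 2] exceeds [T2], the cutoff does not touch [chi]. *)
  set (cut := fun t => step (- / N ^ 2 * t + 4)).
  set (cut1 := fun t => - / N ^ 2 * step1 (- / N ^ 2 * t + 4)).
  set (cut2 := fun t => (- / N ^ 2) ^ 2 * step2 (- / N ^ 2 * t + 4)).
  assert (Hcut : C2fun cut cut1 cut2) by (apply C2fun_affine, C2fun_step).
  assert (cut_low : forall t, t <= N ^ 2 -> cut t = 1 /\ cut1 t = 0 /\ cut2 t = 0).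
  { intros t Ht. unfold cut, cut1, cut2. destruct (step_high (- / N ^ 2 * t + 4)) as [-> [-> ->]]; [|repeat split; ring].
    assert (/ N ^ 2 * t <= / N ^ 2 * N ^ 2) by (apply Rmult_le_compat_l; [apply Rlt_le, Rinv_0_lt_compat, HN2 | lra]).
    rewrite Rinv_l in H by lra. lra. }
  assert (cut_high : forall t, (2 * N) ^ 2 <= t -> cut t = 0 /\ cut1 t = 0 /\ cut2 t = 0).
  { intros t Ht. unfold cut, cut1, cut2. destruct (step_low (- / N ^ 2 * t + 4)) as [-> [-> ->]]; [|repeat split; ring].
    assert (/ N ^ 2 * (4 * N ^ 2) <= / N ^ 2 * t).
    { apply Rmult_le_compat_l; [apply Rlt_le, Rinv_0_lt_compat, HN2 | lra]. }
    replace (/ N ^ 2 * (4 * N ^ 2)) with 4 in H by (field; lra). lra. }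
  pose proof (C2fun_mult _ _ _ _ _ _ HC2 Hcut) as HPsi.
  set (Psi := fun t => psi t * cut t) in *.
  set (Psi1 := fun t => psi1 t * cut t + psi t * cut1 t) in HPsi.
  set (Psi2 := fun t => psi2 t * cut t + 2 * (psi1 t * cut1 t) + psi t * cut2 t) in HPsi.
  assert (HPz : forall t, t <= T1 \/ (2 * N) ^ 2 <= t -> Psi t = 0).
  { intros t [Ht|Ht]; unfold Psi; [rewrite Hpz by exact Ht | rewrite (proj1 (cut_high t Ht))]; ring. }
  assert (HT2' : T1 < (2 * N) ^ 2) by lra.
  assert (Hweak := weak_identity k T0 w (Cw / T0) e n Psi Psi1 Psi2 T1 ((2 * N) ^ 2) (Rlt_le _ _ HT0) Hw Htr).
  fold D in Hweak.
  specialize (Hweak ltac:(apply Rdiv_lt_0_compat; lra)).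
  assert (HwB : forall x, D x -> Rabs (w x) <= Cw / T0).
  { intros x Hx. eapply Rle_trans; [apply Hdec, Hx|]. destruct Hx as [_ Hx].
    apply Rmult_le_compat_l; [lra | apply Rinv_le_contravar; lra]. }
  specialize (Hweak HwB He HPsi HT1 HT2' HPz).
  destruct (odd_power_laplacian e n Psi Psi1 Psi2 He HPsi) as [_ Hlap].
  assert (Hlow : Null (fun x => INR n * INR (n - 1) * (extend D w x * (odd_power e (n - 2) x * Psi (dot x x))))).
  { destruct (le_lt_dec 2 n) as [H2|H2].
    - apply Null_scal. apply (IH (n - 2)%nat ltac:(lia) Psi T1 ((2 * N) ^ 2) HT1 HT2'); [|exact HPz].
      intros t. destruct HPsi as [HPsi _]. exact (is_derive_cont _ _ _ (HPsi t)).
    - assert (Z : INR n * INR (n - 1) = 0).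
      { destruct n as [|[|n']]; [simpl; ring | simpl; ring | lia]. }
      apply Null_ext with (2 := Null_zero). intros x. rewrite Z. ring. }
  set (E := fun t => 4 * t * (2 * (psi1 t * cut1 t) + psi t * cut2 t) + (6 + 4 * INR n) * (psi t * cut1 t)).
  set (Err := fun x => extend D w x * (odd_power e n x * E (dot x x))).
  apply Small_ext with (F := fun x =>
    (extend D w x * (laplacian (fun y => odd_power e n y * Psi (dot y y)) x + k ^ 2 * (odd_power e n x * Psi (dot x x)))
     + -1 * (INR n * INR (n - 1) * (extend D w x * (odd_power e (n - 2) x * Psi (dot x x)))))
    + -1 * Err x).
  { intros x. rewrite Hlap. set (t := dot x x).
    assert (Ec : cut t * chi t = chi t).
    { destruct (Rle_dec t (N ^ 2)) as [Ht|Ht].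
      - rewrite (proj1 (cut_low t Ht)). ring.
      - rewrite (Hz t) by lra. ring. }
    rewrite <- Ec. rewrite <- (Hode t). unfold Err, E, Psi, Psi1, Psi2. fold t. ring. }
  replace eta with (eta / 4 + eta / 4 + eta / 2) by field.
  apply Small_plus; [apply Small_plus|].
  - apply Hweak. lra.
  - apply (Null_scal (-1) _ Hlow). lra.
  - set (lo := fun _ : axis => - (2 * N)). set (hi := fun _ : axis => 2 * N).
    assert (Hlh : forall i, lo i < hi i) by (intros i; unfold lo, hi; lra).
    assert (HKN : 0 <= K * (/ N) ^ 4).
    { apply Rmult_le_pos; [lra|]. apply pow_le, Rlt_le, Rinv_0_lt_compat. lra. }
    apply Small_le with (a := 8 * (K * (/ N) ^ 4) * ((hi X1 - lo X1) * ((hi X2 - lo X2) * (hi X3 - lo X3)))).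
    { unfold hi, lo.
      replace (8 * (K * (/ N) ^ 4) * ((2 * N - - (2 * N)) * ((2 * N - - (2 * N)) * (2 * N - - (2 * N)))))
        with (512 * K * / N) by (field; lra). exact HNK. }
    apply (Small_box lo hi (K * (/ N) ^ 4) _ Hlh HKN).
    intros x. rewrite Rabs_mult, (Rabs_left (-1)) by lra. replace (- -1) with 1 by ring. rewrite Rmult_1_l.
    unfold Err. set (t := dot x x).
    assert (Hnn : 0 <= K * (/ N) ^ 4 * boxind lo hi x) by (apply Rmult_le_pos; [exact HKN | apply boxind_nonneg]).
    destruct (classic (D x)) as [Dx|Dx].
    2: { unfold D. rewrite extend_out by exact Dx. rewrite Rmult_0_l, Rabs_R0. exact Hnn. }
    destruct (Rle_dec t (N ^ 2)) as [Ht1|Ht1].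
    { unfold E. destruct (cut_low t Ht1) as [_ [-> ->]].
      match goal with |- Rabs ?a <= _ => replace a with 0 by ring end. rewrite Rabs_R0. exact Hnn. }
    destruct (Rle_dec ((2 * N) ^ 2) t) as [Ht2|Ht2].
    { unfold E. destruct (cut_high t Ht2) as [_ [-> ->]].
      match goal with |- Rabs ?a <= _ => replace a with 0 by ring end. rewrite Rabs_R0. exact Hnn. }
    assert (Hxc : forall i, Rabs (x i) <= 2 * N).
    { intros i. replace (x i) with (dot x (basis i)).
      - apply dot_unit_bound; [|lra|fold t; lra]. unfold dot, sum3. destruct i; unfold basis; simpl; ring.
      - unfold dot, sum3. destruct i; unfold basis; simpl; ring. }
    assert (Hbox : boxind lo hi x = 1).
    { destruct (boxind_cases lo hi x) as [[_ Hx]|[[i Hx] _]]; [exact Hx|]. exfalso.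
      specialize (Hxc i). apply Rabs_le_between in Hxc. unfold lo, hi in Hx. lra. }
    rewrite Hbox, Rmult_1_r.
    unfold D. rewrite extend_in by exact Dx.
    assert (Bw : Rabs (w x) <= Cw * (/ N) ^ 2).
    { eapply Rle_trans; [apply Hdec, Dx|]. fold t. apply Rmult_le_compat_l; [lra|].
      replace ((/ N) ^ 2) with (/ N ^ 2) by (field; lra). apply Rinv_le_contravar; lra. }
    assert (Bp : Rabs (odd_power e n x) <= 2 * (2 * N) ^ n) by (apply odd_power_bound; [exact He | lra | fold t; lra]).
    destruct (step_bound (- / N ^ 2 * t + 4)) as [_ [S1 S2]].
    assert (HtT : T2 <= t) by lra.
    assert (BE : Rabs (E t) <= 40 * C * (54 + 4 * INR n) * (/ N) ^ (n + 2)).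
    { destruct (Hpd t HtT) as [P0 P1].
      apply (cutoff_error_bound n N t (psi t) (psi1 t)); try assumption. lra. }
    rewrite !Rabs_mult.
    apply Rle_trans with (Cw * (/ N) ^ 2 * (2 * (2 * N) ^ n * (40 * C * (54 + 4 * INR n) * (/ N) ^ (n + 2)))).
    + apply Rmult_le_compat; try apply Rabs_pos; [apply Rmult_le_pos; apply Rabs_pos | exact Bw |].
      apply Rmult_le_compat; try apply Rabs_pos; assumption.
    + right. rewrite Rpow_mult_distr, pow_add.
      unfold K. replace ((/ N) ^ n) with (/ N ^ n) by (rewrite pow_inv; reflexivity).
      assert (N ^ n <> 0) by (apply pow_nonzero; lra). field. repeat split; first [assumption | lra].
Qed.

(** * Rellich's lemma for the exterior half space *)

(** The binomial expansion, one factor at a time: [(c + y) ^ S N * y ^ j] is [c * (c + y) ^ N * y ^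
    j + (c + y) ^ N * y ^ S j]. This recursion is the reason for carrying the exponent [j]. *)
Lemma shifted_moment k T0 w Cw e c :
  k <> 0 -> 0 < T0 -> helm_on k (half_exterior T0) w -> zero_trace T0 w -> 0 < Cw -> decaying T0 w Cw ->
  dot e e = 1 ->
  forall (chi : R -> R) T1 T2, T0 < T1 -> T1 < T2 -> (forall t, continuous chi t) ->
    (forall t, t <= T1 \/ T2 <= t -> chi t = 0) ->
  forall N j, Null (fun x => extend (half_exterior T0) w x *
    (((c + dot x e) ^ N * dot x e ^ j - (c + dot x (flip_dir e)) ^ N * dot x (flip_dir e) ^ j) * chi (dot x x))).
Proof.
  intros Hk HT0 Hw Htr HCw Hdec He chi T1 T2 HT1 HT2 Hchi Hz N.
  induction N as [|N IH]; intros j.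
  - apply Null_ext with (2 := radial_moment k T0 w Cw e Hk HT0 Hw Htr HCw Hdec He j chi T1 T2 HT1 HT2 Hchi Hz).
    intros x. unfold odd_power. simpl. ring.
  - apply Null_ext with (2 := Null_lin c 1 _ _ (IH j) (IH (S j))). intros x. simpl. ring.
Qed.

Lemma lsum_box_lower h K (x1 : point) r c :
  0 < h -> h <= r -> 0 <= c -> (forall i, Rabs (x1 i) + r <= INR K * h) ->
  c * (r * (r * r)) <= lsum h K (fun x => c * boxind (fun i => x1 i - r) (fun i => x1 i + r) x).
Proof.
  intros Hh Hhr Hc HK. rewrite lsum_boxind. apply Rmult_le_compat_l; [exact Hc|].
  assert (B : forall i, r <= h * sumn (2 * K + 1) (fun j => ind (x1 i - r) (x1 i + r) (node h K j))).
  { intros i. eapply Rle_trans; [|apply ind_sum_lower]; try lra.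
    - specialize (HK i). pose proof (Rabs_triang (x1 i) (- r)) as H. rewrite Rabs_Ropp, (Rabs_pos_eq r) in H by lra.
      unfold Rminus. lra.
    - specialize (HK i). pose proof (Rabs_triang (x1 i) r) as H. rewrite (Rabs_pos_eq r) in H by lra. lra. }
  apply Rmult_le_compat; try lra; [apply Rmult_le_pos; lra | apply B |].
  apply Rmult_le_compat; try lra; apply B.
Qed.

Lemma dot_psub_expand x y : dot (psub x y) (psub x y) = dot x x - 2 * dot x y + dot y y.
Proof. unfold dot, sum3, psub. ring. Qed.

Lemma coord_le_norm x i r : 0 < r -> dot x x < r ^ 2 -> Rabs (x i) < r.
Proof.
  intros Hr H. unfold dot, sum3 in H.
  pose proof (pow2_ge_0 (x X1)). pose proof (pow2_ge_0 (x X2)). pose proof (pow2_ge_0 (x X3)).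
  apply Rabs_lt_between. destruct i; split; nra.
Qed.

Lemma Rmult_bounded a b B M : - B <= a <= B -> 0 <= b <= M -> - (B * M) <= a * b <= B * M.
Proof. intros Ha Hb. split; nra. Qed.

(* With [c = |x0|] and a large [N], the moment weight concentrates near [x0] if [chi] is supported just inside [|x0| ^ 2]. *)
Lemma rellich_nonpositive k T0 w Cw :
  k <> 0 -> 0 < T0 -> helm_on k (half_exterior T0) w -> zero_trace T0 w -> 0 < Cw -> decaying T0 w Cw ->
  forall x0, half_exterior T0 x0 -> w x0 <= 0.
Proof.
  intros Hk HT0 Hw Htr HCw Hdec x0 Hx0. apply Rnot_lt_le. intros Hpos.
  set (D := half_exterior T0) in *.
  assert (Hx03 : 0 < x0 X3) by apply Hx0. assert (Hx0T : T0 < dot x0 x0) by apply Hx0.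
  set (T2 := dot x0 x0) in *. set (r := sqrt T2).
  assert (Hr : 0 < r) by (apply sqrt_lt_R0; lra).
  assert (Hr2 : r ^ 2 = T2) by (unfold r; simpl; rewrite Rmult_1_r; apply sqrt_sqrt; lra).
  set (T1 := (T0 + T2) / 2).
  assert (HT1 : T0 < T1) by (unfold T1; lra). assert (HT2 : T1 < T2) by (unfold T1; lra).
  set (e := fun i => x0 i / r).
  assert (He : dot e e = 1).
  { transitivity (dot x0 x0 / r ^ 2); [unfold dot, sum3, e; field; lra|]. fold T2. rewrite Hr2. field. lra. }
  assert (Eex : forall x, r * dot x e = dot x x0) by (intros x; unfold dot, sum3, e; field; lra).
  set (m := w x0 / 2). assert (Hm : 0 < m) by (unfold m; lra).
  assert (Hrho : exists rho, 0 < rho /\ forall x, near x0 rho x -> D x /\ m <= w x).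
  { destruct (half_exterior_open T0 x0 Hx0) as [r1 [Hr1 H1]].
    destruct (proj1 (continuous_near w x0) (c2_cont _ _ (proj1 Hw x0 Hx0)) m Hm) as [r2 [Hr2' H2]].
    exists (Rmin r1 r2). split; [apply Rmin_glb_lt; assumption|]. intros x Hx. split.
    - apply H1, near_le with (2 := Hx), Rmin_l.
    - specialize (H2 x (near_le _ _ _ _ (Rmin_r r1 r2) Hx)). apply Rabs_lt_between in H2. unfold m in *. lra. }
  destruct Hrho as [rho [Hrho Hnear]].
  (* In the ball [|x| <= r], the cap [x . e > r - kap] lies within [sqrt (2 r kap) < rho] of [x0],
     where [w] is at least [m]. Points of the upper half space are at distance at least [x0 X3] from
     the mirror image of [x0], and the third bound then keeps [x . flip_dir e] at most [r - kap]. *)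
  set (kap := Rmin (r / 2) (Rmin (rho ^ 2 / (4 * r)) (x0 X3 ^ 2 / (2 * r)))).
  assert (Hkap : 0 < kap).
  { repeat apply Rmin_glb_lt; [lra | |]; apply Rdiv_lt_0_compat; try lra; apply pow_lt; assumption. }
  assert (Hk1 : kap <= r / 2) by apply Rmin_l.
  assert (Hk2 : 2 * r * kap < rho ^ 2).
  { assert (kap <= rho ^ 2 / (4 * r)) by (eapply Rle_trans; [apply Rmin_r | apply Rmin_l]).
    apply Rmult_le_compat_l with (r := 2 * r) in H; [|lra].
    replace (2 * r * (rho ^ 2 / (4 * r))) with (rho ^ 2 / 2) in H by (field; lra).
    pose proof (pow_lt rho 2 Hrho). lra. }
  assert (Hk3 : 2 * r * kap <= x0 X3 ^ 2).
  { assert (kap <= x0 X3 ^ 2 / (2 * r)) by (eapply Rle_trans; [apply Rmin_r | apply Rmin_r]).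
    apply Rmult_le_compat_l with (r := 2 * r) in H; [|lra].
    replace (2 * r * (x0 X3 ^ 2 / (2 * r))) with (x0 X3 ^ 2) in H by (field; lra). lra. }
  assert (Hcap : forall x, dot x x <= T2 -> r - kap < dot x e -> near x0 rho x).
  { intros x HxT Hl i. change (x i - x0 i) with (psub x x0 i). apply coord_le_norm; [exact Hrho|].
    rewrite dot_psub_expand, <- Eex. fold T2. rewrite <- Hr2 in *. nra. }
  assert (Hflip : forall x, 0 < x X3 -> dot x x <= T2 -> dot x (flip_dir e) <= r - kap).
  { intros x Hx3 HxT.
    set (y := fun i => sign3 i * x0 i).
    assert (Ey : r * dot x (flip_dir e) = dot x y) by (unfold dot, sum3, flip_dir, e, y; field; lra).
    assert (Eyy : dot y y = T2) by (unfold T2, y, dot, sum3, sign3; ring).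
    assert (Hd : x0 X3 ^ 2 <= dot (psub x y) (psub x y)).
    { unfold dot, sum3, psub. unfold y at 5 6, sign3.
      pose proof (pow2_ge_0 (x X1 - y X1)). pose proof (pow2_ge_0 (x X2 - y X2)). nra. }
    rewrite dot_psub_expand, <- Ey, Eyy in Hd. nra. }
  assert (Hlr : forall x, dot x x <= T2 -> - r <= dot x e <= r /\ - r <= dot x (flip_dir e) <= r).
  { intros x Hx. rewrite <- Hr2 in Hx.
    pose proof (dot_unit_bound x e r He (Rlt_le _ _ Hr) Hx) as H1.
    pose proof (dot_unit_bound x (flip_dir e) r (flip_dir_unit e He) (Rlt_le _ _ Hr) Hx) as H2.
    apply Rabs_le_between in H1. apply Rabs_le_between in H2. split; lra. }
  set (chi := fun t => pos (t - T1) * pos (T2 - t)).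
  assert (Hchi : forall t, continuous chi t).
  { intros t.
    assert (P1 : continuous (fun t : R => pos (t - T1)) t).
    { apply (continuous_comp (fun t => t - T1) pos); [|apply pos_continuous].
      refine (is_derive_cont _ t 1 _). auto_derive; [exact I | ring]. }
    assert (P2 : continuous (fun t : R => pos (T2 - t)) t).
    { apply (continuous_comp (fun t => T2 - t) pos); [|apply pos_continuous].
      refine (is_derive_cont _ t (-1) _). auto_derive; [exact I | ring]. }
    exact (continuous_mult (K := R_AbsRing) _ _ t P1 P2). }
  assert (Hz : forall t, t <= T1 \/ T2 <= t -> chi t = 0).
  { intros t [Ht|Ht]; unfold chi; [rewrite (pos_neg (t - T1)) | rewrite (pos_neg (T2 - t))]; try lra; ring. }
  set (Xm := (T2 - T1) * (T2 - T1)). assert (HXm : 0 < Xm) by (apply Rmult_lt_0_compat; lra).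
  assert (Hchi01 : forall t, 0 <= chi t <= Xm).
  { intros t. destruct (Rle_dec t T1) as [H1|H1]; [rewrite Hz by auto; lra|].
    destruct (Rle_dec T2 t) as [H2|H2]; [rewrite Hz by auto; lra|].
    unfold chi, Xm. rewrite !pos_pos by lra. split; [apply Rmult_le_pos; lra | apply Rmult_le_compat; lra]. }
  (* The shift by [r] makes the bases [r + x . e] and [r + x . flip_dir e] nonnegative on the ball.
     They are at most [B] outside the cap and for the mirrored term, while the first is at least
     [A > B] on the small cube below, so large powers favour the cube. *)
  set (A := 2 * r - kap / 2). set (B := 2 * r - kap).
  assert (HB : 0 < B) by (unfold B; lra). assert (HAB : B < A) by (unfold A, B; lra).
  (* a small cube on which w and chi are bounded below and dot x e is close to r *)
  assert (Hcube : exists x1 r1 c0, 0 < r1 /\ 0 < c0 /\ forall x, cube x1 r1 x ->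
    T1 < dot x x < T2 /\ r - kap / 2 <= dot x e /\ c0 <= chi (dot x x)).
  { set (s := Rmin (1 / 2) (Rmin (kap / (4 * r)) ((T2 - T1) / (4 * T2)))).
    assert (Hs : 0 < s) by (repeat apply Rmin_glb_lt; try apply Rdiv_lt_0_compat; lra).
    assert (Hs1 : s <= 1 / 2) by apply Rmin_l.
    assert (Hs2 : s * (4 * r) <= kap).
    { assert (s <= kap / (4 * r)) by (eapply Rle_trans; [apply Rmin_r | apply Rmin_l]).
      apply Rmult_le_compat_r with (r := 4 * r) in H; [|lra].
      replace (kap / (4 * r) * (4 * r)) with kap in H by (field; lra). exact H. }
    assert (Hs3 : s * (4 * T2) <= T2 - T1).
    { assert (s <= (T2 - T1) / (4 * T2)) by (eapply Rle_trans; [apply Rmin_r | apply Rmin_r]).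
      apply Rmult_le_compat_r with (r := 4 * T2) in H; [|lra].
      replace ((T2 - T1) / (4 * T2) * (4 * T2)) with (T2 - T1) in H by (field; lra). exact H. }
    set (x1 := fun i => (1 - s) * x0 i).
    assert (E1 : dot x1 x1 = (1 - s) ^ 2 * T2) by (unfold x1, T2, dot, sum3; ring).
    assert (H1a : T1 < dot x1 x1) by (rewrite E1; nra).
    assert (H1b : dot x1 x1 < T2) by (rewrite E1; nra).
    assert (E2 : dot x1 e = (1 - s) * r).
    { apply Rmult_eq_reg_l with r; [|lra]. rewrite Eex.
      transitivity ((1 - s) * T2); [unfold x1, T2, dot, sum3; ring | rewrite <- Hr2; ring]. }
    assert (H2 : r - kap / 2 < dot x1 e) by (rewrite E2; lra).
    assert (Hc1 : 0 < chi (dot x1 x1)).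
    { unfold chi. rewrite !pos_pos by lra. apply Rmult_lt_0_compat; lra. }
    set (c0 := chi (dot x1 x1) / 2).
    assert (Hopen : open_set (fun x => ((T1 < dot x x /\ - T2 < - dot x x) /\ r - kap / 2 < dot x e) /\ c0 < chi (dot x x))).
    { apply open_set_and; [apply open_set_and; [apply open_set_and|]|].
      - apply (continuous_open_lt (fun x => dot x x)), dot_self_continuous.
      - apply (continuous_open_lt (fun x => - dot x x)). intros p. apply cont_opp, dot_self_continuous.
      - apply (continuous_open_lt (fun x => dot x e)). intros p. apply dot_continuous.
      - apply (continuous_open_lt (fun x => chi (dot x x))). intros p.
        apply (cont_comp chi (fun x => dot x x)); [apply dot_self_continuous | apply Hchi]. }
    destruct (Hopen x1) as [r1 [Hr1 Hr1']].
    { split; [split; [split|]|]; try lra. unfold c0. lra. }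
    exists x1, (r1 / 2), c0. split; [lra|]. split; [unfold c0; lra|].
    intros x Hx. destruct (Hr1' x) as [[[G1 G2] G3] G4].
    { apply cube_near with (2 := Hx). lra. }
    repeat split; lra. }
  destruct Hcube as [x1 [r1 [c0 [Hr1 [Hc0 Hcube]]]]].
  set (Bw := Cw / T0). assert (HBw : 0 < Bw) by (apply Rdiv_lt_0_compat; lra).
  assert (HwB : forall x, D x -> Rabs (w x) <= Bw).
  { intros x Hx. eapply Rle_trans; [apply Hdec, Hx|]. destruct Hx as [_ Hx].
    apply Rmult_le_compat_l; [lra | apply Rinv_le_contravar; lra]. }
  set (V1 := r1 * (r1 * r1)). set (L := r + 1). set (V2 := 3 * L * (3 * L * (3 * L))).
  assert (HV1 : 0 < V1) by (unfold V1; repeat apply Rmult_lt_0_compat; assumption).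
  assert (HL : 0 < L) by (unfold L; lra).
  assert (HV2 : 0 < V2) by (unfold V2; repeat apply Rmult_lt_0_compat; lra).
  (* choose the power N so large that the cap dominates *)
  assert (HN : exists N : nat, (B / A) ^ N * (2 * Bw * Xm * V2) < m * c0 * V1 / 2).
  { assert (Hq : Rabs (B / A) < 1).
    { rewrite Rabs_pos_eq by (apply Rdiv_le_0_compat; lra). apply Rmult_lt_reg_r with A; [lra|].
      replace (B / A * A) with B by (field; lra). lra. }
    assert (HP : 0 < 2 * Bw * Xm * V2).
    { apply Rmult_lt_0_compat; [apply Rmult_lt_0_compat; [lra | exact HXm] | exact HV2]. }
    destruct (pow_lt_1_zero (B / A) Hq (m * c0 * V1 / 2 / (2 * Bw * Xm * V2))) as [N HN].
    { apply Rdiv_lt_0_compat; [|exact HP]. assert (0 < m * c0 * V1) by (apply Rmult_lt_0_compat; [apply Rmult_lt_0_compat|]; assumption). lra. }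
    exists N. specialize (HN N (le_n N)).
    apply Rabs_lt_between in HN. destruct HN as [_ HN].
    apply Rmult_lt_compat_r with (r := 2 * Bw * Xm * V2) in HN; [|exact HP].
    replace (m * c0 * V1 / 2 / (2 * Bw * Xm * V2) * (2 * Bw * Xm * V2)) with (m * c0 * V1 / 2) in HN by (field; lra).
    exact HN. }
  destruct HN as [N HN].
  assert (HAN : 0 < A ^ N) by (apply pow_lt; lra). assert (HBN : 0 < B ^ N) by (apply pow_lt; lra).
  assert (HN' : 2 * Bw * Xm * B ^ N * V2 < m * c0 * A ^ N * V1 / 2).
  { apply Rmult_lt_compat_r with (r := A ^ N) in HN; [|exact HAN].
    replace ((B / A) ^ N * (2 * Bw * Xm * V2) * A ^ N) with (2 * Bw * Xm * B ^ N * V2) in HN.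
    2: { unfold Rdiv. rewrite Rpow_mult_distr, pow_inv. field. apply pow_nonzero. lra. }
    lra. }
  pose proof (shifted_moment k T0 w Cw e r Hk HT0 Hw Htr HCw Hdec He chi T1 T2 HT1 HT2 Hchi Hz N 0%nat) as HNull.
  fold D in HNull.
  set (F := fun x => extend D w x * (((r + dot x e) ^ N * dot x e ^ 0 -
    (r + dot x (flip_dir e)) ^ N * dot x (flip_dir e) ^ 0) * chi (dot x x))) in *.
  set (lo := fun i => x1 i - r1). set (hi := fun i => x1 i + r1).
  set (LO := fun _ : axis => - L). set (HI := fun _ : axis => L).
  set (c1 := m * (c0 * A ^ N)). set (c2 := 2 * Bw * Xm * B ^ N).
  assert (Hc1 : 0 <= c1).
  { unfold c1. apply Rmult_le_pos; [lra | apply Rmult_le_pos; lra]. }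
  assert (Hc2 : 0 <= c2).
  { unfold c2. apply Rmult_le_pos; [|lra]. apply Rmult_le_pos; [|lra]. lra. }
  (* Inside the cap the contribution with [e] is nonnegative and on the small cube at least [c1].
     Everything that may be negative is bounded by [c2], so the lattice sum of [F] can be estimated
     by two box counts. *)
  assert (Hpoint : forall x, 1 * (c1 * boxind lo hi x) + (-1) * (c2 * boxind LO HI x) <= F x).
  { intros x.
    pose proof (boxind_nonneg LO HI x) as Hb2.
    assert (Hb2' : 0 <= c2 * boxind LO HI x) by (apply Rmult_le_pos; assumption).
    assert (Hsmall : boxind lo hi x = 0 \/ (boxind lo hi x = 1 /\ cube x1 r1 x)).
    { destruct (boxind_cases lo hi x) as [[Hx E]|[_ E]]; [right | left; exact E]. split; [exact E|].
      intros i. specialize (Hx i). unfold lo, hi in Hx. apply Rabs_le_between. lra. }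
    destruct (classic (D x /\ T1 < dot x x < T2)) as [[Dx HxT]|Hout].
    - assert (Hbig : boxind LO HI x = 1).
      { destruct (boxind_cases LO HI x) as [[_ Hx]|[[i Hx] _]]; [exact Hx|]. exfalso.
        assert (Hxr : dot x x < r ^ 2) by lra.
        pose proof (coord_le_norm x i r Hr Hxr) as H. apply Rabs_lt_between in H. unfold LO, HI, L in Hx. lra. }
      rewrite Hbig, Rmult_1_r.
      destruct (Hlr x ltac:(lra)) as [L1 L2]. pose proof (Hflip x (proj1 Dx) ltac:(lra)) as L3.
      pose proof (Hchi01 (dot x x)) as Hc.
      assert (P2 : 0 <= (r + dot x (flip_dir e)) ^ N <= B ^ N).
      { split; [apply pow_le; lra | apply pow_incr; unfold B; lra]. }
      unfold F. unfold D. rewrite extend_in by exact Dx. rewrite !pow_O, !Rmult_1_r.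
      set (p1 := (r + dot x e) ^ N) in *. set (p2 := (r + dot x (flip_dir e)) ^ N) in *. set (ch := chi (dot x x)) in *.
      pose proof (HwB x Dx) as Hwx. apply Rabs_le_between in Hwx.
      assert (Q2 : - (Bw * (Xm * B ^ N)) <= w x * (ch * p2) <= Bw * (Xm * B ^ N)).
      { assert (0 <= ch * p2 <= Xm * B ^ N).
        { split; [apply Rmult_le_pos; lra | apply Rmult_le_compat; lra]. }
        apply Rmult_bounded; lra. }
      assert (HXB : 0 <= Bw * (Xm * B ^ N)) by (apply Rmult_le_pos; [lra | apply Rmult_le_pos; lra]).
      replace (w x * ((p1 - p2) * ch)) with (w x * (ch * p1) - w x * (ch * p2)) by ring.
      destruct (Rle_dec (dot x e) (r - kap)) as [Hle|Hgt].
      + assert (P1 : 0 <= p1 <= B ^ N) by (split; [apply pow_le; lra | apply pow_incr; unfold B; lra]).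
        assert (Q1 : - (Bw * (Xm * B ^ N)) <= w x * (ch * p1) <= Bw * (Xm * B ^ N)).
        { assert (0 <= ch * p1 <= Xm * B ^ N).
          { split; [apply Rmult_le_pos; lra | apply Rmult_le_compat; lra]. }
          apply Rmult_bounded; lra. }
        destruct Hsmall as [->|[_ Hcu]]; [unfold c2; lra|].
        destruct (Hcube x Hcu) as [_ [Hcu' _]]. lra.
      + assert (Hwm : m <= w x) by (apply Hnear, Hcap; lra).
        assert (P1 : 0 <= p1) by (apply pow_le; lra).
        assert (0 <= w x * (ch * p1)) by (apply Rmult_le_pos; [lra | apply Rmult_le_pos; lra]).
        destruct Hsmall as [->|[-> Hcu]]; [unfold c2; lra|].
        destruct (Hcube x Hcu) as [_ [Hcu' Hcu'']]. fold ch in Hcu''.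
        assert (A ^ N <= p1) by (apply pow_incr; unfold A; lra).
        assert (c1 <= w x * (ch * p1)).
        { unfold c1. apply Rmult_le_compat; try lra; [apply Rmult_le_pos; lra|].
          apply Rmult_le_compat; lra. }
        unfold c2. lra.
    - assert (HF : F x = 0).
      { unfold F. destruct (classic (D x)) as [Dx|Dx].
        - rewrite (Hz (dot x x)); [ring|]. apply NNPP. intros Hn. apply Hout. split; [exact Dx | lra].
        - unfold D. rewrite extend_out by exact Dx. ring. }
      rewrite HF. destruct Hsmall as [->|[_ Hcu]]; [lra|].
      exfalso. apply Hout. destruct (Hcube x Hcu) as [Hcu1 [Hcu2 _]]. split; [|exact Hcu1].
      apply Hnear, Hcap; lra. }
  set (eta := m * c0 * A ^ N * V1 / 4).
  assert (Heta : 0 < eta).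
  { unfold eta. assert (0 < m * c0 * A ^ N * V1); [|lra].
    apply Rmult_lt_0_compat; [apply Rmult_lt_0_compat; [apply Rmult_lt_0_compat|]|]; assumption. }
  destruct (HNull eta Heta) as [h0 [Hh0 Hsm]].
  set (h := Rmin (h0 / 2) (Rmin r1 L)).
  assert (Hh : 0 < h) by (repeat apply Rmin_glb_lt; lra).
  assert (Hhh0 : h <= h0 / 2) by apply Rmin_l.
  assert (Hhr1 : h <= r1) by (eapply Rle_trans; [apply Rmin_r | apply Rmin_l]).
  assert (HhL : h <= L) by (eapply Rle_trans; [apply Rmin_r | apply Rmin_r]).
  destruct (Hsm h ltac:(lra)) as [K0 HK0].
  destruct (point_bound x1) as [E [HE HEb]].
  destruct (INR_unbounded ((E + r1) / h)) as [K1 HK1].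
  set (K := Nat.max K0 K1).
  specialize (HK0 K (Nat.le_max_l _ _)).
  assert (HKh : forall i, Rabs (x1 i) + r1 <= INR K * h).
  { intros i. pose proof (le_INR _ _ (Nat.le_max_r K0 K1)) as HKK. fold K in HKK.
    assert (Hq : (E + r1) / h <= INR K) by lra.
    apply Rmult_le_compat_r with (r := h) in Hq; [|lra].
    replace ((E + r1) / h * h) with (E + r1) in Hq by (field; lra). specialize (HEb i). lra. }
  pose proof (lsum_le h K _ _ (Rlt_le _ _ Hh) Hpoint) as Hle.
  rewrite lsum_lin in Hle.
  pose proof (lsum_box_lower h K x1 r1 c1 Hh Hhr1 Hc1 HKh) as Hlow. fold lo hi V1 in Hlow.
  assert (Hup : Rabs (lsum h K (fun x => c2 * boxind LO HI x)) <= c2 * V2).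
  { eapply Rle_trans; [apply (lsum_box_upper h K LO HI c2); try assumption|].
    - intros i. unfold LO, HI. lra.
    - intros x. rewrite Rabs_pos_eq; [lra|]. apply Rmult_le_pos; [exact Hc2 | apply boxind_nonneg].
    - apply Rmult_le_compat_l; [exact Hc2|]. unfold LO, HI, V2.
      apply Rmult_le_compat; try lra; [apply Rmult_le_pos; lra|]. apply Rmult_le_compat; lra. }
  apply Rabs_le_between in Hup. apply Rabs_le_between in HK0.
  unfold c1, c2, eta in *. lra.
Qed.

Theorem half_space_rellich k T0 w Cw :
  k <> 0 -> 0 < T0 -> helm_on k (half_exterior T0) w -> zero_trace T0 w -> 0 < Cw -> decaying T0 w Cw ->
  forall x, half_exterior T0 x -> w x = 0.
Proof.
  intros Hk HT0 Hw Htr HCw Hdec x Hx. apply Rle_antisym.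
  - apply (rellich_nonpositive k T0 w Cw); assumption.
  - assert (H : -1 * w x + 0 * w x <= 0); [|lra].
    apply (rellich_nonpositive k T0 (fun y => -1 * w y + 0 * w y) Cw); try assumption.
    + apply helm_lin; [apply half_exterior_open | exact Hw | exact Hw].
    + intros p Hp HpT eps He. destruct (Htr p Hp HpT eps He) as [d [Hd Hd']]. exists d. split; [exact Hd|].
      intros y Hy Hn. replace (-1 * w y + 0 * w y) with (- w y) by ring. rewrite Rabs_Ropp. apply Hd'; assumption.
    + intros y Hy. replace (-1 * w y + 0 * w y) with (- w y) by ring. rewrite Rabs_Ropp. apply Hdec, Hy.
Qed.

(** * Nodal planes *)

(* Complex fields: [u true] is the real part and [u false] the imaginary part. *)
Definition field := bool -> point -> R.

Definition helm_field (k : R) (O : point -> Prop) (u : field) : Prop := forall b, helm_on k O (u b).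

(** Zeros are required only on some small disc of the plane. Its radius is not recorded, because
    [nodal_move] recovers zeros along every segment of the plane that stays in [O]. *)
Definition nodal (u : field) (O : point -> Prop) (n p : point) : Prop :=
  O p /\ dot n n = 1 /\ exists r, 0 < r /\
    forall q, near p r q -> dot (psub q p) n = 0 -> forall b, u b q = 0.

Lemma near_line_small p e r : 0 < r -> exists a, 0 < a /\ forall q s, near p (r / 2) q -> 0 <= s < a -> near p r (line q e s).
Proof.
  intros Hr. destruct (point_bound e) as [E [HE He]]. exists (r / (2 * E)).
  split; [apply Rdiv_lt_0_compat; lra|]. intros q s Hq Hs i. unfold line.
  replace (q i + s * e i - p i) with ((q i - p i) + s * e i) by ring.
  eapply Rle_lt_trans; [apply Rabs_triang|]. rewrite Rabs_mult, (Rabs_pos_eq s) by lra.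
  assert (s * E < r / 2).
  { destruct Hs as [_ Hs]. apply Rmult_lt_compat_r with (r := E) in Hs; [|lra].
    replace (r / (2 * E) * E) with (r / 2) in Hs by (field; lra). exact Hs. }
  specialize (He i). specialize (Hq i). assert (s * Rabs (e i) <= s * E) by (apply Rmult_le_compat_l; lra). lra.
Qed.

(** Continuation along lines parallel to [e] in the plane. [continuation_line] asks for zeros on the
    line alone, so it applies although [u] need not vanish near [p]. *)
Lemma nodal_move k u O n p e :
  open_set O -> helm_field k O u -> nodal u O n p -> dot e n = 0 ->
  (forall s, 0 <= s <= 1 -> O (line p e s)) -> nodal u O n (line p e 1).
Proof.
  intros HO Hu [Hp [Hn [r [Hr Hz]]]] He Hseg.
  split; [apply Hseg; lra | split; [exact Hn|]].
  destruct (segment_tube O p e HO Hseg) as [t [Ht Htube]].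
  destruct (near_line_small p e r Hr) as [a [Ha Hsmall]].
  exists (Rmin (r / 2) t). split; [apply Rmin_glb_lt; lra|].
  intros q Hq Hqn b. set (q0 := line q e (-1)).
  assert (Hq0 : near p (Rmin (r / 2) t) q0).
  { intros i. specialize (Hq i). unfold q0, line in *.
    replace (q i + -1 * e i - p i) with (q i - (p i + 1 * e i)) by ring. exact Hq. }
  replace q with (line q0 e 1).
  2: { unfold q0. rewrite line_line. replace (-1 + 1) with 0 by ring. apply line_0. }
  apply (continuation_line k O (u b) q0 e a); try assumption; try lra.
  - apply Hu.
  - intros s Hs. apply (Htube s); [exact Hs|]. intros i. specialize (Hq0 i). unfold line.
    replace (q0 i + s * e i - (p i + s * e i)) with (q0 i - p i) by ring.
    pose proof (Rmin_r (r / 2) t). lra.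
  - intros s Hs Hsa. apply Hz.
    + apply Hsmall; [apply near_le with (2 := Hq0), Rmin_l | lra].
    + transitivity (dot (psub q (line p e 1)) n + s * dot e n).
      * unfold dot, sum3, psub, q0, line. ring.
      * rewrite Hqn, He. ring.
Qed.

Lemma nodal_zero u O n p : nodal u O n p -> forall b, u b p = 0.
Proof.
  intros [_ [_ [r [Hr Hz]]]] b. apply Hz; [apply near_refl, Hr|].
  unfold dot, sum3, psub. ring.
Qed.

Lemma near_convex p r x e s : near p r x -> near p r (line x e 1) -> 0 <= s <= 1 -> near p r (line x e s).
Proof.
  intros H0 H1 Hs i. specialize (H0 i). specialize (H1 i). unfold line in *.
  replace (x i + s * e i - p i) with ((1 - s) * (x i - p i) + s * (x i + 1 * e i - p i)) by ring.
  eapply Rle_lt_trans; [apply Rabs_triang|]. rewrite !Rabs_mult, (Rabs_pos_eq s), (Rabs_pos_eq (1 - s)) by lra.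
  set (a := Rabs (x i - p i)) in *. set (b := Rabs (x i + 1 * e i - p i)) in *.
  pose proof (Rmult_le_pos (1 - s) (r - a) ltac:(lra) ltac:(lra)) as P1.
  pose proof (Rmult_le_pos s (r - b) ltac:(lra) ltac:(lra)) as P2.
  destruct (Rle_dec s (1 / 2)) as [Hs2|Hs2].
  - assert (0 < (1 - s) * (r - a)) by (apply Rmult_lt_0_compat; lra). lra.
  - assert (0 < s * (r - b)) by (apply Rmult_lt_0_compat; lra). lra.
Qed.

Lemma line_psub p q : line p (psub q p) 1 = q.
Proof. apply functional_extensionality; intros i. unfold line, psub. ring. Qed.

Lemma dot_small x y a c : 0 <= a -> 0 <= c -> (forall i, Rabs (x i) <= a) -> (forall i, Rabs (y i) <= c) ->
  Rabs (dot x y) <= 3 * (a * c).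
Proof.
  intros Ha Hc Hx Hy. unfold dot, sum3.
  assert (H : forall i, Rabs (x i * y i) <= a * c).
  { intros i. rewrite Rabs_mult. apply Rmult_le_compat; try apply Rabs_pos; auto. }
  pose proof (Rabs_triang (x X1 * y X1 + x X2 * y X2) (x X3 * y X3)).
  pose proof (Rabs_triang (x X1 * y X1) (x X2 * y X2)).
  pose proof (H X1); pose proof (H X2); pose proof (H X3). lra.
Qed.

(** Unit normals have a cluster point [n]. The discs given for the approximating nodal points might
    shrink, but [nodal_move] enlarges them to a common size. Were [u] nonzero at a point of the
    limit plane, it would be nonzero at a nearby point of an approximating plane. *)
Lemma nodal_closed k u O p :
  open_set O -> helm_field k O u -> O p ->
  (forall eps, 0 < eps -> exists q n, near p eps q /\ nodal u O n q) ->
  exists n, nodal u O n p.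
Proof.
  intros HO Hu Hp Hlim.
  destruct (HO p Hp) as [r [Hr Hr']].
  destruct (compact_cluster (fun j n => dot n n = 1 /\ exists q, near p (/ (INR j + 1)) q /\ nodal u O n q) 1)
    as [n Hn].
  { intros j. destruct (Hlim (/ (INR j + 1))) as [q [n [Hq Hqn]]].
    { apply Rinv_0_lt_compat. pose proof (pos_INR j). lra. }
    exists n. pose proof (proj1 (proj2 Hqn)) as H1. split; [split; [exact H1|]|].
    - exists q. split; assumption.
    - intros i. apply unit_coord_le, H1. }
  assert (Hn1 : dot n n = 1).
  { apply Rle_antisym.
    - assert (- (1) <= - dot n n); [|lra].
      apply (continuous_closed_le (fun x => - dot x x) (- (1)) (fun x => cont_opp _ x (dot_self_continuous x)) n).
      intros eps He. destruct (Hn eps 0%nat He) as [j [m [_ [[Hm _] Hnm]]]]. exists m. split; [lra | exact Hnm].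
    - apply (continuous_closed_le (fun x => dot x x) 1 dot_self_continuous n).
      intros eps He. destruct (Hn eps 0%nat He) as [j [m [_ [[Hm _] Hnm]]]]. exists m. split; [lra | exact Hnm]. }
  exists n. split; [exact Hp | split; [exact Hn1|]].
  exists (r / 4). split; [lra|]. intros y Hy Hyn b.
  assert (HOy : O y) by (apply Hr', near_le with (2 := Hy); lra).
  apply NNPP. intros Hne.
  assert (Habs : 0 < Rabs (u b y)) by (apply Rabs_pos_lt, Hne).
  destruct (proj1 (continuous_near (u b) y) (c2_cont _ _ (proj1 (Hu b) y HOy)) (Rabs (u b y)) Habs) as [d [Hd Hd']].
  set (eta := Rmin (r / 4) (Rmin (d / 8) (Rmin (r / 32) (d / (8 * r))))).
  assert (Heta : 0 < eta).
  { repeat apply Rmin_glb_lt; try lra. apply Rdiv_lt_0_compat; lra. }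
  assert (E1 : eta <= r / 4) by apply Rmin_l.
  assert (E2 : eta <= d / 8) by (eapply Rle_trans; [apply Rmin_r | apply Rmin_l]).
  assert (E3 : eta <= r / 32) by (eapply Rle_trans; [apply Rmin_r | eapply Rle_trans; [apply Rmin_r | apply Rmin_l]]).
  assert (E4 : eta * r <= d / 8).
  { assert (eta <= d / (8 * r)) by (eapply Rle_trans; [apply Rmin_r | eapply Rle_trans; [apply Rmin_r | apply Rmin_r]]).
    apply Rmult_le_compat_r with (r := r) in H; [|lra].
    replace (d / (8 * r) * r) with (d / 8) in H by (field; lra). exact H. }
  set (eta' := Rmin eta (/ 32)). assert (Heta' : 0 < eta') by (apply Rmin_glb_lt; lra).
  assert (E5 : eta' <= eta) by apply Rmin_l. assert (E6 : eta' <= / 32) by apply Rmin_r.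
  destruct (inv_INR_lt eta' Heta') as [N HN].
  destruct (Hn eta' N Heta') as [j [m [HNj [[Hm [q [Hq Hqm]]] Hnm]]]].
  specialize (HN j HNj).
  assert (Hq' : near p eta' q) by (apply near_le with (2 := Hq); lra).
  set (c := dot (psub y q) m).
  (* The distance of [y] from the approximating plane, split into the tilt of the normal and the
     displacement of the base point. *)
  assert (Hc : Rabs c <= 3 * (r / 4 * eta') + 3 * (eta' * 1)).
  { replace c with (dot (psub y p) (psub m n) + dot (psub p q) m).
    - eapply Rle_trans; [apply Rabs_triang|]. apply Rplus_le_compat.
      + apply dot_small; try lra.
        * intros i. apply Rlt_le, Hy.
        * intros i. apply Rlt_le, Hnm.
      + apply dot_small; try lra.
        * intros i. apply Rlt_le. unfold psub. rewrite Rabs_minus_sym. apply Hq'.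
        * intros i. apply unit_coord_le, Hm.
    - transitivity (dot (psub y q) m - dot (psub y p) n); [unfold dot, sum3, psub; ring | rewrite Hyn; unfold c; ring]. }
  set (z := fun i => y i - c * m i).
  assert (Hyz : forall i, Rabs (z i - y i) <= Rabs c).
  { intros i. unfold z. replace (y i - c * m i - y i) with (- (c * m i)) by ring. rewrite Rabs_Ropp, Rabs_mult.
    pose proof (unit_coord_le m i Hm). pose proof (Rabs_pos c). nra. }
  assert (Hcd : Rabs c < d) by nra.
  assert (Hcr : Rabs c < r / 2) by nra.
  assert (Hz0 : u b z = 0).
  { rewrite <- (line_psub q z). apply (nodal_zero u O m).
    apply (nodal_move k); try assumption.
    - unfold psub at 1, dot, sum3, z. unfold c, dot, sum3, psub.
      transitivity (((y X1 - q X1) * m X1 + (y X2 - q X2) * m X2 + (y X3 - q X3) * m X3) * (1 - dot m m));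
        [unfold dot, sum3; ring | rewrite Hm; ring].
    - intros s Hs. apply Hr'. apply near_convex; [| rewrite line_psub | exact Hs].
      + apply near_le with (2 := Hq'). lra.
      + intros i. replace (z i - p i) with ((z i - y i) + (y i - p i)) by ring.
        eapply Rle_lt_trans; [apply Rabs_triang|]. specialize (Hyz i). specialize (Hy i). lra. }
  assert (Hnyz : near y d z) by (intros i; specialize (Hyz i); lra).
  specialize (Hd' z Hnyz). rewrite Hz0 in Hd'. unfold Rminus in Hd'. rewrite Rplus_0_l, Rabs_Ropp in Hd'. lra.
Qed.

(** * Reflections in a plane *)

Definition reflect_dir (n e : point) : point := fun i => e i - 2 * dot e n * n i.

Lemma plane_reflection_line p n x e s :
  plane_reflection p n (line x e s) = line (plane_reflection p n x) (reflect_dir n e) s.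
Proof.
  apply functional_extensionality. intros i. unfold plane_reflection, line, reflect_dir, dot, sum3, psub. ring.
Qed.

Lemma plane_reflection_mirror p n : plane_reflection p n = mirror (fun i => 2 * dot p n * n i) n.
Proof.
  apply functional_extensionality. intros x. apply functional_extensionality. intros i.
  unfold plane_reflection, mirror, dot, sum3, psub. ring.
Qed.

Lemma plane_reflection_dot p n x : dot n n = 1 -> dot (psub (plane_reflection p n x) p) n = - dot (psub x p) n.
Proof.
  intros Hn. transitivity (dot (psub x p) n - 2 * dot (psub x p) n * dot n n).
  - unfold plane_reflection. set (c := dot (psub x p) n). unfold dot, sum3, psub in c |- *. unfold c. ring.
  - rewrite Hn. ring.
Qed.

Lemma plane_reflection_involutive p n x : dot n n = 1 -> plane_reflection p n (plane_reflection p n x) = x.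
Proof.
  intros Hn. apply functional_extensionality. intros i.
  unfold plane_reflection at 1. rewrite plane_reflection_dot by exact Hn. unfold plane_reflection. ring.
Qed.

Lemma plane_reflection_fix p n x : dot (psub x p) n = 0 -> plane_reflection p n x = x.
Proof. intros H. apply functional_extensionality. intros i. unfold plane_reflection. rewrite H. ring. Qed.

Lemma dot_psub_self p n : dot (psub p p) n = 0.
Proof. unfold dot, sum3, psub. ring. Qed.

Lemma reflection_open p n O : dot n n = 1 -> open_set O -> open_set (fun x => O (plane_reflection p n x)).
Proof. intros Hn HO. rewrite plane_reflection_mirror. apply mirror_open; assumption. Qed.

Lemma reflection_near p n x y d : dot n n = 1 -> near x d y ->
  near (plane_reflection p n x) (7 * d) (plane_reflection p n y).
Proof. intros Hn H. rewrite plane_reflection_mirror. apply mirror_near; assumption. Qed.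

Lemma helm_reflection k p n O u : dot n n = 1 -> open_set O -> helm_on k O u ->
  helm_on k (fun x => O (plane_reflection p n x)) (fun x => u (plane_reflection p n x)).
Proof. intros Hn HO Hu. rewrite plane_reflection_mirror. apply helm_mirror; assumption. Qed.

Lemma helm_reflection_sum k p n O u : dot n n = 1 -> open_set O -> helm_on k O u ->
  helm_on k (fun x => O x /\ O (plane_reflection p n x)) (fun x => u x + u (plane_reflection p n x)).
Proof.
  intros Hn HO Hu.
  assert (HO2 : open_set (fun x => O x /\ O (plane_reflection p n x))).
  { apply open_set_and; [exact HO | apply reflection_open; assumption]. }
  apply helm_ext with (u := fun x => 1 * u x + 1 * u (plane_reflection p n x)); [exact HO2 | intros x _; ring |].
  apply helm_lin; [exact HO2 | |].
  - apply helm_on_sub with (2 := Hu). intros x Hx; apply Hx.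
  - apply helm_on_sub with (2 := helm_reflection k p n O u Hn HO Hu). intros x Hx; apply Hx.
Qed.

Lemma nodal_odd k u O n p : open_set O -> helm_field k O u -> nodal u O n p ->
  forall b, zero_near (fun x => u b x + u b (plane_reflection p n x)) p.
Proof.
  intros HO Hu [Hp [Hn [r [Hr Hz]]]] b.
  apply (odd_reflection k O (u b) p n r); try assumption.
  - apply Hu.
  - intros x Hx H0. apply Hz; assumption.
Qed.

(** * Continuous selections of affine functions *)

Record affine := mkAffine { sl1 : R; sl2 : R; ic : R }.
Definition aff (P : affine) (t1 t2 : R) : R := sl1 P * t1 + sl2 P * t2 + ic P.

Definition square (s1 s2 d t1 t2 : R) : Prop := Rabs (t1 - s1) < d /\ Rabs (t2 - s2) < d.

Lemma aff_lipschitz P : exists M, 0 < M /\ forall s1 s2 t1 t2 d, square s1 s2 d t1 t2 ->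
  Rabs (aff P t1 t2 - aff P s1 s2) <= M * d.
Proof.
  exists (1 + Rabs (sl1 P) + Rabs (sl2 P)).
  pose proof (Rabs_pos (sl1 P)) as H1. pose proof (Rabs_pos (sl2 P)) as H2.
  split; [lra|]. intros s1 s2 t1 t2 d [Hd1 Hd2].
  replace (aff P t1 t2 - aff P s1 s2) with (sl1 P * (t1 - s1) + sl2 P * (t2 - s2)) by (unfold aff; ring).
  eapply Rle_trans; [apply Rabs_triang|]. rewrite !Rabs_mult.
  pose proof (Rabs_pos (t1 - s1)). pose proof (Rabs_pos (t2 - s2)).
  assert (Rabs (sl1 P) * Rabs (t1 - s1) <= Rabs (sl1 P) * d) by (apply Rmult_le_compat_l; lra).
  assert (Rabs (sl2 P) * Rabs (t2 - s2) <= Rabs (sl2 P) * d) by (apply Rmult_le_compat_l; lra). lra.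
Qed.

Lemma aff_list_near (L : list affine) (q : point) (rho : R) : 0 < rho ->
  exists d, 0 < d /\ forall P, In P L -> forall t1 t2, square (q X1) (q X2) d t1 t2 ->
    Rabs (aff P t1 t2 - aff P (q X1) (q X2)) < rho.
Proof.
  intros Hr. induction L as [|P L [d [Hd IH]]].
  - exists 1. split; [lra|]. intros P [].
  - destruct (aff_lipschitz P) as [M [HM HP]].
    exists (Rmin d (rho / (2 * M))). split; [apply Rmin_glb_lt; [exact Hd | apply Rdiv_lt_0_compat; lra]|].
    intros P' [<-|HP'] t1 t2 Ht.
    + eapply Rle_lt_trans; [apply HP, Ht|].
      pose proof (Rmin_r d (rho / (2 * M))) as H.
      apply Rmult_le_compat_l with (r := M) in H; [|lra].
      replace (M * (rho / (2 * M))) with (rho / 2) in H by (field; lra). lra.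
    + apply IH; [exact HP'|]. pose proof (Rmin_l d (rho / (2 * M))). destruct Ht. split; lra.
Qed.

Lemma square_shrink s1 s2 d t1 t2 : square s1 s2 d t1 t2 ->
  exists e, 0 < e /\ forall x1 x2, square t1 t2 e x1 x2 -> square s1 s2 d x1 x2.
Proof.
  intros [H1 H2]. exists (Rmin (d - Rabs (t1 - s1)) (d - Rabs (t2 - s2))).
  split; [apply Rmin_glb_lt; lra|]. intros x1 x2 [Hx1 Hx2].
  pose proof (Rmin_l (d - Rabs (t1 - s1)) (d - Rabs (t2 - s2))).
  pose proof (Rmin_r (d - Rabs (t1 - s1)) (d - Rabs (t2 - s2))).
  split.
  - replace (x1 - s1) with ((x1 - t1) + (t1 - s1)) by ring. eapply Rle_lt_trans; [apply Rabs_triang|]. lra.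
  - replace (x2 - s2) with ((x2 - t2) + (t2 - s2)) by ring. eapply Rle_lt_trans; [apply Rabs_triang|]. lra.
Qed.

(* If the product of finitely many continuous functions vanishes on an open set, one of them vanishes on an open subset. *)
Lemma selection_vanishes (g : R -> R -> R) (Good : affine -> Prop) (Z : point -> Prop) (D : R -> R -> Prop) :
  (forall P t1 t2, Good P -> D t1 t2 -> ~ Z (mk t1 t2 (aff P t1 t2)) ->
     exists e, 0 < e /\ forall x1 x2, square t1 t2 e x1 x2 -> ~ Z (mk x1 x2 (aff P x1 x2))) ->
  (forall t1 t2, D t1 t2 -> Z (mk t1 t2 (g t1 t2))) ->
  forall (L : list affine) s1 s2 d, 0 < d ->
    (forall t1 t2, square s1 s2 d t1 t2 -> D t1 t2) ->
    (forall t1 t2, square s1 s2 d t1 t2 -> exists P, In P L /\ Good P /\ g t1 t2 = aff P t1 t2) ->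
    exists P c1 c2 e, Good P /\ 0 < e /\
      forall t1 t2, square c1 c2 e t1 t2 -> square s1 s2 d t1 t2 /\ Z (mk t1 t2 (aff P t1 t2)).
Proof.
  intros Hopen Hg L. induction L as [|P L IH]; intros s1 s2 d Hd HD Hsel.
  - destruct (Hsel s1 s2) as [P [[] _]]. split; rewrite Rminus_diag, Rabs_R0; exact Hd.
  - destruct (classic (exists t1 t2, square s1 s2 d t1 t2 /\ Good P /\ ~ Z (mk t1 t2 (aff P t1 t2)))) as [[t1 [t2 [Ht [HP HZ]]]]|Hno].
    + destruct (Hopen P t1 t2 HP (HD t1 t2 Ht) HZ) as [e1 [He1 H1]].
      destruct (square_shrink s1 s2 d t1 t2 Ht) as [e2 [He2 H2]].
      assert (Hsub : forall x1 x2, square t1 t2 (Rmin e1 e2) x1 x2 -> square t1 t2 e1 x1 x2 /\ square s1 s2 d x1 x2).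
      { intros x1 x2 [Hx1 Hx2]. pose proof (Rmin_l e1 e2). pose proof (Rmin_r e1 e2).
        split; [split; lra | apply H2; split; lra]. }
      destruct (IH t1 t2 (Rmin e1 e2)) as [P' [c1 [c2 [e [HP' [He Hc]]]]]].
      * apply Rmin_glb_lt; assumption.
      * intros x1 x2 Hx. apply HD, Hsub, Hx.
      * intros x1 x2 Hx. destruct (Hsub x1 x2 Hx) as [Hx1 Hx2].
        destruct (Hsel x1 x2 Hx2) as [P' [[<-|HP'] [HG E]]]; [exfalso | exists P'; auto].
        apply (H1 x1 x2 Hx1). rewrite <- E. apply Hg, HD, Hx2.
      * exists P', c1, c2, e. split; [exact HP' | split; [exact He|]]. intros x1 x2 Hx.
        destruct (Hc x1 x2 Hx) as [Hx1 Hx2]. split; [apply Hsub, Hx1 | exact Hx2].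
    + destruct (classic (Good P)) as [HP|HP].
      * exists P, s1, s2, d. split; [exact HP | split; [exact Hd|]]. intros t1 t2 Ht. split; [exact Ht|].
        apply NNPP. intros HZ. apply Hno. exists t1, t2. auto.
      * apply (IH s1 s2 d Hd HD). intros t1 t2 Ht.
        destruct (Hsel t1 t2 Ht) as [P' [[<-|HP'] [HG E]]]; [contradiction | exists P'; auto].
Qed.

Definition graph_continuous (f : R -> R -> R) : Prop :=
  forall p : point, continuous (fun x : point => f (x X1) (x X2)) p.

(** What is retained of the triangulation: at each point the height is the value of one of finitely
    many affine functions. The shapes of the pieces play their part only through this. *)
Definition selection (f : R -> R -> R) (L : list affine) : Prop :=
  forall t1 t2, exists P, In P L /\ f t1 t2 = aff P t1 t2.

Definition normal (P : affine) : point :=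
  let c := / sqrt (1 + sl1 P ^ 2 + sl2 P ^ 2) in mk (- sl1 P * c) (- sl2 P * c) c.

Lemma normal_unit P : dot (normal P) (normal P) = 1.
Proof.
  unfold normal, dot, sum3, mk.
  assert (H : 0 < 1 + sl1 P ^ 2 + sl2 P ^ 2) by (pose proof (pow2_ge_0 (sl1 P)); pose proof (pow2_ge_0 (sl2 P)); lra).
  pose proof (sqrt_lt_R0 _ H) as Hs. pose proof (sqrt_sqrt _ (Rlt_le _ _ H)) as Hss.
  set (s := sqrt (1 + sl1 P ^ 2 + sl2 P ^ 2)) in *.
  transitivity ((1 + sl1 P ^ 2 + sl2 P ^ 2) / (s * s)); [field; lra | rewrite Hss; field; lra].
Qed.

Lemma normal_dot P x : exists c, 0 < c /\ dot x (normal P) = c * (x X3 - sl1 P * x X1 - sl2 P * x X2).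
Proof.
  assert (H : 0 < 1 + sl1 P ^ 2 + sl2 P ^ 2) by (pose proof (pow2_ge_0 (sl1 P)); pose proof (pow2_ge_0 (sl2 P)); lra).
  exists (/ sqrt (1 + sl1 P ^ 2 + sl2 P ^ 2)). split; [apply Rinv_0_lt_compat, sqrt_lt_R0, H|].
  unfold normal, dot, sum3, mk. ring.
Qed.

(** The point [q] may lie on an edge or at a vertex. Near it only affine functions passing through
    [q] are selected, and one of them carries a disc of zeros, possibly away from [q]; its plane
    contains [q], so the zeros are moved to [q] within the plane. *)
Lemma nodal_on_graph k w f L q rho d0 :
  graph_continuous f -> selection f L -> f (q X1) (q X2) = q X3 -> 0 < rho -> 0 < d0 ->
  helm_field k (near q rho) w ->
  (forall t1 t2, square (q X1) (q X2) d0 t1 t2 -> forall b, w b (mk t1 t2 (f t1 t2)) = 0) ->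
  exists n, nodal w (near q rho) n q.
Proof.
  intros Hf HL Hq Hrho Hd0 Hw Hz.
  set (Good := fun P => aff P (q X1) (q X2) = q X3).
  (* near q, only the affine pieces through q are selected *)
  assert (Hgood : exists d, 0 < d /\ forall P, In P L -> forall t1 t2, square (q X1) (q X2) d t1 t2 ->
    f t1 t2 = aff P t1 t2 -> Good P).
  { clear HL. induction L as [|P L [d [Hd IH]]].
    - exists 1. split; [lra|]. intros P [].
    - destruct (classic (Good P)) as [HP|HP].
      + exists d. split; [exact Hd|]. intros P' [<-|HP'] t1 t2 Ht E; [exact HP | apply (IH P' HP' t1 t2); assumption].
      + set (gap := Rabs (aff P (q X1) (q X2) - q X3)).
        assert (Hgap : 0 < gap) by (apply Rabs_pos_lt; intros E; apply HP; unfold Good; lra).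
        destruct (aff_list_near (P :: nil) q (gap / 2)) as [e1 [He1 H1]]; [lra|].
        destruct (proj1 (continuous_near _ q) (Hf q) (gap / 2)) as [e2 [He2 H2]]; [lra|].
        exists (Rmin d (Rmin e1 e2)). split; [repeat apply Rmin_glb_lt; assumption|].
        pose proof (Rmin_l d (Rmin e1 e2)). pose proof (Rmin_r d (Rmin e1 e2)).
        pose proof (Rmin_l e1 e2). pose proof (Rmin_r e1 e2).
        intros P' [<-|HP'] t1 t2 [Ht1 Ht2] E.
        * exfalso.
          assert (A1 : Rabs (aff P t1 t2 - aff P (q X1) (q X2)) < gap / 2).
          { apply H1; [left; reflexivity | split; lra]. }
          assert (A2 : Rabs (f t1 t2 - q X3) < gap / 2).
          { rewrite <- Hq. apply (H2 (mk t1 t2 (q X3))). intros []; simpl; try lra.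
            rewrite Rminus_diag, Rabs_R0. exact He2. }
          rewrite E in A2.
          pose proof (Rabs_triang (aff P (q X1) (q X2) - aff P t1 t2) (aff P t1 t2 - q X3)) as T.
          replace (aff P (q X1) (q X2) - aff P t1 t2 + (aff P t1 t2 - q X3)) with (aff P (q X1) (q X2) - q X3) in T by ring.
          rewrite Rabs_minus_sym in A1. fold gap in T. lra.
        * apply (IH P' HP' t1 t2); [split; lra | exact E]. }
  destruct Hgood as [dg [Hdg Hgood]].
  destruct (aff_list_near L q rho Hrho) as [da [Hda Hnear]].
  set (d := Rmin (Rmin dg da) (Rmin d0 rho)).
  assert (Hd : 0 < d) by (repeat apply Rmin_glb_lt; assumption).
  assert (Hd1 : d <= dg) by (eapply Rle_trans; [apply Rmin_l | apply Rmin_l]).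
  assert (Hd2 : d <= da) by (eapply Rle_trans; [apply Rmin_l | apply Rmin_r]).
  assert (Hd3 : d <= d0) by (eapply Rle_trans; [apply Rmin_r | apply Rmin_l]).
  assert (Hd4 : d <= rho) by (eapply Rle_trans; [apply Rmin_r | apply Rmin_r]).
  assert (Hin : forall P t1 t2, In P L -> Good P -> square (q X1) (q X2) d t1 t2 -> near q rho (mk t1 t2 (aff P t1 t2))).
  { intros P t1 t2 HP HG [Ht1 Ht2] []; simpl; try lra.
    rewrite <- HG. apply Hnear; [exact HP | split; lra]. }
  destruct (selection_vanishes f (fun P => In P L /\ Good P) (fun x => forall b, w b x = 0)
    (fun t1 t2 => square (q X1) (q X2) d t1 t2)) with (L := L) (s1 := q X1) (s2 := q X2) (d := d)
    as [P [c1 [c2 [e [[HPL HPG] [He Hc]]]]]].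
  - intros P t1 t2 [HPL HPG] Ht HZ.
    apply not_all_ex_not in HZ. destruct HZ as [b Hb].
    assert (Hab : 0 < Rabs (w b (mk t1 t2 (aff P t1 t2)))) by (apply Rabs_pos_lt, Hb).
    destruct (proj1 (continuous_near (w b) _) (c2_cont _ _ (proj1 (Hw b) _ (Hin P t1 t2 HPL HPG Ht))) _ Hab) as [r [Hr Hr']].
    destruct (aff_list_near (P :: nil) (mk t1 t2 0) r Hr) as [e1 [He1 H1]].
    exists (Rmin r e1). split; [apply Rmin_glb_lt; assumption|].
    intros x1 x2 [Hx1 Hx2] HZ. pose proof (Rmin_l r e1). pose proof (Rmin_r r e1).
    assert (Hn : near (mk t1 t2 (aff P t1 t2)) r (mk x1 x2 (aff P x1 x2))).
    { intros []; simpl; try lra. apply (H1 P (or_introl eq_refl)). split; simpl; lra. }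
    specialize (Hr' _ Hn). rewrite (HZ b) in Hr'. unfold Rminus in Hr'. rewrite Rplus_0_l, Rabs_Ropp in Hr'. lra.
  - intros t1 t2 [Ht1 Ht2] b. apply Hz. split; lra.
  - exact Hd.
  - intros t1 t2 Ht; exact Ht.
  - intros t1 t2 Ht. destruct (HL t1 t2) as [P [HP E]]. exists P. split; [exact HP|]. split; [|exact E].
    split; [exact HP|]. apply (Hgood P HP t1 t2); [|exact E]. destruct Ht. split; lra.
  - exists (normal P).
    set (p := mk c1 c2 (aff P c1 c2)).
    assert (Hcc : square c1 c2 e c1 c2) by (split; rewrite Rminus_diag, Rabs_R0; exact He).
    assert (Hp : near q rho p) by (apply Hin; [exact HPL | exact HPG | apply Hc, Hcc]).
    assert (Hpl : forall x y, dot (psub x y) (normal P) = 0 <->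
      x X3 - aff P (x X1) (x X2) = y X3 - aff P (y X1) (y X2)).
    { intros x y. destruct (normal_dot P (psub x y)) as [c [Hc0 ->]]. unfold psub, aff. split; intros H.
      - apply Rmult_integral in H. destruct H as [H|H]; lra.
      - match goal with |- c * ?a = 0 => replace a with 0 by lra end. ring. }
    assert (Hnp : nodal w (near q rho) (normal P) p).
    { split; [exact Hp | split; [apply normal_unit|]]. exists e. split; [exact He|].
      intros x Hx Hx0 b. apply Hpl in Hx0. unfold p in Hx0. simpl in Hx0.
      rewrite <- (mk_eta x). replace (x X3) with (aff P (x X1) (x X2)) by lra.
      apply Hc. split; [apply (Hx X1) | apply (Hx X2)]. }
    assert (H : nodal w (near q rho) (normal P) (line p (psub q p) 1)).
    { apply (nodal_move k); try assumption.
      - apply near_open.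
      - apply Hpl. unfold p. simpl. unfold Good in HPG. lra.
      - intros s Hs. apply near_convex; [exact Hp | rewrite line_psub; apply near_refl, Hrho | exact Hs]. }
    rewrite line_psub in H. exact H.
Qed.

(** * Total fields above a polyhedral surface *)

Definition epigraph (f : R -> R -> R) (x : point) : Prop := f (x X1) (x X2) < x X3.

(* [u^in + u^re = -2 i exp (i k (al x1 + be x2)) sin (k ga x3)]. *)
Definition flat_field (k al be ga : R) : field := fun b x =>
  let A := k * (al * x X1 + be * x X2) in
  if b then 2 * sin A * sin (k * ga * x X3) else -2 * cos A * sin (k * ga * x X3).

(** The interface between the scattering data and the geometric argument: the scattered part is
    described by its uniform decay [tf_decay], the surface by the list [L] of affine functions, and
    [Rad] bounds both its height and its perturbed part. *)
Record total_field (k al be ga : R) (f : R -> R -> R) (Rad : R) (L : list affine) (u : field) : Prop := {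
  tf_k : 0 < k;
  tf_dir : al ^ 2 + be ^ 2 + ga ^ 2 = 1;
  tf_ga : 0 < ga;
  tf_rad : 0 < Rad;
  tf_cont : graph_continuous f;
  tf_bound : forall t1 t2, Rabs (f t1 t2) < Rad;
  tf_far : forall t1 t2, Rad ^ 2 < t1 ^ 2 + t2 ^ 2 -> f t1 t2 = 0;
  tf_sel : selection f L;
  tf_helm : helm_field k (epigraph f) u;
  tf_bc : forall p, p X3 = f (p X1) (p X2) -> forall eps, 0 < eps ->
    exists d, 0 < d /\ forall x, epigraph f x -> near p d x -> forall b, Rabs (u b x) < eps;
  tf_decay : forall eps, 0 < eps -> exists r0, forall x, epigraph f x -> r0 ^ 2 < dot x x ->
    forall b, Rabs (u b x - flat_field k al be ga b x) < eps
}.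

Lemma epigraph_open f : graph_continuous f -> open_set (epigraph f).
Proof.
  intros Hf p Hp.
  destruct (continuous_open_lt (fun x => x X3 - f (x X1) (x X2)) 0) with (p := p) as [r [Hr H]].
  - intros q. apply cont_minus; [apply cont_coord | apply Hf].
  - unfold epigraph in Hp. lra.
  - exists r. split; [exact Hr|]. intros q Hq. specialize (H q Hq). unfold epigraph. lra.
Qed.

Lemma flat_field_norm k al be ga x :
  flat_field k al be ga true x ^ 2 + flat_field k al be ga false x ^ 2 = 4 * sin (k * ga * x X3) ^ 2.
Proof.
  unfold flat_field. set (A := k * (al * x X1 + be * x X2)). set (S := sin (k * ga * x X3)).
  pose proof (sin2_cos2 A) as H. unfold Rsqr in H.
  transitivity (4 * S ^ 2 * (sin A * sin A + cos A * cos A)); [ring | rewrite H; ring].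
Qed.

Lemma C2fun_sin c a : C2fun (fun t => c * sin (a * t)) (fun t => c * (a * cos (a * t))) (fun t => - (c * (a * (a * sin (a * t))))).
Proof.
  split; [|split]; intros t.
  - auto_derive; [exact I | ring].
  - auto_derive; [exact I | ring].
  - refine (is_derive_cont _ t (- (c * (a * (a * (a * cos (a * t)))))) _). auto_derive; [exact I | ring].
Qed.

Lemma C2fun_cos c a : C2fun (fun t => c * cos (a * t)) (fun t => - (c * (a * sin (a * t)))) (fun t => - (c * (a * (a * cos (a * t))))).
Proof.
  split; [|split]; intros t.
  - auto_derive; [exact I | ring].
  - auto_derive; [exact I | ring].
  - refine (is_derive_cont _ t (c * (a * (a * (a * sin (a * t))))) _). auto_derive; [exact I | ring].
Qed.

Lemma flat_field_helm k al be ga : al ^ 2 + be ^ 2 + ga ^ 2 = 1 -> helm_field k (fun _ => True) (flat_field k al be ga).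
Proof.
  intros Hd b.
  set (e1 := mk al be 0). set (e2 := basis X3).
  assert (E2 : forall x, dot x e2 = x X3) by (intros x; unfold e2, dot, sum3, basis; simpl; ring).
  assert (E1 : forall x, dot x e1 = al * x X1 + be * x X2) by (intros x; unfold e1, dot, sum3, mk; ring).
  assert (Hgen : forall F F1 F2, C2fun F F1 F2 -> (forall t, F2 t = - (k ^ 2 * F t)) ->
    helm_on k (fun _ => True) (fun x => F (dot x e1) * (1 * sin (k * ga * dot x e2)))).
  { intros F F1 F2 HF HF2.
    destruct (c2_linear e1 F F1 F2 HF) as [A1 [A2 A3]].
    destruct (c2_linear e2 _ _ _ (C2fun_sin 1 (k * ga))) as [B1 [B2 B3]].
    destruct (c2_mult _ _ _ full_open A1 B1) as [C1 [_ C3]].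
    split; [exact C1|]. intros x _. unfold laplacian, sum3. rewrite !C3 by exact I.
    rewrite !A2, !A3, !B2, !B3, HF2.
    assert (H1 : e1 X1 = al /\ e1 X2 = be /\ e1 X3 = 0) by (repeat split).
    assert (H2 : e2 X1 = 0 /\ e2 X2 = 0 /\ e2 X3 = 1).
    { unfold e2. rewrite basis_eq, !basis_neq by discriminate. repeat split. }
    destruct H1 as [-> [-> ->]]. destruct H2 as [-> [-> ->]].
    set (P := F (dot x e1)). set (S := sin (k * ga * dot x e2)).
    transitivity (k ^ 2 * P * S * (1 - (al ^ 2 + be ^ 2 + ga ^ 2))); [ring | rewrite Hd; ring]. }
  destruct b.
  - apply helm_ext with (u := fun x => (fun t => 2 * sin (k * t)) (dot x e1) * (1 * sin (k * ga * dot x e2))).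
    + exact full_open.
    + intros x _. rewrite E1, E2. unfold flat_field. ring.
    + apply (Hgen _ _ _ (C2fun_sin 2 k)). intros t. ring.
  - apply helm_ext with (u := fun x => (fun t => -2 * cos (k * t)) (dot x e1) * (1 * sin (k * ga * dot x e2))).
    + exact full_open.
    + intros x _. rewrite E1, E2. unfold flat_field. ring.
    + apply (Hgen _ _ _ (C2fun_cos (-2) k)). intros t. ring.
Qed.

(* The part of an epigraph over a square is swept out by vertical and horizontal segments. *)
Lemma epigraph_continuation k (O : point -> Prop) (f : R -> R -> R) w s1 s2 d T0 T p x :
  open_set O -> helm_on k O w -> T0 < T ->
  (forall t1 t2, square s1 s2 d t1 t2 -> f t1 t2 < T0) ->
  (forall y, square s1 s2 d (y X1) (y X2) -> f (y X1) (y X2) < y X3 < T -> O y) ->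
  square s1 s2 d (p X1) (p X2) -> f (p X1) (p X2) < p X3 < T -> zero_near w p ->
  square s1 s2 d (x X1) (x X2) -> f (x X1) (x X2) < x X3 < T -> zero_near w x.
Proof.
  intros HO Hw HT Hf HO' Hp1 Hp2 Hp Hx1 Hx2.
  set (H := Rmax (Rmax (p X3) (x X3)) ((T0 + T) / 2)).
  assert (HHT : H < T) by (repeat apply Rmax_lub_lt; lra).
  assert (HHp : p X3 <= H) by (eapply Rle_trans; [apply Rmax_l | apply Rmax_l]).
  assert (HHx : x X3 <= H) by (eapply Rle_trans; [apply Rmax_r | apply Rmax_l]).
  assert (HH0 : T0 < H) by (apply Rlt_le_trans with ((T0 + T) / 2); [lra | apply Rmax_r]).
  set (p' := mk (p X1) (p X2) H). set (x' := mk (x X1) (x X2) H).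
  assert (Z1 : zero_near w p').
  { rewrite <- (line_psub p p'). apply (continuation_segment k O); try assumption.
    intros s Hs. apply HO'; unfold line, psub, p', mk; simpl.
    - replace (p X1 + s * (p X1 - p X1)) with (p X1) by ring.
      replace (p X2 + s * (p X2 - p X2)) with (p X2) by ring. exact Hp1.
    - replace (p X1 + s * (p X1 - p X1)) with (p X1) by ring.
      replace (p X2 + s * (p X2 - p X2)) with (p X2) by ring. split; nra. }
  assert (Z2 : zero_near w x').
  { rewrite <- (line_psub p' x'). apply (continuation_segment k O); try assumption.
    intros s Hs.
    assert (Hsq : square s1 s2 d (p X1 + s * (x X1 - p X1)) (p X2 + s * (x X2 - p X2))).
    { pose proof (near_convex (mk s1 s2 0) d (mk (p X1) (p X2) 0) (mk (x X1 - p X1) (x X2 - p X2) 0) s) as Hc.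
      destruct Hp1 as [Q1 Q2]. destruct Hx1 as [Q3 Q4].
      assert (Hd : 0 < d) by (pose proof (Rabs_pos (p X1 - s1)); lra).
      assert (N1 : near (mk s1 s2 0) d (mk (p X1) (p X2) 0)).
      { intros []; simpl; try lra. rewrite Rminus_diag, Rabs_R0. exact Hd. }
      assert (N2 : near (mk s1 s2 0) d (line (mk (p X1) (p X2) 0) (mk (x X1 - p X1) (x X2 - p X2) 0) 1)).
      { intros []; unfold line, mk; simpl.
        - replace (p X1 + 1 * (x X1 - p X1) - s1) with (x X1 - s1) by ring. exact Q3.
        - replace (p X2 + 1 * (x X2 - p X2) - s2) with (x X2 - s2) by ring. exact Q4.
        - replace (0 + 1 * 0 - 0) with 0 by ring. rewrite Rabs_R0. exact Hd. }
      specialize (Hc N1 N2 Hs). split; [apply (Hc X1) | apply (Hc X2)]. }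
    apply HO'; unfold line, psub, p', x', mk; simpl; [exact Hsq|].
    replace (H + s * (H - H)) with H by ring. split; [|exact HHT]. specialize (Hf _ _ Hsq). lra. }
  rewrite <- (line_psub x' x). apply (continuation_segment k O); try assumption.
  intros s Hs. apply HO'; unfold line, psub, x', mk; simpl.
  - replace (x X1 + s * (x X1 - x X1)) with (x X1) by ring.
    replace (x X2 + s * (x X2 - x X2)) with (x X2) by ring. exact Hx1.
  - replace (x X1 + s * (x X1 - x X1)) with (x X1) by ring.
    replace (x X2 + s * (x X2 - x X2)) with (x X2) by ring.
    specialize (Hf _ _ Hx1). split; nra.
Qed.

Lemma square_large (p x : point) : exists d, square 0 0 d (p X1) (p X2) /\ square 0 0 d (x X1) (x X2).
Proof.
  exists (1 + Rabs (p X1) + Rabs (p X2) + Rabs (x X1) + Rabs (x X2)). unfold square. rewrite !Rminus_0_r.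
  pose proof (Rabs_pos (p X1)). pose proof (Rabs_pos (p X2)). pose proof (Rabs_pos (x X1)). pose proof (Rabs_pos (x X2)).
  repeat split; lra.
Qed.

Lemma epigraph_unique_continuation k f Rad w p :
  graph_continuous f -> (forall t1 t2, Rabs (f t1 t2) < Rad) -> helm_on k (epigraph f) w ->
  epigraph f p -> zero_near w p -> forall x, epigraph f x -> w x = 0.
Proof.
  intros Hf Hb Hw Hp Hz x Hx. apply zero_near_at.
  destruct (square_large p x) as [d [Hd1 Hd2]].
  set (T := 1 + Rmax Rad (Rmax (p X3) (x X3))).
  assert (HT1 : Rad < T) by (unfold T; pose proof (Rmax_l Rad (Rmax (p X3) (x X3))); lra).
  assert (HT2 : p X3 < T).
  { unfold T. pose proof (Rmax_r Rad (Rmax (p X3) (x X3))). pose proof (Rmax_l (p X3) (x X3)). lra. }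
  assert (HT3 : x X3 < T).
  { unfold T. pose proof (Rmax_r Rad (Rmax (p X3) (x X3))). pose proof (Rmax_r (p X3) (x X3)). lra. }
  apply (epigraph_continuation k (epigraph f) f w 0 0 d Rad T p x); try assumption.
  - apply epigraph_open, Hf.
  - intros t1 t2 _. specialize (Hb t1 t2). apply Rabs_lt_between in Hb. lra.
  - intros y _ Hy. apply Hy.
  - split; [exact Hp | exact HT2].
  - split; [exact Hx | exact HT3].
Qed.

Lemma nodal_line k u O n p e :
  open_set O -> helm_field k O u -> nodal u O n p -> dot e n = 0 ->
  (forall s, 0 <= s <= 1 -> O (line p e s)) -> forall b, u b (line p e 1) = 0.
Proof.
  intros HO Hu Hn He Hseg. apply (nodal_zero u O n). apply (nodal_move k); assumption.
Qed.

Lemma line_scal p e c s : line p (fun i => c * e i) s = line p e (c * s).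
Proof. apply functional_extensionality. intros i. unfold line. ring. Qed.

Lemma sin_quarter m : sin (PI / 2 + 2 * INR m * PI) = 1.
Proof. rewrite sin_period. apply sin_PI2. Qed.

(** * Nodal planes above the surface *)

Section HighPlanes.

Context (k al be ga : R) (f : R -> R -> R) (Rad : R) (L : list affine) (u : field).
Context (TF : total_field k al be ga f Rad L u).

Let Om := epigraph f.
Let U0 := flat_field k al be ga.

Lemma Om_open : open_set Om.
Proof. apply epigraph_open, (tf_cont _ _ _ _ _ _ _ _ TF). Qed.

Lemma Om_high x : Rad <= x X3 -> Om x.
Proof.
  intros Hx. pose proof (tf_bound _ _ _ _ _ _ _ _ TF (x X1) (x X2)) as H. apply Rabs_lt_between in H.
  unfold Om, epigraph. lra.
Qed.

Lemma Om_far x : Rad ^ 2 < x X1 ^ 2 + x X2 ^ 2 -> 0 < x X3 -> Om x.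
Proof.
  intros Hx H3. unfold Om, epigraph. rewrite (tf_far _ _ _ _ _ _ _ _ TF) by exact Hx. exact H3.
Qed.

(** The projection [tau] of the vertical onto the plane ascends, so the plane is followed upwards,
    clear of the surface, to heights beyond every radius where the sine equals 1. There [u = 0] is
    not close to a flat field of modulus 2. *)
Lemma no_high_slanted_plane n p : nodal u Om n p -> Rad <= p X3 -> n X3 ^ 2 < 1 -> False.
Proof.
  intros Hn Hp Hn3.
  pose proof (tf_k _ _ _ _ _ _ _ _ TF) as Hk. pose proof (tf_ga _ _ _ _ _ _ _ _ TF) as Hga.
  assert (Hkg : 0 < k * ga) by (apply Rmult_lt_0_compat; assumption).
  assert (Hnn : dot n n = 1) by apply Hn.
  destruct (tf_decay _ _ _ _ _ _ _ _ TF (1 / 2) ltac:(lra)) as [r0 Hr0].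
  set (tau := fun i => basis X3 i - n X3 * n i).
  assert (Htn : dot tau n = 0).
  { transitivity (n X3 * (1 - dot n n)); [unfold dot, sum3, tau, basis; simpl; ring | rewrite Hnn; ring]. }
  assert (Ht3 : tau X3 = 1 - n X3 ^ 2) by (unfold tau; rewrite basis_eq; ring).
  set (t3 := 1 - n X3 ^ 2) in *. assert (Ht0 : 0 < t3) by (unfold t3; lra).
  (* a height, above p and far away, at which the flat field has modulus 2 *)
  destruct (INR_unbounded ((k * ga) * (Rabs r0 + Rabs (p X3) + 1))) as [m Hm].
  set (hgt := (PI / 2 + 2 * INR m * PI) / (k * ga)).
  assert (Hh : Rabs r0 + Rabs (p X3) + 1 <= hgt).
  { apply Rmult_le_reg_l with (k * ga); [exact Hkg|].
    replace (k * ga * hgt) with (PI / 2 + 2 * INR m * PI) by (unfold hgt; field; lra).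
    pose proof PI2_1. pose proof (pos_INR m). nra. }
  set (s := (hgt - p X3) / t3).
  assert (Hs : 0 <= s).
  { apply Rdiv_le_0_compat; [|exact Ht0]. pose proof (Rle_abs (p X3)). pose proof (Rabs_pos r0). lra. }
  set (x := line p tau s).
  assert (Hx3 : x X3 = hgt) by (unfold x, line; rewrite Ht3; unfold s; field; lra).
  assert (Hux : forall b, u b x = 0).
  { intros b. unfold x. replace (line p tau s) with (line p (fun i => s * tau i) 1) by (rewrite line_scal; f_equal; ring).
    apply (nodal_line k u Om n); try assumption.
    - apply Om_open.
    - apply (tf_helm _ _ _ _ _ _ _ _ TF).
    - transitivity (s * dot tau n); [unfold dot, sum3; ring | rewrite Htn; ring].
    - intros c Hc. apply Om_high. unfold line. rewrite Ht3.
      assert (0 <= c * (s * t3)) by (apply Rmult_le_pos; [lra | apply Rmult_le_pos; lra]). lra. }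
  assert (HOx : Om x).
  { apply Om_high. rewrite Hx3. pose proof (Rle_abs (p X3)). pose proof (Rabs_pos r0). lra. }
  assert (Hxr : r0 ^ 2 < dot x x).
  { unfold dot, sum3. rewrite Hx3. rewrite <- (pow2_abs r0).
    pose proof (pow2_ge_0 (x X1)). pose proof (pow2_ge_0 (x X2)). pose proof (Rabs_pos r0). pose proof (Rabs_pos (p X3)). nra. }
  pose proof (Hr0 x HOx Hxr true) as B1. pose proof (Hr0 x HOx Hxr false) as B2.
  rewrite Hux in B1, B2. apply Rabs_lt_between in B1. apply Rabs_lt_between in B2.
  pose proof (flat_field_norm k al be ga x) as HN. rewrite Hx3 in HN.
  replace (k * ga * hgt) with (PI / 2 + 2 * INR m * PI) in HN by (unfold hgt; field; lra).
  rewrite sin_quarter in HN. nra.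
Qed.

Definition horizontal (c : R) : Prop := Rad <= c /\ forall y, y X3 = c -> forall b, u b y = 0.

Lemma horizontal_of_nodal n p : nodal u Om n p -> Rad <= p X3 -> n X3 ^ 2 = 1 -> horizontal (p X3).
Proof.
  intros Hn Hp Hn3. split; [exact Hp|]. intros y Hy b.
  assert (Hnn : dot n n = 1) by apply Hn.
  assert (H12 : n X1 = 0 /\ n X2 = 0).
  { unfold dot, sum3 in Hnn. pose proof (pow2_ge_0 (n X1)). pose proof (pow2_ge_0 (n X2)). split; nra. }
  rewrite <- (line_psub p y). apply (nodal_line k u Om n); try assumption.
  - apply Om_open.
  - apply (tf_helm _ _ _ _ _ _ _ _ TF).
  - unfold dot, sum3, psub. destruct H12 as [-> ->]. rewrite Hy. ring.
  - intros s Hs. apply Om_high. unfold line, psub. rewrite Hy. lra.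
Qed.

(** Far out in the plane the scattered part is negligible, while the modulus of the flat field
    depends on the height only. *)
Lemma horizontal_sin c : horizontal c -> sin (k * ga * c) = 0.
Proof.
  intros [Hc Hz]. apply NNPP. intros Hne.
  assert (Hab : 0 < Rabs (sin (k * ga * c))) by (apply Rabs_pos_lt, Hne).
  destruct (tf_decay _ _ _ _ _ _ _ _ TF (Rabs (sin (k * ga * c))) Hab) as [r0 Hr0].
  set (x := mk (Rabs r0 + 1) 0 c).
  assert (HOx : Om x) by (apply Om_high; exact Hc).
  assert (Hxr : r0 ^ 2 < dot x x).
  { unfold dot, sum3, x, mk. rewrite <- (pow2_abs r0). pose proof (Rabs_pos r0). nra. }
  pose proof (Hr0 x HOx Hxr true) as B1. pose proof (Hr0 x HOx Hxr false) as B2.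
  rewrite (Hz x eq_refl) in B1, B2.
  pose proof (flat_field_norm k al be ga x) as HN. change (x X3) with c in HN.
  rewrite <- (pow2_abs (sin (k * ga * c))) in HN.
  set (S := Rabs (sin (k * ga * c))) in *.
  apply Rabs_lt_between in B1. apply Rabs_lt_between in B2. nra.
Qed.

Lemma basis3_unit : dot (basis X3) (basis X3) = 1.
Proof. unfold dot, sum3, basis; simpl; ring. Qed.

Lemma horizontal_reflection p x : plane_reflection p (basis X3) x = mk (x X1) (x X2) (2 * p X3 - x X3).
Proof.
  apply functional_extensionality. intros []; unfold plane_reflection, dot, sum3, psub, basis, mk; simpl; ring.
Qed.

Lemma horizontal_nodal c p : horizontal c -> p X3 = c -> nodal u Om (basis X3) p.
Proof.
  intros [Hc Hz] Hp. split; [apply Om_high; lra | split; [apply basis3_unit|]].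
  exists 1. split; [lra|]. intros q _ Hq b. apply Hz. rewrite <- Hp.
  unfold dot, sum3, psub, basis in Hq; simpl in Hq. lra.
Qed.

(** Stated off the perturbed part, where the surface is the plane [x3 = 0]: there the vertical
    segment from the nodal plane to [y] and its mirror image both stay in the domain. *)
Lemma horizontal_odd c y b : horizontal c -> Rad ^ 2 < y X1 ^ 2 + y X2 ^ 2 -> 0 < y X3 < 2 * c ->
  u b (mk (y X1) (y X2) (2 * c - y X3)) = - u b y.
Proof.
  intros Hc Hfar Hy.
  set (p := mk (y X1) (y X2) c).
  pose proof (horizontal_nodal c p Hc eq_refl) as Hn.
  pose proof (nodal_odd k u Om _ p Om_open (tf_helm _ _ _ _ _ _ _ _ TF) Hn b) as Hz.
  assert (Hzy : zero_near (fun x => u b x + u b (plane_reflection p (basis X3) x)) (line p (psub y p) 1)).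
  { apply (continuation_segment k (fun x => Om x /\ Om (plane_reflection p (basis X3) x))); try exact Hz.
    - apply open_set_and; [apply Om_open | apply reflection_open; [apply basis3_unit | apply Om_open]].
    - apply helm_reflection_sum; [apply basis3_unit | apply Om_open | apply (tf_helm _ _ _ _ _ _ _ _ TF)].
    - intros s Hs. rewrite horizontal_reflection.
      assert (E1 : line p (psub y p) s X1 = y X1) by (unfold line, psub, p, mk; simpl; ring).
      assert (E2 : line p (psub y p) s X2 = y X2) by (unfold line, psub, p, mk; simpl; ring).
      assert (E3 : line p (psub y p) s X3 = c + s * (y X3 - c)) by (unfold line, psub, p, mk; simpl; ring).
      split; apply Om_far; unfold mk; simpl; rewrite ?E1, ?E2, ?E3; try exact Hfar; unfold p, mk; simpl; nra. }
  rewrite line_psub in Hzy. apply zero_near_at in Hzy. rewrite horizontal_reflection in Hzy.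
  unfold p in Hzy. simpl in Hzy. lra.
Qed.

(** Off the perturbed part, the zero boundary values on [x3 = 0] are reflected to the height
    [2 * c]. The resulting disc of zeros extends over the whole plane, since that plane lies above
    the surface. *)
Lemma horizontal_double c : horizontal c -> horizontal (2 * c).
Proof.
  intros Hc. pose proof (tf_rad _ _ _ _ _ _ _ _ TF) as HR. assert (Hc0 : Rad <= c) by apply Hc.
  assert (Hfar0 : forall y, Rad ^ 2 < y X1 ^ 2 + y X2 ^ 2 -> y X3 = 2 * c -> forall b, u b y = 0).
  { intros y Hy Hy3 b. apply NNPP. intros Hne.
    assert (Hab : 0 < Rabs (u b y) / 2) by (pose proof (Rabs_pos_lt _ Hne); lra).
    assert (HOy : Om y) by (apply Om_high; lra).
    destruct (proj1 (continuous_near (u b) y) (c2_cont _ _ (proj1 (tf_helm _ _ _ _ _ _ _ _ TF b) y HOy)) _ Hab)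
      as [d1 [Hd1 H1]].
    destruct (tf_bc _ _ _ _ _ _ _ _ TF (mk (y X1) (y X2) 0)) with (eps := Rabs (u b y) / 2) as [d2 [Hd2 H2]].
    - simpl. rewrite (tf_far _ _ _ _ _ _ _ _ TF) by exact Hy. reflexivity.
    - exact Hab.
    - set (s := Rmin (Rmin d1 d2) c / 2).
      assert (Hm : 0 < Rmin (Rmin d1 d2) c) by (repeat apply Rmin_glb_lt; lra).
      pose proof (Rmin_l (Rmin d1 d2) c). pose proof (Rmin_r (Rmin d1 d2) c).
      pose proof (Rmin_l d1 d2). pose proof (Rmin_r d1 d2).
      set (z := mk (y X1) (y X2) s).
      assert (Hz : Om z) by (apply Om_far; [exact Hy | unfold z, mk, s; lra]).
      assert (Hzn : near (mk (y X1) (y X2) 0) d2 z).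
      { intros []; unfold z, mk; rewrite ?Rminus_diag, ?Rabs_R0; try lra.
        rewrite Rminus_0_r, Rabs_pos_eq; unfold s; lra. }
      specialize (H2 z Hz Hzn b).
      pose proof (horizontal_odd c z b Hc Hy) as Ho. unfold z in Ho at 1 2 3 4 5. simpl in Ho.
      specialize (Ho ltac:(unfold s; lra)).
      set (z' := mk (y X1) (y X2) (2 * c - s)) in *.
      assert (Hz'n : near y d1 z').
      { intros []; unfold z', mk; rewrite ?Rminus_diag, ?Rabs_R0; try lra.
        rewrite Hy3. replace (2 * c - s - 2 * c) with (- s) by ring. rewrite Rabs_Ropp, Rabs_pos_eq; unfold s; lra. }
      specialize (H1 z' Hz'n). fold z in Ho. rewrite Ho in H1.
      pose proof (Rabs_triang_inv (u b y) (- u b z)) as T. rewrite Rabs_Ropp in T.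
      rewrite Rabs_minus_sym in H1. lra. }
  set (q := mk (Rad + 2) 0 (2 * c)).
  assert (Hnq : nodal u Om (basis X3) q).
  { split; [apply Om_high; unfold q, mk; lra | split; [apply basis3_unit|]].
    exists 1. split; [lra|]. intros x Hx Hx0 b. apply Hfar0.
    - specialize (Hx X1). unfold q, mk in Hx. apply Rabs_lt_between in Hx. pose proof (pow2_ge_0 (x X2)). nra.
    - unfold dot, sum3, psub, basis, q, mk in Hx0; simpl in Hx0. lra. }
  pose proof (horizontal_of_nodal (basis X3) q Hnq) as H. simpl in H. apply H; [lra|].
  rewrite basis_eq. ring.
Qed.

Lemma horizontal_pow c m : horizontal c -> horizontal (2 ^ m * c).
Proof.
  intros Hc. induction m as [|m IH]; [simpl; rewrite Rmult_1_l; exact Hc|].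
  replace (2 ^ S m * c) with (2 * (2 ^ m * c)) by (simpl; ring). apply horizontal_double, IH.
Qed.

Lemma flat_field_odd c b x : sin (k * ga * c) = 0 ->
  U0 b (mk (x X1) (x X2) (2 * c - x X3)) = - U0 b x.
Proof.
  intros Hs. unfold U0, flat_field, mk.
  assert (E : sin (k * ga * (2 * c - x X3)) = - sin (k * ga * x X3)).
  { replace (k * ga * (2 * c - x X3)) with (2 * (k * ga * c) - k * ga * x X3) by ring.
    rewrite sin_minus, sin_2a, cos_2a_sin, Hs. ring. }
  destruct b; rewrite E; ring.
Qed.

(* The scattered part is odd about the heights c and 2 c, hence 2 c-periodic in x3; letting c double, it decays along the period. *)
Lemma horizontal_flat c : horizontal c -> forall x, Om x -> forall b, u b x = U0 b x.
Proof.
  intros Hc.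
  pose proof (tf_rad _ _ _ _ _ _ _ _ TF) as HR. assert (Hc0 : Rad <= c) by apply Hc.
  set (v := fun b x => u b x - U0 b x).
  assert (Hodd : forall c' y b, horizontal c' -> Rad ^ 2 < y X1 ^ 2 + y X2 ^ 2 -> 0 < y X3 < 2 * c' ->
    v b (mk (y X1) (y X2) (2 * c' - y X3)) = - v b y).
  { intros c' y b Hc' Hy Hy3. unfold v.
    rewrite (horizontal_odd c' y b Hc' Hy Hy3), (flat_field_odd c' b y (horizontal_sin c' Hc')). ring. }
  assert (Hper : forall c' y b, horizontal c' -> Rad ^ 2 < y X1 ^ 2 + y X2 ^ 2 -> 0 < y X3 < 2 * c' ->
    v b (mk (y X1) (y X2) (2 * c' + y X3)) = v b y).
  { intros c' y b Hc' Hy Hy3.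
    pose proof (Hodd c' y b Hc' Hy Hy3) as O1.
    pose proof (Hodd (2 * c') (mk (y X1) (y X2) (2 * c' - y X3)) b (horizontal_double c' Hc')) as O2.
    simpl in O2. specialize (O2 Hy ltac:(lra)).
    replace (2 * (2 * c') - (2 * c' - y X3)) with (2 * c' + y X3) in O2 by ring. rewrite O2, O1. ring. }
  assert (Hzero : forall y b, Rad ^ 2 < y X1 ^ 2 + y X2 ^ 2 -> 0 < y X3 < 2 * c -> v b y = 0).
  { intros y b Hy Hy3. apply NNPP. intros Hne.
    assert (Hab : 0 < Rabs (v b y)) by (apply Rabs_pos_lt, Hne).
    destruct (tf_decay _ _ _ _ _ _ _ _ TF _ Hab) as [r0 Hr0].
    destruct (Pow_x_infinity 2) with (b := (Rabs r0 + 1) / c) as [m Hm].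
    { rewrite Rabs_pos_eq; lra. }
    specialize (Hm m (le_n m)). rewrite Rabs_pos_eq in Hm by (apply pow_le; lra).
    set (C := 2 ^ m * c) in *.
    assert (H2m : 1 <= 2 ^ m) by (apply pow_R1_Rle; lra).
    assert (HcC : c <= C) by (unfold C; nra).
    assert (HC : Rabs r0 + 1 <= C).
    { apply Rge_le in Hm. apply Rmult_le_compat_r with (r := c) in Hm; [|lra].
      replace ((Rabs r0 + 1) / c * c) with (Rabs r0 + 1) in Hm by (field; lra). exact Hm. }
    pose proof (Hper C y b (horizontal_pow c m Hc) Hy ltac:(lra)) as HP.
    set (z := mk (y X1) (y X2) (2 * C + y X3)) in *.
    assert (HOz : Om z) by (apply Om_high; unfold z, mk; lra).
    assert (Hzr : r0 ^ 2 < dot z z).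
    { unfold dot, sum3. change (z X3) with (2 * C + y X3). rewrite <- (pow2_abs r0).
      pose proof (pow2_ge_0 (z X1)). pose proof (pow2_ge_0 (z X2)). pose proof (Rabs_pos r0). nra. }
    specialize (Hr0 z HOz Hzr b). fold U0 in Hr0. change (Rabs (v b z) < Rabs (v b y)) in Hr0. rewrite HP in Hr0. lra. }
  intros x Hx b.
  assert (Hv : helm_on k Om (v b)).
  { apply helm_ext with (u := fun x => 1 * u b x + (-1) * U0 b x); [apply Om_open | intros y _; unfold v; ring |].
    apply helm_lin; [apply Om_open | apply (tf_helm _ _ _ _ _ _ _ _ TF) |].
    apply helm_on_sub with (2 := flat_field_helm k al be ga (tf_dir _ _ _ _ _ _ _ _ TF) b). trivial. }
  assert (H0 : v b x = 0); [|unfold v in H0; lra].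
  set (p := mk (Rad + 2) 0 c).
  apply (epigraph_unique_continuation k f Rad (v b) p); try assumption.
  - apply (tf_cont _ _ _ _ _ _ _ _ TF).
  - apply (tf_bound _ _ _ _ _ _ _ _ TF).
  - apply Om_high. exact Hc0.
  - exists (Rmin 1 c). split; [apply Rmin_glb_lt; lra|]. intros q Hq. pose proof (Rmin_l 1 c). pose proof (Rmin_r 1 c).
    apply Hzero.
    + specialize (Hq X1). unfold p, mk in Hq. apply Rabs_lt_between in Hq. pose proof (pow2_ge_0 (q X2)). nra.
    + specialize (Hq X3). unfold p, mk in Hq. apply Rabs_lt_between in Hq. lra.
Qed.

Lemma high_nodal_flat n p : nodal u Om n p -> Rad <= p X3 -> forall x, Om x -> forall b, u b x = U0 b x.
Proof.
  intros Hn Hp. destruct (Rlt_dec (n X3 ^ 2) 1) as [H|H].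
  - exfalso. apply (no_high_slanted_plane n p); assumption.
  - apply (horizontal_flat (p X3)). apply (horizontal_of_nodal n p Hn Hp).
    assert (Hnn : dot n n = 1) by apply Hn.
    pose proof (unit_coord_le n X3 Hnn) as H1. apply Rabs_le_between in H1. nra.
Qed.

End HighPlanes.

(** * Climbing by reflected rays *)

Section NodalPlanes.

Context (k al be ga : R) (f : R -> R -> R) (Rad : R) (L : list affine) (u : field).
Context (TF : total_field k al be ga f Rad L u).

Let Om := epigraph f.
Let U0 := flat_field k al be ga.
Let e3 := basis X3.

Let HOm : open_set Om := Om_open k al be ga f Rad L u TF.
Let Hhelm : helm_field k Om u := tf_helm _ _ _ _ _ _ _ _ TF.

Lemma up_coord p s : line p e3 s X1 = p X1 /\ line p e3 s X2 = p X2 /\ line p e3 s X3 = p X3 + s.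
Proof. unfold line, e3, basis; simpl. repeat split; ring. Qed.

Lemma epigraph_up p s : Om p -> 0 <= s -> Om (line p e3 s).
Proof.
  intros Hp Hs. unfold Om, epigraph in *. destruct (up_coord p s) as [-> [-> ->]]. lra.
Qed.

Lemma nodal_vertical n p : nodal u Om n p -> n X3 = 0 -> exists q, Rad <= q X3 /\ nodal u Om n q.
Proof.
  intros Hn H3. set (H := Rad + Rabs (p X3)).
  pose proof (tf_rad _ _ _ _ _ _ _ _ TF) as HR. pose proof (Rabs_pos (p X3)) as Hp.
  exists (line p (fun i => H * e3 i) 1). split.
  - rewrite line_scal. destruct (up_coord p (H * 1)) as [_ [_ ->]]. unfold H.
    pose proof (Rle_abs (- p X3)) as Ha. rewrite Rabs_Ropp in Ha. lra.
  - apply (nodal_move k); try assumption.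
    + unfold dot, sum3, e3, basis; simpl. rewrite H3. ring.
    + intros s Hs. rewrite line_scal. apply epigraph_up; [apply Hn|]. unfold H. apply Rmult_le_pos; lra.
Qed.

(** Here [w] solves the equation on both sides of the surface near [q] and agrees with [- u] above
    it. Its continuity and the boundary condition for [u] give zeros on the graph, hence a plane
    through [q]. *)
Lemma graph_boundary_value (w : field) q rho d :
  f (q X1) (q X2) = q X3 -> 0 < rho -> 0 < d ->
  helm_field k (near q rho) w ->
  (forall t1 t2, square (q X1) (q X2) d t1 t2 -> near q rho (mk t1 t2 (f t1 t2))) ->
  (forall x, square (q X1) (q X2) d (x X1) (x X2) -> near q rho x -> Om x -> forall b, w b x = - u b x) ->
  exists n, nodal w (near q rho) n q.
Proof.
  intros Hq Hrho Hd Hw Hin Hodd.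
  apply (nodal_on_graph k w f L q rho d); try assumption.
  - apply (tf_cont _ _ _ _ _ _ _ _ TF).
  - apply (tf_sel _ _ _ _ _ _ _ _ TF).
  - intros t1 t2 Ht b. set (g := mk t1 t2 (f t1 t2)). apply NNPP. intros Hne.
    assert (Hab : 0 < Rabs (w b g) / 2) by (pose proof (Rabs_pos_lt _ Hne); lra).
    assert (Hg : near q rho g) by (apply Hin, Ht).
    destruct (proj1 (continuous_near (w b) g) (c2_cont _ _ (proj1 (Hw b) g Hg)) _ Hab) as [d1 [Hd1 H1]].
    destruct (tf_bc _ _ _ _ _ _ _ _ TF g eq_refl _ Hab) as [d2 [Hd2 H2]].
    destruct (near_open q rho g Hg) as [d3 [Hd3 H3]].
    set (s := Rmin d1 (Rmin d2 d3) / 2).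
    assert (Hm : 0 < Rmin d1 (Rmin d2 d3)) by (repeat apply Rmin_glb_lt; assumption).
    pose proof (Rmin_l d1 (Rmin d2 d3)). pose proof (Rmin_r d1 (Rmin d2 d3)).
    pose proof (Rmin_l d2 d3). pose proof (Rmin_r d2 d3).
    set (x := mk t1 t2 (f t1 t2 + s)).
    assert (Hnx : forall r, s < r -> near g r x).
    { intros r Hr. assert (0 < s) by (unfold s; lra).
      intros []; unfold g, x, mk; rewrite ?Rminus_diag, ?Rabs_R0; try lra.
      replace (f t1 t2 + s - f t1 t2) with s by ring. rewrite Rabs_pos_eq; lra. }
    assert (Ox : Om x) by (unfold Om, epigraph, x, mk, s; lra).
    specialize (H1 x (Hnx d1 ltac:(unfold s; lra))).
    specialize (H2 x Ox (Hnx d2 ltac:(unfold s; lra)) b).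
    specialize (H3 x (Hnx d3 ltac:(unfold s; lra))).
    rewrite (Hodd x Ht H3 Ox b) in H1.
    pose proof (Rabs_triang_inv (w b g) (- u b x)) as T. rewrite Rabs_Ropp in T.
    rewrite Rabs_minus_sym in H1. lra.
Qed.

(* The reflected vertical ray leaves the domain after the length [s1]; near the exit point the reflected field vanishes on the
   surface, hence on a plane, whose mirror image is a nodal plane at height [s1] above [P]. *)
Lemma reflected_face n P s1 :
  nodal u Om n P -> 0 < s1 ->
  (forall s, 0 <= s < s1 -> Om (line P (reflect_dir n e3) s)) ->
  (let q := line P (reflect_dir n e3) s1 in f (q X1) (q X2) = q X3) ->
  exists n', nodal u Om n' (line P e3 s1).
Proof.
  intros Hn Hs1 Hray Hq. cbv zeta in Hq.
  assert (Hnn : dot n n = 1) by apply Hn. assert (HP : Om P) by apply Hn.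
  set (m := reflect_dir n e3) in *. set (q := line P m s1) in *. set (y := line P e3 s1).
  assert (Rfix : plane_reflection P n P = P) by (apply plane_reflection_fix, dot_psub_self).
  assert (Rup : forall s, plane_reflection P n (line P e3 s) = line P m s).
  { intros s. rewrite plane_reflection_line, Rfix. reflexivity. }
  assert (Rm : forall s, plane_reflection P n (line P m s) = line P e3 s).
  { intros s. rewrite <- Rup. apply plane_reflection_involutive, Hnn. }
  assert (Hy : Om y) by (apply epigraph_up; [exact HP | lra]).
  set (O' := fun x => Om (plane_reflection P n x)).
  assert (HO' : open_set O') by (apply reflection_open; assumption).
  assert (HO'q : O' q) by (unfold O', q; rewrite Rm; exact Hy).
  destruct (HO' q HO'q) as [rho [Hrho Hrho']].
  destruct (proj1 (continuous_near _ q) (tf_cont _ _ _ _ _ _ _ _ TF q) (rho / 2)) as [d0 [Hd0 Hd0']]; [lra|].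
  set (d := Rmin d0 rho). assert (Hd : 0 < d) by (apply Rmin_glb_lt; assumption).
  assert (Hdd0 : d <= d0) by apply Rmin_l. assert (Hdr : d <= rho) by apply Rmin_r.
  assert (Hfs : forall t1 t2, square (q X1) (q X2) d t1 t2 -> Rabs (f t1 t2 - q X3) < rho / 2).
  { intros t1 t2 [Ht1 Ht2]. rewrite <- Hq. apply (Hd0' (mk t1 t2 (q X3))).
    intros []; simpl; try lra. rewrite Rminus_diag, Rabs_R0. exact Hd0. }
  set (W := fun b x => u b x + u b (plane_reflection P n x)).
  set (O2 := fun x => Om x /\ O' x).
  assert (HO2 : open_set O2) by (apply open_set_and; assumption).
  assert (HW : forall b, helm_on k O2 (W b)) by (intros b; apply helm_reflection_sum; auto).
  assert (HW0 : forall s b, 0 <= s < s1 -> zero_near (W b) (line P m s)).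
  { intros s b Hs. replace (line P m s) with (line P (fun i => s * m i) 1) by (rewrite line_scal; f_equal; ring).
    apply (continuation_segment k O2); [exact HO2 | apply HW | | apply (nodal_odd k u Om); assumption].
    intros c Hc. rewrite line_scal. assert (0 <= c * s < s1) by nra.
    replace (s * c) with (c * s) by ring.
    split; [apply Hray; lra|]. unfold O'. rewrite Rm. apply epigraph_up; [exact HP | lra]. }
  (* A point of the reflected ray just before its exit, so close to [q] that continuation can start
     there. *)
  assert (Hbefore : exists s, 0 <= s < s1 /\ near q d (line P m s)).
  { destruct (point_bound m) as [E [HE HEm]].
    set (t := Rmin (s1 / 2) (d / (2 * E))).
    assert (Ht : 0 < t) by (apply Rmin_glb_lt; [lra | apply Rdiv_lt_0_compat; lra]).
    assert (Ht1 : t <= s1 / 2) by apply Rmin_l.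
    assert (Ht2 : t * E <= d / 2).
    { assert (t <= d / (2 * E)) by apply Rmin_r. apply Rmult_le_compat_r with (r := E) in H; [|lra].
      replace (d / (2 * E) * E) with (d / 2) in H by (field; lra). exact H. }
    exists (s1 - t). split; [lra|]. intros i. unfold q, line.
    replace (P i + (s1 - t) * m i - (P i + s1 * m i)) with (- (t * m i)) by ring.
    rewrite Rabs_Ropp, Rabs_mult, (Rabs_pos_eq t) by lra. specialize (HEm i).
    assert (t * Rabs (m i) <= t * E) by (apply Rmult_le_compat_l; lra). lra. }
  destruct Hbefore as [s [Hs Hsq]]. set (p := line P m s) in *.
  (* The odd symmetry, known along the ray, spreads from this single point to the whole part of the
     epigraph near [q]. This part is connected by vertical and horizontal segments, whatever the
     shape of the surface at [q]. *)
  assert (HWz : forall x, square (q X1) (q X2) d (x X1) (x X2) -> near q rho x -> Om x -> forall b, W b x = 0).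
  { intros x Hxs Hxn Hx b. apply zero_near_at.
    assert (Hps : square (q X1) (q X2) d (p X1) (p X2)) by (split; apply Hsq).
    apply (epigraph_continuation k O2 f (W b) (q X1) (q X2) d (q X3 + rho / 2) (q X3 + rho) p x); try assumption.
    - apply HW.
    - lra.
    - intros t1 t2 Ht. specialize (Hfs t1 t2 Ht). apply Rabs_lt_between in Hfs. lra.
    - intros z Hzs Hz. split; [apply Hz|]. apply Hrho'. specialize (Hfs _ _ Hzs). apply Rabs_lt_between in Hfs.
      destruct Hzs. intros []; try lra. apply Rabs_lt_between. lra.
    - split; [apply Hray, Hs|]. pose proof (Hsq X3) as H3. apply Rabs_lt_between in H3. lra.
    - apply HW0, Hs.
    - split; [exact Hx|]. pose proof (Hxn X3) as H3. apply Rabs_lt_between in H3. lra. }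
  set (w := fun b x => u b (plane_reflection P n x)).
  destruct (graph_boundary_value w q rho d) as [n' [_ [Hn' [r [Hr Hz]]]]]; try assumption.
  - intros b. apply helm_on_sub with (2 := helm_reflection k P n Om (u b) Hnn HOm (Hhelm b)). exact Hrho'.
  - intros t1 t2 Ht. pose proof (Hfs t1 t2 Ht) as H3. destruct Ht. intros []; simpl; lra.
  - intros x Hxs Hxn Hx b. pose proof (HWz x Hxs Hxn Hx b) as H0. unfold W in H0. unfold w. lra.
  (* The plane found at the exit point is carried back by the reflection, which maps [q] to [y] and
     the normal [n'] to [reflect_dir n n']. *)
  - exists (reflect_dir n n'). split; [exact Hy|]. split.
    + transitivity (dot n' n' - 4 * dot n' n * dot n' n + 4 * dot n' n * dot n' n * dot n n).
      * unfold reflect_dir. set (c := dot n' n). unfold dot, sum3 in c |- *. unfold c. ring.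
      * rewrite Hn', Hnn. ring.
    + exists (r / 7). split; [lra|]. intros z Hzn Hz0 b.
      rewrite <- (plane_reflection_involutive P n z Hnn).
      apply (Hz (plane_reflection P n z)).
      * replace q with (plane_reflection P n y) by (unfold y; rewrite Rup; reflexivity).
        apply near_le with (2 := reflection_near P n y z _ Hnn Hzn). lra.
      * replace q with (plane_reflection P n y) by (unfold y; rewrite Rup; reflexivity).
        rewrite <- Hz0. unfold plane_reflection, reflect_dir.
        set (c := dot n' n). set (a := dot (psub z P) n). set (a' := dot (psub y P) n).
        transitivity (dot (psub z y) n' - 2 * (a - a') * c).
        -- unfold c, dot, sum3, psub. ring.
        -- unfold a, a', dot, sum3, psub. ring.
Qed.

Lemma line_reflect_dir_height n P s : line P (reflect_dir n e3) s X3 = P X3 + s * (1 - 2 * n X3 ^ 2).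
Proof. unfold line, reflect_dir, dot, sum3, e3, basis; simpl. ring. Qed.

(** The odd symmetry is continued up the vertical ray and then across, at a large distance from [P],
    to a point [M] of the nodal plane itself. There the reflection fixes the plane, so the symmetry
    says [2 * u = 0] on it, and [M] is as high as required. *)
Lemma unbounded_ray n P :
  nodal u Om n P -> n X3 <> 0 ->
  (forall s, 0 <= s -> Om (line P (reflect_dir n e3) s)) ->
  exists q, Rad <= q X3 /\ nodal u Om n q.
Proof.
  intros Hn Hn3 Hray.
  pose proof (tf_rad _ _ _ _ _ _ _ _ TF) as HR.
  assert (Hnn : dot n n = 1) by apply Hn. assert (HP : Om P) by apply Hn.
  set (m := reflect_dir n e3) in *. set (mu := 1 - 2 * n X3 ^ 2).
  assert (Hn32 : 0 < n X3 ^ 2) by (pose proof (pow2_ge_0 (n X3)); nra).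
  (* [mu] is the vertical component of the reflected direction; a descending ray would leave the
     epigraph. *)
  assert (Hmu : 0 <= mu).
  { apply Rnot_lt_le. intros Hneg.
    set (s := (Rabs (P X3) + Rad + 1) / - mu).
    assert (Hs : 0 <= s) by (apply Rdiv_le_0_compat; [pose proof (Rabs_pos (P X3)) |]; lra).
    pose proof (Hray s Hs) as H. unfold Om, epigraph in H. unfold m in H.
    rewrite (line_reflect_dir_height n P s) in H. fold mu in H.
    assert (E : s * mu = - (Rabs (P X3) + Rad + 1)) by (unfold s; field; lra).
    pose proof (tf_bound _ _ _ _ _ _ _ _ TF (line P (reflect_dir n e3) s X1) (line P (reflect_dir n e3) s X2)) as Hb.
    apply Rabs_lt_between in Hb. pose proof (Rle_abs (P X3)). lra. }
  set (N2 := P X1 ^ 2 + P X2 ^ 2). assert (HN2 : 0 <= N2) by (unfold N2; pose proof (pow2_ge_0 (P X1)); pose proof (pow2_ge_0 (P X2)); lra).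
  (* Interpolates between the vertical at [lam = 0] and the reflected direction at [lam = 1]. At
     [lam = / 2] it is the projection of the vertical onto the nodal plane, and the reflection
     exchanges [lam] and [1 - lam]. *)
  set (v := fun lam i => e3 i - 2 * lam * n X3 * n i).
  assert (v3 : forall lam, v lam X3 = 1 - lam * (1 - mu)) by (intros lam; unfold v, mu, e3; rewrite basis_eq; ring).
  assert (Hhigh : forall x, Rad <= x X3 -> Om x) by (intros x; apply (Om_high k al be ga f Rad L u TF)).
  (* The lower bound on [s] puts [M] at height at least [Rad], because [v (/ 2)] has vertical
     component at least one half. If [mu > 0], a long enough [s] lifts the entire crossing segment
     above the surface. *)
  assert (Hs : exists s, 2 * (Rad + Rabs (P X3)) <= s /\ forall lam, 0 <= lam <= 1 -> Om (line P (v lam) s)).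
  { destruct (Rlt_dec 0 mu) as [Hpos|Hzero].
    - exists ((2 * (Rad + Rabs (P X3))) / mu).
      assert (Hs2 : 2 * (Rad + Rabs (P X3)) <= 2 * (Rad + Rabs (P X3)) / mu).
      { pose proof (Rabs_pos (P X3)). apply Rmult_le_reg_r with mu; [exact Hpos|].
        replace (2 * (Rad + Rabs (P X3)) / mu * mu) with (2 * (Rad + Rabs (P X3))) by (field; lra).
        assert (mu <= 1) by (unfold mu; lra). nra. }
      split; [exact Hs2|]. intros lam Hlam. apply Hhigh. unfold line. rewrite v3.
      set (s := 2 * (Rad + Rabs (P X3)) / mu) in *.
      assert (Es : s * mu = 2 * (Rad + Rabs (P X3))) by (unfold s; field; lra).
      assert (mu <= 1) by (unfold mu; lra).
      assert (0 <= s) by (pose proof (Rabs_pos (P X3)); lra).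
      assert (s * mu <= s * (1 - lam * (1 - mu))) by (apply Rmult_le_compat_l; nra).
      pose proof (Rle_abs (- P X3)) as Ha. rewrite Rabs_Ropp in Ha.
      pose proof (Rabs_pos (P X3)). lra.
    (* The reflected ray is horizontal, so height alone does not suffice. For [lam >= / 2] the point
       is horizontally far away, over the flat part of the surface, and for smaller [lam] it is
       high. The height of [P] is positive because the ray itself runs over the flat part. *)
    - assert (Emu : mu = 0) by lra.
      assert (Hn12 : n X1 ^ 2 + n X2 ^ 2 = / 2).
      { unfold dot, sum3 in Hnn. unfold mu in Emu. lra. }
      assert (Hn3h : n X3 ^ 2 = / 2) by (unfold mu in Emu; lra).
      assert (Hfar : forall lam s, / 2 <= lam <= 1 -> 8 * (Rad + 1 + N2) <= s ->
        Rad ^ 2 < line P (v lam) s X1 ^ 2 + line P (v lam) s X2 ^ 2).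
      { intros lam s Hlam Hs.
        assert (E1 : line P (v lam) s X1 = P X1 - 2 * lam * s * n X3 * n X1) by (unfold line, v, e3, basis; simpl; ring).
        assert (E2 : line P (v lam) s X2 = P X2 - 2 * lam * s * n X3 * n X2) by (unfold line, v, e3, basis; simpl; ring).
        rewrite E1, E2. set (c := 2 * lam * s * n X3).
        assert (Ec : (c * n X1) ^ 2 + (c * n X2) ^ 2 = (lam * s) ^ 2).
        { transitivity (4 * (lam * s) ^ 2 * n X3 ^ 2 * (n X1 ^ 2 + n X2 ^ 2)); [unfold c; ring|].
          rewrite Hn3h, Hn12. field. }
        assert (Hls : 4 * (Rad + 1 + N2) <= lam * s) by nra.
        assert (Hsq : (4 * (Rad + 1 + N2)) ^ 2 <= (lam * s) ^ 2) by (apply pow_incr; lra).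
        pose proof (pow2_ge_0 (2 * P X1 - c * n X1)). pose proof (pow2_ge_0 (2 * P X2 - c * n X2)).
        assert ((lam * s) ^ 2 / 2 - N2 <= (P X1 - c * n X1) ^ 2 + (P X2 - c * n X2) ^ 2).
        { rewrite <- Ec. unfold N2. lra. }
        nra. }
      assert (HP3 : 0 < P X3).
      { set (s := 8 * (Rad + 1 + N2)).
        pose proof (Hray s ltac:(unfold s; lra)) as H. unfold Om, epigraph in H. unfold m in H.
        assert (Em : line P (reflect_dir n e3) s = line P (v 1) s).
        { apply functional_extensionality. intros i. unfold line, v, reflect_dir.
          replace (dot e3 n) with (n X3) by (unfold dot, sum3, e3, basis; simpl; ring). ring. }
        rewrite Em in H. rewrite (tf_far _ _ _ _ _ _ _ _ TF) in H by (apply Hfar; unfold s; lra).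
        unfold line in H. rewrite v3, Emu in H. lra. }
      exists (8 * (Rad + 1 + N2) + 2 * (Rad + Rabs (P X3))).
      pose proof (Rabs_pos (P X3)).
      split; [lra|]. intros lam Hlam.
      set (s := 8 * (Rad + 1 + N2) + 2 * (Rad + Rabs (P X3))).
      assert (E3 : line P (v lam) s X3 = P X3 + s * (1 - lam)) by (unfold line; rewrite v3, Emu; ring).
      destruct (Rle_dec (/ 2) lam) as [Hl|Hl].
      + apply (Om_far k al be ga f Rad L u TF).
        * apply Hfar; [lra | unfold s; lra].
        * rewrite E3. assert (0 <= s * (1 - lam)) by (apply Rmult_le_pos; unfold s; lra). lra.
      + apply Hhigh. rewrite E3. assert (s * / 2 <= s * (1 - lam)) by (apply Rmult_le_compat_l; unfold s; lra).
        unfold s in *. lra. }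
  destruct Hs as [s [Hs Hseg]].
  assert (Hs0 : 0 <= s) by (pose proof (Rabs_pos (P X3)); lra).
  assert (Rfix : plane_reflection P n P = P) by (apply plane_reflection_fix, dot_psub_self).
  set (O2 := fun x => Om x /\ Om (plane_reflection P n x)).
  assert (HO2 : open_set O2) by (apply open_set_and; [exact HOm | apply reflection_open; assumption]).
  set (W := fun b x => u b x + u b (plane_reflection P n x)).
  assert (HW : forall b, helm_on k O2 (W b)) by (intros b; apply helm_reflection_sum; auto).
  assert (Z1 : forall b, zero_near (W b) (line P (fun i => s * e3 i) 1)).
  { intros b. apply (continuation_segment k O2); [exact HO2 | apply HW | | apply (nodal_odd k u Om); assumption].
    intros c Hc. rewrite line_scal. assert (0 <= s * c) by (apply Rmult_le_pos; lra).
    split; [apply epigraph_up; assumption|].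
    rewrite plane_reflection_line, Rfix. apply Hray. assumption. }
  assert (Rv : forall lam, plane_reflection P n (line P (v lam) s) = line P (v (1 - lam)) s).
  { intros lam. rewrite plane_reflection_line, Rfix. f_equal.
    apply functional_extensionality. intros i. unfold reflect_dir.
    replace (dot (v lam) n) with (n X3 * (1 - 2 * lam * dot n n)).
    2: { unfold v, e3, dot, sum3, basis; simpl. ring. }
    rewrite Hnn. unfold v. ring. }
  set (M := line P (v (/ 2)) s).
  (* The crossing runs from [lam = 0] to [lam = / 2]; its mirror image runs from [lam = 1] to
     [lam = / 2], so [Hseg] covers both. *)
  assert (Z2 : forall b, zero_near (W b) M).
  { intros b.
    assert (EM : M = line (line P (fun i => s * e3 i) 1) (fun i => - (s * n X3 * n i)) 1).
    { apply functional_extensionality. intros i. unfold M, line, v. field. }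
    rewrite EM. apply (continuation_segment k O2); [exact HO2 | apply HW | | apply Z1].
    intros c Hc.
    assert (Ec : line (line P (fun i => s * e3 i) 1) (fun i => - (s * n X3 * n i)) c = line P (v (c / 2)) s).
    { apply functional_extensionality. intros i. unfold line, v. field. }
    rewrite Ec. split; [apply Hseg; lra|]. rewrite Rv. apply Hseg. lra. }
  exists M. split.
  - unfold M, line. rewrite v3. unfold mu.
    assert (1 / 2 <= 1 - / 2 * (1 - (1 - 2 * n X3 ^ 2))) by (unfold mu in Hmu; lra).
    assert (s * (1 / 2) <= s * (1 - / 2 * (1 - (1 - 2 * n X3 ^ 2)))) by (apply Rmult_le_compat_l; lra).
    pose proof (Rle_abs (- P X3)) as Ha. rewrite Rabs_Ropp in Ha.
      pose proof (Rabs_pos (P X3)). lra.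
  - split; [apply Hseg; lra | split; [exact Hnn|]].
    destruct (Z2 true) as [r1 [Hr1 H1]]. destruct (Z2 false) as [r2 [Hr2 H2]].
    exists (Rmin r1 r2). split; [apply Rmin_glb_lt; assumption|]. intros x Hx Hx0 b.
    assert (Hfix : plane_reflection P n x = x).
    { apply plane_reflection_fix.
      transitivity (dot (psub x M) n + s * dot (v (/ 2)) n); [unfold M, dot, sum3, psub, line; ring|].
      rewrite Hx0. replace (dot (v (/ 2)) n) with (n X3 * (1 - dot n n)).
      - rewrite Hnn. ring.
      - unfold v, e3, dot, sum3, basis; simpl. field. }
    assert (H : W b x = 0).
    { destruct b; [apply H1 | apply H2]; apply near_le with (2 := Hx); [apply Rmin_l | apply Rmin_r]. }
    unfold W in H. rewrite Hfix in H. lra.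
Qed.

Lemma first_exit n P s0 :
  Om P -> 0 <= s0 -> ~ Om (line P (reflect_dir n e3) s0) ->
  exists s1, 0 < s1 /\ (forall s, 0 <= s < s1 -> Om (line P (reflect_dir n e3) s)) /\
    let q := line P (reflect_dir n e3) s1 in f (q X1) (q X2) = q X3.
Proof.
  intros HP Hs0 Hout. set (m := reflect_dir n e3) in *.
  set (E := fun s => 0 <= s /\ forall t, 0 <= t <= s -> Om (line P m t)).
  assert (HE0 : E 0).
  { split; [lra|]. intros t Ht. replace t with 0 by lra. rewrite line_0. exact HP. }
  destruct (completeness E) as [s1 [Hup Hleast]].
  { exists s0. intros s [Hs HsE]. apply Rnot_lt_le. intros Hlt. apply Hout, HsE. lra. }
  { exists 0. exact HE0. }
  assert (Hbefore : forall s, 0 <= s < s1 -> Om (line P m s)).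
  { intros s Hs. apply NNPP. intros Hn. assert (s1 <= s); [|lra].
    apply Hleast. intros t [Ht HtE]. apply Rnot_lt_le. intros Hlt. apply Hn, HtE. lra. }
  assert (Hs10 : 0 <= s1) by (apply Hup, HE0).
  assert (Hlocal : forall s, Om (line P m s) -> exists e, 0 < e /\ forall t, Rabs (t - s) < e -> Om (line P m t)).
  { intros s Hs. destruct (HOm _ Hs) as [r [Hr Hr']]. destruct (point_bound m) as [B [HB HBm]].
    exists (r / (2 * B)). split; [apply Rdiv_lt_0_compat; lra|]. intros t Ht. apply Hr'. intros i. unfold line.
    replace (P i + t * m i - (P i + s * m i)) with ((t - s) * m i) by ring. rewrite Rabs_mult.
    apply Rmult_lt_compat_r with (r := B) in Ht; [|exact HB].
    replace (r / (2 * B) * B) with (r / 2) in Ht by (field; lra). specialize (HBm i).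
    pose proof (Rmult_le_compat_l _ _ _ (Rabs_pos (t - s)) HBm). lra. }
  assert (Hnot : ~ Om (line P m s1)).
  { intros Hin. destruct (Hlocal s1 Hin) as [e [He Hloc]].
    assert (E (s1 + e / 2)).
    { split; [lra|]. intros t Ht. destruct (Rlt_dec t s1) as [H|H]; [apply Hbefore; lra|].
      apply Hloc. apply Rabs_lt_between. lra. }
    apply Hup in H. lra. }
  exists s1. split; [|split; [exact Hbefore|]].
  - destruct (Rle_lt_or_eq_dec 0 s1 Hs10) as [H|H]; [exact H|]. exfalso. apply Hnot. rewrite <- H, line_0. exact HP.
  - cbv zeta. set (q := line P m s1) in *.
    assert (Hge : q X3 <= f (q X1) (q X2)) by (apply Rnot_lt_le; exact Hnot).
    apply Rle_antisym; [|exact Hge]. apply Rnot_lt_le. intros Hlt.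
    assert (Hs1p : 0 < s1).
    { destruct (Rle_lt_or_eq_dec 0 s1 Hs10) as [H|H]; [exact H|]. exfalso. apply Hnot. unfold q. rewrite <- H, line_0. exact HP. }
    destruct (continuous_open_lt (fun x => f (x X1) (x X2) - x X3) 0) with (p := q) as [r [Hr Hr']].
    + intros x. apply cont_minus; [apply (tf_cont _ _ _ _ _ _ _ _ TF) | apply cont_coord].
    + lra.
    + destruct (point_bound m) as [B [HB HBm]].
      set (t := Rmin (s1 / 2) (r / (2 * B))).
      assert (Ht : 0 < t) by (apply Rmin_glb_lt; [lra | apply Rdiv_lt_0_compat; lra]).
      assert (Ht1 : t <= s1 / 2) by apply Rmin_l.
      assert (Ht2 : t * B <= r / 2).
      { assert (t <= r / (2 * B)) by apply Rmin_r. apply Rmult_le_compat_r with (r := B) in H; [|lra].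
        replace (r / (2 * B) * B) with (r / 2) in H by (field; lra). exact H. }
      pose proof (Hbefore (s1 - t) ltac:(lra)) as Hin. unfold Om, epigraph in Hin.
      assert (Hnear : near q r (line P m (s1 - t))).
      { intros i. unfold q, line.
        replace (P i + (s1 - t) * m i - (P i + s1 * m i)) with (- (t * m i)) by ring.
        rewrite Rabs_Ropp, Rabs_mult, (Rabs_pos_eq t) by lra. specialize (HBm i).
        assert (t * Rabs (m i) <= t * B) by (apply Rmult_le_compat_l; lra). lra. }
      specialize (Hr' _ Hnear). lra.
Qed.

Theorem nodal_flat n p : nodal u Om n p -> forall x, Om x -> forall b, u b x = U0 b x.
Proof.
  intros Hnp. apply NNPP. intros Hnf.
  (* If the conclusion fails, no nodal point reaches the level [Rad]; this bounds the supremum taken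
     below and also closes the cases in which a high nodal point is produced. *)
  assert (Hlow : forall m q, nodal u Om m q -> q X3 < Rad).
  { intros m q Hq. apply Rnot_le_lt. intros Hle. apply Hnf.
    exact (high_nodal_flat k al be ga f Rad L u TF m q Hq Hle). }
  assert (Hp : Om p) by apply Hnp.
  (* the highest nodal point above the base point of p *)
  set (S := fun s => 0 <= s /\ exists m, nodal u Om m (line p e3 s)).
  assert (HS0 : S 0) by (split; [lra|]; exists n; rewrite line_0; exact Hnp).
  destruct (completeness S) as [s1 [Hup Hleast]].
  { exists (Rad - p X3). intros s [Hs [m Hm]]. specialize (Hlow m _ Hm). destruct (up_coord p s) as [_ [_ E]].
    rewrite E in Hlow. lra. }
  { exists 0. exact HS0. }
  assert (Hs10 : 0 <= s1) by (apply Hup, HS0).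
  set (P := line p e3 s1).
  assert (HP : Om P) by (apply epigraph_up; assumption).
  destruct (nodal_closed k u Om P HOm Hhelm HP) as [m Hm].
  { intros eps He.
    assert (Hs : exists s, S s /\ s1 - eps < s).
    { apply NNPP. intros Hn. assert (s1 <= s1 - eps); [|lra]. apply Hleast. intros s Hs.
      apply Rnot_lt_le. intros Hlt. apply Hn. exists s. auto. }
    destruct Hs as [s [HsS Hs]]. pose proof (Hup s HsS) as Hs2. destruct HsS as [Hs3 [m Hm]].
    exists (line p e3 s), m. split; [|exact Hm]. intros i. unfold P, line.
    replace (p i + s * e3 i - (p i + s1 * e3 i)) with ((s - s1) * e3 i) by ring. rewrite Rabs_mult.
    pose proof (basis_le X3 i) as Hb. fold e3 in Hb.
    pose proof (Rmult_le_compat_l _ _ _ (Rabs_pos (s - s1)) Hb).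
    assert (Rabs (s - s1) < eps) by (apply Rabs_lt_between; lra). lra. }
  destruct (Req_dec (m X3) 0) as [H3|H3].
  { destruct (nodal_vertical m P Hm H3) as [q [Hq1 Hq2]]. specialize (Hlow m q Hq2). lra. }
  destruct (classic (exists s0, 0 <= s0 /\ ~ Om (line P (reflect_dir m e3) s0))) as [[s0 [Hs0 Hout]]|Hall].
  - destruct (first_exit m P s0 HP Hs0 Hout) as [s2 [Hs2 [Hray Hq]]].
    destruct (reflected_face m P s2 Hm Hs2 Hray Hq) as [n' Hn'].
    assert (HS : S (s1 + s2)).
    { split; [lra|]. exists n'. rewrite <- line_line. exact Hn'. }
    apply Hup in HS. lra.
  - destruct (unbounded_ray m P Hm H3) as [q [Hq1 Hq2]].
    + intros s Hs. apply NNPP. intros Hn. apply Hall. exists s. auto.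
    + specialize (Hlow m q Hq2). lra.
Qed.

End NodalPlanes.

(** * Comparison of two surfaces *)

(** If [|x| ^ 2 > 2 * Rad ^ 2], either the horizontal distance exceeds [Rad], where [f = 0], or [x3]
    exceeds [Rad] and hence the surface. *)
Lemma half_exterior_epigraph f Rad T0 x : 0 < Rad ->
  (forall t1 t2, Rabs (f t1 t2) < Rad) -> (forall t1 t2, Rad ^ 2 < t1 ^ 2 + t2 ^ 2 -> f t1 t2 = 0) ->
  2 * Rad ^ 2 <= T0 -> half_exterior T0 x -> epigraph f x.
Proof.
  intros HR Hb Hf HT [H3 Hx]. unfold epigraph, dot, sum3 in *.
  destruct (Rlt_dec (Rad ^ 2) (x X1 ^ 2 + x X2 ^ 2)) as [H|H].
  - rewrite Hf by exact H. exact H3.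
  - specialize (Hb (x X1) (x X2)). apply Rabs_lt_between in Hb.
    assert (Rad ^ 2 < x X3 ^ 2) by nra. nra.
Qed.

Lemma epigraph_half_exterior f Rad T0 x : 0 < Rad ->
  (forall t1 t2, Rabs (f t1 t2) < Rad) -> (forall t1 t2, Rad ^ 2 < t1 ^ 2 + t2 ^ 2 -> f t1 t2 = 0) ->
  2 * Rad ^ 2 <= T0 -> T0 < dot x x -> epigraph f x -> half_exterior T0 x.
Proof.
  intros HR Hb Hf HT Hx He. split; [|exact Hx]. unfold epigraph, dot, sum3 in *.
  destruct (Rlt_dec (Rad ^ 2) (x X1 ^ 2 + x X2 ^ 2)) as [H|H].
  - rewrite Hf in He by exact H. exact He.
  - specialize (Hb (x X1) (x X2)). apply Rabs_lt_between in Hb.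
    assert (Rad ^ 2 < x X3 ^ 2) by nra. nra.
Qed.

Section Comparison.

Context (k al be ga : R) (f1 f2 : R -> R -> R) (Rad : R) (L1 L2 : list affine) (u1 u2 : field).
Context (TF1 : total_field k al be ga f1 Rad L1 u1) (TF2 : total_field k al be ga f2 Rad L2 u2).

(** The common domain is the epigraph of the larger of the two functions. From any of its points the
    vertical segment up to a point of the half-space exterior stays inside, so the zeros given by
    Rellich's lemma are continued straight down. *)
Lemma fields_agree T0 C : 2 * Rad ^ 2 <= T0 -> 0 < C ->
  (forall x, half_exterior T0 x -> forall b, Rabs (u1 b x - u2 b x) <= C / dot x x) ->
  forall x, epigraph f1 x -> epigraph f2 x -> forall b, u1 b x = u2 b x.
Proof.
  intros HT HC Hdec x Hx1 Hx2 b.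
  pose proof (tf_rad _ _ _ _ _ _ _ _ TF1) as HR. pose proof (tf_k _ _ _ _ _ _ _ _ TF1) as Hk.
  assert (HRad2 : 0 < Rad ^ 2) by (apply pow_lt, HR). assert (HT0 : 0 < T0) by lra.
  assert (Hsub1 : forall y, half_exterior T0 y -> epigraph f1 y).
  { intros y. apply (half_exterior_epigraph f1 Rad); [exact HR | apply (tf_bound _ _ _ _ _ _ _ _ TF1) | apply (tf_far _ _ _ _ _ _ _ _ TF1) | exact HT]. }
  assert (Hsub2 : forall y, half_exterior T0 y -> epigraph f2 y).
  { intros y. apply (half_exterior_epigraph f2 Rad); [exact HR | apply (tf_bound _ _ _ _ _ _ _ _ TF2) | apply (tf_far _ _ _ _ _ _ _ _ TF2) | exact HT]. }
  set (w := fun y => 1 * u1 b y + (-1) * u2 b y).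
  set (O := fun y => epigraph f1 y /\ epigraph f2 y).
  assert (HO : open_set O).
  { apply open_set_and; apply epigraph_open; [apply (tf_cont _ _ _ _ _ _ _ _ TF1) | apply (tf_cont _ _ _ _ _ _ _ _ TF2)]. }
  assert (Hw : helm_on k O w).
  { apply helm_lin; [exact HO | |].
    - apply helm_on_sub with (2 := tf_helm _ _ _ _ _ _ _ _ TF1 b). intros y Hy; apply Hy.
    - apply helm_on_sub with (2 := tf_helm _ _ _ _ _ _ _ _ TF2 b). intros y Hy; apply Hy. }
  assert (Hfar : forall y, half_exterior T0 y -> w y = 0).
  { apply (half_space_rellich k T0 w C); try assumption.
    - lra.
    - apply helm_on_sub with (2 := Hw). intros y Hy. split; [apply Hsub1 | apply Hsub2]; exact Hy.
    - intros p Hp HpT eps He.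
      assert (Hp12 : Rad ^ 2 < p X1 ^ 2 + p X2 ^ 2) by (unfold dot, sum3 in HpT; rewrite Hp in HpT; nra).
      destruct (tf_bc _ _ _ _ _ _ _ _ TF1 p) with (eps := eps / 2) as [d1 [Hd1 H1]].
      { rewrite (tf_far _ _ _ _ _ _ _ _ TF1) by exact Hp12. exact Hp. }
      { lra. }
      destruct (tf_bc _ _ _ _ _ _ _ _ TF2 p) with (eps := eps / 2) as [d2 [Hd2 H2]].
      { rewrite (tf_far _ _ _ _ _ _ _ _ TF2) by exact Hp12. exact Hp. }
      { lra. }
      exists (Rmin d1 d2). split; [apply Rmin_glb_lt; assumption|]. intros y Hy Hn.
      pose proof (H1 y (Hsub1 y Hy) (near_le _ _ _ _ (Rmin_l d1 d2) Hn) b) as B1.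
      pose proof (H2 y (Hsub2 y Hy) (near_le _ _ _ _ (Rmin_r d1 d2) Hn) b) as B2.
      apply Rabs_lt_between in B1. apply Rabs_lt_between in B2. unfold w. apply Rabs_lt_between. lra.
    - intros y Hy. unfold w. replace (1 * u1 b y + -1 * u2 b y) with (u1 b y - u2 b y) by ring. apply Hdec, Hy. }
  set (H := 1 + T0 + Rabs (x X3)). pose proof (Rabs_pos (x X3)) as Hx3. pose proof (Rle_abs (x X3)) as Hx3'.
  set (p := mk (x X1) (x X2) H).
  assert (Hp : half_exterior T0 p).
  { split; [unfold p, mk, H; lra|]. unfold dot, sum3, p, mk.
    pose proof (pow2_ge_0 (x X1)). pose proof (pow2_ge_0 (x X2)). unfold H. nra. }
  assert (Zp : zero_near w p).
  { destruct (half_exterior_open T0 p Hp) as [r [Hr Hr']]. exists r. split; [exact Hr|]. intros q Hq. apply Hfar, Hr', Hq. }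
  assert (Zx : zero_near w (line p (psub x p) 1)).
  { apply (continuation_segment k O); try assumption.
    intros s Hs.
    assert (E1 : line p (psub x p) s X1 = x X1) by (unfold line, psub, p, mk; simpl; ring).
    assert (E2 : line p (psub x p) s X2 = x X2) by (unfold line, psub, p, mk; simpl; ring).
    assert (E3 : x X3 <= line p (psub x p) s X3) by (unfold line, psub, p, mk; simpl; unfold H; nra).
    unfold O, epigraph in *. rewrite E1, E2. split; lra. }
  rewrite line_psub in Zx. apply zero_near_at in Zx. unfold w in Zx. lra.
Qed.

End Comparison.

(** * One surface cannot rise above the other *)

Lemma graph_continuous_slice f p : graph_continuous f -> continuity (fun s => f (p X1 + s) (p X2)).
Proof.
  intros Hf s. apply continuity_pt_filterlim.
  assert (Hc : continuous (fun t => f (line p (basis X1) t X1) (line p (basis X1) t X2)) s).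
  { apply (continuous_comp (line p (basis X1) : R -> point) (fun x : point => f (x X1) (x X2)) s); [apply continuous_line | apply Hf]. }
  refine (continuous_ext (T := R_UniformSpace) (U := R_UniformSpace) _ _ _ _ Hc).
  intros t. unfold line, basis; simpl. rewrite Rmult_1_r, Rmult_0_r, Rplus_0_r. reflexivity.
Qed.

(** Along a line running out to the flat part, a positive value forces every smaller positive value,
    in particular some [y] with [0 < c * y <= PI / 2], where the sine does not vanish. *)
Lemma sine_graph_nonpositive f c Rad : 0 < c -> 0 < Rad -> graph_continuous f ->
  (forall t1 t2, Rad ^ 2 < t1 ^ 2 + t2 ^ 2 -> f t1 t2 = 0) ->
  (forall t1 t2, 0 < f t1 t2 -> sin (c * f t1 t2) = 0) -> forall t1 t2, f t1 t2 <= 0.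
Proof.
  intros Hc HR Hf Hfar Hsin t1 t2. apply Rnot_lt_le. intros Hpos.
  set (Lam := Rad + Rabs t1 + 1).
  set (y := Rmin (f t1 t2) (PI / (2 * c))).
  pose proof PI_RGT_0 as HPI.
  assert (Hy : 0 < y) by (apply Rmin_glb_lt; [exact Hpos | apply Rdiv_lt_0_compat; lra]).
  assert (Hy1 : y <= f t1 t2) by apply Rmin_l.
  assert (Hy2 : c * y <= PI / 2).
  { assert (y <= PI / (2 * c)) by apply Rmin_r. apply Rmult_le_compat_l with (r := c) in H; [|lra].
    replace (c * (PI / (2 * c))) with (PI / 2) in H by (field; lra). exact H. }
  assert (Hend : f (t1 + Lam) t2 = 0).
  { apply Hfar. pose proof (Rle_abs (- t1)) as Ha. rewrite Rabs_Ropp in Ha.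
    assert (Rad + 1 <= t1 + Lam) by (unfold Lam; lra). pose proof (pow2_ge_0 t2). nra. }
  destruct (IVT_gen (fun s => f (t1 + s) t2) 0 Lam y) as [s [_ Hs]].
  - apply (graph_continuous_slice f (mk t1 t2 0) Hf).
  - rewrite Rplus_0_r, Hend. rewrite Rmin_right, Rmax_left by lra. lra.
  - assert (H0 : sin (c * y) = 0) by (rewrite <- Hs; apply Hsin; lra).
    assert (0 < c * y) by (apply Rmult_lt_0_compat; assumption).
    pose proof (sin_gt_0 (c * y)). lra.
Qed.

Section OneSided.

Context (k al be ga : R) (f1 f2 : R -> R -> R) (Rad : R) (L1 L2 : list affine) (u1 u2 : field).
Context (TF1 : total_field k al be ga f1 Rad L1 u1) (TF2 : total_field k al be ga f2 Rad L2 u2).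
Context (Hagree : forall x, epigraph f1 x -> epigraph f2 x -> forall b, u1 b x = u2 b x).

(** Approach the graph of [f1] from above: there [u2 = u1], which tends to zero by the boundary
    condition for the first surface, and [u2] is continuous at the limit. *)
Lemma upper_graph_zero t1 t2 : f2 t1 t2 < f1 t1 t2 -> forall b, u2 b (mk t1 t2 (f1 t1 t2)) = 0.
Proof.
  intros Ht b. set (g := mk t1 t2 (f1 t1 t2)). apply NNPP. intros Hne.
  assert (Hab : 0 < Rabs (u2 b g) / 2) by (pose proof (Rabs_pos_lt _ Hne); lra).
  assert (Hg : epigraph f2 g) by exact Ht.
  destruct (proj1 (continuous_near (u2 b) g) (c2_cont _ _ (proj1 (tf_helm _ _ _ _ _ _ _ _ TF2 b) g Hg)) _ Hab) as [d1 [Hd1 H1]].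
  destruct (tf_bc _ _ _ _ _ _ _ _ TF1 g eq_refl _ Hab) as [d2 [Hd2 H2]].
  set (s := Rmin d1 d2 / 2). assert (Hm : 0 < Rmin d1 d2) by (apply Rmin_glb_lt; assumption).
  pose proof (Rmin_l d1 d2). pose proof (Rmin_r d1 d2).
  set (x := mk t1 t2 (f1 t1 t2 + s)).
  assert (Hnx : forall r, s < r -> near g r x).
  { intros r Hr. assert (0 < s) by (unfold s; lra).
    intros []; unfold g, x, mk; rewrite ?Rminus_diag, ?Rabs_R0; try lra.
    replace (f1 t1 t2 + s - f1 t1 t2) with s by ring. rewrite Rabs_pos_eq; lra. }
  assert (Ox1 : epigraph f1 x) by (unfold epigraph, x, mk, s; lra).
  assert (Ox2 : epigraph f2 x) by (unfold epigraph, x, mk, s; lra).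
  specialize (H1 x (Hnx d1 ltac:(unfold s; lra))).
  specialize (H2 x Ox1 (Hnx d2 ltac:(unfold s; lra)) b).
  rewrite <- (Hagree x Ox1 Ox2 b) in H1.
  pose proof (Rabs_triang_inv (u2 b g) (u1 b x)) as T. rewrite Rabs_minus_sym in H1. lra.
Qed.

(** The modulus of the flat field is twice the absolute value of the sine, so the boundary condition
    on the second surface becomes a condition on its height alone. *)
Lemma flat_lower_graph : (forall x, epigraph f2 x -> forall b, u2 b x = flat_field k al be ga b x) ->
  forall t1 t2, sin (k * ga * f2 t1 t2) = 0.
Proof.
  intros Hflat t1 t2. apply NNPP. intros Hne.
  set (S := Rabs (sin (k * ga * f2 t1 t2))). assert (HS : 0 < S) by (apply Rabs_pos_lt, Hne).
  pose proof (tf_k _ _ _ _ _ _ _ _ TF2) as Hk. pose proof (tf_ga _ _ _ _ _ _ _ _ TF2) as Hga.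
  assert (Hkg : 0 < k * ga) by (apply Rmult_lt_0_compat; assumption).
  set (g := mk t1 t2 (f2 t1 t2)).
  destruct (tf_bc _ _ _ _ _ _ _ _ TF2 g eq_refl (S / 2)) as [d [Hd H]]; [lra|].
  assert (Hc : continuous (fun x : point => sin (k * ga * x X3)) g).
  { apply (cont_comp sin (fun x : point => k * ga * x X3)); [cont_tac|].
    refine (is_derive_cont _ _ _ (proj2 (is_derive_Reals _ _ _) (derivable_pt_lim_sin _))). }
  destruct (proj1 (continuous_near _ g) Hc (S / 4)) as [d' [Hd' H']]; [lra|].
  set (s := Rmin d d' / 2). assert (Hm : 0 < Rmin d d') by (apply Rmin_glb_lt; assumption).
  pose proof (Rmin_l d d'). pose proof (Rmin_r d d').
  set (x := mk t1 t2 (f2 t1 t2 + s)).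
  assert (Hnx : forall r, s < r -> near g r x).
  { intros r Hr. assert (0 < s) by (unfold s; lra).
    intros []; unfold g, x, mk; rewrite ?Rminus_diag, ?Rabs_R0; try lra.
    replace (f2 t1 t2 + s - f2 t1 t2) with s by ring. rewrite Rabs_pos_eq; lra. }
  assert (Ox : epigraph f2 x) by (unfold epigraph, x, mk, s; lra).
  pose proof (H x Ox (Hnx d ltac:(unfold s; lra))) as HB.
  pose proof (HB true) as B1. pose proof (HB false) as B2. rewrite Hflat in B1, B2 by exact Ox.
  specialize (H' x (Hnx d' ltac:(unfold s; lra))). change (g X3) with (f2 t1 t2) in H'.
  pose proof (flat_field_norm k al be ga x) as HN.
  set (sx := sin (k * ga * x X3)) in *.
  assert (3 / 4 * S <= Rabs sx).
  { pose proof (Rabs_triang_inv (sin (k * ga * f2 t1 t2)) sx) as T.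
    pose proof (Rabs_triang_inv (sin (k * ga * f2 t1 t2)) (sin (k * ga * f2 t1 t2) - sx)) as T2.
    replace (sin (k * ga * f2 t1 t2) - (sin (k * ga * f2 t1 t2) - sx)) with sx in T2 by ring.
    rewrite (Rabs_minus_sym (sin (k * ga * f2 t1 t2)) sx) in T2. fold S in T2. lra. }
  rewrite <- (pow2_abs sx) in HN.
  rewrite <- (pow2_abs (flat_field k al be ga true x)) in HN. rewrite <- (pow2_abs (flat_field k al be ga false x)) in HN.
  pose proof (Rabs_pos (flat_field k al be ga true x)). pose proof (Rabs_pos (flat_field k al be ga false x)). nra.
Qed.

Lemma graph_le t1 t2 : f1 t1 t2 <= f2 t1 t2.
Proof.
  apply Rnot_lt_le. intros Ht.
  pose proof (tf_k _ _ _ _ _ _ _ _ TF2) as Hk. pose proof (tf_ga _ _ _ _ _ _ _ _ TF2) as Hga.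
  assert (Hkg : 0 < k * ga) by (apply Rmult_lt_0_compat; assumption).
  pose proof (tf_rad _ _ _ _ _ _ _ _ TF2) as HR.
  set (q := mk t1 t2 (f1 t1 t2)).
  assert (Hq2 : epigraph f2 q) by exact Ht.
  destruct (epigraph_open f2 (tf_cont _ _ _ _ _ _ _ _ TF2) q Hq2) as [rho [Hrho Hrho']].
  destruct (continuous_open_lt (fun x => f1 (x X1) (x X2) - f2 (x X1) (x X2)) 0) with (p := q) as [d [Hd Hd']].
  { intros x. apply cont_minus; [apply (tf_cont _ _ _ _ _ _ _ _ TF1) | apply (tf_cont _ _ _ _ _ _ _ _ TF2)]. }
  { unfold q; simpl. lra. }
  assert (Hnod : exists n, nodal u2 (near q rho) n q).
  { apply (nodal_on_graph k u2 f1 L1 q rho d); try assumption.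
    - apply (tf_cont _ _ _ _ _ _ _ _ TF1).
    - apply (tf_sel _ _ _ _ _ _ _ _ TF1).
    - reflexivity.
    - intros b. apply helm_on_sub with (2 := tf_helm _ _ _ _ _ _ _ _ TF2 b). exact Hrho'.
    - intros x1 x2 [Hx1 Hx2]. apply upper_graph_zero.
      assert (Hn : near q d (mk x1 x2 (f1 t1 t2))).
      { intros []; simpl; try assumption. rewrite Rminus_diag, Rabs_R0. exact Hd. }
      specialize (Hd' _ Hn). simpl in Hd'. lra. }
  destruct Hnod as [n [_ [Hn Hz]]].
  assert (Hflat := nodal_flat k al be ga f2 Rad L2 u2 TF2 n q (conj Hq2 (conj Hn Hz))).
  pose proof (flat_lower_graph Hflat) as Hs2.
  assert (Hf2a : forall x1 x2, f2 x1 x2 <= 0).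
  { apply (sine_graph_nonpositive f2 (k * ga) Rad); try assumption.
    - apply (tf_cont _ _ _ _ _ _ _ _ TF2).
    - apply (tf_far _ _ _ _ _ _ _ _ TF2).
    - intros x1 x2 _. apply Hs2. }
  assert (Hf2b : forall x1 x2, - f2 x1 x2 <= 0).
  { apply (sine_graph_nonpositive (fun x1 x2 => - f2 x1 x2) (k * ga) Rad); try assumption.
    - intros p. apply (cont_opp (fun x => f2 (x X1) (x X2))), (tf_cont _ _ _ _ _ _ _ _ TF2).
    - intros x1 x2 Hx. rewrite (tf_far _ _ _ _ _ _ _ _ TF2) by exact Hx. ring.
    - intros x1 x2 _. rewrite Ropp_mult_distr_r_reverse, sin_neg, Hs2. ring. }
  assert (Hf2 : forall x1 x2, f2 x1 x2 = 0) by (intros x1 x2; specialize (Hf2a x1 x2); specialize (Hf2b x1 x2); lra).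
  (* With [f2 = 0], positivity of [f1] means that the graph of [f1] lies in the domain of [u2].
     There [u2] is both zero and flat, so the sine vanishes at exactly the heights that
     [sine_graph_nonpositive] asks about. *)
  assert (Hf1 : forall x1 x2, f1 x1 x2 <= 0).
  { apply (sine_graph_nonpositive f1 (k * ga) Rad); try assumption.
    - apply (tf_cont _ _ _ _ _ _ _ _ TF1).
    - apply (tf_far _ _ _ _ _ _ _ _ TF1).
    - intros x1 x2 Hx.
      assert (Hx2 : f2 x1 x2 < f1 x1 x2) by (rewrite Hf2; exact Hx).
      pose proof (flat_field_norm k al be ga (mk x1 x2 (f1 x1 x2))) as HN. simpl (mk x1 x2 (f1 x1 x2) X3) in HN.
      rewrite <- !Hflat, !(upper_graph_zero x1 x2 Hx2) in HN by exact Hx2.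
      assert (E : sin (k * ga * f1 x1 x2) ^ 2 = 0) by lra.
      apply Rsqr_0_uniq. unfold Rsqr. lra. }
  specialize (Hf1 t1 t2). rewrite Hf2 in Ht. lra.
Qed.

End OneSided.

(** * From scattered fields with a far-field pattern to total fields *)

(** Half the radius suffices to pass from the sup norm to the Euclidean one, as [sqrt 3 / 2 < 1]. *)
Lemma dist3_near (p q : point) d : near p (d / 2) q -> dist3 (p X1) (p X2) (p X3) (q X1) (q X2) (q X3) < d.
Proof.
  intros H. unfold dist3, norm3.
  assert (Hd : 0 < d) by (pose proof (H X1); pose proof (Rabs_pos (q X1 - p X1)); lra).
  rewrite <- (sqrt_pow2 d) by lra. apply sqrt_lt_1.
  - pose proof (pow2_ge_0 (p X1 - q X1)). pose proof (pow2_ge_0 (p X2 - q X2)). pose proof (pow2_ge_0 (p X3 - q X3)). lra.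
  - apply pow2_ge_0.
  - assert (Hi : forall i, (p i - q i) ^ 2 < d ^ 2 / 4).
    { intros i. specialize (H i). rewrite Rabs_minus_sym in H. rewrite <- pow2_abs.
      pose proof (Rabs_pos (p i - q i)). nra. }
    pose proof (Hi X1). pose proof (Hi X2). pose proof (Hi X3). pose proof (pow_lt d 2 Hd). lra.
Qed.

Lemma norm2_small s1 s2 t1 t2 d : Rabs (t1 - s1) < d / 2 -> Rabs (t2 - s2) < d / 2 -> norm2 (t1 - s1) (t2 - s2) < d.
Proof.
  intros H1 H2. unfold norm2.
  assert (Hd : 0 < d) by (pose proof (Rabs_pos (t1 - s1)); lra).
  rewrite <- (sqrt_pow2 d) by lra. apply sqrt_lt_1.
  - pose proof (pow2_ge_0 (t1 - s1)). pose proof (pow2_ge_0 (t2 - s2)). lra.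
  - apply pow2_ge_0.
  - rewrite <- (pow2_abs (t1 - s1)), <- (pow2_abs (t2 - s2)).
    pose proof (Rabs_pos (t1 - s1)). pose proof (Rabs_pos (t2 - s2)). nra.
Qed.

Definition lift (v : R -> R -> R -> R) (x : point) : R := v (x X1) (x X2) (x X3).

Lemma cont_on_lift v (O : R -> R -> R -> Prop) p :
  open_set (fun x => O (x X1) (x X2) (x X3)) -> cont_on v O -> O (p X1) (p X2) (p X3) -> continuous (lift v) p.
Proof.
  intros HO Hv Hp. apply continuous_near. intros eps He.
  destruct (Hv _ _ _ Hp eps He) as [d [Hd H]]. destruct (HO p Hp) as [r [Hr Hr']].
  exists (Rmin (d / 2) r). split; [apply Rmin_glb_lt; lra|]. intros q Hq. unfold lift. apply H.
  - apply Hr', near_le with (2 := Hq), Rmin_r.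
  - apply dist3_near, near_le with (2 := Hq), Rmin_l.
Qed.

Lemma derivable_is_deriv (F : R -> R) x l a :
  derivable_pt_lim F x l -> a = x -> is_derive (fun t => F (a + t)) 0 l.
Proof.
  intros H ->. apply is_derive_Reals in H. replace l with (1 * l) by ring.
  apply (is_derive_comp F (fun t => x + t)).
  - rewrite Rplus_0_r. exact H.
  - auto_derive; [exact I | ring].
Qed.

Lemma is_deriv_lift1 v p l : derivable_pt_lim (fun t => v t (p X2) (p X3)) (p X1) l -> is_deriv (basis X1) (lift v) p l.
Proof.
  intros H. unfold is_deriv. apply is_derive_ext with (fun t => v (p X1 + t) (p X2) (p X3)).
  - intros t. unfold lift, line, basis; simpl. f_equal; ring.
  - exact (derivable_is_deriv _ _ _ _ H eq_refl).
Qed.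

Lemma is_deriv_lift2 v p l : derivable_pt_lim (fun t => v (p X1) t (p X3)) (p X2) l -> is_deriv (basis X2) (lift v) p l.
Proof.
  intros H. unfold is_deriv. apply is_derive_ext with (fun t => v (p X1) (p X2 + t) (p X3)).
  - intros t. unfold lift, line, basis; simpl. f_equal; ring.
  - exact (derivable_is_deriv (fun t => v (p X1) t (p X3)) _ _ _ H eq_refl).
Qed.

Lemma is_deriv_lift3 v p l : derivable_pt_lim (fun t => v (p X1) (p X2) t) (p X3) l -> is_deriv (basis X3) (lift v) p l.
Proof.
  intros H. unfold is_deriv. apply is_derive_ext with (fun t => v (p X1) (p X2) (p X3 + t)).
  - intros t. unfold lift, line, basis; simpl. f_equal; ring.
  - exact (derivable_is_deriv (fun t => v (p X1) (p X2) t) _ _ _ H eq_refl).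
Qed.

Lemma helmholtz_lift k v (O : R -> R -> R -> Prop) :
  open_set (fun x => O (x X1) (x X2) (x X3)) -> helmholtz k v O ->
  helm_on k (fun x => O (x X1) (x X2) (x X3)) (lift v).
Proof.
  intros HO (g1 & g2 & g3 & h1 & h2 & h3 & Hv & P1 & P2 & P3 & G1 & G2 & G3 & Q1 & Q2 & Q3 & H1 & H2 & H3 & E).
  destruct (c2_intro (fun x => O (x X1) (x X2) (x X3)) (lift v)
    (fun i => lift (match i with X1 => g1 | X2 => g2 | X3 => g3 end))
    (fun i => lift (match i with X1 => h1 | X2 => h2 | X3 => h3 end)) HO) as [A [_ B]].
  - intros p Hp. exact (cont_on_lift v O p HO Hv Hp).
  - intros [] p Hp.
    + apply is_deriv_lift1. exact (P1 _ _ _ Hp).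
    + apply is_deriv_lift2. exact (P2 _ _ _ Hp).
    + apply is_deriv_lift3. exact (P3 _ _ _ Hp).
  - intros [] p Hp.
    + exact (cont_on_lift g1 O p HO G1 Hp).
    + exact (cont_on_lift g2 O p HO G2 Hp).
    + exact (cont_on_lift g3 O p HO G3 Hp).
  - intros [] p Hp.
    + apply is_deriv_lift1. exact (Q1 _ _ _ Hp).
    + apply is_deriv_lift2. exact (Q2 _ _ _ Hp).
    + apply is_deriv_lift3. exact (Q3 _ _ _ Hp).
  - intros [] p Hp.
    + exact (cont_on_lift h1 O p HO H1 Hp).
    + exact (cont_on_lift h2 O p HO H2 Hp).
    + exact (cont_on_lift h3 O p HO H3 Hp).
  - split; [exact A|]. intros p Hp. unfold laplacian, sum3. rewrite !B by exact Hp. exact (E _ _ _ Hp).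
Qed.

Lemma continuous2_graph f : continuous2 f -> graph_continuous f.
Proof.
  intros Hf p. apply continuous_near. intros eps He.
  destruct (Hf (p X1) (p X2) eps He) as [d [Hd H]]. exists (d / 2). split; [lra|].
  intros q Hq. apply H, norm2_small; apply Hq.
Qed.

Lemma polyhedral_selection f : polyhedral f -> exists L, selection f L.
Proof.
  intros [_ [Rb [l [Hout [Hin Haff]]]]].
  (* The zero function is added for the flat part outside the triangulated disc. *)
  exists (mkAffine 0 0 0 :: map (fun P => mkAffine (ca P) (cb P) (cc P)) l).
  intros t1 t2. destruct (Rlt_dec Rb (norm2 t1 t2)) as [H|H].
  - exists (mkAffine 0 0 0). split; [left; reflexivity|]. rewrite Hout by exact H. unfold aff; simpl. ring.
  - destruct (Hin t1 t2 ltac:(lra)) as [P [HP Ht]].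
    exists (mkAffine (ca P) (cb P) (cc P)). split.
    + right. apply (in_map (fun P => mkAffine (ca P) (cb P) (cc P))), HP.
    + exact (Haff P HP t1 t2 Ht).
Qed.

Definition total (k al be ga : R) (vR vI : R -> R -> R -> R) : field :=
  fun b => lift (if b then utot_re k al be ga vR else utot_im k al be ga vI).

Lemma total_flat k al be ga vR vI b x :
  total k al be ga vR vI b x = flat_field k al be ga b x + lift (if b then vR else vI) x.
Proof.
  unfold total, lift, flat_field.
  set (A := k * (al * x X1 + be * x X2)). set (B := k * ga * x X3).
  assert (E1 : k * (al * x X1 + be * x X2 - ga * x X3) = A - B) by (unfold A, B; ring).
  assert (E2 : k * (al * x X1 + be * x X2 + ga * x X3) = A + B) by (unfold A, B; ring).
  destruct b; [unfold utot_re | unfold utot_im]; rewrite E1, E2.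
  - rewrite cos_minus, cos_plus. ring.
  - rewrite sin_minus, sin_plus. ring.
Qed.

Lemma flat_field_bounded k al be ga b x : Rabs (flat_field k al be ga b x) <= 2.
Proof.
  pose proof (flat_field_norm k al be ga x) as H. pose proof (SIN_bound (k * ga * x X3)) as [S1 S2].
  assert (sin (k * ga * x X3) ^ 2 <= 1) by nra.
  pose proof (pow2_ge_0 (flat_field k al be ga true x)). pose proof (pow2_ge_0 (flat_field k al be ga false x)).
  apply Rabs_le_between. destruct b; split; nra.
Qed.

Lemma norm3_dot x : norm3 (x X1) (x X2) (x X3) = sqrt (dot x x).
Proof. unfold norm3, dot, sum3. f_equal. ring. Qed.

(** Points where the field blows up would accumulate in the closed epigraph: at an interior point
    continuity forbids it, and on the surface the boundary condition does. *)
Lemma hemisphere_bounded k f Rad u r :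
  0 < Rad -> graph_continuous f -> (forall t1 t2, Rabs (f t1 t2) < Rad) ->
  (forall t1 t2, Rad ^ 2 < t1 ^ 2 + t2 ^ 2 -> f t1 t2 = 0) ->
  helm_field k (epigraph f) u ->
  (forall p, p X3 = f (p X1) (p X2) -> forall eps, 0 < eps ->
    exists d, 0 < d /\ forall x, epigraph f x -> near p d x -> forall b, Rabs (u b x) < eps) ->
  2 * Rad ^ 2 < r ^ 2 ->
  exists M, 0 < M /\ forall x, epigraph f x -> dot x x = r ^ 2 -> forall b, Rabs (u b x) <= M.
Proof.
  intros HR Hf Hb Hfar Hu Hbc Hr.
  assert (Hsingle : forall b, exists M, 0 < M /\ forall x, epigraph f x -> dot x x = r ^ 2 -> Rabs (u b x) <= M).
  { intros b. apply NNPP. intros Hn.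
    destruct (compact_cluster (fun n x => epigraph f x /\ dot x x = r ^ 2 /\ INR n + 1 < Rabs (u b x)) (1 + r ^ 2)) as [l Hl].
    { intros n. apply NNPP. intros Hm. apply Hn. exists (INR n + 1). split; [pose proof (pos_INR n); lra|].
      intros x Hx Hxr. apply Rnot_lt_le. intros Hlt. apply Hm. exists x. split; [tauto|].
      intros i. rewrite <- Hxr. apply dot_self_coord. }
    assert (Hlr : r ^ 2 <= dot l l).
    { apply (continuous_closed_le (fun x => dot x x) _ dot_self_continuous l). intros eps He.
      destruct (Hl eps O He) as [n [x [_ [[_ [Hx _]] Hxn]]]]. exists x. split; [lra | exact Hxn]. }
    assert (Hle : f (l X1) (l X2) <= l X3).
    { assert (H0 : 0 <= l X3 - f (l X1) (l X2)); [|lra].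
      apply (continuous_closed_le (fun x => x X3 - f (x X1) (x X2)) 0) with (l := l).
      - intros p. apply cont_minus; [apply cont_coord | apply Hf].
      - intros eps He. destruct (Hl eps O He) as [n [x [_ [[Hx _] Hxn]]]]. exists x.
        unfold epigraph in Hx. split; [lra | exact Hxn]. }
    assert (Hblow : forall B d, 0 < d -> exists x, epigraph f x /\ near l d x /\ B < Rabs (u b x)).
    { intros B d Hd. destruct (INR_unbounded B) as [N HN].
      destruct (Hl d N Hd) as [n [x [Hn' [[Hx [_ Hux]] Hxn]]]]. exists x. split; [exact Hx | split; [exact Hxn|]].
      apply le_INR in Hn'. lra. }
    destruct (Rle_lt_or_eq_dec _ _ Hle) as [Hlt|Heq].
    - destruct (proj1 (continuous_near (u b) l) (c2_cont _ _ (proj1 (Hu b) l Hlt)) 1 Rlt_0_1) as [d [Hd Hd']].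
      destruct (Hblow (Rabs (u b l) + 1) d Hd) as [x [_ [Hxn Hux]]]. specialize (Hd' x Hxn).
      pose proof (Rabs_triang (u b x - u b l) (u b l)) as T. replace (u b x - u b l + u b l) with (u b x) in T by ring. lra.
    - destruct (Hbc l (eq_sym Heq) 1 Rlt_0_1) as [d [Hd Hd']].
      destruct (Hblow 1 d Hd) as [x [Hx [Hxn Hux]]]. specialize (Hd' x Hx Hxn b). lra. }
  destruct (Hsingle true) as [M1 [HM1 H1]]. destruct (Hsingle false) as [M2 [HM2 H2]].
  exists (M1 + M2). split; [lra|]. intros x Hx Hxr [].
  - specialize (H1 x Hx Hxr). lra.
  - specialize (H2 x Hx Hxr). lra.
Qed.

Lemma components_le a b c : sqrt (a ^ 2 + b ^ 2) <= c -> Rabs a <= c /\ Rabs b <= c.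
Proof.
  intros H. pose proof (pow2_ge_0 a). pose proof (pow2_ge_0 b). split.
  - eapply Rle_trans; [|exact H]. rewrite <- sqrt_Rsqr_abs. apply sqrt_le_1; unfold Rsqr; nra.
  - eapply Rle_trans; [|exact H]. rewrite <- sqrt_Rsqr_abs. apply sqrt_le_1; unfold Rsqr; nra.
Qed.

Lemma rotation_bound c s a b B : Rabs c <= 1 -> Rabs s <= 1 -> Rabs a <= B -> Rabs b <= B -> Rabs (c * a + s * b) <= 2 * B.
Proof.
  intros Hc Hs Ha Hb. eapply Rle_trans; [apply Rabs_triang|]. rewrite !Rabs_mult.
  pose proof (Rmult_le_compat _ _ _ _ (Rabs_pos c) (Rabs_pos a) Hc Ha).
  pose proof (Rmult_le_compat _ _ _ _ (Rabs_pos s) (Rabs_pos b) Hs Hb). lra.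
Qed.

(* The far-field pattern is bounded because the field is bounded on one large hemisphere; hence the field decays uniformly. *)
Lemma far_field_decay k al be ga f Rad vR vI FR FI :
  0 < Rad -> graph_continuous f -> (forall t1 t2, Rabs (f t1 t2) < Rad) ->
  (forall t1 t2, Rad ^ 2 < t1 ^ 2 + t2 ^ 2 -> f t1 t2 = 0) ->
  helm_field k (epigraph f) (total k al be ga vR vI) ->
  (forall p, p X3 = f (p X1) (p X2) -> forall eps, 0 < eps ->
    exists d, 0 < d /\ forall x, epigraph f x -> near p d x -> forall b, Rabs (total k al be ga vR vI b x) < eps) ->
  far_field_pattern k f vR vI FR FI ->
  forall eps, 0 < eps -> exists r0, forall x, epigraph f x -> r0 ^ 2 < dot x x ->
    forall b, Rabs (total k al be ga vR vI b x - flat_field k al be ga b x) < eps.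
Proof.
  intros HR Hf Hb Hfar Hu Hbc [C [r0 HF]] eps He.
  (* Beyond the range of the far-field expansion, and so large that the open upper hemisphere of
     radius [r1] lies in the domain. *)
  set (r1 := Rabs r0 + 2 * Rad + 1).
  pose proof (Rabs_pos r0) as Hr0. pose proof (Rle_abs r0) as Hr0'.
  assert (Hr1 : 1 <= r1) by (unfold r1; lra). assert (Hr1R : 2 * Rad <= r1) by (unfold r1; lra).
  assert (Hr12 : 2 * Rad ^ 2 < r1 ^ 2) by (unfold r1; nra).
  destruct (hemisphere_bounded k f Rad _ r1 HR Hf Hb Hfar Hu Hbc Hr12) as [M [HM HMb]].
  set (B := M + 2 + Rabs C). pose proof (Rabs_pos C) as HC.
  assert (HB : 0 < B) by (unfold B; lra).
  assert (HFb : forall y1 y2 y3, y1 ^ 2 + y2 ^ 2 + y3 ^ 2 = 1 -> 0 < y3 ->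
    Rabs (FR y1 y2 y3) <= 2 * (r1 * B) /\ Rabs (FI y1 y2 y3) <= 2 * (r1 * B)).
  { intros y1 y2 y3 Hy Hy3. set (x := mk (r1 * y1) (r1 * y2) (r1 * y3)).
    assert (Hxx : dot x x = r1 ^ 2).
    { unfold dot, sum3, x, mk. transitivity (r1 ^ 2 * (y1 ^ 2 + y2 ^ 2 + y3 ^ 2)); [ring | rewrite Hy; ring]. }
    assert (Ox : epigraph f x).
    { apply (half_exterior_epigraph f Rad (2 * Rad ^ 2)); try assumption; [lra|]. split; [|lra].
      unfold x, mk. apply Rmult_lt_0_compat; lra. }
    assert (Hn : norm3 (x X1) (x X2) (x X3) = r1) by (rewrite norm3_dot, Hxx; apply sqrt_pow2; lra).
    pose proof (HF (x X1) (x X2) (x X3) Ox ltac:(rewrite Hn; unfold r1; lra)) as H. cbv zeta in H.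
    rewrite Hn in H.
    replace (x X1 / r1) with y1 in H by (unfold x, mk; field; lra).
    replace (x X2 / r1) with y2 in H by (unfold x, mk; field; lra).
    replace (x X3 / r1) with y3 in H by (unfold x, mk; field; lra).
    apply components_le in H. destruct H as [HA HB'].
    assert (HCr : C / r1 ^ 2 <= Rabs C).
    { apply Rle_trans with (Rabs C / r1 ^ 2).
      - apply Rmult_le_compat_r; [apply Rlt_le, Rinv_0_lt_compat, pow_lt; lra | apply Rle_abs].
      - apply Rmult_le_reg_r with (r1 ^ 2); [apply pow_lt; lra|].
        replace (Rabs C / r1 ^ 2 * r1 ^ 2) with (Rabs C) by (field; lra).
        assert (1 <= r1 ^ 2) by nra. nra. }
    assert (Hv : forall b : bool, Rabs (lift (if b then vR else vI) x) <= M + 2).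
    { intros b. pose proof (total_flat k al be ga vR vI b x) as E.
      pose proof (HMb x Ox Hxx b) as H1. pose proof (flat_field_bounded k al be ga b x) as H2.
      replace (lift (if b then vR else vI) x) with (total k al be ga vR vI b x - flat_field k al be ga b x) by lra.
      unfold Rminus. eapply Rle_trans; [apply Rabs_triang|]. rewrite Rabs_Ropp. lra. }
    pose proof (Hv true) as V1. pose proof (Hv false) as V2. unfold lift in V1, V2.
    set (co := cos (k * r1)) in *. set (si := sin (k * r1)) in *.
    set (eR := (co * FR y1 y2 y3 - si * FI y1 y2 y3) / r1) in *.
    set (eI := (si * FR y1 y2 y3 + co * FI y1 y2 y3) / r1) in *.
    assert (BR : Rabs eR <= B).
    { apply Rabs_le_between in HA. apply Rabs_le_between in V1. apply Rabs_le_between. unfold B. lra. }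
    assert (BI : Rabs eI <= B).
    { apply Rabs_le_between in HB'. apply Rabs_le_between in V2. apply Rabs_le_between. unfold B. lra. }
    (* The pattern is recovered from the leading term by the inverse rotation, through the angle
       [- k * r1]. *)
    assert (Ecs : si * si + co * co = 1) by (pose proof (sin2_cos2 (k * r1)) as H; unfold Rsqr in H; exact H).
    assert (ER : FR y1 y2 y3 = co * (r1 * eR) + si * (r1 * eI)).
    { transitivity ((si * si + co * co) * FR y1 y2 y3); [rewrite Ecs; ring | unfold eR, eI; field; lra]. }
    assert (EI : FI y1 y2 y3 = (- si) * (r1 * eR) + co * (r1 * eI)).
    { transitivity ((si * si + co * co) * FI y1 y2 y3); [rewrite Ecs; ring | unfold eR, eI; field; lra]. }
    assert (Hr1eR : Rabs (r1 * eR) <= r1 * B) by (rewrite Rabs_mult, Rabs_pos_eq by lra; apply Rmult_le_compat_l; lra).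
    assert (Hr1eI : Rabs (r1 * eI) <= r1 * B) by (rewrite Rabs_mult, Rabs_pos_eq by lra; apply Rmult_le_compat_l; lra).
    split; [rewrite ER | rewrite EI]; apply rotation_bound; try assumption.
    - apply Rabs_cos_le.
    - apply Rabs_sin_le.
    - rewrite Rabs_Ropp. apply Rabs_sin_le.
    - apply Rabs_cos_le. }
  set (D := 4 * (r1 * B) + Rabs C).
  assert (HD : 0 < D) by (unfold D; assert (0 < r1 * B) by (apply Rmult_lt_0_compat; lra); lra).
  exists (r1 + D / eps). intros x Ox Hx b.
  assert (HDe : 0 < D / eps) by (apply Rdiv_lt_0_compat; assumption).
  assert (Hxr1 : r1 ^ 2 < dot x x) by nra.
  set (r := sqrt (dot x x)).
  assert (Hrr : r1 + D / eps < r).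
  { unfold r. rewrite <- (sqrt_pow2 (r1 + D / eps)) by lra. apply sqrt_lt_1; [apply pow2_ge_0 | nra | exact Hx]. }
  assert (Hr2 : r ^ 2 = dot x x) by (unfold r; simpl; rewrite Rmult_1_r; apply sqrt_sqrt; nra).
  assert (Hx3 : 0 < x X3).
  { apply (epigraph_half_exterior f Rad (2 * Rad ^ 2)); try assumption; lra. }
  assert (Hn : norm3 (x X1) (x X2) (x X3) = r) by apply norm3_dot.
  pose proof (HF (x X1) (x X2) (x X3) Ox ltac:(rewrite Hn; unfold r1 in *; lra)) as H. cbv zeta in H.
  rewrite Hn in H. apply components_le in H.
  destruct (HFb (x X1 / r) (x X2 / r) (x X3 / r)) as [FRb FIb].
  { transitivity (dot x x / r ^ 2); [unfold dot, sum3; field; lra | rewrite Hr2; field; nra]. }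
  { apply Rdiv_lt_0_compat; lra. }
  set (FRx := FR (x X1 / r) (x X2 / r) (x X3 / r)) in *. set (FIx := FI (x X1 / r) (x X2 / r) (x X3 / r)) in *.
  rewrite total_flat. replace (flat_field k al be ga b x + lift (if b then vR else vI) x - flat_field k al be ga b x)
    with (lift (if b then vR else vI) x) by ring.
  assert (Hgen : forall v num, Rabs (v - num / r) <= C / r ^ 2 -> Rabs num <= 4 * (r1 * B) -> Rabs v < eps).
  { intros v num Hv Hnum.
    assert (Hi : 0 < / r) by (apply Rinv_0_lt_compat; lra).
    assert (Hir : / r <= 1) by (rewrite <- Rinv_1; apply Rinv_le_contravar; lra).
    assert (HCr : C / r ^ 2 <= Rabs C * / r).
    { apply Rle_trans with (Rabs C * (/ r * / r)).
      - replace (C / r ^ 2) with (C * (/ r * / r)) by (field; lra).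
        apply Rmult_le_compat_r; [apply Rmult_le_pos; lra | apply Rle_abs].
      - apply Rmult_le_compat_l; [exact HC | nra]. }
    assert (Rabs v <= D * / r).
    { replace v with ((v - num / r) + num * / r) by (unfold Rdiv; ring).
      eapply Rle_trans; [apply Rabs_triang|]. rewrite (Rabs_mult num), (Rabs_pos_eq (/ r)) by lra.
      assert (Rabs num * / r <= 4 * (r1 * B) * / r) by (apply Rmult_le_compat_r; lra).
      unfold D. lra. }
    assert (D * / r < eps).
    { apply Rmult_lt_reg_r with r; [lra|]. rewrite Rmult_assoc, Rinv_l, Rmult_1_r by lra.
      assert (H1 : D / eps < r) by lra. apply Rmult_lt_compat_r with (r := eps) in H1; [|exact He].
      replace (D / eps * eps) with D in H1 by (field; lra). lra. }
    lra. }
  unfold lift. destruct H as [H1 H2]. destruct b.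
  - apply Hgen with (1 := H1). replace (4 * (r1 * B)) with (2 * (2 * (r1 * B))) by ring.
    unfold Rminus. rewrite Ropp_mult_distr_l. apply rotation_bound; try assumption; [apply Rabs_cos_le|].
    rewrite Rabs_Ropp. apply Rabs_sin_le.
  - apply Hgen with (1 := H2). replace (4 * (r1 * B)) with (2 * (2 * (r1 * B))) by ring.
    apply rotation_bound; try assumption; [apply Rabs_sin_le | apply Rabs_cos_le].
Qed.

(** Stated for all sufficiently large [Rad], so that two surfaces can share one value. *)
Lemma total_field_intro k al be ga f vR vI FR FI :
  0 < k -> al ^ 2 + be ^ 2 + ga ^ 2 = 1 -> 0 < ga ->
  locally_perturbed f -> polyhedral f -> dirichlet_scattered_field k al be ga f vR vI ->
  far_field_pattern k f vR vI FR FI ->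
  exists Rad1, forall Rad, Rad1 <= Rad ->
    exists L, total_field k al be ga f Rad L (total k al be ga vR vI).
Proof.
  intros Hk Hd Hga [_ [Rad1 [Hb Hfar]]] Hpoly [HhR [HhI [Hbc _]]] HF.
  exists Rad1. intros Rad HRad.
  assert (HR1 : 0 < Rad1) by (pose proof (Hb 0 0); pose proof (Rabs_pos (f 0 0)); lra).
  assert (HR : 0 < Rad) by lra.
  destruct (polyhedral_selection f Hpoly) as [L HL]. exists L.
  pose proof (continuous2_graph f (proj1 Hpoly)) as Hf.
  assert (Hb' : forall t1 t2, Rabs (f t1 t2) < Rad) by (intros t1 t2; specialize (Hb t1 t2); lra).
  assert (Hfar' : forall t1 t2, Rad ^ 2 < t1 ^ 2 + t2 ^ 2 -> f t1 t2 = 0).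
  { intros t1 t2 Ht. apply Hfar. unfold norm2. apply Rle_lt_trans with (1 := HRad).
    rewrite <- (sqrt_pow2 Rad) by lra. apply sqrt_lt_1; [apply pow2_ge_0 | nra | exact Ht]. }
  pose proof (epigraph_open f Hf) as HO.
  assert (Hu : helm_field k (epigraph f) (total k al be ga vR vI)).
  { intros []; unfold total.
    - exact (helmholtz_lift k _ (in_Omega f) HO HhR).
    - exact (helmholtz_lift k _ (in_Omega f) HO HhI). }
  assert (Hbc' : forall p, p X3 = f (p X1) (p X2) -> forall eps, 0 < eps ->
    exists d, 0 < d /\ forall x, epigraph f x -> near p d x -> forall b, Rabs (total k al be ga vR vI b x) < eps).
  { intros p Hp eps He. destruct (Hbc (p X1) (p X2) eps He) as [d [Hd0 H]].
    exists (d / 2). split; [lra|]. intros x Hx Hn b.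
    destruct (H (x X1) (x X2) (x X3) Hx) as [H1 H2].
    - rewrite <- Hp. apply dist3_near, Hn.
    - destruct b; assumption. }
  constructor; try assumption.
  exact (far_field_decay k al be ga f Rad vR vI FR FI HR Hf Hb' Hfar' Hu Hbc' HF).
Qed.

(** The leading terms coincide and cancel, as do the two flat fields, leaving the two remainders of
    order [1 / r ^ 2]. *)
Lemma far_field_difference k al be ga f1 f2 v1R v1I v2R v2I F1R F1I F2R F2I :
  far_field_pattern k f1 v1R v1I F1R F1I -> far_field_pattern k f2 v2R v2I F2R F2I ->
  (forall y1 y2 y3, y1 ^ 2 + y2 ^ 2 + y3 ^ 2 = 1 -> 0 < y3 ->
     F1R y1 y2 y3 = F2R y1 y2 y3 /\ F1I y1 y2 y3 = F2I y1 y2 y3) ->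
  exists T C, 0 < C /\ forall x, epigraph f1 x -> epigraph f2 x -> 0 < x X3 -> T < dot x x ->
    forall b, Rabs (total k al be ga v1R v1I b x - total k al be ga v2R v2I b x) <= C / dot x x.
Proof.
  intros [C1 [r1 H1]] [C2 [r2 H2]] HF.
  pose proof (Rabs_pos C1) as HC1. pose proof (Rabs_pos C2) as HC2.
  pose proof (Rabs_pos r1) as Hr1. pose proof (Rabs_pos r2) as Hr2.
  exists ((1 + Rabs r1 + Rabs r2) ^ 2), (1 + Rabs C1 + Rabs C2). split; [lra|].
  intros x O1 O2 Hx3 Hx b.
  set (r := sqrt (dot x x)).
  assert (Hrr : 1 + Rabs r1 + Rabs r2 < r).
  { unfold r. rewrite <- (sqrt_pow2 (1 + Rabs r1 + Rabs r2)) by lra. apply sqrt_lt_1; [apply pow2_ge_0 | nra | exact Hx]. }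
  assert (Er : r ^ 2 = dot x x) by (unfold r; simpl; rewrite Rmult_1_r; apply sqrt_sqrt; nra).
  assert (Hn : norm3 (x X1) (x X2) (x X3) = r) by apply norm3_dot.
  pose proof (Rle_abs r1). pose proof (Rle_abs r2).
  pose proof (H1 (x X1) (x X2) (x X3) O1 ltac:(rewrite Hn; lra)) as A1.
  pose proof (H2 (x X1) (x X2) (x X3) O2 ltac:(rewrite Hn; lra)) as A2.
  cbv zeta in A1, A2. rewrite Hn in A1, A2.
  destruct (HF (x X1 / r) (x X2 / r) (x X3 / r)) as [ER EI].
  { transitivity (dot x x / r ^ 2); [unfold dot, sum3; field; lra | rewrite Er; field; nra]. }
  { apply Rdiv_lt_0_compat; lra. }
  rewrite ER, EI in A1.
  apply components_le in A1. apply components_le in A2. destruct A1 as [A1 B1]. destruct A2 as [A2 B2].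
  rewrite !total_flat. rewrite <- Er.
  assert (HC : C1 / r ^ 2 + C2 / r ^ 2 <= (1 + Rabs C1 + Rabs C2) / r ^ 2).
  { rewrite <- Rdiv_plus_distr. apply Rmult_le_compat_r; [apply Rlt_le, Rinv_0_lt_compat, pow_lt; lra|].
    pose proof (Rle_abs C1). pose proof (Rle_abs C2). lra. }
  unfold lift. destruct b.
  - apply Rabs_le_between in A1. apply Rabs_le_between in A2. apply Rabs_le_between. lra.
  - apply Rabs_le_between in B1. apply Rabs_le_between in B2. apply Rabs_le_between. lra.
Qed.

Theorem mainTheorem5
  (k al be ga : R) (f1 f2 : R -> R -> R)
  (v1R v1I v2R v2I F1R F1I F2R F2I : R -> R -> R -> R) :
  0 < k ->
  al ^ 2 + be ^ 2 + ga ^ 2 = 1 -> 0 < ga ->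
  locally_perturbed f1 -> polyhedral f1 ->
  locally_perturbed f2 -> polyhedral f2 ->
  dirichlet_scattered_field k al be ga f1 v1R v1I ->
  dirichlet_scattered_field k al be ga f2 v2R v2I ->
  far_field_pattern k f1 v1R v1I F1R F1I ->
  far_field_pattern k f2 v2R v2I F2R F2I ->
  (forall y1 y2 y3, y1 ^ 2 + y2 ^ 2 + y3 ^ 2 = 1 -> 0 < y3 ->
     F1R y1 y2 y3 = F2R y1 y2 y3 /\ F1I y1 y2 y3 = F2I y1 y2 y3) ->
  forall t1 t2, f1 t1 t2 = f2 t1 t2.
Proof.
  intros Hk Hd Hga Lp1 Po1 Lp2 Po2 S1 S2 P1 P2 HF.
  destruct (total_field_intro k al be ga f1 v1R v1I F1R F1I Hk Hd Hga Lp1 Po1 S1 P1) as [Ra TFa].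
  destruct (total_field_intro k al be ga f2 v2R v2I F2R F2I Hk Hd Hga Lp2 Po2 S2 P2) as [Rb TFb].
  set (Rad := Rmax Ra Rb).
  destruct (TFa Rad (Rmax_l _ _)) as [L1 TF1]. destruct (TFb Rad (Rmax_r _ _)) as [L2 TF2].
  destruct (far_field_difference k al be ga f1 f2 v1R v1I v2R v2I F1R F1I F2R F2I P1 P2 HF) as [T [C [HC HT]]].
  set (T0 := Rmax T (2 * Rad ^ 2)).
  assert (HT0 : T <= T0) by apply Rmax_l. assert (HT0R : 2 * Rad ^ 2 <= T0) by apply Rmax_r.
  assert (Hdec : forall x, half_exterior T0 x -> forall b,
    Rabs (total k al be ga v1R v1I b x - total k al be ga v2R v2I b x) <= C / dot x x).
  { intros x Hx. destruct TF1 as [? ? ? HR ? B1 Fr1 ? ? ? ?]. destruct TF2 as [? ? ? ? ? B2 Fr2 ? ? ? ?].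
    apply HT.
    - apply (half_exterior_epigraph f1 Rad T0); assumption.
    - apply (half_exterior_epigraph f2 Rad T0); assumption.
    - apply Hx.
    - apply Rle_lt_trans with (1 := HT0). apply Hx. }
  assert (Hag := fields_agree k al be ga f1 f2 Rad L1 L2 _ _ TF1 TF2 T0 C HT0R HC Hdec).
  intros t1 t2. apply Rle_antisym.
  - exact (graph_le k al be ga f1 f2 Rad L1 L2 _ _ TF1 TF2 Hag t1 t2).
  - refine (graph_le k al be ga f2 f1 Rad L2 L1 _ _ TF2 TF1 _ t1 t2).
    intros x Hx2 Hx1 b. symmetry. apply Hag; assumption.
Qed.
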